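(* Let $u$ be a singular inner function and $p\in(1,\infty)$. Let $A$ be a truncated Toeplitz operator on $K_u$ in the Schatten class $S_p$ with canonical symbol $f=\phi+\overline\psi\in K_u+\overline{K_u}$ such that, for some $r\in(0,1)$, $A_{P_rf}\in S_p$ (equivalently, $A_{P_r\phi}\in S_p$). Then $A_\phi$ and $A_{\overline\psi}$ are both $S_p$ operators.
   Context: $\mathbb D$ is the open unit disk, $H^2$ is the Hardy space of $\mathbb D$, identified with its boundary values in $L^2=L^2(\partial\mathbb D)$. For an inner function $v$, $K_v=H^2\ominus vH^2$. $P_u$ is the orthogonal projection of $L^2$ onto $K_u$. For a symbol $\phi\in L^2$, the truncated Toeplitz operator $A_\phi$ on $K_u$ is $A_\phi g=P_u(\phi g)$; it is defined at least on the dense subspace $K_u\cap H^\infty$, and it is said to be in $S_p$ if it extends to an $S_p$ operator on $K_u$. Every truncated Toeplitz operator has a unique symbol in $K_u+\overline{K_u}$, its canonical symbol; it is split as $\phi+\overline\psi$ with $\phi,\psi\in K_u$, and the splitting is made unique by requiring $\psi$ to be orthogonal to the projection $P_u1$ of the constant function $1$ onto $K_u$. For $r\in(0,1)$, $u^r$ is the singular inner function obtained by multiplying the singular measure of $u$ by $r$, and $P_r$ denotes the orthogonal projection of $L^2$ onto $K_{u^r}$. An operator is in $S_p$ if its sequence of singular values is in $\ell^p$. *)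

(* Defs.v *)
From mathcomp Require Import all_boot all_order all_algebra.
From mathcomp Require Import all_classical all_reals all_analysis.
From mathcomp Require Import complex.

Set Implicit Arguments.
Unset Strict Implicit.
Unset Printing Implicit Defensive.
Import Order.TTheory GRing.Theory Num.Theory.
Import numFieldNormedType.Exports.

Local Open Scope classical_set_scope.
Local Open Scope ring_scope.
Local Open Scope complex_scope.

Section truncated_toeplitz.
Variable R : realType.
Implicit Types (f g h : R -> R[i]) (F v : R[i] -> R[i]) (z : R[i])
  (mu : {measure set (measurableTypeR R) -> \bar R}) (K : set (R -> R[i]))
  (T : (R -> R[i]) -> (R -> R[i])).

(* The modulus with values in R, whereas [`|z|] lives in R[i]. *)
Definition cabs z : R := ComplexField.Normc.normc z.

Definition cis (t : R) : R[i] := cos t +i* sin t.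

Definition cexp z : R[i] := (expR (complex.Re z))%:C * cis (complex.Im z).

(* The unit circle is parametrized by the angle t in [0, 2pi[: a function on the
   circle is a function of t, whose values off [0, 2pi[ are irrelevant, and a
   measure on the circle is the restriction to [0, 2pi[ of a measure on R. *)
Definition circle : set R := `[0, 2 * pi[.

Definition cintegral mu f : R[i] :=
  Rintegral mu circle (fun t => complex.Re (f t)) +i*
  Rintegral mu circle (fun t => complex.Im (f t)).

(* Elements of L^2 are handled through representatives, so that equality in L^2
   is [circle_eq] rather than [=]. *)
Definition circle_eq f g : Prop :=
  {ae @lebesgue_measure R, forall t, circle t -> f t = g t}.

Definition L2 : set (R -> R[i]) := [set f |
  [/\ measurable_fun circle (fun t => complex.Re (f t)),
      measurable_fun circle (fun t => complex.Im (f t)) &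
      (\int[@lebesgue_measure R]_(t in circle) ((cabs (f t)) ^+ 2)%:E < +oo)%E]].

(* Arc length is normalized to have total mass 1. *)
Definition inner f g : R[i] :=
  ((2 * pi)^-1)%:C * cintegral (@lebesgue_measure R) (fun t => f t * conjc (g t)).

Definition conj_fun f : R -> R[i] := fun t => conjc (f t).

Definition norm2 f : R := Num.sqrt (complex.Re (inner f f)).

(* f is the radial boundary function of F, a function on the open unit disk.
   R[i]^o carries the topology of the norm of R[i]. *)
Definition boundary_value F f : Prop :=
  {ae @lebesgue_measure R, forall t, circle t ->
    (F (rho%:C * cis t) : R[i]^o) @[rho --> (1 : R)^'-] --> (f t : R[i]^o)}.

(* H^2 as a space of analytic functions on the disk: the sums of the power
   series with square-summable coefficients. *)
Definition hardy2 F : Prop :=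
  exists a : nat -> R[i],
    cvgn (series (fun n => (cabs (a n)) ^+ 2)) /\
    forall z, cabs z < 1 ->
      (\sum_(k < n) a k * z ^+ k : R[i]^o) @[n --> \oo] --> (F z : R[i]^o).

(* H^2 as a subspace of L^2. *)
Definition H2 : set (R -> R[i]) := [set f |
  L2 f /\ exists F, hardy2 F /\ boundary_value F f].

Definition Hinfty : set (R -> R[i]) := [set f |
  H2 f /\ exists F, [/\ hardy2 F, boundary_value F f &
    exists M : R, forall z, cabs z < 1 -> cabs (F z) <= M]].

(* v H^2, for v an inner function on the disk. *)
Definition mulH2 v : set (R -> R[i]) := [set f |
  L2 f /\ exists F, hardy2 F /\ boundary_value (fun z => v z * F z) f].

Definition model_space v : set (R -> R[i]) := [set f |
  H2 f /\ forall g, mulH2 v g -> inner f g = 0].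

(* h is (a representative of) the orthogonal projection of f onto K. *)
Definition is_proj K f h : Prop :=
  K h /\ forall k, K k -> inner (fun t => f t - h t) k = 0.

Definition singular_to_lebesgue mu : Prop :=
  exists N : set R, [/\ measurable N, @lebesgue_measure R N = 0%E &
    mu (circle `\` N) = 0%E].

(* The general singular inner function; c is a unimodular constant. *)
Definition singular_inner (c : R[i]) mu z : R[i] :=
  c * cexp (- cintegral mu (fun t => (cis t + z) / (cis t - z))).

Definition bounded_operator K T : Prop :=
  [/\ forall f, K f -> K (T f),
      forall (a : R[i]) f g, K f -> K g ->
        circle_eq (T (fun t => a * f t + g t)) (fun t => a * T f t + T g t) &
      exists M : R, forall f, K f -> norm2 (T f) <= M * norm2 f].

(* s lists the singular values of T, i.e. the square roots of the eigenvalues of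
   T^* T with multiplicity, possibly interspersed with zeros: (e n) are
   orthogonal eigenvectors of T^* T for the (s n) ^+ 2, normalized when s n is
   nonzero, and T vanishes on their orthogonal complement.  The vectors attached
   to s n = 0 may be 0, which accommodates operators of finite rank. *)
Definition singular_values K T (s : nat -> R) : Prop :=
  exists e : nat -> R -> R[i],
    [/\ forall n, K (e n) /\ 0 <= s n,
        forall m n, m <> n -> inner (e m) (e n) = 0,
        forall n, s n <> 0 -> inner (e n) (e n) = 1,
        forall n g, K g ->
          inner (T (e n)) (T g) = ((s n) ^+ 2)%:C * inner (e n) g &
        forall g, K g -> (forall n, inner g (e n) = 0) ->
          circle_eq (T g) (fun=> 0)].

Definition schatten K (p : R) T : Prop :=
  bounded_operator K T /\
  exists s : nat -> R, singular_values K T s /\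
    (\sum_(0 <= n <oo) ((s n) `^ p)%:E < +oo)%E.

(* T coincides on K_u \cap H^infty with the truncated Toeplitz operator on K_u
   with symbol f. *)
Definition extends_tto u f T : Prop :=
  forall g, model_space u g -> Hinfty g ->
    is_proj (model_space u) (fun t => f t * g t) (T g).

Definition tto_in_schatten u (p : R) f : Prop :=
  exists T, schatten (model_space u) p T /\ extends_tto u f T.

(* A_h is in S_p for h the projection of f onto K_v. *)
Definition proj_tto_in_schatten u v (p : R) f : Prop :=
  exists h, is_proj (model_space v) f h /\ tto_in_schatten u p h.

(* phi + conj psi is a canonical symbol on K_u, with the normalization of psi that
   makes the splitting unique. *)
Definition canonical_symbol u phi psi : Prop :=
  [/\ model_space u phi, model_space u psi &
      forall k, is_proj (model_space u) (fun=> 1) k -> inner psi k = 0].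

End truncated_toeplitz.

(* Main.v *)
Require Import Defs.
From mathcomp Require Import all_boot all_order all_algebra.
From mathcomp Require Import all_classical all_reals all_analysis.
From mathcomp Require Import complex ring lra measurable_realfun.

(** Since psi(0) = 0, conj psi is orthogonal to H^2, so f and phi have the same projection
    onto K_{u^r}.  Write v_s for the inner function with singular measure s mu, so that
    K_u = K_{v_1} and v_s v_t = v_{s+t}.  Choose N >= 1/r, let P_j be the projection of K_u
    onto K_{v_{j/N}}, let D be the S_p extension of A_{P_r f} and B = A - D.  The operator
      T = D + sum_(j < N) (1 - P_{j+1}) B (P_{j+1} - P_j)
    is in S_p, and it is shown to extend A_phi, so that A - T extends A_{conj psi}.  It is
    enough to compare T with A_phi on bounded elements d of
    K_{v_{(j+1)/N}} - K_{v_{j/N}} = v_{j/N} K_{v_{1/N}}, whose span is dense.  Against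
    K_{v_{(j+1)/N}} the symbols phi and P_r f act in the same way on d, because
    phi - P_r f is in v_r H^2 and r >= 1/N; against the orthogonal complement of
    K_{v_{(j+1)/N}}, which lies in v_{(j+1)/N} H^2, conj psi d vanishes, so that the
    compression of A_phi is that of A.

    Membership in S_p is handled through sums of |<T e_i, f_i>|^p over pairs of orthogonal
    families, a condition visibly stable under sums and under composition with
    projections; it yields singular values by maximizing |T x| successively. *)

Set Implicit Arguments.
Unset Strict Implicit.
Unset Printing Implicit Defensive.
Import Order.TTheory GRing.Theory Num.Theory.
Import numFieldNormedType.Exports.
Local Open Scope classical_set_scope.
Local Open Scope ring_scope.
Local Open Scope complex_scope.
Arguments cabs : simpl never.
Arguments cintegral : simpl never.
Arguments inner : simpl never.
Local Opaque cos sin pi expR.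

(** For the decomposition of K_u into the differences K_{v_{(j+1)/N}} - K_{v_{j/N}}, a coanalytic
    symbol gives a block upper triangular operator and an analytic one a block lower triangular
    operator. So A shows A_phi below the diagonal but mixes the two parts on it: the diagonal is the
    obstacle. D supplies it, since blocks no wider than r do not distinguish phi from P_r f. Thus T
    is D plus the strictly lower triangular part of A - D, and as there are finitely many blocks,
    this truncation is a finite sum of compositions with projections. A_phi is not known to be
    bounded beforehand. T is therefore compared with it as a form on bounded functions, whose
    density in the model spaces comes from reproducing kernels. Vectors are representatives of
    classes in L^2, hence semi-inner products and identities up to null vectors. Division by v_s on
    the circle rests on |v_s| = 1 almost everywhere, which is derived from Fatou's theorem and from
    the Poisson integral of the singular measure. *)

Section cabs.
Variable R : realType.
Implicit Types (z w : R[i]) (x : R).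

Lemma cabs_ge0 z : 0 <= cabs z.
Proof. by case: z => a b; exact: sqrtr_ge0. Qed.

Lemma cabs_sqr z : cabs z ^+ 2 = complex.Re z ^+ 2 + complex.Im z ^+ 2.
Proof. by case: z => a b; rewrite /cabs /= sqr_sqrtr // addr_ge0 ?sqr_ge0. Qed.

Lemma cabs_sqrC z : (cabs z ^+ 2)%:C = z * conjc z.
Proof. by rewrite cabs_sqr; case: z => a b; simpc => /=; congr (_ +i* _); ring. Qed.

Lemma cabsM z w : cabs (z * w) = cabs z * cabs w.
Proof. exact: ComplexField.Normc.normcM. Qed.

Lemma cabsD z w : cabs (z + w) <= cabs z + cabs w.
Proof. exact: le_normcD. Qed.

Lemma cabsN z : cabs (- z) = cabs z.
Proof. exact: normcN. Qed.

Lemma cabsB z w : cabs (z - w) <= cabs z + cabs w.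
Proof. by rewrite -(cabsN w) cabsD. Qed.

Lemma cabs_distC z w : cabs (z - w) = cabs (w - z).
Proof. by rewrite -cabsN opprB. Qed.

Lemma cabs0 : cabs (0 : R[i]) = 0.
Proof. exact: ComplexField.Normc.normc0. Qed.

Lemma cabs1 : cabs (1 : R[i]) = 1.
Proof. exact: ComplexField.Normc.normc1. Qed.

Lemma cabs_eq0 z : cabs z = 0 -> z = 0.
Proof. exact: ComplexField.Normc.eq0_normc. Qed.

Lemma cabs_real x : cabs x%:C = `|x|.
Proof. by rewrite /cabs /= expr0n /= addr0 sqrtr_sqr. Qed.

Lemma cabs_conj z : cabs (conjc z) = cabs z.
Proof. by case: z => a b; rewrite /cabs /= sqrrN. Qed.

Lemma cabsX z n : cabs (z ^+ n) = cabs z ^+ n.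
Proof. by elim: n => [|n IH]; rewrite ?expr0 ?cabs1 // !exprS cabsM IH. Qed.

Lemma cabsV z : cabs z^-1 = (cabs z)^-1.
Proof. exact: ComplexField.Normc.normcV. Qed.

Lemma Re_le_cabs z : `|complex.Re z| <= cabs z.
Proof.
rewrite -(ler_pXn2r (n:=2)) ?nnegrE ?cabs_ge0 // cabs_sqr real_normK ?num_real //.
by rewrite lerDl sqr_ge0.
Qed.

Lemma Im_le_cabs z : `|complex.Im z| <= cabs z.
Proof.
rewrite -(ler_pXn2r (n:=2)) ?nnegrE ?cabs_ge0 // cabs_sqr real_normK ?num_real //.
by rewrite lerDr sqr_ge0.
Qed.

Lemma cabs_le_ReIm z : cabs z <= `|complex.Re z| + `|complex.Im z|.
Proof.
rewrite -(ler_pXn2r (n:=2)) ?nnegrE ?cabs_ge0 ?addr_ge0 // cabs_sqr.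
rewrite sqrrD !real_normK ?num_real // -addrA lerD2l lerDr.
by rewrite mulrn_wge0 // mulr_ge0.
Qed.

Lemma cabs_sum I (r : seq I) (P : pred I) (F : I -> R[i]) :
  cabs (\sum_(i <- r | P i) F i) <= \sum_(i <- r | P i) cabs (F i).
Proof.
elim/big_rec2 : _ => [|i x y _ h]; first by rewrite cabs0.
by apply: (le_trans (cabsD _ _)); rewrite lerD2l.
Qed.

Lemma normE z : `|z| = (cabs z)%:C.
Proof. by case: z. Qed.

Lemma complexP z w : complex.Re z = complex.Re w -> complex.Im z = complex.Im w -> z = w.
Proof. by case: z w => a b [c d] /= -> ->. Qed.

Lemma ReM z w : complex.Re (z * w) = complex.Re z * complex.Re w - complex.Im z * complex.Im w.
Proof. by case: z w => a b [c d]; simpc. Qed.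

Lemma ImM z w : complex.Im (z * w) = complex.Re z * complex.Im w + complex.Im z * complex.Re w.
Proof. by case: z w => a b [c d]; simpc. Qed.

Lemma ReD z w : complex.Re (z + w) = complex.Re z + complex.Re w.
Proof. by case: z w => a b [c d]. Qed.

Lemma ImD z w : complex.Im (z + w) = complex.Im z + complex.Im w.
Proof. by case: z w => a b [c d]. Qed.

Lemma ReN z : complex.Re (- z) = - complex.Re z.
Proof. by case: z. Qed.

Lemma ImN z : complex.Im (- z) = - complex.Im z.
Proof. by case: z. Qed.

Lemma Re_conj z : complex.Re (conjc z) = complex.Re z.
Proof. by case: z. Qed.

Lemma Im_conj z : complex.Im (conjc z) = - complex.Im z.
Proof. by case: z. Qed.

Lemma ger0_ReIm z : 0 <= z -> z = (complex.Re z)%:C /\ 0 <= complex.Re z.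
Proof. by rewrite lecE /= => /andP[/eqP h0 h]; split => //; case: z h0 {h} => a b /= ->. Qed.

Lemma conjcM z w : conjc (z * w) = conjc z * conjc w.
Proof. by rewrite rmorphM. Qed.
Lemma conjcD z w : conjc (z + w) = conjc z + conjc w.
Proof. by rewrite rmorphD. Qed.
Lemma conjcN z : conjc (- z) = - conjc z.
Proof. by rewrite rmorphN. Qed.

End cabs.

(** * Semi-inner products *)

Section hilbert.
Variables (R : realType) (V : lmodType R[i]).
Implicit Types (ip : V -> V -> R[i]) (H D : set V) (x y z : V) (a b : R[i]).

(** No definiteness: vectors will be representatives of L^2 classes, so that vectors at distance 0
    may differ. Identities between vectors are stated as [nrm (x - y) = 0] or tested against all of
    [H]. The carrier is a subset of an ambient module, so that L^2, H^2 and all model spaces share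
    their operations. *)
Record pre_hilbert ip H : Prop := PreHilbert {
  ph0 : H 0;
  phL : forall a x y, H x -> H y -> H (a *: x + y);
  ipL : forall a x y z, H x -> H y -> H z ->
    ip (a *: x + y) z = a * ip x z + ip y z;
  ipC : forall x y, H x -> H y -> ip y x = conjc (ip x y);
  ip_ge0 : forall x, H x -> 0 <= ip x x }.

Definition nrm ip x : R := Num.sqrt (complex.Re (ip x x)).

Definition cvg_to ip (x : nat -> V) y := forall e : R, 0 < e ->
  exists N, forall n, (N <= n)%N -> nrm ip (x n - y) <= e.

Definition cauchy_in ip (x : nat -> V) := forall e : R, 0 < e ->
  exists N, forall m n, (N <= m)%N -> (N <= n)%N -> nrm ip (x m - x n) <= e.

Definition ip_complete ip H := forall x : nat -> V, (forall n, H (x n)) ->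
  cauchy_in ip x -> exists2 y, H y & cvg_to ip x y.

Section basics.
Variables (ip : V -> V -> R[i]) (H : set V) (hH : pre_hilbert ip H).
Local Notation nrm := (nrm ip).

Lemma phZ a x : H x -> H (a *: x).
Proof. by move=> hx; rewrite -[_ *: _]addr0; apply: (phL hH) => //; exact: (ph0 hH). Qed.

Lemma phD x y : H x -> H y -> H (x + y).
Proof. by move=> hx hy; rewrite -[x]scale1r; exact: (phL hH). Qed.

Lemma phN x : H x -> H (- x).
Proof. by move=> hx; rewrite -scaleN1r; exact: phZ. Qed.

Lemma phB x y : H x -> H y -> H (x - y).
Proof. by move=> hx hy; apply: phD => //; exact: phN. Qed.

Lemma ph_sum I (r : seq I) (P : pred I) (F : I -> V) :
  (forall i, P i -> H (F i)) -> H (\sum_(i <- r | P i) F i).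
Proof.
by move=> h; elim/big_ind : _ => //; [exact: (ph0 hH)|exact: phD].
Qed.

Lemma ip0l z : H z -> ip 0 z = 0.
Proof.
move=> hz; have := ipL hH 1 (ph0 hH) (ph0 hH) hz.
by rewrite scale1r addr0 mul1r => /eqP; rewrite -subr_eq subrr eq_sym => /eqP.
Qed.

Lemma ipZl a x z : H x -> H z -> ip (a *: x) z = a * ip x z.
Proof.
by move=> hx hz; rewrite -[a *: x]addr0 (ipL hH) ?ip0l ?addr0 //; exact: (ph0 hH).
Qed.

Lemma ipDl x y z : H x -> H y -> H z -> ip (x + y) z = ip x z + ip y z.
Proof. by move=> hx hy hz; rewrite -{1}[x]scale1r (ipL hH) // mul1r. Qed.

Lemma ipNl x z : H x -> H z -> ip (- x) z = - ip x z.
Proof. by move=> hx hz; rewrite -scaleN1r ipZl // mulN1r. Qed.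

Lemma ipBl x y z : H x -> H y -> H z -> ip (x - y) z = ip x z - ip y z.
Proof. by move=> hx hy hz; rewrite ipDl ?ipNl //; exact: phN. Qed.

Lemma ip0r z : H z -> ip z 0 = 0.
Proof. by move=> hz; rewrite (ipC hH) ?ip0l ?conjc0 //; exact: (ph0 hH). Qed.

Lemma ipZr a x z : H x -> H z -> ip z (a *: x) = conjc a * ip z x.
Proof.
move=> hx hz; rewrite (ipC hH (x := a *: x)) ?ipZl //; last exact: phZ.
by rewrite conjcM -(ipC hH).
Qed.

Lemma ipDr x y z : H x -> H y -> H z -> ip z (x + y) = ip z x + ip z y.
Proof.
move=> hx hy hz; rewrite (ipC hH (x := x + y)) ?ipDl //; last exact: phD.
by rewrite conjcD -!(ipC hH).
Qed.

Lemma ipNr x z : H x -> H z -> ip z (- x) = - ip z x.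
Proof. by move=> hx hz; rewrite -scaleN1r ipZr // conjcN conjc1 mulN1r. Qed.

Lemma ipBr x y z : H x -> H y -> H z -> ip z (x - y) = ip z x - ip z y.
Proof. by move=> hx hy hz; rewrite ipDr ?ipNr //; exact: phN. Qed.

Lemma ip_suml I (r : seq I) (P : pred I) (F : I -> V) z :
  (forall i, P i -> H (F i)) -> H z ->
  ip (\sum_(i <- r | P i) F i) z = \sum_(i <- r | P i) ip (F i) z.
Proof.
move=> hF hz.
pose Q (v : V) (c : R[i]) := H v /\ ip v z = c.
suff: Q (\sum_(i <- r | P i) F i) (\sum_(i <- r | P i) ip (F i) z) by case.
apply: (big_ind2 Q).
- by split; [exact: (ph0 hH)|exact: ip0l].
- by move=> ? ? ? ? [h1 <-] [h2 <-]; split; [exact: phD|exact: ipDl].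
- by move=> i /hF.
Qed.

Lemma ph_lincomb n (c : 'I_n -> R[i]) (F : 'I_n -> V) : (forall i, H (F i)) ->
  H (\sum_(i < n) c i *: F i).
Proof. by move=> h; apply: ph_sum => i _; exact: phZ. Qed.

Lemma ip_lincombr n (c : 'I_n -> R[i]) (F : 'I_n -> V) z : (forall i, H (F i)) -> H z ->
  ip z (\sum_(i < n) c i *: F i) = \sum_(i < n) conjc (c i) * ip z (F i).
Proof.
move=> hF hz; rewrite (ipC hH (ph_lincomb c hF) hz) ip_suml //; last by move=> i _; exact: phZ.
rewrite rmorph_sum; apply: eq_bigr => i _ /=.
by rewrite -(ipC hH) ?ipZr //; exact: phZ.
Qed.

Lemma nrm_ge0 x : 0 <= nrm x. Proof. exact: sqrtr_ge0. Qed.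

Lemma nrm_sqr x : H x -> nrm x ^+ 2 = complex.Re (ip x x).
Proof.
by move=> hx; rewrite sqr_sqrtr //; case: (ger0_ReIm (ip_ge0 hH hx)).
Qed.

Lemma ip_nrm x : H x -> ip x x = (nrm x ^+ 2)%:C.
Proof.
by move=> hx; rewrite nrm_sqr //; case: (ger0_ReIm (ip_ge0 hH hx)).
Qed.

Lemma nrmZ a x : H x -> nrm (a *: x) = cabs a * nrm x.
Proof.
move=> hx; apply/eqP; rewrite -(eqrXn2 (n:=2)) ?mulr_ge0 ?nrm_ge0 ?cabs_ge0 //.
rewrite nrm_sqr ?ipZl ?ipZr //; [|exact: phZ|exact: phZ].
rewrite mulrA -cabs_sqrC ip_nrm // -rmorphM /= exprMn; exact/eqP.
Qed.

Lemma nrmN x : H x -> nrm (- x) = nrm x.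
Proof. by move=> hx; rewrite -scaleN1r nrmZ // cabsN cabs1 mul1r. Qed.

Lemma nrm0 : nrm 0 = 0.
Proof. by rewrite /nrm ip0l ?sqrtr0 //; exact: (ph0 hH). Qed.

Lemma nrmBC x y : H x -> H y -> nrm (x - y) = nrm (y - x).
Proof. by move=> hx hy; rewrite -nrmN ?opprB //; exact: phB. Qed.

Lemma nrmD_sqr x y : H x -> H y ->
  nrm (x + y) ^+ 2 = nrm x ^+ 2 + nrm y ^+ 2 + 2 * complex.Re (ip x y).
Proof.
move=> hx hy; have hxy := phD hx hy.
rewrite nrm_sqr // ipDl // !ipDr // [ip y x](ipC hH) // !ip_nrm // !ReD Re_conj /=.
by ring.
Qed.

Lemma pythagoras x y : H x -> H y -> ip x y = 0 ->
  nrm (x + y) ^+ 2 = nrm x ^+ 2 + nrm y ^+ 2.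
Proof. by move=> hx hy h; rewrite nrmD_sqr // h /= mulr0 addr0. Qed.

Lemma cauchy_schwarz x y : H x -> H y -> cabs (ip x y) <= nrm x * nrm y.
Proof.
move=> hx hy; set c := ip x y; set A := nrm x ^+ 2; set B := nrm y ^+ 2.
(* This is the square of the norm of [x - (t * c) *: y]; the factor [c] removes the phase, so that a
   real parameter is enough. *)
have key (t : R) : 0 <= A - 2 * t * cabs c ^+ 2 + t ^+ 2 * cabs c ^+ 2 * B.
  have hz : H (- (t%:C * c) *: y) by exact: phZ.
  have := sqr_ge0 (nrm (x + - (t%:C * c) *: y)).
  rewrite nrmD_sqr // ipZr // -/c nrmZ // conjcN conjcM conjc_real.
  rewrite cabsN cabsM cabs_real exprMn exprMn real_normK ?num_real // -/A -/B.
  have -> : complex.Re (- (t%:C * conjc c) * c) = - (t * cabs c ^+ 2).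
    by rewrite mulNr -mulrA [conjc c * c]mulrC -cabs_sqrC -rmorphM ReN.
  by move=> h; apply: (le_trans h); rewrite le_eqVlt; apply/orP; left; apply/eqP; ring.
have A0 : 0 <= A by exact: sqr_ge0.
have B0 : 0 <= B by exact: sqr_ge0.
have C0 : 0 <= cabs c ^+ 2 by exact: sqr_ge0.
suff : cabs c ^+ 2 <= A * B.
  rewrite /A /B -exprMn => h.
  by rewrite -(ler_pXn2r (n:=2)) ?nnegrE ?cabs_ge0 ?mulr_ge0 ?nrm_ge0.
have [B1|B1] := eqVneq B 0.
  rewrite B1 mulr0.
  case: (leP (cabs c ^+ 2) 0) => [//|C1].
  (* A null vector [y] need not be 0. If [c] were nonzero, this [t] would give the nonnegative
     expression the value -1. *)
  have := key ((A + 1) / (2 * cabs c ^+ 2)); rewrite B1 mulr0 addr0.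
  have -> : A - 2 * ((A + 1) / (2 * cabs c ^+ 2)) * cabs c ^+ 2 = -1.
    have C2 : cabs c != 0 by apply: contraTneq C1 => ->; rewrite expr0n ltxx.
    by field.
  by rewrite oppr_ge0 ler10.
have B2 : 0 < B by rewrite lt_neqAle eq_sym B1.
have := key B^-1.
have -> : A - 2 * B^-1 * cabs c ^+ 2 + B^-1 ^+ 2 * cabs c ^+ 2 * B
   = A - cabs c ^+ 2 / B by field.
by rewrite subr_ge0 ler_pdivrMr.
Qed.

Lemma nrmD x y : H x -> H y -> nrm (x + y) <= nrm x + nrm y.
Proof.
move=> hx hy.
rewrite -(ler_pXn2r (n:=2)) ?nnegrE ?addr_ge0 ?nrm_ge0 //.
rewrite nrmD_sqr // sqrrD -mulr_natl.
have h := cauchy_schwarz hx hy.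
have h1 := le_trans (ler_norm _) (Re_le_cabs (ip x y)).
lra.
Qed.

Lemma nrmB x y : H x -> H y -> nrm (x - y) <= nrm x + nrm y.
Proof. by move=> hx hy; rewrite -(nrmN hy); apply: nrmD => //; exact: phN. Qed.

Lemma nrm_triB x y z : H x -> H y -> H z -> nrm (x - z) <= nrm (x - y) + nrm (y - z).
Proof.
move=> hx hy hz; rewrite (_ : x - z = (x - y) + (y - z)).
  by apply: nrmD; exact: phB.
by rewrite addrA subrK.
Qed.

Lemma nrm_sum I (r : seq I) (P : pred I) (F : I -> V) :
  (forall i, P i -> H (F i)) ->
  nrm (\sum_(i <- r | P i) F i) <= \sum_(i <- r | P i) nrm (F i).
Proof.
move=> hF.
pose Q (v : V) (c : R) := H v /\ nrm v <= c.
suff: Q (\sum_(i <- r | P i) F i) (\sum_(i <- r | P i) nrm (F i)) by case.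
apply: (big_ind2 Q).
- by split; [exact: (ph0 hH)|rewrite nrm0].
- move=> ? ? ? ? [h1 l1] [h2 l2]; split; first exact: phD.
  by apply: (le_trans (nrmD h1 h2)); exact: lerD.
- by move=> i /hF.
Qed.

Lemma nrm0_ip x y : H x -> H y -> nrm x = 0 -> ip x y = 0.
Proof.
move=> hx hy h; apply: cabs_eq0; apply/eqP; rewrite eq_le cabs_ge0 andbT.
by have := cauchy_schwarz hx hy; rewrite h mul0r.
Qed.

Lemma nrm_eq0 x : ip x x = 0 -> nrm x = 0.
Proof. by rewrite /nrm => ->; rewrite /= sqrtr0. Qed.

Lemma nrmB0_ip x y z : H x -> H y -> H z -> nrm (x - y) = 0 -> ip x z = ip y z.
Proof.
move=> hx hy hz h; apply/eqP; rewrite -subr_eq0 -ipBl //.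
by rewrite nrm0_ip //; exact: phB.
Qed.

Lemma nrmB0_nrm x y : H x -> H y -> nrm (x - y) = 0 -> nrm x = nrm y.
Proof.
move=> hx hy h; rewrite /nrm; congr (Num.sqrt (complex.Re _)).
rewrite (nrmB0_ip hx hy hx h) [LHS](ipC hH) // (nrmB0_ip hx hy hy h).
by rewrite -(ipC hH).
Qed.

Lemma le_nrm_eps x : (forall e : R, 0 < e -> nrm x <= e) -> nrm x = 0.
Proof.
move=> h; apply/eqP; rewrite eq_le nrm_ge0 andbT.
by apply/ler_addgt0Pr => e e0; rewrite add0r; exact: h.
Qed.

Lemma nrm_all_orth x : H x -> (forall y, H y -> ip x y = 0) -> nrm x = 0.
Proof. by move=> hx /(_ x hx); exact: nrm_eq0. Qed.

End basics.

Lemma pre_hilbert_sub ip H D : pre_hilbert ip H -> D `<=` H -> D 0 ->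
  (forall a x y, D x -> D y -> D (a *: x + y)) -> pre_hilbert ip D.
Proof.
move=> hH DH D0 DL; split => //.
- by move=> a x y z /DH hx /DH hy /DH hz; exact: (ipL hH).
- by move=> x y /DH hx /DH hy; exact: (ipC hH).
- by move=> x /DH hx; exact: (ip_ge0 hH).
Qed.

Section proj.
Variables (ip : V -> V -> R[i]) (H : set V) (hH : pre_hilbert ip H).
Local Notation nrm := (nrm ip).

Lemma cvg_to_ip (x : nat -> V) y z : (forall n, H (x n)) -> H y -> H z ->
  cvg_to ip x y -> (forall n, ip (x n) z = 0) -> ip y z = 0.
Proof.
move=> hx hy hz xy h; apply: cabs_eq0; apply/eqP; rewrite eq_le cabs_ge0 andbT.
apply/ler_addgt0Pr => e e0; rewrite add0r.
have n0 : 0 < nrm z + 1 by rewrite ltr_wpDl ?nrm_ge0.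
have [|N /(_ N (leqnn _))] := xy (e / (nrm z + 1)); first exact: divr_gt0.
move=> le.
have -> : ip y z = - ip (x N - y) z by rewrite (ipBl hH) // h sub0r opprK.
rewrite cabsN; apply: (le_trans (cauchy_schwarz hH _ hz)); first exact: (phB hH).
apply: (@le_trans _ _ (e / (nrm z + 1) * (nrm z + 1))).
  by apply: ler_pM; rewrite ?nrm_ge0 // lerDl.
by rewrite divfK // lt0r_neq0.
Qed.

(** [D] is not closed, so the nearest point is a limit in [H] of a minimizing sequence of [D]. The
    sequence is returned with it: it gives density when only 0 is orthogonal to [D], and a
    projection when [D] is complete. *)
Lemma subspace_approx D x : ip_complete ip H -> D `<=` H -> D 0 ->
  (forall a u v, D u -> D v -> D (a *: u + v)) -> H x ->
  exists2 y, H y & (exists d : nat -> V, [/\ forall n, D (d n), cauchy_in ip d & cvg_to ip d y])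
    /\ forall z, D z -> ip (x - y) z = 0.
Proof.
move=> cH DH D0 DL hx.
have hD := pre_hilbert_sub hH DH D0 DL.
pose S := [set nrm (x - d) | d in D].
have S0 : S !=set0 by exists (nrm (x - 0)), 0.
have lbS : has_lbound S by exists 0 => _ [d _ <-]; exact: nrm_ge0.
have iS : has_inf S by split.
set m := inf S.
have m0 : 0 <= m by apply: lb_le_inf => // _ [d _ <-]; exact: nrm_ge0.
have mle d : D d -> m <= nrm (x - d).
  by move=> Dd; apply: ge_inf => //; exists d.
have ex n : exists d, D d /\ nrm (x - d) <= m + n.+1%:R^-1.
  have [|_ [d Dd <-] /ltW le] := @inf_adherent _ S n.+1%:R^-1 _ iS; first by rewrite invr_gt0.
  by exists d.
have [d hd] := choice ex.
(* Parallelogram law: the midpoint of [a] and [b] belongs to [D], hence is at distance at least [m]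
   from [x]. *)
have para (a b : V) : D a -> D b ->
    nrm (a - b) ^+ 2 <= 2 * nrm (x - a) ^+ 2 + 2 * nrm (x - b) ^+ 2 - 4 * m ^+ 2.
  move=> Da Db; have Ha := DH _ Da; have Hb := DH _ Db.
  have H1 := phB hH hx Ha; have H2 := phB hH hx Hb.
  have e1 := nrmD_sqr hH H2 H1.
  have e2 := nrmD_sqr hH H2 (phN hH H1).
  rewrite (nrmN hH) // (ipNr hH) // ReN in e2.
  have e3 : (x - b) - (x - a) = a - b by rewrite opprB addrC addrA subrK.
  rewrite e3 in e2.
  have e4 : (x - b) + (x - a) = (2%:C : R[i]) *: (x - (2^-1%:C : R[i]) *: (a + b)).
    rewrite scalerBr scalerA -rmorphM /= divff ?pnatr_eq0 // scale1r.
    rewrite (_ : 2%:C = 1 + 1 :> R[i]); last by rewrite -[RHS](rmorphD (real_complex R) 1 1).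
    by rewrite scalerDl scale1r opprD addrACA; congr (_ + _); rewrite addrC.
  have Dm : D ((2^-1%:C : R[i]) *: (a + b)).
    by apply: (phZ hD); apply: (phD hD).
  have := mle _ Dm.
  rewrite -(ler_pXn2r (n:=2)) ?nnegrE ?nrm_ge0 // => e5.
  move: e1; rewrite e4 (nrmZ hH); last by apply: (phB hH) => //; exact: DH.
  rewrite cabs_real exprMn normr_nat => e1; nra.
have dc : cauchy_in ip d.
  move=> e e0.
  (* From this rank on, (m + 1/(k+1))^2 exceeds m^2 by at most e^2 / 4, and [para] turns two such
     excesses into e^2. *)
  pose K := 4 * (2 * m + 1) / e ^+ 2.
  have [N hN] : exists N, K <= N.+1%:R.
    exists (Num.truncn K); apply/ltW; exact: truncnS_gt.
  have e20 : 0 < e ^+ 2 by exact: exprn_gt0.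
  have bd k : (N <= k)%N -> nrm (x - d k) ^+ 2 <= m ^+ 2 + e ^+ 2 / 4.
    move=> Nk; have [Dk le] := hd k.
    have i0 : 0 < k.+1%:R^-1 :> R by rewrite invr_gt0.
    have i1 : k.+1%:R^-1 <= 1 :> R by rewrite invf_le1 // ler1n.
    have i2 : (2 * m + 1) * k.+1%:R^-1 <= e ^+ 2 / 4.
      rewrite ler_pdivrMr //.
      have : K <= k.+1%:R by apply: (le_trans hN); rewrite ler_nat.
      by rewrite /K ler_pdivrMr // => h; lra.
    have i3 : k.+1%:R^-1 * k.+1%:R^-1 <= k.+1%:R^-1 :> R by rewrite ler_piMl // ltW.
    apply: (@le_trans _ _ ((m + k.+1%:R^-1) ^+ 2)).
      by rewrite ler_pXn2r ?nnegrE ?nrm_ge0 ?addr_ge0 // ltW.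
    by move: (k.+1%:R^-1) i2 i3 => i i2 i3; lra.
  exists N => k l Nk Nl.
  rewrite -(ler_pXn2r (n:=2)) ?nnegrE ?nrm_ge0 ?(ltW e0) //.
  have [Dk _] := hd k; have [Dl _] := hd l.
  have := para _ _ Dk Dl; have := bd _ Nk; have := bd _ Nl; lra.
have dD n : D (d n) by case: (hd n).
have [y Hy dy] := cH d (fun n => DH _ (dD n)) dc.
exists y => //; split; first by exists d.
have Hxy := phB hH hx Hy.
have nxy : nrm (x - y) <= m.
  apply/ler_addgt0Pr => e e0.
  have e2 : 0 < e / 2 by rewrite divr_gt0.
  have [N hN] := dy _ e2.
  have [M hM] : exists M, (e / 2)^-1 <= M.+1%:R.
    exists (Num.truncn (e/2)^-1); apply/ltW; exact: truncnS_gt.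
  have := hN (maxn N M) (leq_maxl _ _).
  have [_ h1] := hd (maxn N M).
  have h2 : (maxn N M).+1%:R^-1 <= e / 2.
    rewrite -[e / 2]invrK lef_pV2 ?posrE ?invr_gt0 ?ltr0Sn //.
    by apply: (le_trans hM); rewrite ler_nat ltnS leq_maxr.
  move: ((maxn N M).+1%:R^-1) h1 h2 => i h1 h2 h3.
  have := nrm_triB hH hx (DH _ (dD (maxn N M))) Hy; lra.
move=> z Dz; have Hz := DH _ Dz.
(* Variation around the minimum. As [y] may lie outside [D], the lower bound is obtained through the
   approximants [d N]. *)
have key (a : R[i]) : m ^+ 2 <= nrm (x - y + a *: z) ^+ 2.
  rewrite ler_pXn2r ?nnegrE ?nrm_ge0 //.
  apply/ler_addgt0Pr => e e0; have [N /(_ N (leqnn _)) h] := dy _ e0.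
  have Dn : D (d N - a *: z) by apply: (phB hD) => //; exact: (phZ hD).
  apply: (le_trans (mle _ Dn)).
  have -> : x - (d N - a *: z) = (x - y + a *: z) - (d N - y).
    by rewrite !opprB addrACA subrK.
  apply: (le_trans (nrmB hH _ _)); last by rewrite lerD2l.
    by apply: (phD hH) => //; exact: (phZ hH).
  by apply: (phB hH) => //; exact: DH.
set c := ip (x - y) z.
have B0 : 0 <= nrm z ^+ 2 by exact: sqr_ge0.
have keyt (t : R) : 0 <= - 2 * t * cabs c ^+ 2 + t ^+ 2 * cabs c ^+ 2 * nrm z ^+ 2.
  have := key (- (t%:C * c)); rewrite (nrmD_sqr hH) //; last exact: (phZ hH).
  rewrite (ipZr hH) // -/c (nrmZ hH) // conjcN conjcM conjc_real.
  rewrite cabsN cabsM cabs_real exprMn exprMn real_normK ?num_real //.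
  have -> : complex.Re (- (t%:C * conjc c) * c) = - (t * cabs c ^+ 2).
    by rewrite mulNr -mulrA [conjc c * c]mulrC -cabs_sqrC -rmorphM ReN.
  have : nrm (x - y) ^+ 2 <= m ^+ 2 by rewrite ler_pXn2r ?nnegrE ?nrm_ge0.
  by move=> h1 h2; nra.
apply: cabs_eq0; apply/eqP; rewrite -(sqrf_eq0 (cabs c)) eq_le sqr_ge0 andbT.
(* The optimal parameter would be the inverse of |z|^2; adding 1 also covers null vectors [z] and
   still gives a negative multiple of |c|^2. *)
have := keyt (nrm z ^+ 2 + 1)^-1.
set B := nrm z ^+ 2 in B0 *; set C := cabs c ^+ 2.
have B1 : B + 1 != 0 by rewrite lt0r_neq0 // ltr_wpDl.
have -> : - 2 * (B + 1)^-1 * C + (B + 1)^-1 ^+ 2 * C * B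
  = - (C * ((B + 2) / (B + 1) ^+ 2)) by field.
rewrite oppr_ge0 pmulr_lle0 // divr_gt0 ?exprn_gt0 ?ltr_wpDl //.
Qed.

Lemma dense_of_orth D x : ip_complete ip H -> D `<=` H -> D 0 ->
  (forall a u v, D u -> D v -> D (a *: u + v)) ->
  (forall y, H y -> (forall z, D z -> ip y z = 0) -> nrm y = 0) ->
  H x -> forall e : R, 0 < e -> exists2 d, D d & nrm (x - d) <= e.
Proof.
move=> cH DH D0 DL D_orth hx e e0.
have [y hy [[d [dD _ dy]] xy]] := subspace_approx cH DH D0 DL hx.
have h : nrm (x - y) = 0 by apply: D_orth => //; exact: (phB hH).
have [N /(_ N (leqnn _)) hN] := dy _ e0.
exists (d N) => //.
apply: (le_trans (nrm_triB hH hx hy (DH _ (dD N)))).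
by rewrite h add0r (nrmBC hH) //; exact: DH.
Qed.

(** The limit in [H] of the minimizing sequence and its limit in the complete set [D] may be
    different vectors, but they are at distance 0, which no inner product detects. *)
Lemma projection D x : D `<=` H -> D 0 ->
  (forall a u v, D u -> D v -> D (a *: u + v)) -> ip_complete ip H ->
  ip_complete ip D -> H x ->
  exists2 y, D y & forall z, D z -> ip (x - y) z = 0.
Proof.
move=> DH D0 DL cH cD hx.
have [y hy [[d [dD dc dy]] xy]] := subspace_approx cH DH D0 DL hx.
have [y' Dy' dy'] := cD d dD dc.
have hy' := DH _ Dy'.
exists y' => // z Dz; rewrite -(xy _ Dz).
have : nrm (y - y') = 0.
  apply: le_nrm_eps => e e0.
  have e2 : 0 < e / 2 by rewrite divr_gt0.
  have [N hN] := dy _ e2; have [M hM] := dy' _ e2.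
  have hd := DH _ (dD (maxn N M)).
  apply: (le_trans (nrm_triB hH hy hd hy')).
  rewrite (nrmBC hH) //.
  have := hN _ (leq_maxl N M); have := hM _ (leq_maxr N M); lra.
have hz := DH _ Dz.
by move/(nrmB0_ip hH hy hy' hz) => h; rewrite !(ipBl hH) // h.
Qed.

End proj.
End hilbert.

(** * Operators up to null vectors and the intrinsic Schatten condition *)

Section schatten_abstract.
Variables (R : realType) (V : lmodType R[i]) (ip : V -> V -> R[i]) (H : set V).
Hypotheses (hH : pre_hilbert ip H) (cH : ip_complete ip H).
Local Notation nrm := (nrm ip).
Implicit Types (T S P : V -> V) (x y z : V) (e f : nat -> V).

Record lin_op T : Prop := LinOp {
  op_in : forall x, H x -> H (T x);
  op_lin : forall a x y, H x -> H y -> nrm (T (a *: x + y) - (a *: T x + T y)) = 0;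
  op_bd : exists M : R, forall x, H x -> nrm (T x) <= M * nrm x }.

(** Norms at most 1 instead of equal to 1: finite families padded with 0 are included, and so are
    normalizations of vectors that may vanish. *)
Definition orthosys e := [/\ forall i, H (e i),
  forall i j, i <> j -> ip (e i) (e j) = 0 & forall i, nrm (e i) <= 1].

(* An intrinsic form of the Schatten condition, free of singular values. *)
Definition spb (p : R) T := exists C : R, forall m e f, orthosys e -> orthosys f ->
  \sum_(i < m) cabs (ip (T (e i)) (f i)) `^ p <= C.

(** The content of [singular_values], with almost everywhere equality to 0 replaced by a vanishing
    norm. *)
Record sing_data T (s : nat -> R) e : Prop := SingData {
  sd_in : forall n, H (e n) /\ 0 <= s n;
  sd_orth : forall m n, m <> n -> ip (e m) (e n) = 0;
  sd_norm : forall n, s n <> 0 -> ip (e n) (e n) = 1;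
  sd_eig : forall n g, H g -> ip (T (e n)) (T g) = ((s n) ^+ 2)%:C * ip (e n) g;
  sd_ker : forall g, H g -> (forall n, ip g (e n) = 0) -> nrm (T g) = 0 }.

Section op_basics.
Variables (T : V -> V) (hT : lin_op T).

Lemma op_ip a x y z : H x -> H y -> H z ->
  ip (T (a *: x + y)) z = a * ip (T x) z + ip (T y) z.
Proof.
move=> hx hy hz; have hTx := op_in hT hx; have hTy := op_in hT hy.
rewrite -(ipL hH) //; apply: (nrmB0_ip hH) => //.
- by apply: (op_in hT); exact: (phL hH).
- exact: (phL hH).
- exact: (op_lin hT).
Qed.

Lemma op0_ip z : H z -> ip (T 0) z = 0.
Proof.
move=> hz; have := op_ip 1 (ph0 hH) (ph0 hH) hz.
by rewrite scale1r addr0 mul1r => /eqP; rewrite -subr_eq subrr eq_sym => /eqP.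
Qed.

Lemma opZ_ip a x z : H x -> H z -> ip (T (a *: x)) z = a * ip (T x) z.
Proof.
by move=> hx hz; rewrite -[a *: x]addr0 op_ip ?op0_ip ?addr0 //; exact: (ph0 hH).
Qed.

Lemma opD_ip x y z : H x -> H y -> H z -> ip (T (x + y)) z = ip (T x) z + ip (T y) z.
Proof. by move=> hx hy hz; rewrite -{1}[x]scale1r op_ip // mul1r. Qed.

Lemma opB_ip x y z : H x -> H y -> H z -> ip (T (x - y)) z = ip (T x) z - ip (T y) z.
Proof.
move=> hx hy hz; rewrite opD_ip //; last exact: (phN hH).
by rewrite -scaleN1r opZ_ip // mulN1r.
Qed.

Lemma op_sum_ip I (r : seq I) (Q : pred I) (F : I -> V) z :
  (forall i, Q i -> H (F i)) -> H z ->
  ip (T (\sum_(i <- r | Q i) F i)) z = \sum_(i <- r | Q i) ip (T (F i)) z.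
Proof.
move=> hF hz.
pose K (v : V) (c : R[i]) := H v /\ ip (T v) z = c.
suff: K (\sum_(i <- r | Q i) F i) (\sum_(i <- r | Q i) ip (T (F i)) z) by case.
apply: (big_ind2 K).
- by split; [exact: (ph0 hH)|exact: op0_ip].
- by move=> ? ? ? ? [h1 <-] [h2 <-]; split; [exact: (phD hH)|exact: opD_ip].
- by move=> i /hF.
Qed.

Lemma op_eqv x y : H x -> (forall z, H z -> ip (T x) z = ip y z) -> H y -> nrm (T x - y) = 0.
Proof.
move=> hx h hy; have hTx := op_in hT hx.
apply: (@nrm_all_orth _ _ ip H); first exact: (phB hH).
by move=> z hz; rewrite (ipBl hH) // h // subrr.
Qed.

Lemma op_nrmB x y : H x -> H y -> nrm (T x - T y) = nrm (T (x - y)).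
Proof.
move=> hx hy; have hTx := op_in hT hx; have hTy := op_in hT hy.
symmetry; apply: (nrmB0_nrm hH).
- by apply: (op_in hT); exact: (phB hH).
- exact: (phB hH).
- apply: op_eqv; [exact: (phB hH)| |exact: (phB hH)].
  by move=> z hz; rewrite opB_ip // (ipBl hH).
Qed.

Lemma op_bd_pos : exists2 M : R, 0 < M & forall x, H x -> nrm (T x) <= M * nrm x.
Proof.
have [M hM] := op_bd hT; exists (`|M| + 1); first by rewrite ltr_wpDl.
move=> x hx; apply: (le_trans (hM x hx)); rewrite ler_wpM2r ?nrm_ge0 //.
by apply: (le_trans (ler_norm _)); rewrite lerDl.
Qed.

Lemma op_nrm0 x : H x -> nrm x = 0 -> nrm (T x) = 0.
Proof.
move=> hx h; have [M hM] := op_bd hT; apply/eqP; rewrite eq_le nrm_ge0 andbT.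
by have := hM x hx; rewrite h mulr0.
Qed.

Lemma op_ip_eqv x y z : H x -> H y -> H z -> nrm (x - y) = 0 -> ip (T x) z = ip (T y) z.
Proof.
move=> hx hy hz h; apply: (nrmB0_ip hH) => //; try exact: (op_in hT).
by rewrite op_nrmB // op_nrm0 //; exact: (phB hH).
Qed.

End op_basics.

Lemma lin_opD T S : lin_op T -> lin_op S -> lin_op (fun x => T x + S x).
Proof.
move=> hT hS; split.
- by move=> x hx; apply: (phD hH); [exact: (op_in hT)|exact: (op_in hS)].
- move=> a x y hx hy.
  have h1 := op_in hT hx; have h2 := op_in hT hy.
  have h3 := op_in hS hx; have h4 := op_in hS hy.
  have h := phL hH a hx hy; have h5 := op_in hT h; have h6 := op_in hS h.
  apply: (@nrm_all_orth _ _ ip H).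
    by apply: (phB hH); [exact: (phD hH)|apply: (phL hH) => //; exact: (phD hH)].
  move=> z hz; rewrite (ipBl hH) //; [|exact: (phD hH)|by apply: (phL hH) => //; exact: (phD hH)].
  rewrite (ipL hH) //; [|exact: (phD hH)|exact: (phD hH)].
  by rewrite !(ipDl hH) // (op_ip hT) // (op_ip hS) //; ring.
- have [M hM] := op_bd hT; have [N hN] := op_bd hS; exists (M + N) => x hx.
  apply: (le_trans (nrmD hH (op_in hT hx) (op_in hS hx))).
  by rewrite mulrDl lerD ?hM ?hN.
Qed.

Lemma lin_opN T : lin_op T -> lin_op (fun x => - T x).
Proof.
move=> hT; split.
- by move=> x hx; apply: (phN hH); exact: (op_in hT).
- move=> a x y hx hy.
  have h1 := op_in hT hx; have h2 := op_in hT hy.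
  have h := phL hH a hx hy; have h5 := op_in hT h.
  rewrite -[RHS](op_lin hT a hx hy) -(nrmN hH).
    by congr (nrm _); rewrite scalerN !opprB opprK -opprD addrC.
  by apply: (phB hH); [exact: (phN hH)|apply: (phL hH) => //; exact: (phN hH)].
- have [M hM] := op_bd hT; exists M => x hx.
  by rewrite (nrmN hH) ?hM //; exact: (op_in hT).
Qed.

Lemma lin_op_comp T S : lin_op T -> lin_op S -> lin_op (fun x => T (S x)).
Proof.
move=> hT hS; split.
- by move=> x hx; apply: (op_in hT); exact: (op_in hS).
- move=> a x y hx hy.
  have h1 := op_in hS hx; have h2 := op_in hS hy.
  have h3 := op_in hT h1; have h4 := op_in hT h2.
  have h := phL hH a hx hy; have h5 := op_in hS h.
  apply: (op_eqv hT) => //; last exact: (phL hH).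
  move=> z hz; rewrite (ipL hH) //.
  rewrite (op_ip_eqv hT h5 (phL hH a h1 h2) hz (op_lin hS a hx hy)).
  by rewrite (op_ip hT).
- have [M M0 hM] := op_bd_pos hT; have [N hN] := op_bd hS; exists (M * N) => x hx.
  apply: (le_trans (hM _ (op_in hS hx))).
  by rewrite -mulrA ler_pM2l // hN.
Qed.

Lemma lin_op0 : lin_op (fun=> 0).
Proof.
split.
- by move=> _ _; exact: (ph0 hH).
- by move=> a x y _ _; rewrite scaler0 addr0 subrr (nrm0 hH).
- by exists 0 => x _; rewrite mul0r (nrm0 hH).
Qed.

Lemma lin_op_sum (I : Type) (r : seq I) (F : I -> V -> V) :
  (forall i, lin_op (F i)) -> lin_op (fun x => \sum_(i <- r) F i x).
Proof.
move=> hF; elim: r => [|i r IH].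
  by under [fun x => _]eq_fun do rewrite big_nil; exact: lin_op0.
by under [fun x => _]eq_fun do rewrite big_cons; exact: lin_opD.
Qed.

Section spb_closure.
Variable (p : R).
Hypothesis p0 : 0 < p.

Lemma powR_add2 (a b c : R) : 0 <= a -> 0 <= b -> 0 <= c -> c <= a + b ->
  c `^ p <= 2 `^ p * (a `^ p + b `^ p).
Proof.
move=> a0 b0 c0 cab.
wlog ab : a b a0 b0 cab / a <= b.
  move=> h; case: (leP a b) => [/h|/ltW /h]; first exact.
  by rewrite addrC [b `^ _ + _]addrC; exact.
apply: (@le_trans _ _ ((2 * b) `^ p)).
  apply: ge0_ler_powR; rewrite ?nnegrE ?mulr_ge0 ?(ltW p0) //.
  by apply: (le_trans cab); rewrite mulr2n mulrDl mul1r lerD2r.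
by rewrite powRM // ler_pM2l ?powR_gt0 // lerDr powR_ge0.
Qed.

(** The common source of the stability properties of [spb]: the pair of systems may be traded for
    two other pairs, possibly different for the two operators, at the cost of a factor 2^p. No norm
    on S_p is involved. *)
Lemma spb_le2 T S1 S2 : spb p S1 -> spb p S2 ->
  (forall e f, orthosys e -> orthosys f -> exists e1 f1 e2 f2,
     [/\ orthosys e1 /\ orthosys f1, orthosys e2 /\ orthosys f2 &
      forall i, cabs (ip (T (e i)) (f i)) <=
        cabs (ip (S1 (e1 i)) (f1 i)) + cabs (ip (S2 (e2 i)) (f2 i))]) -> spb p T.
Proof.
move=> [C1 h1] [C2 h2] h; exists (2 `^ p * (C1 + C2)) => m e f he hf.
have [e1 [f1 [e2 [f2 [[he1 hf1] [he2 hf2] le]]]]] := h e f he hf.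
apply: (@le_trans _ _ (\sum_(i < m) 2 `^ p * (cabs (ip (S1 (e1 i)) (f1 i)) `^ p +
    cabs (ip (S2 (e2 i)) (f2 i)) `^ p))).
  by apply: ler_sum => i _; apply: powR_add2; rewrite ?cabs_ge0.
rewrite -mulr_sumr big_split /= ler_pM2l ?powR_gt0 //.
by apply: lerD; [exact: h1|exact: h2].
Qed.

Lemma spbD T S : lin_op T -> lin_op S -> spb p T -> spb p S -> spb p (fun x => T x + S x).
Proof.
move=> hT hS sT sS; apply: (spb_le2 sT sS) => e f he hf; exists e, f, e, f; split=> // i.
have [He _ _] := he; have [Hf _ _] := hf.
rewrite (ipDl hH) ?cabsD //; [exact: (op_in hT)|exact: (op_in hS)].
Qed.

Lemma spbN T : lin_op T -> spb p T -> spb p (fun x => - T x).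
Proof.
move=> hT [C hC]; exists C => m e f he hf; apply: le_trans (hC m e f he hf).
have [He _ _] := he; have [Hf _ _] := hf.
apply: ler_sum => i _; rewrite (ipNl hH) ?cabsN //; exact: (op_in hT).
Qed.

Lemma spb0 : spb p (fun=> 0).
Proof.
exists 0 => m e f _ [Hf _ _]; rewrite big1 // => i _.
by rewrite (ip0l hH) // cabs0 powR0 // lt0r_neq0.
Qed.

Lemma spb_sum (I : Type) (r : seq I) (F : I -> V -> V) :
  (forall i, lin_op (F i)) -> (forall i, spb p (F i)) ->
  spb p (fun x => \sum_(i <- r) F i x).
Proof.
move=> hF sF; elim: r => [|i r IH].
  by under [fun x => _]eq_fun do rewrite big_nil; exact: spb0.
under [fun x => _]eq_fun do rewrite big_cons.
by apply: spbD => //; exact: lin_op_sum.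
Qed.

(** The single identity expresses self-adjointness and idempotence together, up to null vectors;
    linearity and contractivity follow from it. *)
Record orth_proj P : Prop := OrthProj {
  op_proj_in : forall x, H x -> H (P x);
  op_proj : forall x y, H x -> H y -> ip (P x) (P y) = ip (P x) y }.

Lemma orth_proj_sym P x y : orth_proj P -> H x -> H y -> ip (P x) y = ip x (P y).
Proof.
move=> hP hx hy; have h1 := op_proj_in hP hx; have h2 := op_proj_in hP hy.
by rewrite -(op_proj hP) // (ipC hH h2 h1) (op_proj hP) // -(ipC hH).
Qed.

Lemma orth_proj_lin P : orth_proj P -> lin_op P.
Proof.
move=> hP; split; first exact: (op_proj_in hP).
- move=> a x y hx hy; have h1 := op_proj_in hP hx; have h2 := op_proj_in hP hy.
  have h3 := phL hH a hx hy; have h4 := op_proj_in hP h3; have h5 := phL hH a h1 h2.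
  apply: (@nrm_all_orth _ _ ip H); first exact: (phB hH).
  move=> z hz; have h6 := op_proj_in hP hz.
  by rewrite (ipBl hH) // (ipL hH) // !(orth_proj_sym hP) // (ipL hH) // subrr.
- exists 1 => x hx; rewrite mul1r; have h := op_proj_in hP hx.
  have [h0|h0] := eqVneq (nrm (P x)) 0; first by rewrite h0 nrm_ge0.
  have h0' : 0 < nrm (P x) by rewrite lt_neqAle eq_sym h0 nrm_ge0.
  rewrite -(ler_pM2l h0'); apply: le_trans (cauchy_schwarz hH h hx).
  by rewrite -(op_proj hP) // (ip_nrm hH) // cabs_real normrX ger0_norm ?nrm_ge0.
Qed.

Lemma orth_projC P : orth_proj P -> orth_proj (fun x => x - P x).
Proof.
move=> hP; split=> [x hx|x y hx hy].
  by apply: (phB hH) => //; exact: (op_proj_in hP).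
have h1 := op_proj_in hP hx; have h2 := op_proj_in hP hy.
rewrite (ipBr hH) //; last exact: (phB hH).
have -> : ip (x - P x) (P y) = 0.
  by rewrite (ipBl hH) // (op_proj hP) // (orth_proj_sym hP) // subrr.
by rewrite subr0.
Qed.

(** A projection does not preserve orthogonality, so [P (e i)] cannot be used as a system in [spb].
    The reflection is isometric, hence carries systems to systems, and [P] is its mean with the
    identity. *)
Definition reflection P x := (2%:C : R[i]) *: P x - x.

Lemma reflection_in P x : orth_proj P -> H x -> H (reflection P x).
Proof.
move=> hP hx; apply: (phB hH) => //; apply: (phZ hH); exact: (op_proj_in hP).
Qed.

Lemma reflection_ip P x y : orth_proj P -> H x -> H y ->
  ip (reflection P x) (reflection P y) = ip x y.
Proof.
move=> hP hx hy; have h1 := op_proj_in hP hx; have h2 := op_proj_in hP hy.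
have h3 := phZ hH 2%:C h1; have h4 := phZ hH 2%:C h2.
rewrite /reflection (ipBl hH) //; last exact: (phB hH).
rewrite !(ipBr hH) // !(ipZl hH) // !(ipZr hH) // conjc_real (op_proj hP) //.
by rewrite -(orth_proj_sym hP) //; ring.
Qed.

Lemma reflection_orthosys P e : orth_proj P -> orthosys e ->
  orthosys (fun i => reflection P (e i)).
Proof.
move=> hP [h1 h2 h3]; split.
- by move=> i; exact: reflection_in.
- by move=> i j ij; rewrite reflection_ip // h2.
- by move=> i; rewrite /nrm reflection_ip //; exact: h3.
Qed.

Lemma half_reflection P x : P x = (2^-1%:C : R[i]) *: (reflection P x + x).
Proof.
by rewrite /reflection subrK scalerA -rmorphM /= mulVf ?pnatr_eq0 // scale1r.
Qed.

Lemma spb_projr T P : lin_op T -> orth_proj P -> spb p T -> spb p (fun x => T (P x)).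
Proof.
move=> hT hP sT; apply: (spb_le2 sT sT) => e f he hf.
exists (fun i => reflection P (e i)), f, e, f.
split=> //; first by split=> //; exact: reflection_orthosys.
have [He _ _] := he; have [Hf _ _] := hf => i.
have hr := reflection_in hP (He i).
rewrite (half_reflection P) (opZ_ip hT) //; last exact: (phD hH).
rewrite (opD_ip hT) // cabsM cabs_real ger0_norm ?invr_ge0 //.
by apply: le_trans (cabsD _ _); rewrite ler_piMl ?cabs_ge0 // invf_le1 // ler1n.
Qed.

Lemma spb_projl T P : lin_op T -> orth_proj P -> spb p T -> spb p (fun x => P (T x)).
Proof.
move=> hT hP sT; apply: (spb_le2 sT sT) => e f he hf.
exists e, (fun i => reflection P (f i)), e, f.
split=> //; first by split=> //; exact: reflection_orthosys.
have [He _ _] := he; have [Hf _ _] := hf => i.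
have hr := reflection_in hP (Hf i); have h := op_in hT (He i).
rewrite (orth_proj_sym hP) // (half_reflection P) (ipZr hH) //; last exact: (phD hH).
rewrite (ipDr hH) // cabsM conjc_real cabs_real ger0_norm ?invr_ge0 //.
by apply: le_trans (cabsD _ _); rewrite ler_piMl ?cabs_ge0 // invf_le1 // ler1n.
Qed.

End spb_closure.

End schatten_abstract.

(** * From summable singular values to the intrinsic condition *)

Section schatten_svd.
Variables (R : realType) (V : lmodType R[i]) (ip : V -> V -> R[i]) (H : set V).
Hypotheses (hH : pre_hilbert ip H) (cH : ip_complete ip H).
Local Notation nrm := (nrm ip).
Local Notation orthosys := (orthosys ip H).
Local Notation spb := (spb ip H).
Implicit Types (T S P : V -> V) (x y z : V) (e f : nat -> V).

Lemma orthosys_nrm e (c : nat -> R[i]) (N M : nat) : orthosys e ->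
  nrm (\sum_(N <= n < M) c n *: e n) ^+ 2 <= \sum_(N <= n < M) cabs (c n) ^+ 2.
Proof.
move=> [h1 h2 h3]; elim: M => [|M IH]; first by rewrite !big_geq // (nrm0 hH) expr0n.
have [NM|MN] := leqP N M; last by rewrite !big_geq // (nrm0 hH) expr0n.
have hs : H (\sum_(N <= n < M) c n *: e n) by apply: (ph_sum hH) => i _; exact: (phZ hH).
have hz : H (c M *: e M) by exact: (phZ hH).
rewrite !big_nat_recr //= (pythagoras hH) //.
  apply: lerD => //; rewrite (nrmZ hH) // exprMn ler_piMr ?sqr_ge0 //.
  by rewrite -(expr1n _ 2) ler_pXn2r ?nnegrE ?nrm_ge0.
rewrite big_nat_cond (ip_suml hH) //.
  rewrite big1 // => i /andP[/andP[_ iM] _].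
  by rewrite (ipZl hH) // (ipZr hH) // h2 ?mulr0 //; apply/eqP; rewrite ltn_eqF.
by move=> i _; exact: (phZ hH).
Qed.

(** With norms at most 1, the Fourier sum [y] satisfies |y|^2 <= S and Re <x, y> = S, so that 0 <=
    |x - y|^2 still yields S <= |x|^2. *)
Lemma bessel e x N : orthosys e -> H x ->
  \sum_(0 <= n < N) cabs (ip x (e n)) ^+ 2 <= nrm x ^+ 2.
Proof.
move=> he hx; have [h1 h2 h3] := he.
have := orthosys_nrm (fun n => ip x (e n)) 0 N he.
set S := \sum_(0 <= n < N) cabs _ ^+ 2; set y := \sum_(0 <= n < N) _ => le.
have hy : H y by apply: (ph_sum hH) => i _; exact: (phZ hH).
have := sqr_ge0 (nrm (x + - y)).
rewrite (nrmD_sqr hH) //; last exact: (phN hH).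
rewrite (nrmN hH) // (ipNr hH) // ReN.
have -> : complex.Re (ip x y) = S.
  rewrite (ipC hH hy hx) Re_conj (ip_suml hH) //; last by move=> i _; exact: (phZ hH).
  rewrite (_ : \sum_(0 <= i < N) _ = (\sum_(0 <= n < N) (cabs (ip x (e n)) ^+ 2))%:C) //.
  rewrite rmorph_sum; apply: eq_bigr => i _ /=.
  by rewrite (ipZl hH) // (ipC hH hx (h1 i)) cabs_sqrC.
lra.
Qed.

Lemma bounded_tail (a : nat -> R) (C : R) : (forall n, 0 <= a n) ->
  (forall N, \sum_(0 <= n < N) a n <= C) ->
  forall eps : R, 0 < eps -> exists N, forall M, (N <= M)%N -> \sum_(N <= n < M) a n <= eps.
Proof.
move=> a0 aC eps e0.
pose S := [set \sum_(0 <= n < N) a n | N in setT].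
have hS : has_sup S.
  by split; [exists (\sum_(0 <= n < 0) a n), 0%N|exists C => _ [N _ <-]].
have [_ [N _ <-] hN] := sup_adherent e0 hS.
exists N => M NM.
have : \sum_(0 <= n < M) a n <= sup S by apply: ub_le_sup; [exact: hS.2|exists M].
rewrite (big_cat_nat (n := N)) //= => h; lra.
Qed.

Lemma orthosys_cvg e x : orthosys e -> H x -> (forall n, nrm (e n) = 1 \/ nrm (e n) = 0) ->
  exists2 y, H y & cvg_to ip (fun N => \sum_(0 <= n < N) ip x (e n) *: e n) y /\
   forall n, ip (x - y) (e n) = 0.
Proof.
move=> he hx h01; have [h1 h2 h3] := he.
pose s N := \sum_(0 <= n < N) ip x (e n) *: e n.
have hs N : H (s N) by apply: (ph_sum hH) => i _; exact: (phZ hH).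
have cs : cauchy_in ip s.
  move=> eps e0.
  have [N hN] := @bounded_tail (fun n => cabs (ip x (e n)) ^+ 2) (nrm x ^+ 2)
     (fun n => sqr_ge0 _) (fun N => bessel N he hx) (eps ^+ 2) (exprn_gt0 2 e0).
  have key m n : (N <= n)%N -> (n <= m)%N -> nrm (s m - s n) <= eps.
    move=> Nn nm; rewrite -(ler_pXn2r (n:=2)) ?nnegrE ?nrm_ge0 ?(ltW e0) //.
    rewrite /s (big_cat_nat (n := n)) //= addrAC subrr add0r.
    apply: (le_trans (orthosys_nrm _ _ _ he)); apply: le_trans (hN m (leq_trans Nn nm)).
    rewrite [leRHS](big_cat_nat (n := n)) //= lerDr.
    by apply: sumr_ge0 => i _; exact: sqr_ge0.
  exists N => m n Nm Nn; have [nm|/ltnW mn] := leqP n m; first exact: key.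
  by rewrite (nrmBC hH) //; exact: key.
have [y hy sy] := cH hs cs.
exists y => //; split=> // k.
apply/eqP; rewrite (ipBl hH) // subr_eq0; apply/eqP.
have [ek|ek] := h01 k; last first.
  by rewrite !(ipC hH (h1 k)) ?(nrm0_ip hH) //.
have h : ip (x - y) (e k) = 0.
  (* The shift by [k.+1] makes every partial sum contain the term of index [k], so that all the
     inner products with [e k] vanish. *)
  apply: (@cvg_to_ip _ _ _ _ hH (fun N => x - s (N + k.+1)%N)) => //.
  - by move=> n; exact: (phB hH).
  - exact: (phB hH).
  - move=> eps /sy[N hN]; exists N => n Nn.
    rewrite opprB addrC addrA subrK (nrmBC hH) //.
    by apply: hN; exact: leq_trans Nn (leq_addr _ _).
  - move=> n; rewrite (ipBl hH) // /s (ip_suml hH) //; last by move=> i _; exact: (phZ hH).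
    rewrite (bigD1_seq k) /= ?mem_index_iota ?iota_uniq ?addnS ?ltnS ?leq_addl //.
    rewrite (ipZl hH) // (ip_nrm hH) // ek expr1n mulr1 big1 ?addr0 ?subrr // => i ik.
    by rewrite (ipZl hH) // h2 ?mulr0 //; exact/eqP.
by move: h; rewrite (ipBl hH) // => /eqP; rewrite subr_eq0 => /eqP.
Qed.

Section sum_to_spb.
Variable p : R.
Hypothesis p1 : 1 < p.

Let p0 : 0 < p. Proof. exact: lt_trans p1. Qed.

(* Tangent line of the convex function [s `^ p] at [t]. *)
Lemma young_tangent (s t : R) : 0 <= s -> 0 <= t ->
  p * t `^ (p - 1) * s - (p - 1) * t `^ p <= s `^ p.
Proof.
move=> s0 t0.
have q0 : 0 < p - 1 by rewrite subr_gt0.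
have qq : 0 < p / (p - 1) by exact: divr_gt0.
have pp : p != 0 by exact: lt0r_neq0.
have pq : p - 1 != 0 by exact: lt0r_neq0.
have := @conjugate_powR R s (t `^ (p - 1)) p (p / (p - 1)) s0 (powR_ge0 _ _) p0 qq.
have -> : p^-1 + (p / (p - 1))^-1 = 1 by field; apply/andP.
rewrite -powRrM (_ : (p - 1) * (p / (p - 1)) = p); last by field.
move=> /(_ erefl); rewrite -(ler_pM2l p0) mulrDr => h.
have e1 : p * (s `^ p / p) = s `^ p by field.
have e2 : p * (t `^ p / (p / (p - 1))) = (p - 1) * t `^ p by field; apply/andP.
rewrite e1 e2 in h; lra.
Qed.

(** By the singular value expansion, |<T a_i, b_i>| is at most a sum over n of s_n w_in, up to a
    small error, where [w] is doubly substochastic. Convexity of the p-th power then transfers the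
    bound on the sum of the s_n^p; it is used through tangent lines, which tolerate rows of sum less
    than 1. *)
Lemma sing_data_spb T s e (C : R) : lin_op ip H T -> sing_data ip H T s e ->
  (forall N, \sum_(0 <= n < N) s n `^ p <= C) -> spb p T.
Proof.
move=> hT hs hC.
have He n : H (e n) by case: (sd_in hs n).
have s0 n : 0 <= s n by case: (sd_in hs n).
(* The vectors attached to [s n = 0] have arbitrary norm. Null vectors become 0, as the inverse of 0
   is 0. *)
pose u n := ((nrm (e n))^-1%:C : R[i]) *: e n.
have Hu n : H (u n) by exact: (phZ hH).
have nu n : nrm (u n) = (nrm (e n))^-1 * nrm (e n).
  by rewrite (nrmZ hH) // cabs_real ger0_norm // invr_ge0 nrm_ge0.
have u01 n : nrm (u n) = 1 \/ nrm (u n) = 0.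
  rewrite nu; have [->|h] := eqVneq (nrm (e n)) 0; first by right; rewrite mulr0.
  by left; rewrite mulVf.
have hu : orthosys u.
  split=> //; last by move=> i; case: (u01 i) => ->.
  by move=> i j ij; rewrite (ipZl hH) // (ipZr hH) // (sd_orth hs) // !mulr0.
have u_e n z : H z -> ip z (u n) = 0 -> ip z (e n) = 0.
  move=> hz; rewrite (ipZr hH) // conjc_real => /eqP; rewrite mulf_eq0.
  move=> /orP[|/eqP //]; rewrite -(rmorph0 (real_complex R)) => /eqP/complexI/eqP.
  by rewrite invr_eq0 => /eqP h; rewrite (ipC hH (He n)) // (nrm0_ip hH) // conjc0.
have eigu n g : H g -> ip (T (u n)) (T g) = (s n ^+ 2)%:C * ip (u n) g.
  move=> hg; rewrite (opZ_ip hH hT) //; last exact: (op_in hT).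
  by rewrite (sd_eig hs) // (ipZl hH) //; ring.
have HTu n : H (T (u n)) by exact: (op_in hT).
have nTu n : nrm (T (u n)) = s n * nrm (u n).
  apply/eqP; rewrite -(eqrXn2 (n:=2)) ?mulr_ge0 ?nrm_ge0 //.
  rewrite (nrm_sqr hH) // eigu // (ip_nrm hH) // exprMn -rmorphM; exact/eqP.
(* Left singular vectors, equal to 0 when [s n = 0] by the same convention. *)
pose h n := ((s n)^-1%:C : R[i]) *: T (u n).
have hh : orthosys h.
  split.
  - by move=> i; exact: (phZ hH).
  - move=> i j ij; rewrite (ipZl hH) // ?(ipZr hH) //; last exact: (phZ hH).
    by rewrite eigu // [ip (u i) (u j)](let: And3 _ h2 _ := hu in h2 i j ij) !mulr0.
  - move=> i; rewrite (nrmZ hH) // cabs_real nTu ger0_norm ?invr_ge0 // mulrA.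
    have [->|si] := eqVneq (s i) 0; first by rewrite mulr0 mul0r.
    by rewrite mulVf // mul1r; case: (u01 i) => ->.
have Tuh n (f : V) : H f -> ip (T (u n)) f = (s n)%:C * ip (h n) f.
  move=> hf; rewrite (ipZl hH) // mulrA -rmorphM /=.
  have [s1|s1] := eqVneq (s n) 0; last by rewrite mulfV // mul1r.
  by rewrite (nrm0_ip hH) ?mulr0 // nTu s1 mul0r.
have [B B0 hB] := op_bd_pos hT.
have approx x (f : V) (eps : R) : H x -> H f -> nrm f <= 1 -> 0 < eps -> exists N0, forall N,
    (N0 <= N)%N -> cabs (ip (T x) f) <=
      \sum_(0 <= n < N) s n * (cabs (ip x (u n)) * cabs (ip (h n) f)) + eps.
  move=> hx hf nf e0.
  have [y hy [cy xy]] := orthosys_cvg hu hx u01.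
  have /cy[N0 hN0] : 0 < eps / B by exact: divr_gt0.
  exists N0 => N /hN0; set sN := \sum_(0 <= n < N) _ => le.
  have hsN : H sN by apply: (ph_sum hH) => i _; exact: (phZ hH).
  have hTy : H (T (y - sN)) by apply: (op_in hT); exact: (phB hH).
  have -> : ip (T x) f = ip (T sN) f + ip (T (y - sN)) f.
    rewrite (opB_ip hH hT) // addrC subrK; apply/eqP; rewrite -subr_eq0.
    rewrite -(opB_ip hH hT) // (nrm0_ip hH) //.
      by apply: (op_in hT); exact: (phB hH).
    apply: (sd_ker hs); first exact: (phB hH).
    by move=> n; apply: u_e; [exact: (phB hH)|exact: xy].
  apply: (le_trans (cabsD _ _)); apply: lerD.
    rewrite (op_sum_ip hH hT) //; last by move=> i _; exact: (phZ hH).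
    apply: (le_trans (cabs_sum _ _ _)); apply: ler_sum => n _.
    rewrite (opZ_ip hH hT) // Tuh // !cabsM cabs_real ger0_norm //.
    by rewrite mulrCA.
  apply: (le_trans (cauchy_schwarz hH hTy hf)).
  apply: (@le_trans _ _ (nrm (T (y - sN)))); first by rewrite ler_piMr ?nrm_ge0.
  apply: (le_trans (hB _ (phB hH hy hsN))).
  by rewrite -ler_pdivlMl // mulrC (nrmBC hH).
exists C => m a b ha hb; have [ha1 ha2 ha3] := ha; have [hb1 hb2 hb3] := hb.
pose t i := cabs (ip (T (a i)) (b i)).
have t0 i : 0 <= t i by exact: cabs_ge0.
(* Rows and columns of [w] have sum at most 1: products are bounded by half sums of squares, to
   which Bessel's inequality applies, for [u] and [h] along rows, for [a] and [b] along columns. *)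
pose w i n := cabs (ip (a i) (u n)) * cabs (ip (h n) (b i)).
have w0 i n : 0 <= w i n by rewrite mulr_ge0 ?cabs_ge0.
have Hh n : H (h n) by case: hh.
have amgm (x y : R) : x * y <= 2^-1 * (x ^+ 2 + y ^+ 2).
  by have := sqr_ge0 (x - y); rewrite sqrrB; lra.
have ne1 (x : V) : nrm x <= 1 -> nrm x ^+ 2 <= 1.
  by move=> hx; rewrite -(expr1n _ 2) ler_pXn2r ?nnegrE ?nrm_ge0.
have wn i N : \sum_(0 <= n < N) w i n <= 1.
  apply: (@le_trans _ _ (\sum_(0 <= n < N) 2^-1 *
     (cabs (ip (a i) (u n)) ^+ 2 + cabs (ip (b i) (h n)) ^+ 2))).
    apply: ler_sum => n _; rewrite /w [ip (h n) _](ipC hH (hb1 i) (Hh n)) cabs_conj.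
    exact: amgm.
  rewrite -mulr_sumr big_split /=.
  have h1 := bessel N hu (ha1 i); have h2 := bessel N hh (hb1 i).
  have h3 := ne1 _ (ha3 i); have h4 := ne1 _ (hb3 i); lra.
have wi n : \sum_(i < m) w i n <= 1.
  rewrite -(big_mkord xpredT (fun i => w i n)).
  apply: (@le_trans _ _ (\sum_(0 <= i < m) 2^-1 *
     (cabs (ip (u n) (a i)) ^+ 2 + cabs (ip (h n) (b i)) ^+ 2))).
    apply: ler_sum => i _; rewrite /w [ip (a i) _](ipC hH (Hu n) (ha1 i)) cabs_conj.
    exact: amgm.
  rewrite -mulr_sumr big_split /=.
  have h1 := bessel m ha (Hu n).
  have h2 := bessel m hb (Hh n).
  have [_ _ h5] := hu; have [_ _ h6] := hh.
  have h3 := ne1 _ (h5 n); have h4 := ne1 _ (h6 n); lra.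
(* The error of [approx] at [i] gets multiplied by the slope of the tangent at [t i]. [K] is the sum
   of the slopes, and errors of [eps / (K + 1)] add up to at most [eps]. *)
pose K := \sum_(i < m) p * t i `^ (p - 1).
have K0 : 0 <= K by apply: sumr_ge0 => i _; rewrite mulr_ge0 ?powR_ge0 // ltW.
apply/ler_addgt0Pr => eps e0.
have e1 : 0 < eps / (K + 1) by rewrite divr_gt0 // ltr_wpDl.
have ex (i : nat) := approx _ _ _ (ha1 i) (hb1 i) (hb3 i) e1.
have [N0 hN0] := choice ex.
pose N := \max_(i < m) N0 i.
apply: (@le_trans _ _ (\sum_(i < m) (\sum_(0 <= n < N) w i n * s n `^ p
   + p * t i `^ (p - 1) * (eps / (K + 1))))).
  apply: ler_sum => i _.
  have NiN : (N0 i <= N)%N by exact: (leq_bigmax i (F := fun j : 'I_m => N0 j)).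
  have := hN0 i N NiN; rewrite -/(t i) => le.
  have e2 : t i `^ (p - 1) * t i = t i `^ p.
    have [->|ti] := eqVneq (t i) 0; first by rewrite mulr0 powR0 // lt0r_neq0.
    by rewrite -{2}[t i]powRr1 // -powRD ?subrK // ti implybT.
  have e3 : 0 <= p * t i `^ (p - 1) by rewrite mulr_ge0 ?powR_ge0 // ltW.
  have e4 : 0 <= (p - 1) * t i `^ p by rewrite mulr_ge0 ?powR_ge0 // subr_ge0 ltW.
  have e5 : t i `^ p <= p * t i `^ (p - 1) *
      (\sum_(0 <= n < N) s n * w i n + eps / (K + 1)) - (p - 1) * t i `^ p.
    have h1 := ler_wpM2l e3 le; rewrite -mulrA e2 in h1.
    by apply: (@le_trans _ _ (p * t i `^ p - (p - 1) * t i `^ p)); [lra|rewrite lerB].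
  apply: (le_trans e5); rewrite mulrDr addrAC lerD2r.
  (* The constant term of the tangent line is negative, so distributing it over a row of sum at most
     1 goes in the right direction. *)
  have e6 : (p - 1) * t i `^ p >= \sum_(0 <= n < N) w i n * ((p - 1) * t i `^ p).
    by rewrite -mulr_suml ler_piMl // wn.
  apply: (@le_trans _ _ (\sum_(0 <= n < N) w i n * (p * t i `^ (p - 1) * s n - (p - 1) * t i `^ p))).
    under [leRHS]eq_bigr do rewrite mulrBr.
    rewrite sumrB lerB // mulr_sumr le_eqVlt; apply/orP; left; apply/eqP.
    by apply: eq_bigr => n _; ring.
  apply: ler_sum => n _; apply: ler_wpM2l => //.
  exact: young_tangent.
rewrite big_split /= -mulr_suml; apply: lerD; last first.
  by rewrite mulrCA ler_piMr ?(ltW e0) // ler_pdivrMr ?ltr_wpDl // mul1r lerDl.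
rewrite exchange_big /=; apply: le_trans (hC N); apply: ler_sum => n _.
by rewrite -mulr_suml ler_piMl ?powR_ge0.
Qed.

End sum_to_spb.
End schatten_svd.

(** * From the intrinsic condition to singular values *)

Section spb_svd.
Variables (R : realType) (V : lmodType R[i]) (ip : V -> V -> R[i]) (H : set V).
Hypotheses (hH : pre_hilbert ip H) (cH : ip_complete ip H).
Local Notation nrm := (nrm ip).
Local Notation orthosys := (orthosys ip H).
Local Notation spb := (spb ip H).
Variables (p : R) (T : V -> V).
Hypotheses (p0 : 0 < p) (hT : lin_op ip H T) (sT : spb p T).
Implicit Types (x y z : V).

(* A maximal pair of orthonormal families with [cabs (ip (T (e i)) (f i)) > eps]:
   off these families [T] has norm at most [eps]. *)
Lemma spb_finite_rank_approx (eps : R) : 0 < eps -> exists m e f,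
  [/\ orthosys e, orthosys f, forall i, (i < m)%N -> nrm (e i) = 1 /\ nrm (f i) = 1 &
   forall x y, H x -> H y -> (forall i, (i < m)%N -> ip x (e i) = 0) ->
     (forall i, (i < m)%N -> ip y (f i) = 0) -> cabs (ip (T x) y) <= eps * nrm x * nrm y].
Proof.
move=> e0.
pose Q m := `[< exists e f, [/\ orthosys e, orthosys f,
  forall i, (i < m)%N -> [/\ nrm (e i) = 1, nrm (f i) = 1 & eps <= cabs (ip (T (e i)) (f i))] &
  forall i, (m <= i)%N -> e i = 0 /\ f i = 0] >].
have [C hC] := sT.
(* Each pair contributes at least eps^p to a sum bounded by [C], which bounds the length of the
   families. *)
have [B hB] : exists B, C / eps `^ p < B.+1%:R by exists (Num.truncn (C / eps `^ p)); exact: truncnS_gt.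
have Qb m : Q m -> (m <= B)%N.
  move=> /asboolP[e [f [he hf h _]]].
  rewrite leqNgt; apply/negP => Bm.
  have := hC m e f he hf; apply/negP; rewrite -ltNge.
  rewrite ltr_pdivrMr ?powR_gt0 // in hB; apply: (lt_le_trans hB).
  apply: (@le_trans _ _ (\sum_(i < m) eps `^ p)).
    rewrite big_const_ord iter_addr_0 -[leRHS]mulr_natl ler_wpM2r ?powR_ge0 //.
    by rewrite ler_nat.
  apply: ler_sum => i _; have [_ _ le] := h i (ltn_ord i).
  by apply: ge0_ler_powR; rewrite ?nnegrE ?cabs_ge0 // ltW.
have Q0 : exists m, Q m.
  exists 0%N; apply/asboolP; exists (fun=> 0), (fun=> 0); split => //.
  - split => [_|i j _|_]; rewrite ?(nrm0 hH) ?(ip0l hH) //; exact: (ph0 hH).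
  - split => [_|i j _|_]; rewrite ?(nrm0 hH) ?(ip0l hH) //; exact: (ph0 hH).
case: (ex_maxnP Q0 Qb) => m /asboolP[e [f [he hf h h']]] hmax.
exists m, e, f; split => //; first by move=> i /h[].
move=> x y hx hy xe yf; rewrite leNgt; apply/negP => lt.
have hTx := op_in hT hx.
have nx : nrm x != 0.
  apply/negP => /eqP nx; move: lt; rewrite (nrm0_ip hH) ?cabs0 ?nx ?mulr0 ?mul0r ?ltxx //.
  exact: (op_nrm0 hT).
have ny : nrm y != 0.
  apply/negP => /eqP ny; move: lt; rewrite (ipC hH hy hTx) (nrm0_ip hH) // conjc0 cabs0 ny mulr0.
  by rewrite ltxx.
pose x' := ((nrm x)^-1%:C : R[i]) *: x; pose y' := ((nrm y)^-1%:C : R[i]) *: y.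
have hx' : H x' by exact: (phZ hH).
have hy' : H y' by exact: (phZ hH).
have nx' : nrm x' = 1 by rewrite (nrmZ hH) // cabs_real ger0_norm ?invr_ge0 ?nrm_ge0 // mulVf.
have ny' : nrm y' = 1 by rewrite (nrmZ hH) // cabs_real ger0_norm ?invr_ge0 ?nrm_ge0 // mulVf.
have ext (g : nat -> V) z : orthosys g -> (forall i, (m <= i)%N -> g i = 0) -> H z -> nrm z = 1 ->
    (forall i, (i < m)%N -> ip z (g i) = 0) -> orthosys (fun i => if i == m then z else g i).
  move=> [g1 g2 g3] g0 hz nz zg.
  have zg' i : i != m -> ip z (g i) = 0.
    by move=> im; have [/zg //|/g0 ->] := ltnP i m; rewrite (ip0r hH).
  split.
  - by move=> i; case: ifP.
  - move=> i j ij; case: ifP => [/eqP im|/negbT im]; case: ifP => [/eqP jm|/negbT jm].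
    + by case: ij; rewrite im jm.
    + exact: zg'.
    + by rewrite (ipC hH) // zg' // conjc0.
    + exact: g2.
  - by move=> i; case: ifP => // _; rewrite nz.
(* A pair violating the bound, once normalized, extends the maximal families by one term. *)
suff /hmax : Q m.+1 by rewrite ltnn.
apply/asboolP; exists (fun i => if i == m then x' else e i), (fun i => if i == m then y' else f i).
have [He _ _] := he; have [Hf _ _] := hf.
split.
- by apply: ext => // [i /h' []//|i im]; rewrite (ipZl hH) // xe // mulr0.
- by apply: ext => // [i /h' []//|i im]; rewrite (ipZl hH) // yf // mulr0.
- move=> i; rewrite ltnS leq_eqVlt => /orP[/eqP ->|im]; last by rewrite ltn_eqF //; exact: h.
  rewrite eqxx; split => //.
  rewrite (opZ_ip hH hT) // (ipZr hH) // conjc_real !cabsM !cabs_real !ger0_norm ?invr_ge0 ?nrm_ge0 //.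
  rewrite mulrA -invfM mulrC ler_pdivlMr; last by rewrite mulr_gt0 // lt_neqAle eq_sym ?nx ?ny nrm_ge0.
  by rewrite mulrA ltW.
- by move=> i mi; rewrite gtn_eqF //; apply: h'; exact: ltnW.
Qed.

Lemma orthosys_sub e m x : orthosys e ->
  (forall i, (i < m)%N -> nrm (e i) = 1 \/ nrm (e i) = 0) -> H x ->
  let y := x - \sum_(0 <= i < m) ip x (e i) *: e i in
  [/\ H y, forall i, (i < m)%N -> ip y (e i) = 0 & nrm y <= nrm x].
Proof.
move=> [h1 h2 h3] hm hx.
set s := \sum_(0 <= i < m) _.
have hs : H s by apply: (ph_sum hH) => i _; exact: (phZ hH).
have hy : H (x - s) by exact: (phB hH).
have yo i : (i < m)%N -> ip (x - s) (e i) = 0.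
  move=> im; case: (hm i im) => ei; last first.
    by rewrite (ipC hH (h1 i) hy) (nrm0_ip hH) // conjc0.
  rewrite (ipBl hH) // (ip_suml hH) //; last by move=> j _; exact: (phZ hH).
  rewrite (bigD1_seq i) /= ?mem_index_iota ?iota_uniq //.
  rewrite (ipZl hH) // (ip_nrm hH) // ei expr1n mulr1 big1 ?addr0 ?subrr // => j ji.
  by rewrite (ipZl hH) // h2 ?mulr0 //; exact/eqP.
split => //.
have yx : ip (x - s) s = 0.
  rewrite (ipC hH hs hy) {1}/s big_nat_cond (ip_suml hH) //; last by move=> j _; exact: (phZ hH).
  rewrite big1 ?conjc0 // => i /andP[/andP[_ im] _].
  by rewrite (ipZl hH) // (ipC hH hy) // yo // conjc0 mulr0.
have := pythagoras hH hy hs yx; rewrite subrK => e1.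
rewrite -(ler_pXn2r (n:=2)) ?nnegrE ?nrm_ge0 // e1 lerDl; exact: sqr_ge0.
Qed.

(** Compactness in quantitative form: up to [eps * nrm x], finitely many functionals of [x] and of
    [T x] control [T x]. It is obtained by removing from [x] its components along [e], then from the
    image of the rest its components along [f]. *)
Lemma spb_compact_bound (eps : R) : 0 < eps -> exists m e f (M : R),
  [/\ 0 <= M, orthosys e, orthosys f & forall x, H x -> nrm (T x) <=
    eps * nrm x + M * \sum_(0 <= i < m) (cabs (ip x (e i)) + cabs (ip (T x) (f i)))].
Proof.
move=> e0; have [m [e [f [he hf h1 hef]]]] := spb_finite_rank_approx e0.
have [B B0 hB] := op_bd_pos hT.
(* The three terms account for the components of [T x] along [f], for the image [T s] of the part of
   [x] along [e], and for the [m] components of [T s] along [f]. *)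
exists m, e, f, (1 + B + B *+ m); split => //.
  by rewrite !addr_ge0 ?mulrn_wge0 ?(ltW B0).
move=> x hx.
have [He _ e1] := he; have [Hf _ f1] := hf.
set s := \sum_(0 <= i < m) ip x (e i) *: e i.
have hs : H s by apply: (ph_sum hH) => i _; exact: (phZ hH).
have [hy ye ny] := @orthosys_sub e m x he (fun i im => or_introl (h1 i im).1) hx.
rewrite -/s in hy ye ny; set y := x - s in hy ye ny.
have hTy := op_in hT hy; have hTx := op_in hT hx; have hTs := op_in hT hs.
have [hz zf nz] := @orthosys_sub f m (T y) hf (fun i im => or_introl (h1 i im).2) hTy.
set t := \sum_(0 <= i < m) _ in hz zf nz.
have ht : H t by apply: (ph_sum hH) => i _; exact: (phZ hH).
set z := T y - t in hz zf nz.
have zt : ip t z = 0.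
  rewrite /t big_nat_cond (ip_suml hH) //; last by move=> j _; exact: (phZ hH).
  rewrite big1 // => i /andP[/andP[_ im] _].
  by rewrite (ipZl hH) // (ipC hH hz) // zf // conjc0 mulr0.
have nz' : nrm z <= eps * nrm x.
  have [z0|z0] := eqVneq (nrm z) 0; first by rewrite z0 mulr_ge0 ?nrm_ge0 ?ltW.
  have z1 : 0 < nrm z by rewrite lt_neqAle eq_sym z0 nrm_ge0.
  rewrite -(ler_pM2r z1).
  have -> : nrm z * nrm z = cabs (ip (T y) z).
    have -> : ip (T y) z = ip z z by rewrite {2}/z (ipBl hH) // zt subr0.
    by rewrite (ip_nrm hH) // cabs_real ger0_norm ?sqr_ge0 // expr2.
  apply: (le_trans (hef _ _ hy hz ye zf)).
  by rewrite ler_wpM2r ?nrm_ge0 // ler_pM2l.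
set S := \sum_(0 <= i < m) (_ + _).
have Sx : \sum_(0 <= i < m) cabs (ip x (e i)) + \sum_(0 <= i < m) cabs (ip (T x) (f i)) = S.
  by rewrite -big_split.
have S1 : 0 <= \sum_(0 <= i < m) cabs (ip x (e i)) by apply: sumr_ge0 => *; exact: cabs_ge0.
have S2 : 0 <= \sum_(0 <= i < m) cabs (ip (T x) (f i)) by apply: sumr_ge0 => *; exact: cabs_ge0.
have ns : nrm s <= \sum_(0 <= i < m) cabs (ip x (e i)).
  apply: (le_trans (nrm_sum hH _ _)); first by move=> i _; exact: (phZ hH).
  by apply: ler_sum => i _; rewrite (nrmZ hH) // ler_piMr ?cabs_ge0.
have nTs : nrm (T s) <= B * \sum_(0 <= i < m) cabs (ip x (e i)).
  by apply: (le_trans (hB _ hs)); rewrite ler_pM2l.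
have nt : nrm t <= \sum_(0 <= i < m) cabs (ip (T x) (f i)) + nrm (T s) *+ m.
  apply: (le_trans (nrm_sum hH _ _)); first by move=> i _; exact: (phZ hH).
  rewrite -[X in _ <= _ + _ *+ X]subn0 -sumr_const_nat -big_split.
  apply: ler_sum => i _; rewrite (nrmZ hH) //.
  apply: (@le_trans _ _ (cabs (ip (T y) (f i)))); first by rewrite ler_piMr ?cabs_ge0.
  rewrite (opB_ip hH hT) //; apply: (le_trans (cabsB _ _)); rewrite lerD2l.
  apply: (le_trans (cauchy_schwarz hH hTs (Hf i))).
  by rewrite ler_piMr ?nrm_ge0.
have nTx : nrm (T x) <= nrm z + nrm t + nrm (T s).
  have -> : nrm (T x) = nrm (z + t + T s).
    apply: (nrmB0_nrm hH) => //; first by rewrite /z subrK; exact: (phD hH).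
    rewrite /z subrK; apply: (op_eqv hH hT) => //; last exact: (phD hH).
    by move=> w hw; rewrite (ipDl hH) // (opB_ip hH hT) // subrK.
  apply: (le_trans (nrmD hH _ hTs)); first exact: (phD hH).
  by rewrite lerD2r; exact: (nrmD hH).
apply: (le_trans nTx); rewrite -addrA; apply: lerD => //.
apply: (le_trans (lerD nt nTs)).
have h2 : nrm (T s) *+ m <= (B *+ m) * S.
  rewrite mulrnAl -[leLHS]mulr_natl -[leRHS]mulr_natl ler_wpM2l //.
  by apply: (le_trans nTs); rewrite ler_pM2l // -Sx lerDl.
have h3 : B * \sum_(0 <= i < m) cabs (ip x (e i)) <= B * S by rewrite ler_pM2l // -Sx lerDl.
rewrite !mulrDl mul1r; have : \sum_(0 <= i < m) cabs (ip (T x) (f i)) <= S by rewrite -Sx lerDr.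
lra.
Qed.

End spb_svd.

(** Along an ultrafilter every bounded scalar sequence is Cauchy, by compactness of segments. The
    same ultrafilter serves for all sequences, which replaces successive extractions of
    subsequences. *)
Lemma bounded_ultra_lim (R : realType) (G : set_system nat) (c : nat -> R[i]) (B : R) :
  UltraFilter G -> (forall k, cabs (c k) <= B) ->
  forall eps : R, 0 < eps -> exists2 S, G S & forall k l, S k -> S l -> cabs (c k - c l) <= eps.
Proof.
move=> uG cB eps e0.
have real_case (r : nat -> R) : (forall k, `|r k| <= B) ->
    exists2 S, G S & forall k l, S k -> S l -> `|r k - r l| <= eps / 2.
  move=> rB.
  pose F := r @ G.
  have pG : ProperFilter G by exact: ultra_proper.
  have pF : ProperFilter F by exact: fmap_proper_filter.
  have FB : F `[-B, B]%classic.
    by apply: (@filterE _ G) => k /=; rewrite in_itv /= -ler_norml.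
  have [l [_ cl]] := @segment_compact R (-B) B F pF FB.
  exists [set k | `|r k - l| <= eps / 4].
    have [//|] := in_ultra_setVsetC [set k | `|r k - l| <= eps / 4] uG.
    move=> GC.
    have /cl : F [set x | eps / 4 < `|x - l|].
      by apply: (@filterS _ G _ _ _ _ GC) => k /=; move/negP; rewrite -ltNge.
    have nb : nbhs l [set x | `|l - x| < eps / 4].
      by apply: nbhsx_ballx; rewrite divr_gt0.
    by move=> /(_ _ nb)[x [/= h1]]; rewrite distrC => h2; have := lt_trans h1 h2; rewrite ltxx.
  move=> k l' /= h1 h2; have -> : r k - r l' = (r k - l) - (r l' - l) by ring.
  apply: (le_trans (ler_normB _ _)); lra.
have [S1 G1 h1] := real_case (fun k => complex.Re (c k)) (fun k => le_trans (Re_le_cabs _) (cB k)).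
have [S2 G2 h2] := real_case (fun k => complex.Im (c k)) (fun k => le_trans (Im_le_cabs _) (cB k)).
exists (S1 `&` S2); first exact: filterI.
move=> k l [k1 k2] [l1 l2]; apply: (le_trans (cabs_le_ReIm _)).
rewrite ReD ReN ImD ImN; have := h1 _ _ k1 l1; have := h2 _ _ k2 l2; lra.
Qed.
Local Notation nrm_of := nrm.

Section spb_svd_exists.
Variables (R : realType) (V : lmodType R[i]) (ip : V -> V -> R[i]) (H : set V).
Hypotheses (hH : pre_hilbert ip H) (cH : ip_complete ip H).
Local Notation nrm := (nrm ip).
Local Notation orthosys := (orthosys ip H).
Local Notation spb := (spb ip H).
Variables (p : R) (T : V -> V).
Hypotheses (p0 : 0 < p) (hT : lin_op ip H T) (sT : spb p T).
Implicit Types (x y z : V).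

Lemma filter_big_nat (G : set_system nat) (S : nat -> set nat) n : Filter G ->
  (forall i, G (S i)) -> G [set k | forall i, (i < n)%N -> S i k].
Proof.
move=> fG GS; elim: n => [|n IH]; first exact: filterE.
apply: filterS (filterI IH (GS n)) => k [h1 h2] i.
by rewrite ltnS leq_eqVlt => /orP[/eqP ->|/h1].
Qed.

(** [T] is compact. Along one ultrafilter, the functionals of [spb_compact_bound] are Cauchy for
    every [eps] at once, hence so are the images; a subsequence is then picked in sets of the
    ultrafilter. *)
Lemma spb_cauchy_subseq (x : nat -> V) : (forall k, H (x k)) -> (forall k, nrm (x k) <= 1) ->
  exists2 k : nat -> nat, (forall j, (j <= k j)%N) & cauchy_in ip (fun j => T (x (k j))).
Proof.
move=> hx nx.
have [G [uG FG]] := @ultraFilterLemma nat \oo _.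
have pG : ProperFilter G by exact: ultra_proper.
have hTx k := op_in hT (hx k).
have [B B0 hB] := op_bd_pos hT.
have nTx k : nrm (T (x k)) <= B.
  by apply: (le_trans (hB _ (hx k))); rewrite ler_piMr // ltW.
have key (eps : R) : 0 < eps ->
    exists2 S, G S & forall k l, S k -> S l -> nrm (T (x k) - T (x l)) <= eps.
  move=> e0.
  have e4 : 0 < eps / 4 by rewrite divr_gt0.
  have [m [e [f [M [M0 [He _ e1] [Hf _ f1] bd]]]]] := spb_compact_bound hH p0 hT sT e4.
  (* Each of the 2m functionals varies by at most [d], so their contribution is at most M * m * 2d
     <= eps / 2. The other half comes from [eps / 4] times a difference of norm at most 2. *)
  pose d := eps / (4 * (M * m%:R + 1)).
  have Mm : 0 < M * m%:R + 1 by rewrite ltr_wpDl // mulr_ge0.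
  have d0 : 0 < d by rewrite divr_gt0 // mulr_gt0.
  have bnd y e' C : H y -> H e' -> nrm y <= C -> nrm e' <= 1 -> cabs (ip y e') <= C.
    move=> hy he ny ne; apply: (le_trans (cauchy_schwarz hH hy he)).
    by apply: le_trans ny; rewrite ler_piMr ?nrm_ge0.
  have ex1 i : exists S, G S /\ forall k l, S k -> S l -> cabs (ip (x k) (e i) - ip (x l) (e i)) <= d.
    have [S GS hS] := @bounded_ultra_lim R G (fun k => ip (x k) (e i)) 1 uG
      (fun k => bnd _ _ _ (hx k) (He i) (nx k) (e1 i)) d d0.
    by exists S.
  have ex2 i : exists S, G S /\ forall k l, S k -> S l -> cabs (ip (T (x k)) (f i) - ip (T (x l)) (f i)) <= d.
    have [S GS hS] := @bounded_ultra_lim R G (fun k => ip (T (x k)) (f i)) B uG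
      (fun k => bnd _ _ _ (hTx k) (Hf i) (nTx k) (f1 i)) d d0.
    by exists S.
  have [S1 hS1] := choice ex1; have [S2 hS2] := choice ex2.
  exists [set k | forall i, (i < m)%N -> (S1 i `&` S2 i) k].
    apply: filter_big_nat => i; apply: filterI; [by case: (hS1 i)|by case: (hS2 i)].
  move=> k l /= hk hl.
  rewrite (op_nrmB hH hT) //; apply: (le_trans (bd _ (phB hH (hx k) (hx l)))).
  have h1 : eps / 4 * nrm (x k - x l) <= eps / 2.
    have h : nrm (x k - x l) <= 2.
      by apply: (le_trans (nrmB hH (hx k) (hx l))); have := nx k; have := nx l; lra.
    apply: (@le_trans _ _ (eps / 4 * 2)); first by rewrite ler_pM2l.
    lra.
  have h2 : M * \sum_(0 <= i < m) (cabs (ip (x k - x l) (e i)) + cabs (ip (T (x k - x l)) (f i)))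
       <= M * (m%:R * (2 * d)).
    rewrite ler_wpM2l //.
    apply: (@le_trans _ _ (\sum_(0 <= i < m) (2 * d))); last first.
      by rewrite sumr_const_nat subn0 [leRHS]mulr_natl.
    rewrite big_nat_cond [leRHS]big_nat_cond; apply: ler_sum => i /andP[/andP[_ im] _].
    rewrite (ipBl hH) // (opB_ip hH hT) //.
    have [k1 k2] := hk i im; have [l1 l2] := hl i im.
    have := (hS1 i).2 _ _ k1 l1; have := (hS2 i).2 _ _ k2 l2; lra.
  have h3 : M * (m%:R * (2 * d)) <= eps / 2.
    have -> : M * (m%:R * (2 * d)) = (eps / 2) * (M * m%:R / (M * m%:R + 1)).
      have Mm' := lt0r_neq0 Mm; rewrite /d; move: (m%:R) Mm' => r Mm'; by field.
    rewrite ler_piMr ?divr_ge0 ?(ltW e0) //.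
    by rewrite ler_pdivrMr // mul1r lerDl.
  lra.
have keyn n : exists S, G S /\ forall k l, S k -> S l -> nrm (T (x k) - T (x l)) <= n.+1%:R^-1.
  by have [|S GS hS] := key n.+1%:R^-1; [rewrite invr_gt0|exists S].
have [S hS] := choice keyn.
have pick j : exists k, (j <= k)%N /\ forall i, (i < j.+1)%N -> S i k.
  have h1 : G [set k | forall i, (i < j.+1)%N -> S i k].
    by apply: filter_big_nat => i; case: (hS i).
  have h2 : G [set k | (j <= k)%N] by apply: FG; exists j.
  by have [k [h3 h4]] := filter_ex (filterI h1 h2); exists k.
have [k hk] := choice pick.
exists k; first by move=> j; case: (hk j).
move=> eps e0.
have [N hN] : exists N, eps^-1 <= N.+1%:R.
  by exists (Num.truncn eps^-1); apply/ltW; exact: truncnS_gt.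
exists N => i j Ni Nj.
apply: (@le_trans _ _ N.+1%:R^-1).
  by apply: (hS N).2; [apply: (hk i).2|apply: (hk j).2]; rewrite ltnS.
by rewrite -[leRHS]invrK lef_pV2 ?posrE ?invr_gt0 ?ltr0Sn.
Qed.

Section step.
Variable M : set V.
Hypotheses (MH : M `<=` H) (M0 : M 0)
  (ML : forall a x y, M x -> M y -> M (a *: x + y))
  (Mcl : forall (x : nat -> V) y, (forall n, M (x n)) -> H y -> cvg_to ip x y -> M y).

(** [s] is the norm of [T] on the closed subspace [M], attained at [e] by compactness; if [T]
    vanishes on [M], the default is [e = 0]. The eigenvalue equation is obtained only against
    [M]. *)
Lemma spb_maximizer : exists e s, [/\ 0 <= s /\ M e, s <> 0 -> nrm e = 1, s = 0 -> e = 0 & [/\ nrm (T e) = s,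
   (forall x, M x -> nrm (T x) <= s * nrm x) &
   (forall g, M g -> ip (T e) (T g) = (s ^+ 2)%:C * ip e g)]].
Proof.
have hM := pre_hilbert_sub hH MH M0 ML.
have [B B0 hB] := op_bd_pos hT.
pose S := [set nrm (T x) | x in [set x | M x /\ nrm x <= 1]].
have S0 : S (nrm (T 0)) by exists 0 => //; split => //; rewrite (nrm0 hH).
have ubS : ubound S B.
  move=> _ [x [Mx nx] <-]; apply: (le_trans (hB _ (MH Mx))); rewrite ler_piMr //; exact: ltW.
have hS : has_sup S by split; [exists (nrm (T 0))|exists B].
set s := sup S.
have nT0 : nrm (T 0) = 0 by apply: (op_nrm0 hT); [exact: (ph0 hH)|exact: (nrm0 hH)].
have s0 : 0 <= s by rewrite -nT0; apply: ub_le_sup => //; exact: hS.2.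
have Ts x : M x -> nrm (T x) <= s * nrm x.
  move=> Mx; have Hx := MH Mx.
  have [nx|nx] := eqVneq (nrm x) 0; first by rewrite (op_nrm0 hT) // nx mulr0.
  have nx0 : 0 < nrm x by rewrite lt_neqAle eq_sym nx nrm_ge0.
  rewrite -ler_pdivrMr //.
  have Mx' : M (((nrm x)^-1%:C : R[i]) *: x) by exact: (phZ hM).
  have -> : nrm (T x) / nrm x = nrm (T (((nrm x)^-1%:C : R[i]) *: x)).
    have hTx := op_in hT Hx.
    transitivity (nrm (((nrm x)^-1%:C : R[i]) *: T x)).
      by rewrite (nrmZ hH) // cabs_real ger0_norm ?invr_ge0 ?nrm_ge0 // mulrC.
    symmetry; apply: (nrmB0_nrm hH); [by apply: (op_in hT); exact: MH|exact: (phZ hH)|].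
    apply: (op_eqv hH hT); [exact: MH| |exact: (phZ hH)].
    by move=> z hz; rewrite (opZ_ip hH hT) // (ipZl hH).
  apply: ub_le_sup; first exact: hS.2.
  eexists; last reflexivity; split => //.
  by rewrite (nrmZ hH) // cabs_real ger0_norm ?invr_ge0 ?nrm_ge0 // mulVf.
have [sz|sz] := eqVneq s 0.
  exists 0, 0; split => //; split => //; first by move=> x Mx; rewrite -sz; exact: Ts.
  move=> g Mg; rewrite expr0n /= mul0r (nrm0_ip hH) //; [|]; apply: (op_in hT); [exact: (ph0 hH)|exact: MH].
have sp : 0 < s by rewrite lt_neqAle eq_sym sz.
(* [s^2 |x|^2 - |T x|^2] is a positive form on [M]: its Cauchy-Schwarz inequality
   yields both the convergence of maximizing sequences and the eigenvalue equation. *)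
pose q x y := (s ^+ 2)%:C * ip x y - ip (T x) (T y).
have hq : pre_hilbert q M.
  split => //.
  - move=> a x y z /MH hx /MH hy /MH hz; rewrite /q (ipL hH) // (op_ip hH hT) //; last exact: (op_in hT).
    by ring.
  - move=> x y /MH hx /MH hy; rewrite /q conjcD conjcN conjcM conjc_real -(ipC hH) // -(ipC hH) //.
    exact: (op_in hT). exact: (op_in hT).
  - move=> x Mx; have hx := MH Mx; have hTx := op_in hT hx.
    rewrite /q !(ip_nrm hH) // -rmorphM -rmorphB ler0c subr_ge0 /= -exprMn.
    by rewrite ler_pXn2r ?nnegrE ?mulr_ge0 ?nrm_ge0 //; exact: Ts.
have qn x : M x -> nrm_of q x ^+ 2 = s ^+ 2 * nrm x ^+ 2 - nrm (T x) ^+ 2.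
  move=> Mx; have hx := MH Mx; have hTx := op_in hT hx.
  by rewrite (nrm_sqr hq) // /q !(ip_nrm hH) // -rmorphM -rmorphB.
have exx n : exists x, [/\ M x, nrm x <= 1 & s - n.+1%:R^-1 <= nrm (T x)].
  have [|_ [x [Mx nx] <-] /ltW lt] := @sup_adherent _ S n.+1%:R^-1 _ hS; first by rewrite invr_gt0.
  by exists x.
have [x0 hx0] := choice exx.
have [k kj cTx] := @spb_cauchy_subseq x0 (fun n => MH (let: And3 h _ _ := hx0 n in h))
  (fun n => let: And3 _ h _ := hx0 n in h).
pose x n := x0 (k n).
have Mx n : M (x n) by case: (hx0 (k n)).
have Hx n : H (x n) by exact: MH.
have nx n : nrm (x n) <= 1 by case: (hx0 (k n)).
have HTx n : H (T (x n)) by exact: (op_in hT).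
have xT n : s - n.+1%:R^-1 <= nrm (T (x n)).
  have [_ _ h] := hx0 (k n); apply: le_trans h; rewrite lerB // lef_pV2 ?posrE ?ltr0Sn //.
  by rewrite ler_nat ltnS.
have small (eps : R) : 0 < eps -> exists N, forall n, (N <= n)%N -> n.+1%:R^-1 <= eps.
  move=> e0; exists (Num.truncn eps^-1) => n Nn.
  rewrite -[leRHS]invrK lef_pV2 ?posrE ?invr_gt0 ?ltr0Sn //.
  apply/ltW; apply: (lt_le_trans (truncnS_gt _)); by rewrite ler_nat ltnS.
have qx n : nrm_of q (x n) ^+ 2 <= 2 * s * n.+1%:R^-1.
  rewrite qn //; have i0 : 0 < n.+1%:R^-1 :> R by rewrite invr_gt0.
  move: (n.+1%:R^-1) i0 (xT n) => i i0 xTn.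
  have h1 : nrm (x n) ^+ 2 <= 1 by rewrite -(expr1n _ 2) ler_pXn2r ?nnegrE ?nrm_ge0.
  have h2 : s ^+ 2 * nrm (x n) ^+ 2 <= s ^+ 2 by rewrite ler_piMr ?sqr_ge0.
  have h3 : s ^+ 2 - 2 * s * i <= nrm (T (x n)) ^+ 2.
    have [si|/ltW si] := leP i s.
      apply: (@le_trans _ _ ((s - i) ^+ 2)); first by rewrite sqrrB; have := sqr_ge0 i; lra.
      by rewrite ler_pXn2r ?nnegrE ?nrm_ge0 // subr_ge0.
    apply: le_trans (sqr_ge0 _).
    rewrite subr_le0 expr2 -mulrA mulrCA ler_pM2l //; lra.
  lra.
(* s^2 |x m - x n|^2 is the sum of the form [q] at the difference, small for a maximizing sequence,
   and of |T (x m - x n)|^2, small along the subsequence. So the vectors converge in norm, and no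
   weak limit is taken. *)
have cx : cauchy_in ip x.
  move=> eps e0.
  pose d := (s * eps) ^+ 2 / 2.
  have d0 : 0 < d by rewrite divr_gt0 // exprn_gt0 // mulr_gt0.
  have se0 : 0 < s * eps / 2 by rewrite divr_gt0 // mulr_gt0.
  have [N1 h1] := cTx _ se0.
  have q0 : 0 < (s * eps / 4) ^+ 2 / (2 * s).
    by rewrite divr_gt0 ?exprn_gt0 ?mulr_gt0 ?divr_gt0 ?mulr_gt0.
  have [N2 h2] := small _ q0.
  exists (maxn N1 N2) => m n; rewrite !geq_max => /andP[m1 m2] /andP[n1 n2].
  have Md : M (x m - x n) by exact: (phB hM).
  have Qle j : (N2 <= j)%N -> nrm_of q (x j) <= s * eps / 4.
    move=> Nj; have s4 : 0 <= s * eps / 4 by rewrite divr_ge0 ?mulr_ge0 ?(ltW e0).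
    rewrite -(ler_pXn2r (n:=2)) ?nnegrE ?nrm_ge0 //; apply: (le_trans (qx j)).
    have s2 : 0 < 2 * s by rewrite mulr_gt0.
    by have := h2 j Nj; rewrite ler_pdivlMr // mulrC.
  have Q1 : nrm_of q (x m - x n) <= s * eps / 2.
    apply: (le_trans (nrmB hq (Mx m) (Mx n))); have := Qle m m2; have := Qle n n2; lra.
  have Q2 : nrm_of q (x m - x n) ^+ 2 <= (s * eps / 2) ^+ 2.
    by rewrite ler_pXn2r ?nnegrE ?nrm_ge0 // ltW.
  have Q3 : nrm (T (x m - x n)) ^+ 2 <= (s * eps / 2) ^+ 2.
    by rewrite ler_pXn2r ?nnegrE ?nrm_ge0 ?(ltW se0) // -(op_nrmB hH hT) //; exact: h1.
  rewrite -(ler_pM2l sp) -(ler_pXn2r (n:=2)) ?nnegrE ?mulr_ge0 ?nrm_ge0 ?(ltW e0) //.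
  rewrite exprMn; move: Q2; rewrite qn //.
  have : (s * eps / 2) ^+ 2 + (s * eps / 2) ^+ 2 <= (s * eps) ^+ 2.
    by have := sqr_ge0 (s * eps); lra.
  lra.
have [e He xe] := cH Hx cx.
have Me : M e by exact: Mcl xe.
have ne : nrm e <= 1.
  apply/ler_addgt0Pr => eps /xe[N /(_ N (leqnn _)) h].
  rewrite (_ : e = x N - (x N - e)); last by rewrite subKr.
  apply: (le_trans (nrmB hH _ _)) => //; first exact: (phB hH).
  exact: lerD.
have nTe : nrm (T e) = s.
  apply/eqP; rewrite eq_le; apply/andP; split.
    by apply: (le_trans (Ts e Me)); rewrite ler_piMr.
  apply/ler_addgt0Pr => eps e0.
  have e1 : 0 < eps / 2 by rewrite divr_gt0.
  have e2 : 0 < eps / 2 / B by rewrite divr_gt0.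
  have [N1 h1] := xe _ e2; have [N2 h2] := small _ e1.
  pose n := maxn N1 N2.
  have := xT n; have := h2 n (leq_maxr _ _); move: (n.+1%:R^-1) => i i1 i2.
  have h3 : nrm (T (x n)) <= nrm (T e) + eps / 2.
    have hTe := op_in hT He.
    rewrite -[T (x n)](subrK (T e)) addrC.
    apply: (le_trans (nrmD hH hTe (phB hH (HTx n) hTe))); rewrite lerD2l.
    rewrite (op_nrmB hH hT) //; apply: (le_trans (hB _ (phB hH (Hx n) He))).
    by rewrite mulrC -ler_pdivlMr //; apply: h1; exact: leq_maxl.
  lra.
exists e, s; split => //.
- move=> _; apply/eqP; rewrite eq_le ne /=.
  by have := Ts e Me; rewrite nTe ler_pMr.
- by move=> h; rewrite h eqxx in sz.
split => //.
move=> g Mg; apply/eqP; rewrite eq_sym -subr_eq0; apply/eqP.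
apply: (nrm0_ip hq Me Mg); apply/eqP; rewrite -(sqrf_eq0 (nrm_of q e)) qn // nTe.
apply/eqP; suff -> : nrm e = 1 by rewrite expr1n mulr1 subrr.
by apply/eqP; rewrite eq_le ne /=; have := Ts e Me; rewrite nTe ler_pMr.
Qed.
End step.

(** The vector [e n] maximizes |T x| on the orthogonal complement of its predecessors. The images
    are orthogonal as well, so [spb] for the [e n] and their normalized images, whose pairing with
    [T (e n)] is [s n], bounds the sum of the p-th powers. *)
Lemma spb_sing_data : exists s e, sing_data ip H T s e /\
  exists C, forall N, \sum_(0 <= n < N) s n `^ p <= C.
Proof.
pose M (l : seq V) := [set x | H x /\ forall y, y \in l -> ip x y = 0].
have step (l : seq V) : exists es : V * R, (forall y, y \in l -> H y) ->
  [/\ 0 <= es.2 /\ M l es.1, es.2 <> 0 -> nrm es.1 = 1, es.2 = 0 -> es.1 = 0 & [/\ nrm (T es.1) = es.2,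
   (forall x, M l x -> nrm (T x) <= es.2 * nrm x) &
   (forall g, M l g -> ip (T es.1) (T g) = (es.2 ^+ 2)%:C * ip es.1 g)]].
  (* Choice asks for a total function of the list of predecessors; lists not contained in [H] get a
     default. *)
  have [hl|hl] := pselect (forall y, y \in l -> H y); last by exists (0, 0) => /hl.
  have [||||e [s h]] := @spb_maximizer (M l).
  - by move=> x [].
  - by split; [exact: (ph0 hH)|move=> y yl; rewrite (ip0l hH) //; exact: hl].
  - move=> a x y [hx xl] [hy yl]; split; first exact: (phL hH).
    by move=> z zl; rewrite (ipL hH) ?xl ?yl ?mulr0 ?addr0 //; exact: hl.
  - move=> x y hx hy xy; split => // z zl.
    apply: (@cvg_to_ip _ _ _ _ hH x) => //; first by move=> n; case: (hx n).
      exact: hl.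
    by move=> n; case: (hx n) => _; exact.
  by exists (e, s).
have [st hst] := choice step.
pose fix L n := if n is n'.+1 then rcons (L n') (st (L n')).1 else [::].
pose e n := (st (L n)).1; pose s n := (st (L n)).2.
have LS n : L n.+1 = rcons (L n) (e n) by [].
have LH n : forall y, y \in L n -> H y.
  elim: n => [//|n IH] y; rewrite LS mem_rcons in_cons => /orP[/eqP ->|]; last exact: IH.
  by have [[_ [h _]] _ _ _] := hst _ IH.
have eL m n : (m < n)%N -> e m \in L n.
  elim: n => [//|n IH]; rewrite ltnS leq_eqVlt LS mem_rcons in_cons => /orP[/eqP ->|/IH ->].
    by rewrite eqxx.
  by rewrite orbT.
have Lsub n x : H x -> (forall m, (m < n)%N -> ip x (e m) = 0) -> M (L n) x.
  move=> hx h; split => //; elim: n h => [//|n IH] h y.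
  rewrite LS mem_rcons in_cons => /orP[/eqP ->|]; first exact: h.
  by apply: IH => m mn; apply: h; exact: ltnW.
have s0 n : 0 <= s n by case: (hst _ (LH n)) => -[].
have eM n : M (L n) (e n) by case: (hst _ (LH n)) => -[].
have e0 n : s n = 0 -> e n = 0 by case: (hst _ (LH n)).
have He n : H (e n) by case: (eM n).
have e1 n : s n <> 0 -> nrm (e n) = 1 by case: (hst _ (LH n)).
have Te n : nrm (T (e n)) = s n by case: (hst _ (LH n)) => _ _ _ [].
have Tx n x : M (L n) x -> nrm (T x) <= s n * nrm x by case: (hst _ (LH n)) => _ _ _ [_ h _]; exact: h.
have Tg n g : M (L n) g -> ip (T (e n)) (T g) = (s n ^+ 2)%:C * ip (e n) g.
  by case: (hst _ (LH n)) => _ _ _ [_ _ h]; exact: h.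
have HT n : H (T (e n)) by exact: (op_in hT).
have lt0 m n : (m < n)%N -> ip (e n) (e m) = 0.
  by move=> mn; case: (eM n) => _; apply; exact: eL.
have orth m n : m <> n -> ip (e m) (e n) = 0.
  move=> /eqP; rewrite neq_ltn => /orP[|] mn; last exact: lt0.
  by rewrite (ipC hH (He n)) // lt0 // conjc0.
have orthT m n : m <> n -> ip (T (e m)) (T (e n)) = 0.
  suff h m' n' : (m' < n')%N -> ip (T (e m')) (T (e n')) = 0.
    move=> /eqP; rewrite neq_ltn => /orP[|] mn; first exact: h.
    by rewrite (ipC hH (HT n)) // h // conjc0.
  move=> mn; rewrite Tg; last first.
    by apply: Lsub => // j jm; apply: orth => /eqP; rewrite gtn_eqF // (ltn_trans jm).
  by rewrite orth ?mulr0 //; apply/eqP; rewrite ltn_eqF.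
pose f n := ((s n)^-1%:C : R[i]) *: T (e n).
have e01 n : nrm (e n) = 1 \/ nrm (e n) = 0.
  by have [/e0 ->|/eqP/e1] := eqVneq (s n) 0; [right; rewrite (nrm0 hH)|left].
have oe : orthosys e by split => // n; case: (e01 n) => ->.
have of_ : orthosys f.
  split.
  - by move=> n; exact: (phZ hH).
  - by move=> i j ij; rewrite (ipZl hH) ?(ipZr hH) ?orthT ?mulr0 //; exact: (phZ hH).
  - move=> n; rewrite (nrmZ hH) // cabs_real Te ger0_norm ?invr_ge0 //.
    by have [->|sn] := eqVneq (s n) 0; [rewrite mulr0|rewrite mulVf].
have [C hC] := sT.
have sC N : \sum_(0 <= n < N) s n `^ p <= C.
  apply: le_trans (hC N e f oe of_); rewrite big_mkord; apply: ler_sum => n _.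
  suff -> : cabs (ip (T (e n)) (f n)) = s n by [].
  rewrite (ipZr hH) // conjc_real (ip_nrm hH) // Te -rmorphM cabs_real /=.
  have [->|sn] := eqVneq (s n) 0; first by rewrite expr0n mulr0 normr0.
  by rewrite expr2 mulKf // ger0_norm.
exists s, e; split; last by exists C.
split => //.
- by move=> n /e1 h; rewrite (ip_nrm hH) // h expr1n.
(* The equation of [spb_maximizer] holds on the complement of the first [n] vectors. The component
   [v] of [g] along these vectors contributes 0 to both sides, because the [e i] and the [T (e i)]
   are orthogonal. *)
- move=> n g hg.
  have [h1 h2 _] := @orthosys_sub _ _ _ _ hH e n g oe (fun i _ => e01 i) hg.
  set v := \sum_(0 <= i < n) _ in h1 h2.
  have hv : H v by apply: (ph_sum hH) => i _; exact: (phZ hH).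
  have Mg' := Lsub n _ h1 h2.
  have v0 : ip v (e n) = 0.
    rewrite /v big_nat_cond (ip_suml hH) //; last by move=> i _; exact: (phZ hH).
    rewrite big1 // => i /andP[/andP[_ im] _].
    by rewrite (ipZl hH) // orth ?mulr0 //; apply/eqP; rewrite ltn_eqF.
  have Tv0 : ip (T v) (T (e n)) = 0.
    rewrite /v big_nat_cond (op_sum_ip hH hT) //; last by move=> i _; exact: (phZ hH).
    rewrite big1 // => i /andP[/andP[_ im] _].
    by rewrite (opZ_ip hH hT) // orthT ?mulr0 //; apply/eqP; rewrite ltn_eqF.
  have hTg := op_in hT hg; have hTg' := op_in hT h1.
  rewrite -[g](subrK v); set g' := g - v in h1 h2 Mg' hTg' *.
  have hgv : H (g' + v) by exact: (phD hH).
  rewrite (ipDr hH) // (ipC hH hv (He n)) v0 conjc0 addr0.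
  rewrite (ipC hH (op_in hT hgv)) // (opD_ip hH hT) // Tv0 addr0 -(ipC hH) //.
  exact: Tg.
(* Such a [g] competes in every maximization. If [T g] were not null, every [s n] would be at least
   |T g| / |g| > 0, against the bound on the sum. *)
- move=> g hg gort.
  apply/eqP/negPn/negP => ng.
  have ng0 : 0 < nrm (T g) by rewrite lt_neqAle eq_sym ng nrm_ge0.
  have le n : nrm (T g) <= s n * nrm g by apply: Tx; exact: Lsub.
  have g0 : 0 < nrm g.
    rewrite lt_neqAle eq_sym nrm_ge0 andbT; apply/eqP => h.
    by have := le 0%N; rewrite h mulr0 leNgt ng0.
  pose d := nrm (T g) / nrm g.
  have d0 : 0 < d by exact: divr_gt0.
  have ds n : d <= s n by rewrite ler_pdivrMr.
  have [N hN] : exists N, C / d `^ p < N%:R.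
    by exists (Num.truncn (C / d `^ p)).+1; exact: truncnS_gt.
  have := sC N; apply/negP; rewrite -ltNge.
  rewrite ltr_pdivrMr ?powR_gt0 // in hN; apply: (lt_le_trans hN).
  rewrite mulr_natl -[X in _ *+ X]subn0 -sumr_const_nat; apply: ler_sum => n _.
  by apply: ge0_ler_powR; rewrite ?nnegrE // ltW.
Qed.

End spb_svd_exists.
(** * Integrals over the circle and the space L^2 *)

Section circle_integral.
Variable R : realType.
Local Notation mR := (measurableTypeR R).
Local Notation circle := (@circle R : set mR).
Local Notation leb := (@lebesgue_measure R).
Implicit Types (mu : {measure set (measurableTypeR R) -> \bar R})
  (f g h : mR -> R[i]) (F G : mR -> R).

Lemma measurable_circle : measurable circle.
Proof. exact: (@measurable_itv R). Qed.
Local Hint Resolve measurable_circle : core.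

Definition cmeas f := measurable_fun circle (fun t => complex.Re (f t)) /\
  measurable_fun circle (fun t => complex.Im (f t)).

Definition rint mu F := mu.-integrable circle (EFin \o F).

Definition cint mu f := cmeas f /\ rint mu (fun t => cabs (f t)).

Lemma measurable_sqrt : measurable_fun setT (@Num.sqrt R).
Proof. by apply: measurable_realfun.continuous_measurable_fun; exact: sqrt_continuous. Qed.

Lemma cmeas_cabs f : cmeas f -> measurable_fun circle (fun t => cabs (f t)).
Proof.
move=> [m1 m2].
have -> : (fun t : mR => cabs (f t)) =
    @Num.sqrt R \o (fun t => complex.Re (f t) ^+ 2 + complex.Im (f t) ^+ 2).
  by apply/funext => t /=; case: (f t) => a b.
apply: measurableT_comp; first exact: measurable_sqrt.
by apply: measurable_funD; exact: measurable_funX.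
Qed.

Lemma cmeas_cst z : cmeas (fun _ : mR => z).
Proof. by split; exact: (@measurable_cst _ _ mR). Qed.

Lemma cmeasD f g : cmeas f -> cmeas g -> cmeas (fun t => f t + g t).
Proof.
move=> [f1 f2] [g1 g2]; split.
  by under eq_fun do rewrite ReD; exact: measurable_funD.
by under eq_fun do rewrite ImD; exact: measurable_funD.
Qed.

Lemma cmeasM f g : cmeas f -> cmeas g -> cmeas (fun t => f t * g t).
Proof.
move=> [f1 f2] [g1 g2]; split.
  by under eq_fun do rewrite ReM; apply: measurable_funB; exact: measurable_funM.
by under eq_fun do rewrite ImM; apply: measurable_funD; exact: measurable_funM.
Qed.

Lemma cmeas_conj f : cmeas f -> cmeas (fun t => conjc (f t)).
Proof.
move=> [f1 f2]; split; first by under eq_fun do rewrite Re_conj.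
under eq_fun do rewrite Im_conj.
by apply: measurableT_comp => //; exact: oppr_measurable.
Qed.

Lemma cmeasN f : cmeas f -> cmeas (fun t => - f t).
Proof.
move=> h; have := cmeasM (cmeas_cst (-1)) h.
by under eq_fun do rewrite mulN1r.
Qed.

Lemma cmeasB f g : cmeas f -> cmeas g -> cmeas (fun t => f t - g t).
Proof. by move=> hf hg; apply: cmeasD => //; exact: cmeasN. Qed.

Lemma cmeas_sum (I : Type) (r : seq I) (f_ : I -> mR -> R[i]) :
  (forall i, cmeas (f_ i)) -> cmeas (fun t => \sum_(i <- r) f_ i t).
Proof.
move=> h; elim: r => [|i r IH].
  by under eq_fun do rewrite big_nil; exact: cmeas_cst.
by under eq_fun do rewrite big_cons; exact: cmeasD.
Qed.

Lemma rint_meas mu F : rint mu F -> measurable_fun circle F.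
Proof. by move=> /integrableP[/measurable_EFinP]. Qed.

Lemma rint_le_ae mu F G : measurable_fun circle F -> rint mu G ->
  {ae mu, forall t, circle t -> `|F t| <= `|G t|} -> rint mu F.
Proof.
move=> mF hG le; apply/integrableP; split; first exact/measurable_EFinP.
have /integrableP[mG] := hG; apply: le_lt_trans.
apply: ae_ge0_le_integral => //.
- by apply: measurableT_comp => //; exact/measurable_EFinP.
- exact: measurableT_comp.
Qed.

Lemma rint_le mu F G : measurable_fun circle F -> rint mu G ->
  (forall t, circle t -> `|F t| <= G t) -> rint mu F.
Proof.
move=> mF hG le; apply: rint_le_ae hG _ => //; apply: aeW => t ct.
by apply: (le_trans (le t ct)); exact: ler_norm.
Qed.

Lemma rintD mu F G : rint mu F -> rint mu G -> rint mu (fun t => F t + G t).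
Proof. by move=> hF hG; have := integrableD measurable_circle hF hG. Qed.

Lemma rintZ mu a F : rint mu F -> rint mu (fun t => a * F t).
Proof. by move=> hF; have := integrableZl measurable_circle a hF. Qed.

Lemma rint_ge0 mu F : measurable_fun circle F -> (forall t, 0 <= F t) ->
  (\int[mu]_(t in circle) (F t)%:E < +oo)%E -> rint mu F.
Proof.
move=> mF F0 lt; apply/integrableP; split; first exact/measurable_EFinP.
by under eq_integral do rewrite /= ger0_norm //.
Qed.

Lemma rint_lty mu F : rint mu F -> (forall t, 0 <= F t) ->
  (\int[mu]_(t in circle) (F t)%:E < +oo)%E.
Proof.
move=> /integrableP[_] + F0; congr (_ < _)%E.
by apply: eq_integral => t _ /=; rewrite ger0_norm.
Qed.

Lemma cint_le mu f G : cmeas f -> rint mu G -> (forall t, circle t -> cabs (f t) <= G t) ->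
  cint mu f.
Proof.
move=> mf hG le; split => //; apply: rint_le hG _; first exact: cmeas_cabs.
by move=> t ct; rewrite ger0_norm ?cabs_ge0 //; exact: le.
Qed.

Lemma cint_Re mu f : cint mu f -> rint mu (fun t => complex.Re (f t)).
Proof. by move=> [[m1 _] hf]; apply: rint_le hf _ => // t _; exact: Re_le_cabs. Qed.

Lemma cint_Im mu f : cint mu f -> rint mu (fun t => complex.Im (f t)).
Proof. by move=> [[_ m1] hf]; apply: rint_le hf _ => // t _; exact: Im_le_cabs. Qed.

Lemma cintD mu f g : cint mu f -> cint mu g -> cint mu (fun t => f t + g t).
Proof.
move=> [mf hf] [mg hg]; apply: (cint_le (cmeasD mf mg) (rintD hf hg)) => t _.
exact: cabsD.
Qed.

Lemma cintZ mu a f : cint mu f -> cint mu (fun t => a * f t).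
Proof.
move=> [mf hf]; apply: (cint_le (cmeasM (cmeas_cst a) mf) (rintZ (cabs a) hf)) => t _.
by rewrite cabsM.
Qed.

Lemma cintegralD mu f g : cint mu f -> cint mu g ->
  cintegral mu (fun t => f t + g t) = cintegral mu f + cintegral mu g.
Proof.
move=> hf hg; rewrite /cintegral; apply: complexP => /=.
  rewrite -RintegralD //; [|exact: cint_Re|exact: cint_Re].
  by apply: eq_Rintegral => t _; rewrite ReD.
rewrite -RintegralD //; [|exact: cint_Im|exact: cint_Im].
by apply: eq_Rintegral => t _; rewrite ImD.
Qed.

Lemma cintegralZ mu a f : cint mu f ->
  cintegral mu (fun t => a * f t) = a * cintegral mu f.
Proof.
move=> hf; have hR := cint_Re hf; have hI := cint_Im hf.
rewrite /cintegral; apply: complexP; rewrite ?ReM ?ImM /=.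
  rewrite -!RintegralZl // -RintegralB //; [|exact: rintZ|exact: rintZ].
  by apply: eq_Rintegral => t _; rewrite ReM.
rewrite -!RintegralZl // -RintegralD //; [|exact: rintZ|exact: rintZ].
by apply: eq_Rintegral => t _; rewrite ImM.
Qed.

Lemma cintegral_conj mu f : cint mu f ->
  cintegral mu (fun t => conjc (f t)) = conjc (cintegral mu f).
Proof.
move=> hf; rewrite /cintegral; apply: complexP => /=.
  by apply: eq_Rintegral => t _; rewrite Re_conj.
rewrite -mulN1r -RintegralZl //; last exact: cint_Im.
by apply: eq_Rintegral => t _; rewrite Im_conj mulN1r.
Qed.

Lemma cintegral0 mu : cintegral mu (fun=> 0) = 0.
Proof. by rewrite /cintegral /= Rintegral_cst // mul0r. Qed.

Lemma cint0 mu : cint mu (fun=> 0).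
Proof.
split; first exact: cmeas_cst.
by rewrite /rint; under eq_fun do rewrite cabs0; exact: integrable0.
Qed.

Lemma cint_sum mu (I : Type) (r : seq I) (f_ : I -> mR -> R[i]) :
  (forall i, cint mu (f_ i)) -> cint mu (fun t => \sum_(i <- r) f_ i t) /\
  cintegral mu (fun t => \sum_(i <- r) f_ i t) = \sum_(i <- r) cintegral mu (f_ i).
Proof.
move=> h; elim: r => [|i r [IH1 IH2]].
  by under eq_fun do rewrite big_nil; rewrite big_nil cintegral0; split => //; exact: cint0.
under eq_fun do rewrite big_cons; rewrite big_cons cintegralD // IH2.
by split => //; exact: cintD.
Qed.

Lemma eq_cintegral mu f g : (forall t, circle t -> f t = g t) -> cintegral mu f = cintegral mu g.
Proof.
by move=> fg; rewrite /cintegral; congr (_ +i* _); apply: eq_Rintegral => t /set_mem /fg ->.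
Qed.

Lemma ae_eq_cintegral mu f g : cmeas f -> cmeas g ->
  {ae mu, forall t, circle t -> f t = g t} -> cintegral mu f = cintegral mu g.
Proof.
move=> [f1 f2] [g1 g2] fg; rewrite /cintegral /Rintegral; congr (fine _ +i* fine _).
  apply: ae_eq_integral => //; try exact/measurable_EFinP.
  by apply: filterS fg => t h /= /h ->.
apply: ae_eq_integral => //; try exact/measurable_EFinP.
by apply: filterS fg => t h /= /h ->.
Qed.

(** The factor 2 comes from treating real and imaginary parts separately; the bound serves only for
    limits and boundedness. *)
Lemma cabs_cintegral mu f : cint mu f ->
  cabs (cintegral mu f) <= 2 * Rintegral mu circle (fun t => cabs (f t)).
Proof.
move=> hf; apply: (le_trans (cabs_le_ReIm _)) => /=.
have [_ ha] := hf.
have h1 : `|Rintegral mu circle (fun t => complex.Re (f t))| <= Rintegral mu circle (fun t => cabs (f t)).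
  apply: (le_trans (le_normr_Rintegral measurable_circle (cint_Re hf))).
  apply: le_Rintegral => //; last by move=> t _; exact: Re_le_cabs.
  exact: integrable_norm (cint_Re hf).
have h2 : `|Rintegral mu circle (fun t => complex.Im (f t))| <= Rintegral mu circle (fun t => cabs (f t)).
  apply: (le_trans (le_normr_Rintegral measurable_circle (cint_Im hf))).
  apply: le_Rintegral => //; last by move=> t _; exact: Im_le_cabs.
  exact: integrable_norm (cint_Im hf).
lra.
Qed.

Lemma Rintegral_dct mu (h_ : nat -> mR -> R) G : (forall n, measurable_fun circle (h_ n)) ->
  rint mu G -> {ae mu, forall t, circle t -> (fun n => h_ n t) @ \oo --> (0 : R)} ->
  (forall n t, circle t -> `|h_ n t| <= G t) ->
  (fun n => Rintegral mu circle (h_ n)) @ \oo --> (0 : R).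
Proof.
move=> mh hG h0 hle.
have [|||||i1 i2 i3] := @dominated_convergence _ _ _ mu circle measurable_circle
   (fun n t => (h_ n t)%:E) (cst 0%E) (EFin \o G).
- by move=> n; exact/measurable_EFinP.
- exact: measurable_cst.
- apply: filterS h0 => t h ct; have := h ct => h'.
  by apply: cvg_EFin; [exact: nearW|exact: h'].
- exact: hG.
- by apply: aeW => t n ct; rewrite /= lee_fin; exact: hle.
rewrite integral0 in i3.
exact: (fine_cvg i3).
Qed.

Lemma cintegral_dct mu (f_ : nat -> mR -> R[i]) f G : (forall n, cmeas (f_ n)) -> cmeas f ->
  rint mu G -> {ae mu, forall t, circle t -> (fun n => cabs (f_ n t - f t)) @ \oo --> (0 : R)} ->
  (forall n t, circle t -> cabs (f_ n t) <= G t) -> cint mu f ->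
  (fun n => cabs (cintegral mu (f_ n) - cintegral mu f)) @ \oo --> (0 : R).
Proof.
move=> mf_ mf hG h0 hle if_.
have ifn n : cint mu (f_ n) by exact: cint_le (hle n).
have h1 : (fun n => Rintegral mu circle (fun t => cabs (f_ n t - f t))) @ \oo --> (0 : R).
  apply: (@Rintegral_dct mu _ (fun t => G t + cabs (f t))) => //.
  - by move=> n; apply: cmeas_cabs; exact: cmeasB.
  - by apply: rintD => //; case: if_.
  - move=> n t ct; rewrite ger0_norm ?cabs_ge0 //; apply: (le_trans (cabsB _ _)).
    by rewrite lerD2r hle.
have h2 : (fun n => 2 * Rintegral mu circle (fun t => cabs (f_ n t - f t))) @ \oo --> (2 * 0 : R).
  exact: (cvgM (cvg_cst _) h1).
rewrite mulr0 in h2.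
apply: squeeze_cvgr (cvg_cst 0) h2; apply: nearW => n; rewrite cabs_ge0 /=.
rewrite [X in cabs X](_ : _ = cintegral mu (fun t => f_ n t - f t)); last first.
  rewrite -mulN1r -cintegralZ // -cintegralD //; last exact: cintZ.
  by apply: eq_cintegral => t _; rewrite mulN1r.
apply: cabs_cintegral; under eq_fun do rewrite -mulN1r.
by apply: cintD => //; exact: cintZ.
Qed.

Lemma circle_mu : leb circle = (2 * pi)%:E.
Proof. by rewrite lebesgue_measure_itv /= lte_fin mulr_gt0 ?pi_gt0 // sube0. Qed.

Lemma ae_leb1 (P Q : R -> Prop) : (forall t, P t -> Q t) ->
  {ae @lebesgue_measure R, forall t, P t} -> {ae @lebesgue_measure R, forall t, Q t}.
Proof. by move=> h; exact: (@filterS _ _ (ae_filter_ringOfSetsType leb) P Q h). Qed.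

Lemma ae_leb2 (P Q S : R -> Prop) : (forall t, P t -> Q t -> S t) ->
  {ae @lebesgue_measure R, forall t, P t} -> {ae @lebesgue_measure R, forall t, Q t} ->
  {ae @lebesgue_measure R, forall t, S t}.
Proof. by move=> h; exact: (@filterS2 _ _ (ae_filter_ringOfSetsType leb) P Q S h). Qed.

Lemma ae_lebW (P : R -> Prop) : (forall t, P t) -> {ae @lebesgue_measure R, forall t, P t}.
Proof. by move=> h; exact: (@aeW _ _ _ leb P h). Qed.

Definition bounded_mass mu := (mu circle < +oo)%E.

Lemma rint_cst mu a : bounded_mass mu -> rint mu (fun=> a).
Proof.
move=> hm; apply/integrableP; split; first exact: measurable_cst.
rewrite integral_cst //=; have m0 : (0 <= mu circle)%E by [].
by rewrite -(@fineK _ (mu circle)) ?ge0_fin_numE // -EFinM ltry.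
Qed.

Lemma leb_mass : bounded_mass leb.
Proof. exact: (eq_ind_r (fun x => (x < +oo)%E) (ltry (2 * pi)) circle_mu). Qed.

Lemma cint_bounded mu f M : bounded_mass mu -> cmeas f ->
  (forall t, circle t -> cabs (f t) <= M) -> cint mu f.
Proof. by move=> hm mf h; apply: (cint_le mf (rint_cst M hm)) => t /h. Qed.

End circle_integral.
#[global] Hint Resolve measurable_circle : core.
Section L2_space.
Variable R : realType.
Local Notation mR := (measurableTypeR R).
Local Notation circle := (@circle R : set mR).
Local Notation leb := (@lebesgue_measure R).
Local Notation V := (R -> R[i]^o).
Implicit Types (f g h : mR -> R[i]).

Lemma L2P f : L2 f <-> cmeas f /\ rint leb (fun t => cabs (f t) ^+ 2).
Proof.
split=> [[m1 m2 lt]|[[m1 m2] hf]].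
  have mf : cmeas f by [].
  split => //; apply: rint_ge0 => //; last by move=> t; exact: sqr_ge0.
  by apply: measurable_funX; exact: cmeas_cabs.
by split => //; apply: (rint_lty hf) => t; exact: sqr_ge0.
Qed.

Lemma L2_meas f : L2 f -> cmeas f. Proof. by move=> /L2P[]. Qed.
Lemma L2_rint f : L2 f -> rint leb (fun t => cabs (f t) ^+ 2).
Proof. by move=> /L2P[]. Qed.

Lemma L2_le_ae f g (M : R) : cmeas f -> L2 g ->
  {ae leb, forall t, circle t -> cabs (f t) <= M * cabs (g t)} -> L2 f.
Proof.
move=> mf /L2P[_ hg] le; apply/L2P; split => //.
apply: (rint_le_ae _ (rintZ (M ^+ 2) hg)).
  by apply: measurable_funX; exact: cmeas_cabs.
apply: filterS le => t h /h {}h.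
rewrite -exprMn !normrX ler_pXn2r ?nnegrE ?normr_ge0 //.
rewrite ger0_norm ?cabs_ge0 //; exact: le_trans (ler_norm _).
Qed.

Lemma L2_circle_eq f g : cmeas g -> L2 f -> circle_eq f g -> L2 g.
Proof.
move=> mg hf fg; apply: (@L2_le_ae _ f 1) => //.
by apply: ae_leb1 fg => t h /h ->; rewrite mul1r.
Qed.

Lemma L2_bounded f M : cmeas f -> (forall t, circle t -> cabs (f t) <= M) -> L2 f.
Proof.
move=> mf h; apply/L2P; split => //.
apply: (rint_le _ (rint_cst (M ^+ 2) (leb_mass R))).
  by apply: measurable_funX; exact: cmeas_cabs.
move=> t /h le; rewrite ger0_norm ?sqr_ge0 // ler_pXn2r ?nnegrE ?cabs_ge0 //.
exact: le_trans (cabs_ge0 _) le.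
Qed.

Lemma L2_mul f g : L2 f -> L2 g -> cint leb (fun t => f t * g t).
Proof.
move=> /L2P[mf hf] /L2P[mg hg]; apply: (cint_le (cmeasM mf mg) (rintD hf hg)) => t _.
rewrite cabsM; have := sqr_ge0 (cabs (f t) - cabs (g t)).
by have := cabs_ge0 (f t); have := cabs_ge0 (g t); nra.
Qed.

Lemma L2_conj f : L2 f -> L2 (fun t => conjc (f t)).
Proof.
move=> /L2P[mf hf]; apply/L2P; split; first exact: cmeas_conj.
by under eq_fun do rewrite cabs_conj.
Qed.

Lemma L2_inner f g : L2 f -> L2 g -> cint leb (fun t => f t * conjc (g t)).
Proof. by move=> hf /L2_conj hg; exact: L2_mul. Qed.

Lemma L2_lin (a : R[i]) f g : L2 f -> L2 g -> L2 (fun t => a * f t + g t).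
Proof.
move=> /L2P[mf hf] /L2P[mg hg]; apply/L2P.
have m : cmeas (fun t => a * f t + g t) by apply: cmeasD => //; apply: cmeasM => //; exact: cmeas_cst.
split => //; apply: (rint_le _ (rintD (rintZ (2 * cabs a ^+ 2) hf) (rintZ 2 hg))).
  by apply: measurable_funX; exact: cmeas_cabs.
move=> t _; rewrite ger0_norm ?sqr_ge0 //.
apply: (@le_trans _ _ ((cabs (a * f t) + cabs (g t)) ^+ 2)).
  by rewrite ler_pXn2r ?nnegrE ?addr_ge0 ?cabs_ge0 ?cabsD.
rewrite cabsM -mulrA -exprMn; set x := cabs a * _; set y := cabs _.
by have := sqr_ge0 (x - y); nra.
Qed.

Lemma pi2_gt0 : 0 < 2 * pi :> R. Proof. by rewrite mulr_gt0 // pi_gt0. Qed.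

Lemma inner_self f : L2 f ->
  inner f f = ((2 * pi)^-1 * Rintegral leb circle (fun t => cabs (f t) ^+ 2))%:C.
Proof.
move=> hf; rewrite /inner rmorphM; congr (_ * _); rewrite /cintegral; apply: complexP => /=.
  by apply: eq_Rintegral => t _; rewrite -cabs_sqrC.
rewrite (@eq_Rintegral _ _ _ leb circle (fun=> 0)); first by rewrite Rintegral_cst // mul0r.
by move=> t _; rewrite -cabs_sqrC.
Qed.

Lemma norm2_sqr f : L2 f ->
  norm2 f ^+ 2 = (2 * pi)^-1 * Rintegral leb circle (fun t => cabs (f t) ^+ 2).
Proof.
move=> hf; rewrite /norm2 inner_self // sqr_sqrtr //=.
by rewrite mulr_ge0 ?invr_ge0 ?(ltW pi2_gt0) // Rintegral_ge0 // => t _; exact: sqr_ge0.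
Qed.

Lemma cst0_L2 : L2 (fun _ : mR => 0 : R[i]).
Proof. by apply: (@L2_bounded _ 0) => [|t _]; [exact: cmeas_cst|rewrite cabs0]. Qed.

Lemma L2_pre_hilbert : pre_hilbert (@inner R : V -> V -> R[i]) (@L2 R : set V).
Proof.
split.
- exact: cst0_L2.
- by move=> a x y hx hy; exact: L2_lin.
- move=> a x y z hx hy hz; rewrite /inner.
  rewrite (@eq_cintegral _ _ _ (fun t => a * (x t * conjc (z t)) + y t * conjc (z t))).
    rewrite cintegralD ?cintegralZ; [by ring| | |]; try exact: L2_inner.
    by apply: cintZ; exact: L2_inner.
  by move=> t _; rewrite mulrA -mulrDl.
- move=> x y hx hy; rewrite /inner conjcM conjc_real -cintegral_conj; last exact: L2_inner.
  congr (_ * _); apply: eq_cintegral => t _; by rewrite conjcM conjcK mulrC.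
- move=> x hx; rewrite inner_self // ler0c mulr_ge0 ?invr_ge0 ?(ltW pi2_gt0) //.
  by rewrite Rintegral_ge0 // => t _; exact: sqr_ge0.
Qed.

Lemma inner_conj2 f g : L2 f -> L2 g -> inner (conj_fun f) (conj_fun g) = conjc (inner f g).
Proof.
move=> hf hg; rewrite /inner conjcM conjc_real -cintegral_conj; last exact: L2_inner.
by congr (_ * _); apply: eq_cintegral => t _; rewrite conjcM.
Qed.

Lemma inner_circle_eql f f' g : L2 f -> L2 f' -> L2 g -> circle_eq f f' -> inner f g = inner f' g.
Proof.
move=> hf hf' hg ff'; rewrite /inner; congr (_ * _); apply: ae_eq_cintegral.
- by case: (L2_inner hf hg).
- by case: (L2_inner hf' hg).
- by apply: ae_leb1 ff' => t h /h ->.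
Qed.

Lemma Rint_sqr_eq0 f : L2 f -> Rintegral leb circle (fun t => cabs (f t) ^+ 2) = 0 ->
  circle_eq f (fun=> 0).
Proof.
move=> hf h.
have hi := L2_rint hf.
have e : (\int[leb]_(t in circle) `|(cabs (f t) ^+ 2)%:E| = 0)%E.
  have fi : (\int[leb]_(t in circle) (cabs (f t) ^+ 2)%:E)%E \is a fin_num.
    exact: integrable_fin_num hi.
  rewrite -[RHS](_ : (Rintegral leb circle (fun t => cabs (f t) ^+ 2))%:E = _); last by rewrite h.
  rewrite /Rintegral fineK //; apply: eq_integral => t _.
  by rewrite /= ger0_norm ?sqr_ge0.
have := (ae_eq_integral_abs leb (@measurable_circle R) (measurable_int _ hi)).1 e.
apply: ae_leb1 => t h' /h' [] /eqP.
by rewrite sqrf_eq0 => /eqP/cabs_eq0.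
Qed.

Lemma norm2_eq0 f : L2 f -> norm2 f = 0 -> circle_eq f (fun=> 0).
Proof.
move=> hf h; apply: Rint_sqr_eq0 => //.
have := norm2_sqr hf; rewrite h expr0n /= => /esym/eqP.
by rewrite mulf_eq0 invr_eq0 (gt_eqF pi2_gt0) /= => /eqP.
Qed.

Lemma norm2B_eq0 f g : L2 f -> L2 g -> nrm (@inner R : V -> V -> R[i]) ((f : V) - g) = 0 -> circle_eq f g.
Proof.
move=> hf hg h; have hfg := phB L2_pre_hilbert hf hg.
have := norm2_eq0 hfg h; apply: ae_leb1 => t h' /h' /eqP.
by rewrite subr_eq0 => /eqP.
Qed.

Lemma circle_eq_norm2B f g : L2 f -> L2 g -> circle_eq f g ->
  nrm (@inner R : V -> V -> R[i]) ((f : V) - g) = 0.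
Proof.
move=> hf hg fg; have hfg := phB L2_pre_hilbert hf hg.
apply: nrm_eq0; rewrite (inner_circle_eql hfg cst0_L2 hfg); first exact: (ip0l L2_pre_hilbert).
by apply: ae_leb1 fg => t h /h e; apply/eqP; rewrite subr_eq0 e.
Qed.

Lemma circle_eq_sym f g : circle_eq f g -> circle_eq g f.
Proof. by apply: ae_leb1 => t h /h. Qed.
Lemma circle_eq_trans g f h : circle_eq f g -> circle_eq g h -> circle_eq f h.
Proof. by apply: ae_leb2 => t h1 h2 ct; rewrite h1 // h2. Qed.

End L2_space.
Section L2_complete.
Variable R : realType.
Local Notation mR := (measurableTypeR R).
Local Notation circle := (@circle R : set mR).
Local Notation leb := (@lebesgue_measure R).
Local Notation V := (R -> R[i]^o).
Local Notation ipL := (@inner R : V -> V -> R[i]).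
Implicit Types (f g h : mR -> R[i]).

Let hL := L2_pre_hilbert R.

Lemma cst_L2 (z : R[i]) : L2 (fun _ : mR => z).
Proof. by apply: (@L2_bounded _ _ (cabs z)) => [|t _]; [exact: cmeas_cst|]. Qed.

Lemma norm2_cst1 : norm2 (fun _ : R => 1 : R[i]) = 1.
Proof.
apply/eqP; rewrite -(eqrXn2 (n:=2)) ?sqrtr_ge0 // norm2_sqr; last exact: cst_L2.
under eq_Rintegral do rewrite cabs1.
rewrite Rintegral_cst // expr1n mul1r.
have -> : fine (leb circle) = 2 * pi by rewrite [leb circle]circle_mu.
by rewrite mulVf // gt_eqF // pi2_gt0.
Qed.

Lemma Rint_cabs_le f : L2 f ->
  Rintegral leb circle (fun t => cabs (f t)) <= 2 * pi * norm2 f.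
Proof.
move=> hf; have mf := L2_meas hf.
pose a : mR -> R[i] := fun t => (cabs (f t))%:C.
have ma : cmeas a.
  by split; rewrite /a /=; [exact: cmeas_cabs|exact: measurable_cst].
have ca t : cabs (a t) = cabs (f t) by rewrite cabs_real ger0_norm ?cabs_ge0.
have ha : L2 a.
  apply: (@L2_le_ae _ _ f 1) => //; apply: ae_lebW => t _; by rewrite ca mul1r.
have na : norm2 a = norm2 f.
  apply/eqP; rewrite -(eqrXn2 (n:=2)) ?sqrtr_ge0 // !norm2_sqr //.
  by apply/eqP; congr (_ * _); apply: eq_Rintegral => t _; rewrite ca.
have := cauchy_schwarz hL ha (cst_L2 1).
rewrite /nrm -/(norm2 _) -/(norm2 _) na norm2_cst1 mulr1 => le.
rewrite -ler_pdivrMl ?pi2_gt0 //; apply: le_trans le.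
rewrite /inner cabsM cabs_real ger0_norm ?invr_ge0 ?(ltW (pi2_gt0 R)) //.
rewrite ler_pM2l ?invr_gt0 ?pi2_gt0 //.
apply: le_trans (Re_le_cabs _); apply: le_trans (ler_norm _).
rewrite le_eqVlt; apply/orP; left; apply/eqP.
by apply: eq_Rintegral => t _; rewrite conjc1 mulr1.
Qed.

Lemma cvg_of_summable (u : nat -> R) (d : nat -> R) : (forall k, `|u k.+1 - u k| <= d k) ->
  (\sum_(0 <= k <oo) (d k)%:E < +oo)%E -> exists l, u @ \oo --> (l : R).
Proof.
move=> ud lt.
have d0 k : 0 <= d k by apply: le_trans (ud k).
have cd : cvgn (series d).
  apply: nondecreasing_is_cvgn.
    by apply/nondecreasing_seqP => n; rewrite seriesSr /= lerDl.
  exists (fine (\sum_(0 <= k <oo) (d k)%:E)%E) => _ [n _ <-].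
  have fi : (\sum_(0 <= k <oo) (d k)%:E)%E \is a fin_num.
    by rewrite ge0_fin_numE //; apply: nneseries_ge0 => k _ _; rewrite lee_fin.
  rewrite -lee_fin fineK // /series /= -sumEFin.
  by apply: nneseries_lim_ge => k _ _; rewrite lee_fin.
pose v k := u k.+1 - u k.
have cv : cvgn (series v).
  have cn : cvgn (series (fun k => `|v k|)) by exact: (@series_le_cvg _ (fun k => `|v k|) d).
  exact: (@normed_cvg R R^o v cn).
exists (limn (series v) + u 0%N).
have e : (fun n => series v n + u 0%N) = u.
  by apply/funext => n; rewrite /series /= telescope_sumr // subrK.
have h : (fun n => series v n + u 0%N) @ \oo --> limn (series v) + u 0%N.
  exact: (cvgD cv (cvg_cst _)).
by rewrite e in h.
Qed.

Lemma cabs_dist (a b : R[i]) : `|cabs a - cabs b| <= cabs (a - b).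
Proof.
have h1 : cabs a <= cabs (a - b) + cabs b by rewrite -{1}(subrK b a) cabsD.
have h2 : cabs b <= cabs (a - b) + cabs a by rewrite cabs_distC -{1}(subrK a b) cabsD.
by rewrite ler_norml; apply/andP; split; lra.
Qed.

Lemma cvg_cabs (T : Type) (G : set_system T) {FG : Filter G} (u : T -> R[i]) (l : R[i]) :
  (fun k => cabs (u k - l)) @ G --> (0 : R) -> (fun k => cabs (u k)) @ G --> (cabs l : R).
Proof.
move=> h; apply/cvgrPdist_le => e e0; have /cvgrPdist_le /(_ e e0) := h.
apply: filterS => k; rewrite sub0r normrN ger0_norm ?cabs_ge0 // => le.
by apply: le_trans le; rewrite cabs_distC; exact: cabs_dist.
Qed.

Lemma limn_einf_le_near (a : nat -> \bar R) (c : \bar R) : (\forall n \near \oo, (a n <= c)%E) ->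
  (limn_einf a <= c)%E.
Proof.
move=> [N _ hN]; rewrite limn_einf_lim; apply: lime_le; first exact: is_cvg_einfs.
apply: nearW => n; apply: (@le_trans _ _ (a (maxn n N))).
  by apply: ereal_inf_lbound; exists (maxn n N) => //=; exact: leq_maxl.
by apply: hN => /=; exact: leq_maxr.
Qed.

(** Riesz-Fischer: along a subsequence with increments at most 2^-k the sum of the moduli of the
    increments is integrable, hence finite almost everywhere, which gives a pointwise limit. Fatou's
    lemma converts it into a limit in norm. *)
Lemma L2_complete : ip_complete ipL (@L2 R : set V).
Proof.
move=> x hx cx.
have ex k : exists N, forall m n, (N <= m)%N -> (N <= n)%N -> nrm ipL (x m - x n) <= (2^-1) ^+ k.
  by apply: cx; rewrite exprn_gt0 // invr_gt0.
have [N hN] := choice ex.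
(* Taking the maximum over all indices up to [k] makes the sequence of ranks nondecreasing; [k]
   itself makes it tend to infinity. *)
pose nn k := maxn k (\max_(i < k.+1) N i).
have nk k : (k <= nn k)%N by exact: leq_maxl.
have nN k : (N k <= nn k)%N.
  apply: leq_trans (leq_maxr _ _).
  exact: (leq_bigmax (ord_max : 'I_k.+1) (F := fun i : 'I_k.+1 => N i)).
have nS k : (nn k <= nn k.+1)%N.
  rewrite geq_max (leq_trans _ (nk _)) //= (leq_trans _ (leq_maxr _ _)) //.
  by rewrite [leqRHS]big_ord_recr /= leq_maxl.
pose y k : mR -> R[i] := x (nn k).
have hy k : L2 (y k) by exact: hx.
pose d k (t : mR) := cabs (y k.+1 t - y k t).
have hd k : L2 (fun t => y k.+1 t - y k t) by exact: (phB hL (hx _) (hx _)).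
have md k : measurable_fun circle (d k) by apply: cmeas_cabs; exact: L2_meas.
have nd k : Rintegral leb circle (d k) <= 2 * pi * (2^-1) ^+ k.
  apply: (le_trans (Rint_cabs_le (hd k))); rewrite ler_pM2l ?pi2_gt0 //.
  by apply: (hN k); [exact: leq_trans (nN k) (nS k)|exact: nN].
have id k : rint leb (d k).
  have [_] : cint leb (fun t => (y k.+1 t - y k t) * 1) by apply: L2_mul => //; exact: cst_L2.
  by under eq_fun do rewrite mulr1.
pose F (t : mR) := (\sum_(0 <= k <oo) (d k t)%:E)%E.
have mF : measurable_fun circle F.
  by apply: ge0_emeasurable_sum => // k; [move=> t _ _; rewrite lee_fin cabs_ge0|move=> _; exact/measurable_EFinP].
have F0 t : (0 <= F t)%E by apply: nneseries_ge0 => k _ _; rewrite lee_fin cabs_ge0.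
have iF : leb.-integrable circle F.
  apply/integrableP; split => //.
  under eq_integral do rewrite gee0_abs //.
  have h1 k : measurable_fun circle (fun t => (d k t)%:E) by exact/measurable_EFinP.
  have h2 k t : circle t -> (0 <= (d k t)%:E)%E by rewrite lee_fin cabs_ge0.
  rewrite /F (integral_nneseries leb (@measurable_circle R) h1 h2).
  apply: (@le_lt_trans _ _ (\sum_(0 <= k <oo) (2 * pi * 2^-1 ^+ k)%:E)%E).
    apply: lee_nneseries => k _; first by move=> _; apply: integral_ge0 => t _; rewrite lee_fin cabs_ge0.
    have fi : (\int[leb]_(t in circle) (d k t)%:E)%E \is a fin_num by exact: integrable_fin_num (id k).
    by rewrite -(fineK fi) lee_fin; exact: nd.
  have := @cvg_geometric_series R (2 * pi) 2^-1.
  rewrite ger0_norm ?invr_ge0 // invf_lt1 // ltr1n => /(_ isT) cg.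
  have -> : (\sum_(0 <= k <oo) ((2 * pi * 2^-1 ^+ k)%:E : \bar R))%E = (2 * (pi : R) * (1 - 2^-1)^-1)%:E.
    have cg' : (fun n => \sum_(0 <= k < n) ((2 * pi * 2^-1 ^+ k)%:E : \bar R))%E @ \oo --> (2 * (pi : R) / (1 - 2^-1))%:E.
      refine (cvg_EFin _ _); first by apply: nearW => n; rewrite sumEFin.
      rewrite (_ : _ \o _ = series (geometric (2 * pi) 2^-1)) //.
      by apply/funext => n; rewrite /= sumEFin.
    exact: (cvg_lim (@ereal_hausdorff R) cg').
  exact: ltry.
have aF : {ae leb, forall t, circle t -> F t \is a fin_num} by exact: integrable_ae iF.
(* Upper limits are measurable without any convergence, and [fine] gives them a real value on the
   exceptional null set. *)
pose z (t : mR) : R[i] := fine (limn_esup (fun k => (complex.Re (y k t))%:E)) +i*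
   fine (limn_esup (fun k => (complex.Im (y k t))%:E)).
have mz : cmeas z.
  split; rewrite /z /=.
    apply: measurableT_comp; first exact: fine_measurable.
    apply: measurable_fun_limn_esup => k; apply/measurable_EFinP; exact: (L2_meas (hy k)).1.
  apply: measurableT_comp; first exact: fine_measurable.
  apply: measurable_fun_limn_esup => k; apply/measurable_EFinP; exact: (L2_meas (hy k)).2.
have yz : {ae leb, forall t, circle t -> (fun k => cabs (y k t - z t)) @ \oo --> (0 : R)}.
  apply: ae_leb1 aF => t h /h fF.
  have Flt : (F t < +oo)%E by rewrite -ge0_fin_numE.
  have [l1 h1] : exists l, (fun k => complex.Re (y k t)) @ \oo --> (l : R).
    apply: (cvg_of_summable _ Flt) => k; rewrite -ReN -ReD; exact: Re_le_cabs.
  have [l2 h2] : exists l, (fun k => complex.Im (y k t)) @ \oo --> (l : R).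
    apply: (cvg_of_summable _ Flt) => k; rewrite -ImN -ImD; exact: Im_le_cabs.
  have e1 : limn_esup (fun k => (complex.Re (y k t))%:E) = l1%:E.
    apply: (cvg_limn_einf_sup _).2; refine (cvg_EFin _ _) => //; exact: nearW.
  have e2 : limn_esup (fun k => (complex.Im (y k t))%:E) = l2%:E.
    apply: (cvg_limn_einf_sup _).2; refine (cvg_EFin _ _) => //; exact: nearW.
  have h3 : (fun k => `|complex.Re (y k t) - l1| + `|complex.Im (y k t) - l2|) @ \oo --> (`|l1 - l1| + `|l2 - l2| : R).
    apply: cvgD; apply: cvg_norm; apply: cvgB => //; exact: cvg_cst.
  rewrite !subrr normr0 addr0 in h3.
  apply: squeeze_cvgr (cvg_cst 0) h3; apply: nearW => k; rewrite cabs_ge0 /=.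
  by apply: (le_trans (cabs_le_ReIm _)); rewrite ReD ReN ImD ImN /z e1 e2.
have key (eps : R) : 0 < eps -> exists M, forall m, (M <= m)%N ->
    L2 (fun t => z t - x m t) /\ norm2 (fun t => z t - x m t) <= eps.
  move=> e0; have [M hM] := cx _ e0; exists M => m Mm.
  have mzx : cmeas (fun t => z t - x m t) by apply: cmeasB => //; exact: (L2_meas (hx m)).
  have le : (\int[leb]_(t in circle) (cabs (z t - x m t) ^+ 2)%:E <= (2 * pi * eps ^+ 2)%:E)%E.
    have hk k : L2 (fun t => y k t - x m t) by exact: (phB hL (hx _) (hx _)).
    have mk k : measurable_fun circle (fun t => (cabs (y k t - x m t) ^+ 2)%:E).
      by apply/measurable_EFinP; exact: rint_meas (L2_rint (hk k)).
    have -> : (\int[leb]_(t in circle) (cabs (z t - x m t) ^+ 2)%:E =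
      \int[leb]_(t in circle) (limn_einf (fun k => (cabs (y k t - x m t) ^+ 2)%:E)))%E.
      apply: ge0_ae_eq_integral => //.
      - by apply/measurable_EFinP; apply: measurable_funX; exact: cmeas_cabs.
      - rewrite /limn_einf; apply: measurableT_comp; first exact: oppe_measurable.
        apply: measurable_fun_limn_esup => k; apply: measurableT_comp => //; exact: oppe_measurable.
      - by move=> t _; rewrite lee_fin sqr_ge0.
      - move=> t _; rewrite limn_einf_lim; apply: lime_ge; first exact: is_cvg_einfs.
        by apply: nearW => n; apply: le_ereal_inf_tmp => _ [j _ <-]; rewrite lee_fin sqr_ge0.
      - apply: ae_leb1 yz => t h /h {}h; symmetry; apply: (cvg_limn_einf_sup _).1.
        refine (cvg_EFin _ _); first exact: nearW.
        have h' : (fun k => cabs ((y k t - x m t) - (z t - x m t))) @ \oo --> (0 : R).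
          have -> : (fun k => cabs ((y k t - x m t) - (z t - x m t))) = (fun k => cabs (y k t - z t)).
            by apply/funext => k; congr cabs; ring.
          exact: h.
        exact: (cvgM (cvg_cabs h') (cvg_cabs h')).
    have pk (k : nat) (t : mR) : circle t -> (0 <= (cabs (y k t - x m t) ^+ 2)%:E)%E.
      by rewrite lee_fin sqr_ge0.
    apply: (le_trans (fatou leb (@measurable_circle R) mk pk)).
    apply: limn_einf_le_near; exists M => // k /= Mk.
    have fi : (\int[leb]_(t in circle) (cabs (y k t - x m t) ^+ 2)%:E)%E \is a fin_num.
      exact: integrable_fin_num (L2_rint (hk k)).
    rewrite -(fineK fi) lee_fin.
    have := norm2_sqr (hk k); move/(congr1 (fun r => 2 * pi * r)) => /=.
    rewrite mulVKf ?gt_eqF ?pi2_gt0 // /Rintegral => <-.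
    rewrite ler_pM2l ?pi2_gt0 // ler_pXn2r ?nnegrE ?sqrtr_ge0 ?(ltW e0) //.
    by apply: hM => //; exact: leq_trans Mk (nk k).
  have hL2 : L2 (fun t => z t - x m t).
    by have [m1 m2] := mzx; split => //; apply: le_lt_trans le _; exact: ltry.
  split => //.
  rewrite -(ler_pXn2r (n:=2)) ?nnegrE ?sqrtr_ge0 ?(ltW e0) // norm2_sqr //.
  rewrite ler_pdivrMl ?pi2_gt0 //.
  have fi := integrable_fin_num (@measurable_circle R) (L2_rint hL2).
  by rewrite -lee_fin /Rintegral fineK.
have hz : L2 z.
  have [M /(_ M (leqnn _))[h _]] := key 1 ltr01.
  have := phD hL h (hx M); congr (L2 _); apply/funext => t; exact: subrK.
exists z => // eps e0; have [M hM] := key _ e0; exists M => n Mn.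
rewrite (nrmBC hL) //; exact: (hM n Mn).2.
Qed.

End L2_complete.

(** * The trigonometric system on the circle *)

Section trigonometric_system.
Variable R : realType.
Local Notation mR := (measurableTypeR R).
Local Notation circle := (@circle R : set mR).
Local Notation leb := (@lebesgue_measure R).
Local Notation V := (R -> R[i]^o).
Local Notation ipL := (@inner R : V -> V -> R[i]).
Implicit Types (f g h : mR -> R[i]) (t s x : R) (z w : R[i]).

Let hL := L2_pre_hilbert R.

Lemma cisD s t : cis (s + t) = cis s * cis t.
Proof. by rewrite /cis cosD sinD; simpc; congr (_ +i* _); rewrite addrC; congr (_ + _); rewrite mulrC. Qed.

Lemma cis0 : cis (0 : R) = 1.
Proof. by rewrite /cis cos0 sin0. Qed.

Lemma cabs_cis t : cabs (cis t) = 1.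
Proof. by rewrite /cabs /= cos2Dsin2 sqrtr1. Qed.

Lemma cisX t n : cis t ^+ n = cis (n%:R * t).
Proof.
elim: n => [|n IH]; first by rewrite expr0 mul0r cis0.
by rewrite exprS IH -cisD -[X in X + _]mul1r -mulrDl -natr1 addrC.
Qed.

Lemma cis_conjM t : cis t * conjc (cis t) = 1.
Proof. by rewrite -cabs_sqrC cabs_cis expr1n. Qed.

Lemma cabs_cisB s t : cabs (cis s - cis t) ^+ 2 = 2 - 2 * cos (s - t).
Proof.
rewrite cabs_sqr /= cosB.
have := cos2Dsin2 s; have := cos2Dsin2 t; nra.
Qed.

Lemma cmeas_cis : cmeas (fun t : mR => cis t).
Proof.
split; rewrite /cis /=; apply: (@measurable_funTS _ _ mR); apply: measurable_realfun.continuous_measurable_fun.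
  exact: continuous_cos.
exact: continuous_sin.
Qed.

Lemma cmeasX f n : cmeas f -> cmeas (fun t => f t ^+ n).
Proof.
move=> mf; elim: n => [|n IH]; first exact: cmeas_cst.
by under eq_fun do rewrite exprS; exact: cmeasM.
Qed.

Definition char_pos (n : nat) : V := fun t => cis t ^+ n.
Definition char_neg (n : nat) : V := fun t => conjc (cis t) ^+ n.

Lemma char_posL2 n : L2 (char_pos n).
Proof.
apply: (@L2_bounded _ _ 1); first exact: cmeasX cmeas_cis.
by move=> t _; rewrite cabsX cabs_cis expr1n.
Qed.

Lemma char_negL2 n : L2 (char_neg n).
Proof.
apply: (@L2_bounded _ _ 1); first exact: (cmeasX _ (cmeas_conj cmeas_cis)).
by move=> t _; rewrite cabsX cabs_conj cabs_cis expr1n.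
Qed.

Lemma Rintegral_cos n : (0 < n)%N ->
  Rintegral leb circle (fun t => cos (n%:R * t)) = 0 /\
  Rintegral leb circle (fun t => sin (n%:R * t)) = 0.
Proof.
move=> n0; have nR : n%:R != 0 :> R by rewrite pnatr_eq0 -lt0n.
(* The sine and the cosine are treated at once: [F] is a primitive of G (n t) with equal values at
   the two ends, and the half-open interval is closed to apply the fundamental theorem. *)
have key (F G : R -> R) : (forall t, is_derive t 1 F (G (n%:R * t))) -> continuous G -> (forall t, `|G t| <= 1) ->
    F (2 * pi) = F 0 -> Rintegral leb circle (fun t => G (n%:R * t)) = 0.
  move=> dF cG bG F0.
  have cGn : continuous (fun t : R => G (n%:R * t)).
    move=> t; apply: (@continuous_comp _ _ _ (fun t => n%:R * t) G); last exact: cG.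
    exact: (@mulrl_continuous R n%:R t).
  have h := @continuous_FTC2 R (fun t => G (n%:R * t)) F 0 (2 * pi) (pi2_gt0 R).
  have iG : leb.-integrable circle (EFin \o (fun t => G (n%:R * t))).
    apply: (@rint_le _ _ _ (fun=> 1)).
    - by apply: (@measurable_funTS _ _ mR); exact: measurable_realfun.continuous_measurable_fun.
    - by apply: rint_cst; exact: leb_mass.
    - by move=> t _; exact: bG.
  rewrite /Rintegral.
  rewrite [X in fine X](_ : _ = \int[leb]_(t in `[0%R, (2 * pi)%R]) (G (n%:R * t))%:E)%E; last first.
    apply: integral_itv_bndo_bndc; exact: measurable_int iG.
  rewrite h.
  - by rewrite F0 subee.
  - exact: continuous_subspaceT.
  - split.
    + by move=> t _; have [] := dF t.
    + apply: cvg_at_right_filter; apply: differentiable_continuous; apply/derivable1_diffP; by have [] := dF 0.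
    + apply: cvg_at_left_filter; apply: differentiable_continuous; apply/derivable1_diffP; by have [] := dF (2 * pi).
  - by move=> t _; rewrite derive1E; have [_ ->] := dF t.
have e2 : n%:R * (2 * pi) = 0 + pi *+ 2 *+ n :> R.
  by rewrite add0r -[RHS]mulr_natl -[pi *+ 2]mulr_natl.
split.
  apply: (key (fun t => n%:R^-1 * sin (n%:R * t))); [|exact: continuous_cos|exact: cos_max|].
    move=> t; apply: is_derive_eq; rewrite /GRing.scale /=; by field.
  by rewrite e2 (periodicn (@sinD2pi R)) mulr0.
apply: (key (fun t => - n%:R^-1 * cos (n%:R * t))); [|exact: continuous_sin|exact: sin_max|].
  move=> t; apply: is_derive_eq; rewrite /GRing.scale /=; by field.
by rewrite e2 (periodicn (@cosD2pi R)) mulr0.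
Qed.

Lemma cintegral_char n : (0 < n)%N -> cintegral leb (char_pos n) = 0.
Proof.
move=> n0; have [h1 h2] := Rintegral_cos n0.
rewrite /cintegral /char_pos; apply: complexP => /=.
  by rewrite -[RHS]h1; apply: eq_Rintegral => t _; rewrite cisX.
by rewrite -[RHS]h2; apply: eq_Rintegral => t _; rewrite cisX.
Qed.

Lemma inner_char_pos m n : inner (char_pos m) (char_pos n) = (m == n)%:R.
Proof.
wlog mn : m n / (n <= m)%N.
  move=> h; have [|/ltnW] := leqP n m; first exact: h.
  by move=> /h; rewrite (ipC hL (char_posL2 n) (char_posL2 m)) => ->; rewrite conjc_nat eq_sym.
have [<-|nm] := eqVneq m n.
  rewrite inner_self; last exact: char_posL2.
  have <- := norm2_sqr (char_posL2 m).
  have -> : norm2 (char_pos m) = 1.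
    rewrite -(norm2_cst1 R) /norm2; congr (Num.sqrt (complex.Re _)).
    rewrite !inner_self; [|exact: cst_L2|exact: char_posL2].
    congr (_ * _)%:C; apply: eq_Rintegral => t _.
    by rewrite cabsX cabs_cis !expr1n cabs1 expr1n.
  by rewrite expr1n.
rewrite /inner (@eq_cintegral _ _ _ (char_pos (m - n))).
  by rewrite cintegral_char ?mulr0 // subn_gt0 ltn_neqAle eq_sym nm.
move=> t _; rewrite /char_pos -{1}(subnK mn) exprD -mulrA rmorphXn /= -exprMn.
by rewrite cis_conjM expr1n mulr1.
Qed.

Lemma inner_char_pos_neg m n : (0 < n)%N -> inner (char_pos m) (char_neg n) = 0.
Proof.
move=> n0; rewrite /inner (@eq_cintegral _ _ _ (char_pos (m + n))).
  by rewrite cintegral_char ?mulr0 // addn_gt0 n0 orbT.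
by move=> t _; rewrite /char_pos /char_neg rmorphXn exprD; congr (_ * _ ^+ _); exact: conjcK.
Qed.

Lemma char_pos0 : char_pos 0 = fun=> 1. Proof. exact/funext. Qed.
Lemma char_neg0 : char_neg 0 = fun=> 1. Proof. exact/funext. Qed.

Lemma orthosys_char : orthosys ipL (@L2 R : set V) char_pos.
Proof.
split; first exact: char_posL2.
  by move=> i j /eqP ij; rewrite inner_char_pos (negbTE ij).
by move=> i; rewrite /nrm inner_char_pos eqxx /= sqrtr1.
Qed.

End trigonometric_system.
(** * Poisson integrals and radial limits *)

Section poisson_kernel.
Local Opaque inner cintegral.
Variable R : realType.
Local Notation mR := (measurableTypeR R).
Local Notation circle := (@circle R : set mR).
Local Notation leb := (@lebesgue_measure R).
Local Notation V := (R -> R[i]^o).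
Local Notation ipL := (@inner R : V -> V -> R[i]).
Implicit Types (f g h : mR -> R[i]) (t s : R) (z w : R[i]).

Let hL := L2_pre_hilbert R.

(** The norm of [R[i]] takes its values in [R[i]]; complex limits are handled from here on through
    the real number [cabs]. *)
Lemma cvg_complexP (T : Type) (G : set_system T) {FG : Filter G} (u : T -> R[i]) (l : R[i]) :
  ((u x : R[i]^o) @[x --> G] --> (l : R[i]^o)) <-> (fun x => cabs (u x - l)) @ G --> (0 : R).
Proof.
split=> [/cvgrPdist_le h|/cvgrPdist_le h].
  apply/cvgrPdist_le => e e0.
  have e0' : 0 < e%:C :> R[i] by rewrite ltcR.
  apply: filterS (h _ e0') => x; rewrite normE lecR sub0r normrN ger0_norm ?cabs_ge0 //.
  by rewrite cabs_distC.
apply/cvgrPdist_le => e e0.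
have [ee er] := ger0_ReIm (ltW e0).
have e1 : 0 < complex.Re e by move: e0; rewrite ltcE => /andP[].
apply: filterS (h _ e1) => x; rewrite sub0r normrN ger0_norm ?cabs_ge0 // => le.
by rewrite normE ee lecR cabs_distC.
Qed.

(** The Poisson kernel of the disk at [z]. *)
Definition pk z t : R := (1 - cabs z ^+ 2) / cabs (cis t - z) ^+ 2.

Lemma cis_subM z t : cis t - z = cis t * (1 - z * conjc (cis t)).
Proof. by rewrite mulrBr mulr1 mulrCA cis_conjM mulr1. Qed.

Lemma cabs_cis_sub_ge z t : 1 - cabs z <= cabs (cis t - z).
Proof.
have := cabs_dist (cis t) z; rewrite cabs_cis.
by apply: le_trans; exact: ler_norm.
Qed.

Lemma cabs_cis_sub_gt0 z t : cabs z < 1 -> 0 < cabs (cis t - z).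
Proof. by move=> z1; apply: lt_le_trans (cabs_cis_sub_ge z t); rewrite subr_gt0. Qed.

Lemma pk_ge0 z t : cabs z < 1 -> 0 <= pk z t.
Proof.
move=> z1; rewrite divr_ge0 ?sqr_ge0 // subr_ge0 expr_le1 ?cabs_ge0 //; exact: ltW.
Qed.

Lemma pk_le z t (c : R) : cabs z < 1 -> 0 < c -> c <= cabs (cis t - z) ->
  pk z t <= 2 * (1 - cabs z) / c ^+ 2.
Proof.
move=> z1 c0 le; have h := cabs_cis_sub_gt0 t z1; rewrite /pk.
apply: (@le_trans _ _ ((2 * (1 - cabs z)) / cabs (cis t - z) ^+ 2)).
  rewrite ler_pM2r ?invr_gt0 ?exprn_gt0 //.
  rewrite (_ : 1 - _ = (1 - cabs z) * (1 + cabs z)); last by ring.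
  by rewrite mulrC ler_pM2r ?subr_gt0 //; have := ltW z1; lra.
rewrite ler_pM2l ?mulr_gt0 ?subr_gt0 // lef_pV2 ?posrE ?exprn_gt0 //.
by rewrite ler_pXn2r ?nnegrE ?(ltW c0) ?cabs_ge0.
Qed.

Lemma pk_bound z t : cabs z < 1 -> pk z t <= 2 / (1 - cabs z).
Proof.
move=> z1; have h : 0 < 1 - cabs z by rewrite subr_gt0.
apply: (le_trans (pk_le z1 h (cabs_cis_sub_ge z t))).
rewrite le_eqVlt; apply/orP; left; apply/eqP; field; exact: lt0r_neq0.
Qed.

Lemma pk_continuous z : cabs z < 1 -> continuous (pk z).
Proof.
move=> z1 t; rewrite /pk.
apply: (@continuousM _ _ (fun=> 1 - cabs z ^+ 2) (fun t => (cabs (cis t - z) ^+ 2)^-1)).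
  exact: cst_continuous.
apply: (@continuousV _ _ (fun t => cabs (cis t - z) ^+ 2)).
  by rewrite lt0r_neq0 // exprn_gt0 // cabs_cis_sub_gt0.
have -> : (fun t => cabs (cis t - z) ^+ 2) =
   (fun t => (cos t - complex.Re z) * (cos t - complex.Re z) + (sin t - complex.Im z) * (sin t - complex.Im z)).
  by apply/funext => s; rewrite cabs_sqr ReD ImD ReN ImN !expr2.
have c1 : {for t, continuous (fun t => cos t - complex.Re z)}.
  by apply: (@continuousB _ _ _ (@cos R) (fun=> complex.Re z)); [exact: continuous_cos|exact: cst_continuous].
have c2 : {for t, continuous (fun t => sin t - complex.Im z)}.
  by apply: (@continuousB _ _ _ (@sin R) (fun=> complex.Im z)); [exact: continuous_sin|exact: cst_continuous].
by apply: (@continuousD _ _ _ (fun t => (cos t - complex.Re z) * (cos t - complex.Re z))); exact: continuousM.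
Qed.

Lemma pk_measurable z : cabs z < 1 -> measurable_fun circle (pk z).
Proof.
move=> z1; apply: (@measurable_funTS _ _ mR).
by apply: measurable_realfun.continuous_measurable_fun; exact: pk_continuous.
Qed.

Lemma pkL2 z : cabs z < 1 -> L2 (fun t : mR => (pk z t)%:C).
Proof.
move=> z1; apply: (@L2_bounded _ _ (2 / (1 - cabs z))).
  by split => /=; [exact: pk_measurable|exact: measurable_cst].
by move=> t _; rewrite cabs_real ger0_norm ?pk_ge0 // pk_bound.
Qed.

Lemma geom_rem w n : cabs w < 1 ->
  (1 - w)^-1 = \sum_(k < n) w ^+ k + w ^+ n / (1 - w) /\ cabs (w ^+ n / (1 - w)) <= cabs w ^+ n / (1 - cabs w).
Proof.
move=> w1.
have nz : 1 - w != 0.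
  by apply/eqP => /eqP; rewrite subr_eq0 => /eqP h; move: w1; rewrite -h cabs1 ltxx.
split.
  have := subrX1 w n; rewrite -opprB -[w - 1]opprB mulNr => /oppr_inj e.
  by apply: (mulfI nz); rewrite mulrDr mulfV // -e mulrCA mulfV // mulr1 subrK.
rewrite cabsM cabsX cabsV ler_wpM2l ?exprn_ge0 ?cabs_ge0 //.
rewrite lef_pV2 ?posrE ?subr_gt0 //.
  by have := cabs_dist 1 w; rewrite cabs1; apply: le_trans; exact: ler_norm.
by rewrite lt_neqAle cabs_ge0 andbT eq_sym; apply: contra nz => /eqP/cabs_eq0 ->.
Qed.

(** The two inverses are geometric series, in positive and in negative characters: this gives the
    Fourier expansion of the kernel, and later identifies it with the real part of the Herglotz
    kernel. *)
Lemma pk_split z t : cabs z < 1 -> let w := z * conjc (cis t) in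
  (pk z t)%:C = (1 - conjc w)^-1 + (1 - w)^-1 - 1.
Proof.
move=> z1 w.
have cw : cabs w = cabs z by rewrite cabsM cabs_conj cabs_cis mulr1.
have nz : 1 - w != 0.
  by apply/eqP => /eqP; rewrite subr_eq0 => /eqP h; move: z1; rewrite -cw -h cabs1 ltxx.
have nz' : 1 - conjc w != 0.
  by rewrite -(conjc1 R) -conjcN -conjcD conjc_eq0.
have -> : pk z t = (1 - cabs w ^+ 2) / cabs (1 - w) ^+ 2.
  by rewrite /pk cis_subM -/w cabsM cabs_cis mul1r cw.
rewrite rmorphM /= fmorphV /= rmorphB /= !cabs_sqrC rmorph1 conjcD conjcN conjc1.
by field; apply/andP.
Qed.

(** Both sums contain the constant character, whence the subtraction of 1. *)
Definition pk_part z n : V := fun t => \sum_(k < n) conjc z ^+ k * char_pos k t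
  + \sum_(k < n) z ^+ k * char_neg k t - 1.

Lemma pk_expand z n t : cabs z < 1 ->
  cabs ((pk z t)%:C - pk_part z n t) <= 2 * (cabs z ^+ n / (1 - cabs z)).
Proof.
move=> z1; rewrite pk_split //; set w := z * conjc (cis t).
have cw : cabs w = cabs z by rewrite cabsM cabs_conj cabs_cis mulr1.
have cw' : cabs (conjc w) = cabs z by rewrite cabs_conj.
have w1 : cabs w < 1 by rewrite cw.
have w1' : cabs (conjc w) < 1 by rewrite cw'.
have [e1 b1] := geom_rem n w1; have [e2 b2] := geom_rem n w1'.
have -> : pk_part z n t = \sum_(k < n) conjc w ^+ k + \sum_(k < n) w ^+ k - 1.
  rewrite /pk_part; congr (_ + _ - _); apply: eq_bigr => k _.
    by rewrite /char_pos /w conjcM conjcK exprMn.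
  by rewrite /char_neg /w exprMn.
rewrite e1 e2; set S1 := \sum_(_ < _) conjc w ^+ _; set S2 := \sum_(_ < _) w ^+ _.
set r1 := _ / (1 - conjc w); set r2 := _ / (1 - w).
rewrite (_ : _ - _ = r1 + r2); last by ring.
rewrite cw in b1; rewrite cw' in b2.
by apply: (le_trans (cabsD _ _)); rewrite /r1 /r2; lra.
Qed.

Definition poisson f z : R[i] := inner f (fun t => (pk z t)%:C).

Lemma pk_partE z n : pk_part z n = \sum_(k < n) (conjc z ^+ k *: char_pos k : V) +
   \sum_(k < n) (z ^+ k *: char_neg k : V) - (fun=> 1).
Proof. by apply/funext => t; rewrite /pk_part !fctE !fct_sumE. Qed.

Lemma pk_partL2 z n : L2 (pk_part z n).
Proof.
rewrite pk_partE; apply: (phB hL); last exact: cst_L2.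
by apply: (phD hL); apply: (ph_lincomb hL) => k; [exact: char_posL2|exact: char_negL2].
Qed.

Lemma inner_pk_part f z n : L2 f -> inner f (pk_part z n) =
  \sum_(k < n) z ^+ k * inner f (char_pos k) + \sum_(k < n) conjc z ^+ k * inner f (char_neg k)
  - inner f (fun=> 1).
Proof.
move=> hf.
rewrite pk_partE.
have h1 (k : 'I_n) := char_posL2 R k; have h2 (k : 'I_n) := char_negL2 R k.
have H1 := ph_lincomb hL (fun k : 'I_n => conjc z ^+ k) h1.
have H2 := ph_lincomb hL (fun k : 'I_n => z ^+ k) h2.
rewrite (ipBr hL (phD hL H1 H2) (cst_L2 _) hf) (ipDr hL H1 H2 hf).
rewrite (ip_lincombr hL _ h1 hf) (ip_lincombr hL _ h2 hf); congr (_ + _ - _).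
  by apply: eq_bigr => k _; rewrite rmorphXn /= conjcK.
by apply: eq_bigr => k _; rewrite rmorphXn.
Qed.

Lemma inner_sup_le f g (M : R) : L2 f -> L2 g -> 0 <= M -> (forall t, circle t -> cabs (g t) <= M) ->
  cabs (inner f g) <= norm2 f * M.
Proof.
move=> hf hg M0 le; apply: (le_trans (cauchy_schwarz hL hf hg)).
rewrite ler_wpM2l ?sqrtr_ge0 // -/(norm2 g).
rewrite -(ler_pXn2r (n:=2)) ?nnegrE ?sqrtr_ge0 // norm2_sqr //.
rewrite ler_pdivrMl ?pi2_gt0 //.
apply: (@le_trans _ _ (Rintegral leb circle (fun=> M ^+ 2))); last first.
  rewrite Rintegral_cst // mulrC ler_wpM2r ?sqr_ge0 //.
  by have -> : fine (leb circle) = 2 * pi by rewrite [leb circle]circle_mu.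
apply: le_Rintegral => //; [exact: L2_rint|by apply: rint_cst; exact: leb_mass|].
by move=> t ct; rewrite ler_pXn2r ?nnegrE ?cabs_ge0 //; exact: le.
Qed.

Lemma cvg_geom_bound (a c : R) : 0 <= a < 1 -> (fun n => c * (a ^+ n / (1 - a))) @ \oo --> (0 : R).
Proof.
move=> /andP[a0 a1].
have h : (fun n => a ^+ n) @ \oo --> (0 : R) by apply: cvg_expr; rewrite ger0_norm.
have := cvgM (cvg_cst c) (cvgM h (cvg_cst (1 - a)^-1)).
by rewrite mul0r mulr0; apply.
Qed.

Lemma poisson_cvg f z : L2 f -> cabs z < 1 ->
  (fun n => cabs (inner f (pk_part z n) - poisson f z)) @ \oo --> (0 : R).
Proof.
move=> hf z1.
have h := @cvg_geom_bound (cabs z) (norm2 f * 2) _.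
have /h {}h : 0 <= cabs z < 1 by rewrite cabs_ge0.
apply: squeeze_cvgr (cvg_cst 0) h; apply: nearW => n; rewrite cabs_ge0 /=.
rewrite /poisson -(ipBr hL (pk_partL2 z n) (pkL2 z1) hf) -mulrA.
apply: inner_sup_le => //.
- exact: (phB hL (pk_partL2 z n) (pkL2 z1)).
- by rewrite mulr_ge0 // divr_ge0 ?exprn_ge0 ?cabs_ge0 // subr_ge0 ltW.
- by move=> t _; have := pk_expand n t z1; rewrite cabs_distC.
Qed.

Lemma poisson_analytic f z : L2 f -> (forall n, (0 < n)%N -> inner f (char_neg n) = 0) -> cabs z < 1 ->
  (fun n => cabs (\sum_(k < n) inner f (char_pos k) * z ^+ k - poisson f z)) @ \oo --> (0 : R).
Proof.
move=> hf f0 z1.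
have := poisson_cvg hf z1; rewrite -(cvg_shiftS (fun n => cabs (inner f _ - _))) => h.
rewrite -(cvg_shiftS (fun n => cabs (\sum_(k < n) _ - _))); move: h; apply: cvg_trans.
apply: near_eq_cvg; apply: nearW => n /=; congr (cabs (_ - _)).
rewrite inner_pk_part //.
have e1 : \sum_(k < n.+1) conjc z ^+ k * inner f (char_neg k) = inner f (fun=> 1).
  rewrite big_ord_recl big1 ?addr0; first by rewrite expr0 mul1r char_neg0.
  by move=> k _; rewrite f0 // mulr0.
have e2 : \sum_(k < n.+1) z ^+ k * inner f (char_pos k) = \sum_(k < n.+1) inner f (char_pos k) * z ^+ k.
  by apply: eq_bigr => k _; rewrite mulrC.
exact: (etrans (congr2 (fun a b => a + b - inner f (fun=> 1)) e2 e1) (addrK _ _)).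
Qed.

Lemma poisson_cst z : cabs z < 1 -> poisson (fun=> 1) z = 1.
Proof.
move=> z1; have h1 := cst_L2 (1 : R[i]).
have := poisson_cvg h1 z1.
rewrite -(cvg_shiftS (fun n => cabs (inner _ _ - _))) => h.
have e : (fun n => cabs (inner (fun _ : R => 1) (pk_part z n.+1) - poisson (fun=> 1) z)) =
  (fun=> cabs (1 - poisson (fun=> 1) z)).
  apply/funext => n; congr (cabs (_ - _)); rewrite inner_pk_part //.
  have i1 : inner (fun _ : R => 1) (fun _ : R => 1) = 1 :> R[i].
    by rewrite -char_pos0 inner_char_pos eqxx.
  have e2 : \sum_(k < n.+1) z ^+ k * inner (fun _ : R => 1) (char_pos k) = 1.
    rewrite big_ord_recl big1 ?addr0; first by rewrite expr0 mul1r char_pos0 i1.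
    by move=> k _; rewrite -char_pos0 inner_char_pos mulr0.
  have e1 : \sum_(k < n.+1) conjc z ^+ k * inner (fun _ : R => 1) (char_neg k) = 1.
    rewrite big_ord_recl big1 ?addr0; first by rewrite expr0 mul1r char_neg0 i1.
    by move=> k _; rewrite -char_pos0 inner_char_pos_neg // mulr0.
  rewrite i1; exact: (etrans (congr2 (fun a b => a + b - 1) e2 e1) (addrK _ _)).
have h' : (fun _ : nat => cabs (1 - poisson (fun=> 1) z)) @ \oo --> (0 : R).
  by rewrite -e.
have e' : 0 = cabs (1 - poisson (fun=> 1) z) := cvg_unique (@Rhausdorff R) h' (cvg_cst _).
apply/eqP; rewrite eq_sym -subr_eq0; apply/eqP.
by apply: cabs_eq0; rewrite -e'.
Qed.

End poisson_kernel.

(** * Fatou's theorem on radial limits *)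

Section fatou_theorem.
Variable R : realType.
Local Notation mR := (measurableTypeR R).
Local Notation circle := (@circle R : set mR).
Local Notation leb := (@lebesgue_measure R).
Local Notation V := (R -> R[i]^o).
Local Notation ipL := (@inner R : V -> V -> R[i]).
Implicit Types (f g : mR -> R[i]) (t s x rho : R) (w : mR -> R).

Let hL := L2_pre_hilbert R.

Lemma circleP s : circle s <-> 0 <= s < 2 * pi.
Proof. by rewrite /Defs.circle /= in_itv. Qed.

Lemma cvg_left1_0 (F : R -> R) : (forall rho, 0 < rho < 1 -> 0 <= F rho) ->
  (forall e : R, 0 < e -> exists2 d, 0 < d & forall rho, 0 < rho -> 1 - d < rho < 1 -> F rho <= e) ->
  F @ (1 : R)^'- --> (0 : R).
Proof.
move=> F0 h; apply/cvgrPdist_le => e /h[d d0 hd].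
near=> rho.
have r0 : 0 < rho by near: rho; exact: nbhs_left_gt.
have r1 : rho < 1 by near: rho; exact: nbhs_left_lt.
have r2 : 1 - d < rho by near: rho; apply: nbhs_left_gt; rewrite ltrBlDr ltrDl.
by rewrite sub0r normrN ger0_norm ?F0 ?r0 // hd // r2.
Unshelve. all: by end_near. Qed.

Lemma sin_lower : exists2 d : R, 0 < d & forall x, `|x| < d -> `|x| / 2 <= `|sin x|.
Proof.
have := @continuous_cos R 0; rewrite /prop_for /continuous_at cos0 => /cvgrPdist_lt /(_ 2^-1).
rewrite invr_gt0 ltr0n => /(_ isT); rewrite -nbhs_ballE => -[d /= d0 hd].
have pos x : 0 < x -> x < d -> x / 2 <= sin x.
  move=> x0 xd.
  have cs : {within `[0, x], continuous (@sin R)} by apply: continuous_subspaceT; exact: continuous_sin.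
  have [y yx] := @MVT R (@sin R) (@cos R) 0 x x0 (fun y _ => is_derive_sin y) cs.
  move: yx; rewrite in_itv /= => /andP[y0 yx]; rewrite sin0 !subr0 => ->.
  rewrite mulrC ler_pM2r //.
  have := hd y; rewrite /ball /= sub0r normrN ger0_norm ?(ltW y0) // => /(_ (lt_trans yx xd)).
  by move=> /ltW; rewrite ler_norml => /andP[]; lra.
exists d => // x xd.
have [x0|x0|->] := ltgtP x 0; last by rewrite normr0 mul0r.
- rewrite (ltr0_norm x0) in xd *; rewrite -normrN -sinN.
  apply: le_trans (ler_norm _); apply: pos => //; by rewrite oppr_gt0.
- rewrite (gtr0_norm x0) in xd *; apply: le_trans (ler_norm _); exact: pos.
Qed.

(** Two points of the circle are close when their angles differ by nearly 0 or by nearly 2 pi; both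
    cases are excluded. The constant is the length of the chord of angle [d]. *)
Lemma cis_sep (d : R) : 0 < d <= pi -> exists2 c : R, 0 < c & forall s t,
  d <= `|s - t| <= 2 * pi - d -> c <= cabs (cis s - cis t).
Proof.
move=> /andP[d0 dpi].
have c1 : cos d < 1.
  have := ltr_cos (x := 0) (y := d); rewrite !in_itv /= lexx pi_ge0 (ltW d0) dpi cos0.
  by move=> /(_ isT isT) ->.
exists (Num.sqrt (2 - 2 * cos d)); first by rewrite sqrtr_gt0; lra.
move=> s t /andP[h1 h2].
rewrite -(ler_pXn2r (n:=2)) ?nnegrE ?sqrtr_ge0 ?cabs_ge0 // cabs_cisB sqr_sqrtr; last by lra.
suff : cos (s - t) <= cos d by lra.
rewrite -(cos_norm (s - t)); move: `|s - t| h1 h2 => x h1 h2.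
have cle y : d <= y -> y <= pi -> cos y <= cos d.
  move=> dy ypi; rewrite leNgt; apply/negP.
  rewrite (ltr_cos (x := y) (y := d)) ?in_itv /= ?(ltW d0) ?dpi ?ypi ?(le_trans (ltW d0)) //.
  by rewrite ltNge dy.
have [xpi|xpi] := leP x pi; first exact: cle.
have -> : cos x = cos (2 * pi - x).
  rewrite cosB (_ : 2 * pi = pi *+ 2); last by rewrite mulr_natl.
  by rewrite cos2pi sin2pi mul1r mul0r addr0.
by apply: cle; lra.
Qed.

Definition cut w (t h : R) : mR -> R := fun s => if `|s - t| < h then w s else 0.

Lemma measurable_dist (D : set mR) t : measurable_fun D (fun s : mR => `|s - t|).
Proof.
apply: (@measurable_funTS _ _ mR); apply: measurable_realfun.continuous_measurable_fun => s.
have h : {for s, continuous (fun s : R => s - t)}.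
  by apply: (@continuousB _ _ _ id (fun=> t)); [exact: cvg_id|exact: cst_continuous].
exact: (@continuous_comp _ _ _ (fun s : R => s - t) Num.norm s h (@norm_continuous _ R^o _)).
Qed.

Lemma cut_meas w t (h : R) : measurable_fun circle w -> measurable_fun circle (cut w t h).
Proof.
move=> mw; apply: (@measurable_fun_if _ _ mR) => //.
- by apply: measurable_fun_ltr; [exact: measurable_dist|exact: measurable_cst].
- by apply: measurable_funS mw => // s [].
Qed.

Lemma rint_cut w t (h : R) : (forall s, 0 <= w s) -> rint leb w -> rint leb (cut w t h).
Proof.
move=> w0 hw; apply: (rint_le _ hw); first exact: cut_meas (rint_meas hw).
by move=> s _; rewrite /cut; case: ifP => _; rewrite ?normr0 // ger0_norm.
Qed.

Lemma geom_half_sum n : \sum_(k < n) (2^-1 : R) ^+ k <= 2.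
Proof.
have h : \sum_(k < n) (2^-1 : R) ^+ k = 2 - 2 * 2^-1 ^+ n.
  elim: n => [|n IH]; first by rewrite big_ord0 expr0; lra.
  by rewrite big_ord_recr /= IH exprS; lra.
by rewrite h lerBlDr lerDl mulr_ge0 // exprn_ge0 // invr_ge0.
Qed.

Lemma pow2_unbounded (a : R) : exists K, a < 2 ^+ K.
Proof.
exists (Num.truncn a).+1; apply: (lt_le_trans (truncnS_gt a)).
by rewrite -natrX ler_nat ltnW // ltn_expl.
Qed.

(* Dyadic decomposition: at distance about [2 ^ k * (1 - rho)] from [t0] the
   kernel is of order [4 ^ - k / (1 - rho)]. *)
Lemma poisson_concentration w t0 : 0 < t0 < 2 * pi -> (forall s, 0 <= w s) -> rint leb w ->
  (forall eta : R, 0 < eta -> exists2 d : R, 0 < d & forall h, 0 < h <= d ->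
     Rintegral leb circle (cut w t0 h) <= eta * h) ->
  (fun rho => Rintegral leb circle (fun s => w s * pk (rho%:C * cis t0) s)) @ (1 : R)^'- --> (0 : R).
Proof.
move=> /andP[t00 t02] w0 hw hcut.
have cz rho : 0 < rho -> cabs (rho%:C * cis t0) = rho.
  by move=> r0; rewrite cabsM cabs_real cabs_cis mulr1 ger0_norm // ltW.
apply: cvg_left1_0.
  move=> rho /andP[r0 r1]; apply: Rintegral_ge0 => s _.
  by rewrite mulr_ge0 // pk_ge0 // cz.
move=> e e0.
(* The dyadic term of index k will be bounded by 8 * 4 / 128 * e * 2^-k = e / 4 * 2^-k, and the sum
   of these terms by e / 2. *)
have e1 : 0 < e / 128 by rewrite divr_gt0.
have [d1 d10 hd1] := hcut _ e1.
have [d2 d20 hd2] := sin_lower.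
(* Being at most [t0] and [2 * pi - t0], the radius [d] keeps the arc around [t0] away from the cut
   at angle 0: angles of the circle at distance at least [d] from [t0] fall under [cis_sep]. *)
pose d := Num.min (Num.min d1 d2) (Num.min (Num.min t0 (2 * pi - t0)) pi).
have d0 : 0 < d by rewrite !lt_min d10 d20 t00 subr_gt0 t02 pi_gt0.
have : d <= d by []. rewrite {2}/d !le_min => /andP[/andP[dd1 dd2] /andP[/andP[dt0 dt1] dpi]].
have [c c0 hc] : exists2 c : R, 0 < c & forall s t,
    d <= `|s - t| <= 2 * pi - d -> c <= cabs (cis s - cis t).
  by apply: cis_sep; rewrite d0.
set W := Rintegral leb circle w.
have W0 : 0 <= W by apply: Rintegral_ge0 => s _.
(* The first bound keeps [z] at distance at least c / 2 from the far points, the second makes their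
   contribution at most e / 2. *)
pose b := Num.min (c / 2) (e * c ^+ 2 / (16 * (W + 1))).
have W1 : 0 < W + 1 by rewrite ltr_wpDl.
have b0 : 0 < b by rewrite lt_min divr_gt0 //= divr_gt0 ?mulr_gt0 ?exprn_gt0.
exists b => // rho r0 /andP[rb r1].
set z := rho%:C * cis t0.
have z1 : cabs z < 1 by rewrite cz.
pose eps := 1 - rho.
have eps0 : 0 < eps by rewrite subr_gt0.
have epsb : eps < b by rewrite /eps; lra.
have ez : 1 - cabs z = eps by rewrite cz.
have near_z s : cabs (cis s - cis t0) - eps <= cabs (cis s - z).
  have h1 : cabs (cis t0 - z) = eps.
    rewrite /z -{1}[cis t0]mul1r -mulrBl cabsM cabs_cis mulr1.
    by rewrite -(rmorph1 (real_complex R)) -rmorphB cabs_real ger0_norm // ltW.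
  have := cabsD (cis s - z) (z - cis t0); rewrite addrA subrK (cabs_distC z) h1; lra.
have [K hK] := pow2_unbounded (d / eps).
have hK' : d < 2 ^+ K * eps by rewrite -ltr_pdivrMr.
pose h k := Num.min (2 ^+ k.+2 * eps) d.
have p2 k : 0 < 2 ^+ k :> R by rewrite exprn_gt0.
have h0 k : 0 < h k by rewrite lt_min d0 mulr_gt0.
pose B s := w s * (8 * eps / c ^+ 2) + \sum_(k < K.+1) 8 / (4 ^+ k * eps) * cut w t0 (h k) s.
have p4 k : 0 < 4 ^+ k :> R by rewrite exprn_gt0.
have sq2 k : (2 ^+ k) ^+ 2 = 4 ^+ k :> R.
  by rewrite -exprM mulnC exprM; congr (_ ^+ _); rewrite expr2 -natrM.
have cut0 k s : 0 <= cut w t0 (h k) s by rewrite /cut; case: ifP.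
have key s : circle s -> w s * pk z s <= B s.
  move=> cs; rewrite /B.
  have S0 : 0 <= \sum_(k < K.+1) 8 / (4 ^+ k * eps) * cut w t0 (h k) s.
    by apply: sumr_ge0 => k _; rewrite mulr_ge0 // divr_ge0 // mulr_ge0 // ltW.
  have F0 : 0 <= w s * (8 * eps / c ^+ 2).
    by rewrite mulr_ge0 // divr_ge0 ?sqr_ge0 // mulr_ge0 // ltW.
  have [far|nearby] := leP d `|s - t0|.
    apply: ler_wpDr => //; rewrite ler_wpM2l //.
    have c2 : c / 2 <= cabs (cis s - z).
      apply: le_trans (near_z s).
      have cc : c <= cabs (cis s - cis t0).
        apply: hc; rewrite far /=; have /andP[s0 s2] := (circleP s).1 cs.
        by rewrite ler_norml; apply/andP; split; lra.
      have : b <= c / 2 by rewrite ge_min lexx.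
      lra.
    have c20 : 0 < c / 2 by rewrite divr_gt0.
    apply: (le_trans (pk_le z1 c20 c2)); rewrite ez le_eqVlt; apply/orP; left; apply/eqP.
    field; exact: lt0r_neq0.
  apply: ler_wpDl => //.
  have exk : exists k, `|s - t0| < 2 ^+ k.+2 * eps.
    exists K; apply: (lt_trans nearby); apply: (lt_le_trans hK'); rewrite ler_pM2r //.
    by rewrite ler_weXn2l ?ler1n // leqW.
  (* By minimality, if k > 0 then [s] is at distance at least 2^(k+1) * eps from [t0], and the
     single term of index k in [B] dominates the kernel at [s]. For k = 0 the crude bound [pk_bound]
     is of the right order. *)
  have [k hk kmin] := ex_minnP exk.
  have kK : (k < K.+1)%N.
    rewrite ltnS; apply: kmin; apply: (lt_trans nearby); apply: (lt_le_trans hK').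
    by rewrite ler_pM2r // ler_weXn2l ?ler1n // leqW.
  rewrite (bigD1 (Ordinal kK)) //=; apply: ler_wpDr.
    by apply: sumr_ge0 => j _; rewrite mulr_ge0 // divr_ge0 // mulr_ge0 // ltW.
  have -> : cut w t0 (h k) s = w s by rewrite /cut lt_min hk nearby.
  rewrite mulrC ler_wpM2r //.
  case: k hk kmin {kK} => [|k] hk kmin.
    rewrite expr0 mul1r; apply: (le_trans (pk_bound s z1)); rewrite ez.
    by rewrite ler_pM2r ?invr_gt0 //; lra.
  have far : 2 ^+ k.+2 * eps <= `|s - t0|.
    by rewrite leNgt; apply/negP => /kmin; rewrite ltnn.
  have sl := hd2 _ (lt_le_trans nearby dd2).
  have c3 : 2 ^+ k * eps <= cabs (cis s - z).
    apply: le_trans (near_z s).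
    have c4 : `|s - t0| / 2 <= cabs (cis s - cis t0).
      apply: (le_trans sl).
      rewrite -(ler_pXn2r (n:=2)) ?nnegrE ?normr_ge0 ?cabs_ge0 // cabs_cisB.
      rewrite real_normK ?num_real // sin2cos2.
      by have := sqr_ge0 (1 - cos (s - t0)); rewrite sqrrB; lra.
    have e3 : 2 ^+ k.+2 * eps = 4 * (2 ^+ k * eps) by rewrite !exprS; ring.
    have e4 : eps <= 2 ^+ k * eps by rewrite ler_peMl ?(ltW eps0) // exprn_ege1 // ler1n.
    by rewrite e3 in far; lra.
  have c5 : 0 < 2 ^+ k * eps by rewrite mulr_gt0.
  apply: (le_trans (pk_le z1 c5 c3)); rewrite ez le_eqVlt; apply/orP; left; apply/eqP.
  rewrite exprMn sq2 [4 ^+ k.+1]exprS.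
  have x0 := lt0r_neq0 eps0; move: (4 ^+ k) (lt0r_neq0 (p4 k)) => y y0.
  by field; rewrite ?x0 ?y0.
have iB1 : rint leb (fun s => (8 * eps / c ^+ 2) * w s) by exact: rintZ.
have iB2 k : rint leb (fun s => 8 / (4 ^+ k * eps) * cut w t0 (h k) s) by apply: rintZ; exact: rint_cut.
have iS n : rint leb (fun s => \sum_(k < n) 8 / (4 ^+ k * eps) * cut w t0 (h k) s) /\
   Rintegral leb circle (fun s => \sum_(k < n) 8 / (4 ^+ k * eps) * cut w t0 (h k) s)
   <= e / 4 * \sum_(k < n) 2^-1 ^+ k.
  elim: n => [|n [IH1 IH2]].
    under eq_fun do rewrite big_ord0.
    split; first by rewrite /rint; exact: integrable0.
    by rewrite Rintegral_cst // mul0r big_ord0 mulr0.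
  have eS : (fun s : mR => \sum_(k < n.+1) 8 / (4 ^+ k * eps) * cut w t0 (h k) s) =
      (fun s => \sum_(k < n) 8 / (4 ^+ k * eps) * cut w t0 (h k) s + 8 / (4 ^+ n * eps) * cut w t0 (h n) s).
    by apply/funext => s; rewrite big_ord_recr.
  rewrite eS; split; first exact: rintD.
  rewrite RintegralD //; last exact: iB2.
  rewrite [X in _ <= _ * X]big_ord_recr /= [leRHS]mulrDr; apply: lerD => //.
  rewrite (RintegralZl _ (@measurable_circle R) (rint_cut _ _ w0 hw)).
  have hn : Rintegral leb circle (cut w t0 (h n)) <= e / 128 * h n.
    by apply: hd1; rewrite h0 /= ge_min dd1 orbT.
  have hn' : h n <= 2 ^+ n.+2 * eps by rewrite ge_min lexx.
  apply: (@le_trans _ _ (8 / (4 ^+ n * eps) * (e / 128 * (2 ^+ n.+2 * eps)))).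
    rewrite ler_wpM2l ?divr_ge0 ?mulr_ge0 ?(ltW eps0) ?(ltW (p4 n)) //.
    by apply: (le_trans hn); rewrite ler_pM2l.
  rewrite le_eqVlt; apply/orP; left; apply/eqP.
  rewrite -sq2 [2 ^+ n.+2]exprS [2 ^+ n.+1]exprS exprVn.
  have x0 := lt0r_neq0 eps0; move: (2 ^+ n) (lt0r_neq0 (p2 n)) => y y0.
  by field; rewrite ?x0 ?y0.
have [iS1 iS2] := iS K.+1.
have iB : rint leb B.
  rewrite /B; apply: rintD => //; by under eq_fun do rewrite mulrC.
apply: (@le_trans _ _ (Rintegral leb circle B)).
  apply: le_Rintegral => //.
  apply: (rint_le _ iB); first by apply: measurable_funM; [exact: rint_meas hw|exact: pk_measurable].
  by move=> s cs; rewrite ger0_norm ?key // mulr_ge0 // pk_ge0.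
rewrite /B RintegralD //; last by under eq_fun do rewrite mulrC.
have -> : Rintegral leb circle (fun s => w s * (8 * eps / c ^+ 2)) = W * (8 * eps / c ^+ 2).
  by rewrite RintegralZr.
have p1 : W * (8 * eps / c ^+ 2) <= e / 2.
  have eb : eps <= e * c ^+ 2 / (16 * (W + 1)).
    by apply: (le_trans (ltW epsb)); rewrite ge_min lexx orbT.
  apply: (@le_trans _ _ (W * (8 * (e * c ^+ 2 / (16 * (W + 1))) / c ^+ 2))).
    rewrite ler_wpM2l // ler_pM2r ?invr_gt0 ?exprn_gt0 // ler_pM2l //.
  have -> : W * (8 * (e * c ^+ 2 / (16 * (W + 1))) / c ^+ 2) = e / 2 * (W / (W + 1)).
    by field; rewrite !lt0r_neq0.
  by rewrite ler_piMr ?divr_ge0 ?(ltW e0) // ler_pdivrMr // mul1r lerDl.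
have p3 : e / 4 * \sum_(k < K.+1) 2^-1 ^+ k <= e / 2.
  apply: (@le_trans _ _ (e / 4 * 2)); last by lra.
  by rewrite ler_pM2l ?divr_gt0 // geom_half_sum.
by apply: (le_trans (lerD p1 (le_trans iS2 p3))); lra.
Qed.

End fatou_theorem.
Section fatou_L2.
Variable R : realType.
Local Notation mR := (measurableTypeR R).
Local Notation circle := (@circle R : set mR).
Local Notation leb := (@lebesgue_measure R).
Local Notation V := (R -> R[i]^o).
Local Notation ip2 := (@inner R : V -> V -> R[i]).
Implicit Types (f g : mR -> R[i]) (t s x rho : R) (F w : mR -> R).

Let hL := L2_pre_hilbert R.

Lemma rint_dist_cst F (a : R) : rint leb F -> rint leb (fun s => `|F s - a|).
Proof.
move=> hF; have mF := rint_meas hF.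
have m : measurable_fun circle (fun s : mR => `|F s - a|).
  exact: (measurableT_comp (@normr_measurable R setT) (measurable_funB mF (measurable_cst _))).
apply: (rint_le m (rintD (integrable_norm hF) (rint_cst `|a| (@leb_mass R)))) => s _.
by rewrite normr_id ler_normB.
Qed.

(** At a Lebesgue point the oscillation satisfies the hypothesis of [poisson_concentration]. A ball
    of radius h has length 2h, so averages below eta / 2 give integrals below eta * h. *)
Lemma lebesgue_pt_cut F t0 : rint leb F -> circle t0 -> lebesgue_pt (F \_ circle : R -> R) t0 ->
  forall eta : R, 0 < eta -> exists2 d : R, 0 < d & forall h, 0 < h <= d ->
     Rintegral leb circle (cut (fun s => `|F s - F t0|) t0 h) <= eta * h.
Proof.
move=> hF ct0 lp eta eta0.
have Ft0 : (F \_ circle) t0 = F t0 by rewrite patchE mem_set.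
have e0 : (0 < (eta / 2)%:E)%E by rewrite lte_fin divr_gt0.
have : \forall h \near (0 : R)^'+, (davg (F \_ circle : R -> R) t0 h < (eta / 2)%:E)%E.
  apply: (lp [set y | (y < (eta / 2)%:E)%E]).
  by apply: open_nbhs_nbhs; split; [exact: open_ereal_lt_ereal|exact: e0].
rewrite /at_right near_withinE -nbhs_ballE => -[d /= d0 hd].
exists (d / 2); first by rewrite divr_gt0.
move=> h /andP[h0 hd2].
have hlt : h < d by apply: (le_lt_trans hd2); rewrite ltr_pdivrMr // ltr_pMr // ltr1n.
have := hd h; rewrite /ball /= sub0r normrN ger0_norm ?(ltW h0) // => /(_ hlt h0).
rewrite /davg /iavg lebesgue_measure_ball ?(ltW h0) //.
rewrite inver mulrn_eq0 /= (gt_eqF h0) /=.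
set I := (\int[_]_(y in _) _)%E => lt.
have I0 : (0 <= I)%E by apply: integral_ge0.
have le : (I <= (eta * h)%:E)%E.
  have : ((h *+ 2)%:E * ((h *+ 2)^-1%:E * I) <= (h *+ 2)%:E * (eta / 2)%:E)%E.
    by rewrite lee_pmul2l ?lte_fin ?mulrn_wgt0 //; exact: ltW.
  rewrite muleA -EFinM mulfV ?mul1e; last by rewrite mulrn_eq0 /= gt_eqF.
  move/le_trans; apply; rewrite -EFinM lee_fin -mulr_natl le_eqVlt; apply/orP; left; apply/eqP.
  by field.
have iF : rint leb (fun s => `|F s - F t0|).
  exact: rint_dist_cst.
have fi : (\int[leb]_(s in circle) (cut (fun s => `|F s - F t0|) t0 h s)%:E)%E \is a fin_num.
  by apply: integrable_fin_num => //; apply: rint_cut.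
rewrite -lee_fin /Rintegral fineK //; apply: le_trans le.
have -> : (\int[leb]_(s in circle) (cut (fun s => `|F s - F t0|) t0 h s)%:E =
   \int[leb]_(s in circle `&` ball t0 h) (`|F s - F t0|)%:E)%E.
  rewrite integral_mkcondr; apply: eq_integral => s _.
  rewrite /cut patchE; case: ifPn => [lt'|nlt].
    by rewrite mem_set //= /ball /= distrC.
  by rewrite memNset //= /ball /= distrC; exact/negP.
apply: (@le_trans _ _ (\int[leb]_(y in circle `&` ball t0 h) `|((F \_ circle) y - F t0)%:E|)%E).
  by apply: le_trans (le_refl _); rewrite le_eqVlt; apply/orP; left; apply/eqP; apply: eq_integral => s /set_mem[cs _]; rewrite patchE mem_set.
rewrite /I Ft0.
have mball : measurable (ball t0 h : set mR) by exact: (@measurable_ball R).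
have mFc : measurable_fun setT (F \_ circle) by exact: ((measurable_restrictT F (@measurable_circle R)).1 (rint_meas hF)).
apply: ge0_subset_integral => //; first exact: measurableI.
apply/measurable_EFinP; apply: (@measurable_funTS _ _ mR).
exact: (measurableT_comp (@normr_measurable R setT) (measurable_funB mFc (measurable_cst _))).
Qed.

Lemma ae_lebesgue_pt F : rint leb F ->
  {ae leb, forall t, lebesgue_pt (F \_ circle : R -> R) t}.
Proof.
move=> hF; apply: lebesgue_differentiation.
apply: open_integrable_locally; first exact: openT.
have := hF; rewrite /rint (integrable_mkcond _ (@measurable_circle R)).
by rewrite restrict_EFin.
Qed.

Lemma poisson_sub f t0 z : L2 f -> cabs z < 1 ->
  poisson f z - f t0 = inner (fun s => f s - f t0) (fun s => (pk z s)%:C).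
Proof.
move=> hf z1.
have hp := pkL2 z1.
have e : (fun s => f s - f t0) = (- f t0 *: (fun=> 1 : R[i]^o) + f : V).
  by apply/funext => s /=; rewrite addrC; congr (_ + _); rewrite /= -[LHS]mulr1.
rewrite e (ipL hL (- f t0) (cst_L2 _) hf hp) -/(poisson _ z) -/(poisson _ z) poisson_cst //.
by rewrite mulr1 addrC.
Qed.

(** As the kernel has mean 1, the difference is the Poisson integral of [f - f t0], which is
    dominated by the oscillations of the real and imaginary parts at a common Lebesgue point. The
    angle 0, where the parametrization is cut, is discarded with the null set. *)
Lemma fatou_radial f : L2 f -> {ae leb, forall t, circle t ->
  (fun rho => cabs (poisson f (rho%:C * cis t) - f t)) @ (1 : R)^'- --> (0 : R)}.
Proof.
move=> hf.
have mf := L2_meas hf.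
have if_ : cint leb f.
  by have := L2_mul hf (cst_L2 1); under eq_fun do rewrite mulr1.
have iR := cint_Re if_; have iI := cint_Im if_.
have ae0 : {ae leb, forall t : R, t <> 0}.
  exists [set 0]; split; [exact: measurable_set1|exact: lebesgue_measure_set1|].
  by move=> t /= /contrapT.
apply: ae_leb2 (ae_leb2 _ (ae_lebesgue_pt iR) (ae_lebesgue_pt iI)) ae0; last first.
  by move=> t h1 h2; exact: (conj h1 h2).
move=> t0 [l1 l2] t00 ct0.
have [t0ge t0lt] : 0 < t0 /\ t0 < 2 * pi.
  have /andP[a b] := (circleP t0).1 ct0; split => //.
  by rewrite lt_neqAle a andbT; apply/eqP => /esym.
pose w (s : mR) := `|complex.Re (f s) - complex.Re (f t0)| + `|complex.Im (f s) - complex.Im (f t0)|.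
have iw : rint leb w.
  by apply: rintD; exact: rint_dist_cst.
have w0 s : 0 <= w s by rewrite addr_ge0.
have cw : (fun rho => Rintegral leb circle (fun s => w s * pk (rho%:C * cis t0) s)) @ (1 : R)^'- --> (0 : R).
  apply: poisson_concentration => //; first by rewrite t0ge.
  move=> eta eta0; have e2 : 0 < eta / 2 by rewrite divr_gt0.
  have [d1 d10 h1] := lebesgue_pt_cut iR ct0 l1 e2.
  have [d2 d20 h2] := lebesgue_pt_cut iI ct0 l2 e2.
  exists (Num.min d1 d2); first by rewrite lt_min d10.
  move=> h /andP[h0]; rewrite le_min => /andP[hd1 hd2].
  have := h1 h; have := h2 h; rewrite h0 hd1 hd2 => /(_ isT) a2 /(_ isT) a1.
  have i1 : rint leb (cut (fun s => `|complex.Re (f s) - complex.Re (f t0)|) t0 h).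
    by apply: rint_cut => //; exact: rint_dist_cst.
  have i2 : rint leb (cut (fun s => `|complex.Im (f s) - complex.Im (f t0)|) t0 h).
    by apply: rint_cut => //; exact: rint_dist_cst.
  have -> : cut w t0 h = (fun s => cut (fun s => `|complex.Re (f s) - complex.Re (f t0)|) t0 h s +
       cut (fun s => `|complex.Im (f s) - complex.Im (f t0)|) t0 h s).
    by apply/funext => s; rewrite /cut; case: ifP => //; rewrite addr0.
  by rewrite RintegralD //; lra.
have cw2 : (fun rho => ((2 * pi)^-1 * 2) * Rintegral leb circle (fun s => w s * pk (rho%:C * cis t0) s))
    @ (1 : R)^'- --> ((2 * pi)^-1 * 2 * 0 : R) by exact: (cvgM (cvg_cst _) cw).
rewrite mulr0 in cw2.
apply: (squeeze_cvgr _ (cvg_cst 0) cw2).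
near=> rho.
have r0 : 0 < rho by near: rho; exact: nbhs_left_gt.
have r1 : rho < 1 by near: rho; exact: nbhs_left_lt.
rewrite cabs_ge0 /=.
have z1 : cabs (rho%:C * cis t0) < 1 by rewrite cabsM cabs_real cabs_cis mulr1 ger0_norm // ltW.
set z := rho%:C * cis t0 in z1 *.
have pk0 s : 0 <= pk z s by exact: pk_ge0.
rewrite poisson_sub //.
have hd : L2 (fun s : mR => f s - f t0).
  by apply: (phB hL hf (cst_L2 (f t0))).
have hi := L2_inner hd (pkL2 z1).
rewrite /inner cabsM cabs_real ger0_norm ?invr_ge0 ?(ltW (pi2_gt0 R)) // -mulrA.
rewrite ler_pM2l ?invr_gt0 ?pi2_gt0 //.
apply: (le_trans (cabs_cintegral hi)); rewrite ler_pM2l //.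
apply: le_Rintegral => //; first by case: hi.
  apply: (@rint_le _ _ _ (fun s => (2 / (1 - cabs z)) * w s)).
  - by apply: measurable_funM; [exact: rint_meas iw|exact: pk_measurable].
  - exact: rintZ.
  - move=> s _; rewrite ger0_norm; last exact: (mulr_ge0 (w0 s) (pk0 s)).
    by rewrite mulrC; apply: (ler_wpM2r (w0 s)); exact: pk_bound.
move=> s _; rewrite conjc_real cabsM cabs_real [X in _ * X]ger0_norm //.
apply: (ler_wpM2r (pk0 s)); apply: (le_trans (cabs_le_ReIm _)).
by rewrite ReD ReN ImD ImN.
Unshelve. all: by end_near. Qed.

End fatou_L2.
(** * The Hardy space *)

Section ip_limits.
Variables (R : realType) (V : lmodType R[i]) (ip : V -> V -> R[i]) (H : set V).
Hypothesis hH : pre_hilbert ip H.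

Lemma cvg_to_ip_const (x : nat -> V) (y z : V) (c : R[i]) (N0 : nat) : (forall n, H (x n)) -> H y -> H z ->
  cvg_to ip x y -> (forall n, (N0 <= n)%N -> ip (x n) z = c) -> ip y z = c.
Proof.
move=> hx hy hz xy h; apply/eqP; rewrite -subr_eq0; apply/eqP/cabs_eq0/eqP.
rewrite eq_le cabs_ge0 andbT.
apply/ler_addgt0Pr => e e0; rewrite add0r.
have n0 : 0 < nrm ip z + 1 by rewrite ltr_wpDl ?nrm_ge0.
have [|N hN] := xy (e / (nrm ip z + 1)); first exact: divr_gt0.
have le := hN _ (leq_maxl N N0).
rewrite -(h _ (leq_maxr N N0)) cabs_distC -(ipBl hH) //.
apply: (le_trans (cauchy_schwarz hH _ hz)); first exact: (phB hH).
apply: (@le_trans _ _ (e / (nrm ip z + 1) * (nrm ip z + 1))).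
  by apply: ler_pM; rewrite ?nrm_ge0 // lerDl.
by rewrite divfK // lt0r_neq0.
Qed.

Lemma orthosys_sum_cvg (cH : ip_complete ip H) (e : nat -> V) (a : nat -> R[i]) (C : R) :
  orthosys ip H e -> (forall i, nrm ip (e i) = 1) ->
  (forall N, \sum_(0 <= n < N) cabs (a n) ^+ 2 <= C) ->
  exists2 y, H y & cvg_to ip (fun N => \sum_(0 <= n < N) a n *: e n) y /\
    forall n, ip y (e n) = a n.
Proof.
move=> he e1 aC; have [h1 h2 h3] := he.
pose s N := \sum_(0 <= n < N) a n *: e n.
have hs N : H (s N) by apply: (ph_sum hH) => i _; exact: (phZ hH).
have cs : cauchy_in ip s.
  move=> eps e0.
  have [N hN] := @bounded_tail _ (fun n => cabs (a n) ^+ 2) C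
     (fun n => sqr_ge0 _) aC (eps ^+ 2) (exprn_gt0 2 e0).
  have key m n : (N <= n)%N -> (n <= m)%N -> nrm ip (s m - s n) <= eps.
    move=> Nn nm; rewrite -(ler_pXn2r (n:=2)) ?nnegrE ?nrm_ge0 ?(ltW e0) //.
    rewrite /s (big_cat_nat (n := n)) //= addrAC subrr add0r.
    apply: (le_trans (orthosys_nrm hH _ _ _ he)); apply: le_trans (hN m (leq_trans Nn nm)).
    rewrite [leRHS](big_cat_nat (n := n)) //= lerDr.
    by apply: sumr_ge0 => i _; exact: sqr_ge0.
  exists N => m n Nm Nn; have [nm|/ltnW mn] := leqP n m; first exact: key.
  by rewrite (nrmBC hH) //; exact: key.
have [y hy sy] := cH s hs cs.
exists y => //; split=> // k.
apply: (@cvg_to_ip_const s y (e k) _ k.+1) => // n kn.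
rewrite /s (ip_suml hH) //; last by move=> i _; exact: (phZ hH).
rewrite (bigD1_seq k) /= ?mem_index_iota ?iota_uniq //.
rewrite (ipZl hH) // (ip_nrm hH) // e1 expr1n mulr1 big1 ?addr0 // => i ik.
by rewrite (ipZl hH) // h2 ?mulr0 //; exact/eqP.
Qed.

End ip_limits.

Section hardy_space.
Variable R : realType.
Local Notation mR := (measurableTypeR R).
Local Notation circle := (@circle R : set mR).
Local Notation leb := (@lebesgue_measure R).
Local Notation V := (R -> R[i]^o).
Local Notation ip2 := (@inner R : V -> V -> R[i]).
Implicit Types (f g : V) (t s rho : R) (F : R[i] -> R[i]) (z : R[i]).

Let hL := L2_pre_hilbert R.

Lemma nrm_char_pos n : nrm ip2 (@char_pos R n) = 1.
Proof. by rewrite /nrm inner_char_pos eqxx /= sqrtr1. Qed.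

Lemma boundary_valueP F f : boundary_value F f <-> {ae leb, forall t, circle t ->
  (fun rho => cabs (F (rho%:C * cis t) - f t)) @ (1 : R)^'- --> (0 : R)}.
Proof.
by split; apply: ae_leb1 => t h ct; apply/cvg_complexP; exact: h.
Qed.

Lemma boundary_value_circle_eq F f g : boundary_value F f -> circle_eq f g -> boundary_value F g.
Proof. by move=> h1 h2; apply: ae_leb2 h1 h2 => t h e ct; rewrite -e //; exact: h. Qed.

Lemma boundary_value_uniq F f g : boundary_value F f -> boundary_value F g -> circle_eq f g.
Proof.
move=> /boundary_valueP h1 /boundary_valueP h2; apply: ae_leb2 h1 h2 => t h1 h2 ct.
have {}h1 := h1 ct; have {}h2 := h2 ct.
have h3 : (fun rho => cabs (F (rho%:C * cis t) - f t) + cabs (F (rho%:C * cis t) - g t)) @ (1 : R)^'- --> (0 + 0 : R).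
  exact: cvgD.
rewrite addr0 in h3.
have h4 : (fun _ : R => cabs (f t - g t)) @ (1 : R)^'- --> (0 : R).
  apply: (squeeze_cvgr _ (cvg_cst 0) h3); apply: nearW => rho; rewrite cabs_ge0 /=.
  by rewrite (cabs_distC _ (f t)) -{1}(subrK (F (rho%:C * cis t)) (f t)) -addrA cabsD.
have e : 0 = cabs (f t - g t) := cvg_unique (@Rhausdorff R) h4 (cvg_cst _).
by apply/eqP; rewrite -subr_eq0; apply/eqP/cabs_eq0; rewrite -e.
Qed.

Lemma eq_boundary_value F G f : (forall z, cabs z < 1 -> F z = G z) ->
  boundary_value F f -> boundary_value G f.
Proof.
move=> FG; apply: ae_leb1 => t h ct; apply: cvg_trans (h ct); apply: near_eq_cvg.
near=> rho; rewrite FG // cabsM cabs_real cabs_cis mulr1 ger0_norm; last first.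
  by near: rho; apply: nbhs_left_ge; exact: ltr01.
by near: rho; exact: nbhs_left_lt.
Unshelve. all: by end_near. Qed.

Lemma eq_hardy2 F G : (forall z, cabs z < 1 -> F z = G z) -> hardy2 F -> hardy2 G.
Proof.
move=> FG [a [ca h]]; exists a; split; first exact: ca.
by move=> z z1; rewrite -(FG z z1); exact: h.
Qed.

Lemma bessel_char f N : L2 f -> \sum_(0 <= n < N) cabs (inner f (char_pos n)) ^+ 2 <= norm2 f ^+ 2.
Proof. by move=> hf; exact: (bessel hL N (orthosys_char R) hf). Qed.

Lemma poisson_hardy2 f : L2 f -> (forall n, (0 < n)%N -> inner f (char_neg n) = 0) ->
  hardy2 (poisson f) /\ boundary_value (poisson f) f.
Proof.
move=> hf f0; split; last by apply/boundary_valueP; exact: fatou_radial.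
exists (fun n => inner f (char_pos n)); split.
  apply: nondecreasing_is_cvgn.
    by apply/nondecreasing_seqP => n; rewrite seriesSr /= lerDl sqr_ge0.
  by exists (norm2 f ^+ 2) => _ [n _ <-]; exact: bessel_char.
by move=> z z1; apply/cvg_complexP; exact: poisson_analytic.
Qed.

(** The square-summable Taylor coefficients are the Fourier coefficients of some [f] in L^2. Then
    [F] is the Poisson integral of [f], and Fatou's theorem makes [f] its radial boundary
    function. *)
Lemma hardy2_boundary F : hardy2 F -> exists2 f, L2 f & [/\ boundary_value F f,
  forall n, (0 < n)%N -> inner f (char_neg n) = 0 & (forall z, cabs z < 1 -> F z = poisson f z) /\
  cvg_to ip2 (fun N => \sum_(0 <= n < N) inner f (char_pos n) *: (char_pos n : V)) f].
Proof.
move=> [a [ca hF]].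
have aC N : \sum_(0 <= n < N) cabs (a n) ^+ 2 <= limn (series (fun n => cabs (a n) ^+ 2)).
  apply: (nondecreasing_cvgn_le _ ca) => //.
  by apply/nondecreasing_seqP => n; rewrite seriesSr /= lerDl sqr_ge0.
have [f hf [sf fa]] := orthosys_sum_cvg hL (@L2_complete R) (orthosys_char R) nrm_char_pos aC.
have fn n : (0 < n)%N -> inner f (char_neg n) = 0.
  move=> n0; apply: (cvg_to_ip hL _ hf (char_negL2 R n) sf).
    by move=> N; apply: (ph_sum hL) => i _; apply: (phZ hL); exact: char_posL2.
  move=> N; rewrite (ip_suml hL) //; last exact: char_negL2.
    by rewrite big1 // => i _; rewrite (ipZl hL (a i) (char_posL2 R i) (char_negL2 R n)) inner_char_pos_neg ?mulr0.
  by move=> i _; apply: (phZ hL); exact: char_posL2.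
have Ff z : cabs z < 1 -> F z = poisson f z.
  move=> z1; have /cvg_complexP h1 := hF z z1.
  have h2 := poisson_analytic hf fn z1.
  have e : (fun n => \sum_(k < n) inner f (char_pos k) * z ^+ k) = (fun n => \sum_(k < n) a k * z ^+ k).
    by apply/funext => n; apply: eq_bigr => k _; rewrite fa.
  have h2' : (fun n => cabs (\sum_(k < n) a k * z ^+ k - poisson f z)) @ \oo --> (0 : R).
    have e' : (fun n => cabs (\sum_(k < n) inner f (char_pos k) * z ^+ k - poisson f z)) =
       (fun n => cabs (\sum_(k < n) a k * z ^+ k - poisson f z)).
      by apply/funext => n; have := congr1 (fun u => cabs (u n - poisson f z)) e.
    by rewrite -e'.
  have h3 : (fun n => cabs (\sum_(k < n) a k * z ^+ k - F z) +
     cabs (\sum_(k < n) a k * z ^+ k - poisson f z)) @ \oo --> (0 + 0 : R) by exact: cvgD.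
  rewrite addr0 in h3.
  have h4 : (fun _ : nat => cabs (F z - poisson f z)) @ \oo --> (0 : R).
    apply: (squeeze_cvgr _ (cvg_cst 0) h3); apply: nearW => n; rewrite cabs_ge0 /=.
    set S := \sum_(k < n) _.
    by rewrite (cabs_distC _ (F z)) -{1}(subrK S (F z)) -addrA cabsD.
  have e2 : 0 = cabs (F z - poisson f z) := cvg_unique (@Rhausdorff R) h4 (cvg_cst _).
  by apply/eqP; rewrite -subr_eq0; apply/eqP/cabs_eq0; rewrite -e2.
exists f; first exact: hf.
have bf : boundary_value F f.
  have [_ h] := poisson_hardy2 hf fn.
  by apply: (eq_boundary_value _ h) => z z1; rewrite Ff.
split; [exact: bf|exact: fn|split; first exact: Ff].
move=> eps e0; have [N hN] := sf _ e0; exists N => n Nn.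
have -> : \sum_(0 <= k < n) inner f (char_pos k) *: (char_pos k : V) = \sum_(0 <= k < n) a k *: (char_pos k : V).
  by apply: eq_bigr => k _; rewrite fa.
exact: hN.
Qed.

Lemma H2_facts F f : L2 f -> hardy2 F -> boundary_value F f ->
  [/\ forall n, (0 < n)%N -> inner f (char_neg n) = 0,
    forall z, cabs z < 1 -> F z = poisson f z &
    cvg_to ip2 (fun N => \sum_(0 <= n < N) inner f (char_pos n) *: (char_pos n : V)) f].
Proof.
move=> hf hF bF; have [g hg [bg gn [Fg cg]]] := hardy2_boundary hF.
have fg : circle_eq f g by exact: boundary_value_uniq bF bg.
have ifg h : L2 h -> inner f h = inner g h by move=> hh; exact: inner_circle_eql.
split.
- by move=> n n0; rewrite (ifg _ (char_negL2 R n)) gn.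
- by move=> z z1; rewrite Fg // /poisson (ifg _ (pkL2 z1)).
- move=> eps e0; have [N hN] := cg _ e0; exists N => n Nn.
  have hs : L2 (\sum_(0 <= k < n) inner g (char_pos k) *: (char_pos k : V)).
    by apply: (ph_sum hL) => i _; apply: (phZ hL); exact: char_posL2.
  have -> : \sum_(0 <= k < n) inner f (char_pos k) *: (char_pos k : V) =
     \sum_(0 <= k < n) inner g (char_pos k) *: (char_pos k : V).
    by apply: eq_bigr => k _; rewrite (ifg _ (char_posL2 R k)).
  apply: (le_trans (nrm_triB hL hs hg hf)).
  rewrite (circle_eq_norm2B hg hf (circle_eq_sym fg)) addr0; exact: hN.
Qed.

(** Radial limits are replaced by the vanishing of continuous functionals on L^2, from which
    linearity and closedness of H^2 are immediate. *)
Lemma H2P f : H2 f <-> L2 f /\ forall n, (0 < n)%N -> inner f (char_neg n) = 0.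
Proof.
split=> [[hf [F [hF bF]]]|[hf f0]].
  by split; [exact: hf|case: (H2_facts hf hF bF)].
by split; [exact: hf|exists (poisson f); exact: poisson_hardy2].
Qed.

Lemma H2_L2 f : H2 f -> L2 f. Proof. by case. Qed.

Lemma H2_poisson f : H2 f -> hardy2 (poisson f) /\ boundary_value (poisson f) f.
Proof. by move=> /H2P[hf f0]; exact: poisson_hardy2. Qed.

Lemma H2_span f : H2 f ->
  cvg_to ip2 (fun N => \sum_(0 <= n < N) inner f (char_pos n) *: (char_pos n : V)) f.
Proof. by move=> [hf [F [hF bF]]]; case: (H2_facts hf hF bF). Qed.

Lemma H2_circle_eq f g : cmeas g -> H2 f -> circle_eq f g -> H2 g.
Proof.
move=> mg [hf [F [hF bF]]] fg; split; first exact: L2_circle_eq fg.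
by exists F; split; [exact: hF|exact: boundary_value_circle_eq bF fg].
Qed.

Lemma H2_lin (a : R[i]) f g : H2 f -> H2 g -> H2 (a *: f + g).
Proof.
move=> /H2P[hf f0] /H2P[hg g0]; apply/H2P; split; first exact: (phL hL).
move=> n n0; rewrite (ipL hL a hf hg (char_negL2 R n)) f0 // g0 //.
by rewrite mulr0 addr0.
Qed.

Lemma H2_0 : H2 (0 : V).
Proof.
apply/H2P; split; first exact: (ph0 hL).
by move=> n _; rewrite (ip0l hL) //; exact: char_negL2.
Qed.

Lemma H2_pre_hilbert : pre_hilbert ip2 (@H2 R : set V).
Proof.
exact: (pre_hilbert_sub hL H2_L2 H2_0 H2_lin).
Qed.

Lemma L2_limit_sub (D : set V) : D `<=` (@L2 R : set V) ->
  (forall x y, (forall n, D (x n)) -> L2 y -> cvg_to ip2 x y -> D y) -> ip_complete ip2 D.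
Proof.
move=> DL h x hx cx; have [y hy xy] := L2_complete (fun n => DL _ (hx n)) cx.
by exists y; [exact: (h x y hx hy xy)|exact: xy].
Qed.

Lemma H2_closed (x : nat -> V) y : (forall n, H2 (x n)) -> L2 y -> cvg_to ip2 x y -> H2 y.
Proof.
move=> hx hy xy; apply/H2P; split; first exact: hy.
move=> n n0.
apply: (cvg_to_ip hL _ hy (char_negL2 R n) xy); first by move=> k; exact: H2_L2.
by move=> k; have /H2P[_ ->] := hx k.
Qed.

Lemma H2_complete : ip_complete ip2 (@H2 R : set V).
Proof. by apply: L2_limit_sub; [exact: H2_L2|exact: H2_closed]. Qed.

Lemma orth_char_pos_H2 f g : L2 f -> (forall n, inner f (char_pos n) = 0) -> H2 g -> inner f g = 0.
Proof.
move=> hf f0 hg; have hg' := H2_L2 hg.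
rewrite (ipC hL hg' hf) (cvg_to_ip hL _ hg' hf (H2_span hg)) ?conjc0 //.
  by move=> N; apply: (ph_sum hL) => i _; apply: (phZ hL); exact: char_posL2.
move=> N; rewrite (ip_suml hL) //; last by move=> i _; apply: (phZ hL); exact: char_posL2.
rewrite big1 // => i _; rewrite (ipZl hL (inner g (char_pos i)) (char_posL2 R i) hf).
by rewrite (ipC hL hf (char_posL2 R i)) f0 conjc0 mulr0.
Qed.

Lemma char_posH2 n : H2 (@char_pos R n : V).
Proof. by apply/H2P; split; [exact: char_posL2|exact: inner_char_pos_neg]. Qed.

End hardy_space.

(** * Locally bounded limits of polynomials on the disk *)

Section poly_limits.
Variable R : realType.
Local Notation mR := (measurableTypeR R).
Local Notation circle := (@circle R : set mR).
Local Notation leb := (@lebesgue_measure R).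
Local Notation V := (R -> R[i]^o).
Local Notation ip2 := (@inner R : V -> V -> R[i]).
Implicit Types (f g : V) (t s rho : R) (F G : R[i] -> R[i]) (z : R[i]) (P : nat -> {poly R[i]}).

Let hL := L2_pre_hilbert R.

Definition ccvg (u : nat -> R[i]) (l : R[i]) := (fun n => cabs (u n - l)) @ \oo --> (0 : R).

Lemma ccvg_uniq u l l' : ccvg u l -> ccvg u l' -> l = l'.
Proof.
move=> h1 h2.
have h3 : (fun n => cabs (u n - l) + cabs (u n - l')) @ \oo --> (0 + 0 : R) by exact: cvgD.
rewrite addr0 in h3.
have h4 : (fun _ : nat => cabs (l - l')) @ \oo --> (0 : R).
  apply: (squeeze_cvgr _ (cvg_cst 0) h3); apply: nearW => n; rewrite cabs_ge0 /=.
  by rewrite (cabs_distC _ l) -{1}(subrK (u n) l) -addrA cabsD.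
have e : 0 = cabs (l - l') := cvg_unique (@Rhausdorff R) h4 (cvg_cst _).
by apply/eqP; rewrite -subr_eq0; apply/eqP/cabs_eq0; rewrite -e.
Qed.

Lemma ccvg_cst l : ccvg (fun=> l) l.
Proof. by rewrite /ccvg; under eq_fun do rewrite subrr cabs0; exact: cvg_cst. Qed.

Lemma ccvgD u v l m : ccvg u l -> ccvg v m -> ccvg (fun n => u n + v n) (l + m).
Proof.
move=> h1 h2.
have h3 : (fun n => cabs (u n - l) + cabs (v n - m)) @ \oo --> (0 + 0 : R) by exact: cvgD.
rewrite addr0 in h3; apply: (squeeze_cvgr _ (cvg_cst 0) h3); apply: nearW => n; rewrite cabs_ge0 /=.
by rewrite (_ : _ - _ = (u n - l) + (v n - m)) ?cabsD //; ring.
Qed.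

Lemma ccvgM u v l m : ccvg u l -> ccvg v m -> ccvg (fun n => u n * v n) (l * m).
Proof.
move=> h1 h2.
have h3 : (fun n => cabs (u n - l) * cabs (v n - m) + (cabs l * cabs (v n - m) + cabs m * cabs (u n - l))) @ \oo
   --> (0 * 0 + (cabs l * 0 + cabs m * 0) : R).
  by apply: cvgD; [exact: cvgM|apply: cvgD; apply: cvgM => //; exact: cvg_cst].
rewrite !mulr0 !addr0 in h3; apply: (squeeze_cvgr _ (cvg_cst 0) h3); apply: nearW => n; rewrite cabs_ge0 /=.
rewrite (_ : _ - _ = (u n - l) * (v n - m) + (l * (v n - m) + m * (u n - l))); last by ring.
by apply: (le_trans (cabsD _ _)); rewrite cabsM lerD2l; apply: (le_trans (cabsD _ _)); rewrite !cabsM.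
Qed.

Lemma ccvg_le u l (M : R) : ccvg u l -> (forall n, cabs (u n) <= M) -> cabs l <= M.
Proof.
move=> h le; apply: (cvgr_to_le (cvg_cabs h)); exact: nearW.
Qed.

Lemma eq_ccvg u v l : u =1 v -> ccvg u l -> ccvg v l.
Proof. by move=> /funext ->. Qed.

(* A form of analyticity stable under products and exponentials. *)
Definition poly_lim F := exists P, (forall rho, 0 < rho < 1 -> exists M, forall n z, cabs z <= rho ->
   cabs (P n).[z] <= M) /\ forall z, cabs z < 1 -> ccvg (fun n => (P n).[z]) (F z).

Lemma poly_lim_cst (a : R[i]) : poly_lim (fun=> a).
Proof.
exists (fun=> a%:P); split=> [rho _|z _].
  by exists (cabs a) => n z _; rewrite hornerC.
by apply: eq_ccvg (ccvg_cst a) => n; rewrite hornerC.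
Qed.

Lemma poly_limD F G : poly_lim F -> poly_lim G -> poly_lim (fun z => F z + G z).
Proof.
move=> [P [bP cP]] [Q [bQ cQ]]; exists (fun n => P n + Q n); split=> [rho r01|z z1].
  have [M hM] := bP _ r01; have [N hN] := bQ _ r01; exists (M + N) => n z zr.
  by rewrite hornerD; apply: (le_trans (cabsD _ _)); rewrite lerD ?hM ?hN.
by apply: eq_ccvg (ccvgD (cP z z1) (cQ z z1)) => n; rewrite hornerD.
Qed.

Lemma poly_limM F G : poly_lim F -> poly_lim G -> poly_lim (fun z => F z * G z).
Proof.
move=> [P [bP cP]] [Q [bQ cQ]]; exists (fun n => P n * Q n); split=> [rho r01|z z1].
  have [M hM] := bP _ r01; have [N hN] := bQ _ r01; exists (M * N) => n z zr.
  by rewrite hornerM cabsM ler_pM ?cabs_ge0 ?hM ?hN.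
by apply: eq_ccvg (ccvgM (cP z z1) (cQ z z1)) => n; rewrite hornerM.
Qed.

Lemma geom_le (a : R) n : 0 <= a < 1 -> \sum_(k < n) a ^+ k <= (1 - a)^-1.
Proof.
move=> /andP[a0 a1]; have h : 0 < 1 - a by rewrite subr_gt0.
rewrite -(ler_pM2l h) mulfV ?lt0r_neq0 // -opprB mulNr -subrX1 opprB.
by rewrite gerBl exprn_ge0.
Qed.

Lemma series_poly_lim (a : nat -> R[i]) (C : R) F : (forall n, cabs (a n) <= C) ->
  (forall z, cabs z < 1 -> ccvg (fun n => \sum_(k < n) a k * z ^+ k) (F z)) -> poly_lim F.
Proof.
move=> aC h; exists (fun n => \poly_(k < n) a k); split=> [rho /andP[r0 r1]|z z1]; last first.
  by apply: eq_ccvg (h z z1) => n; rewrite horner_poly.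
exists (C * (1 - rho)^-1) => n z zr; rewrite horner_poly.
apply: (le_trans (cabs_sum _ _ _)).
have C0 : 0 <= C := le_trans (cabs_ge0 _) (aC 0%N).
apply: (@le_trans _ _ (C * \sum_(k < n) rho ^+ k)); last first.
  by rewrite ler_wpM2l // geom_le // (ltW r0).
rewrite mulr_sumr; apply: ler_sum => k _; rewrite cabsM cabsX ler_pM ?exprn_ge0 ?cabs_ge0 //.
by apply: lerXn2r => //; rewrite nnegrE ?cabs_ge0 // ltW.
Qed.

Lemma hardy2_poly_lim F : hardy2 F -> poly_lim F.
Proof.
move=> [a [ca hF]].
have aC n : cabs (a n) ^+ 2 <= limn (series (fun n => cabs (a n) ^+ 2)).
  have nd : nondecreasing_seq (series (fun n => cabs (a n) ^+ 2)).
    by apply/nondecreasing_seqP => k; rewrite seriesSr /= lerDl sqr_ge0.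
  apply: le_trans (nondecreasing_cvgn_le nd ca n.+1).
  rewrite seriesSr /= lerDr /series /=; apply: sumr_ge0 => k _; exact: sqr_ge0.
set C := limn _ in aC.
have C0 : 0 <= C := le_trans (sqr_ge0 _) (aC 0%N).
apply: (@series_poly_lim a (Num.sqrt C)) => [n|z z1].
  by rewrite -(ler_pXn2r (n:=2)) ?nnegrE ?sqrtr_ge0 ?cabs_ge0 // sqr_sqrtr.
by apply/cvg_complexP; exact: hF.
Qed.

Lemma ccvg_geom_part (w : R[i]) : cabs w < 1 -> ccvg (fun n => \sum_(k < n) w ^+ k) (1 - w)^-1.
Proof.
move=> w1; have h := @cvg_geom_bound R (cabs w) 1 _.
have /h {}h : 0 <= cabs w < 1 by rewrite cabs_ge0.
rewrite /ccvg; apply: (squeeze_cvgr _ (cvg_cst 0) h); apply: nearW => n; rewrite cabs_ge0 /=.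
have [e le] := geom_rem n w1; rewrite e mul1r opprD addrA subrr sub0r cabsN; exact: le.
Qed.

Lemma poly_lim_geom (a : R[i]) : cabs a < 1 -> poly_lim (fun z => (1 - a * z)^-1).
Proof.
move=> a1; apply: (@series_poly_lim (fun n => a ^+ n) 1) => [n|z z1].
  by rewrite cabsX; apply: exprn_ile1; rewrite ?cabs_ge0 // ltW.
have w1 : cabs (a * z) < 1 by rewrite cabsM -[1]mulr1 ltr_pM ?cabs_ge0.
by apply: (eq_ccvg _ (ccvg_geom_part w1)) => n; apply: eq_bigr => k _; rewrite exprMn.
Qed.

Definition dil F rho : V := fun t => F (rho%:C * cis t).

Lemma cabs_dil rho t : 0 < rho -> cabs (rho%:C * cis t) = rho.
Proof. by move=> r0; rewrite cabsM cabs_real cabs_cis mulr1 ger0_norm // ltW. Qed.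

Lemma cmeas_lim (f_ : nat -> V) f : (forall n, cmeas (f_ n : mR -> R[i])) ->
  (forall t, circle t -> ccvg (fun n => f_ n t) (f t)) -> cmeas (f : mR -> R[i]).
Proof.
move=> mf h; split.
  apply: (@measurable_fun_cvg _ mR _ _ (fun n t => complex.Re (f_ n t))) => [n|t ct].
    by case: (mf n).
  apply/cvgrPdist_le => e e0; have /cvgrPdist_le /(_ e e0) := h t ct.
  apply: filterS => n; rewrite sub0r normrN ger0_norm ?cabs_ge0 //; apply: le_trans.
  by rewrite distrC -ReN -ReD; exact: Re_le_cabs.
apply: (@measurable_fun_cvg _ mR _ _ (fun n t => complex.Im (f_ n t))) => [n|t ct].
  by case: (mf n).
apply/cvgrPdist_le => e e0; have /cvgrPdist_le /(_ e e0) := h t ct.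
apply: filterS => n; rewrite sub0r normrN ger0_norm ?cabs_ge0 //; apply: le_trans.
by rewrite distrC -ImN -ImD; exact: Im_le_cabs.
Qed.

Lemma inner_bounded_lim (f_ : nat -> V) f g (M : R) : (forall n, cmeas (f_ n : mR -> R[i])) ->
  (forall t, circle t -> ccvg (fun n => f_ n t) (f t)) -> (forall n t, circle t -> cabs (f_ n t) <= M) ->
  L2 g -> L2 f /\ ccvg (fun n => inner (f_ n) g) (inner f g).
Proof.
move=> mf h le hg; have m := cmeas_lim mf h.
have lef t : circle t -> cabs (f t) <= M by move=> ct; apply: (ccvg_le (h t ct)) => n; exact: le.
have hf := L2_bounded m lef; split; first exact: hf.
have mg := cmeas_conj (L2_meas hg).
have [_ ig] : cint leb (fun t => 1 * conjc (g t)) := L2_inner (cst_L2 1) hg.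
have ig' : rint leb (fun t => cabs (conjc (g t))).
  by move: ig; under eq_fun do rewrite mul1r.
have [_ ifg] := L2_inner hf hg.
have dct := @cintegral_dct R leb (fun n t => f_ n t * conjc (g t)) (fun t => f t * conjc (g t))
  (fun t => M * cabs (conjc (g t))) (fun n => cmeasM (mf n) mg) (cmeasM m mg) (rintZ M ig').
have {}dct : (fun n => cabs (cintegral leb (fun t => f_ n t * conjc (g t)) - cintegral leb (fun t => f t * conjc (g t)))) @ \oo --> (0 : R).
  apply: dct.
  - apply: ae_lebW => t ct; have h' := ccvgM (h t ct) (ccvg_cst (conjc (g t))); exact: h'.
  - by move=> n t ct; rewrite cabsM ler_wpM2r ?cabs_ge0 ?le.
  - exact: L2_inner.
have h2 : (fun n => (2 * pi)^-1 * cabs (cintegral leb (fun t => f_ n t * conjc (g t)) -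
    cintegral leb (fun t => f t * conjc (g t)))) @ \oo --> ((2 * pi)^-1 * 0 : R).
  exact: (cvgM (cvg_cst _) dct).
rewrite mulr0 in h2; rewrite /ccvg.
rewrite (_ : (fun n => _) = (fun n => (2 * pi)^-1 * cabs (cintegral leb (fun t => f_ n t * conjc (g t)) -
    cintegral leb (fun t => f t * conjc (g t))))); first exact: h2.
apply/funext => n.
by rewrite /inner -mulrBr cabsM cabs_real ger0_norm // invr_ge0 ltW // pi2_gt0.
Qed.

Lemma dil_poly (p : {poly R[i]}) rho : dil (horner p) rho =
  \sum_(k < size p) (p`_k * rho%:C ^+ k) *: (char_pos k : V).
Proof.
apply/funext => t; rewrite /dil horner_coef fct_sumE; apply: eq_bigr => k _.
by rewrite exprMn mulrA.
Qed.

Lemma dil_polyL2 (p : {poly R[i]}) rho : L2 (dil (horner p) rho).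
Proof. by rewrite dil_poly; apply: (ph_lincomb hL) => k; exact: char_posL2. Qed.

Lemma inner_dil_poly (p : {poly R[i]}) rho g : L2 g -> inner (dil (horner p) rho) g =
  \sum_(k < size p) (p`_k * rho%:C ^+ k) * inner (char_pos k) g.
Proof.
move=> hg; rewrite dil_poly.
have h1 (k : 'I_(size p)) := char_posL2 R k.
rewrite (ipC hL hg (ph_lincomb hL (fun k : 'I_(size p) => p`_k * rho%:C ^+ k) h1)).
rewrite (ip_lincombr hL _ h1 hg) rmorph_sum; apply: eq_bigr => k _.
rewrite rmorphM /= conjcK; congr (_ * _); exact: (esym (ipC hL hg (h1 k))).
Qed.

Lemma inner_dil_poly_pos (p : {poly R[i]}) rho k : inner (dil (horner p) rho) (char_pos k) = p`_k * rho%:C ^+ k.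
Proof.
rewrite (inner_dil_poly p rho (char_posL2 R k)).
have [kp|pk_] := ltnP k (size p).
  rewrite (bigD1 (Ordinal kp)) //= inner_char_pos eqxx mulr1 big1 ?addr0 // => j jk.
  by rewrite inner_char_pos (_ : (j == k :> nat) = false) ?mulr0 //; apply/negbTE.
rewrite nth_default // mul0r big1 // => j _.
by rewrite inner_char_pos (_ : (j == k :> nat) = false) ?mulr0 // ltn_eqF // (leq_trans (ltn_ord j)).
Qed.

Lemma inner_dil_poly_neg (p : {poly R[i]}) rho k : (0 < k)%N -> inner (dil (horner p) rho) (char_neg k) = 0.
Proof.
move=> k0; rewrite (inner_dil_poly p rho (char_negL2 R k)) big1 // => j _.
by rewrite inner_char_pos_neg // mulr0.
Qed.

Lemma ccvg_evc (u : nat -> R[i]) l N : (forall n, (N <= n)%N -> u n = l) -> ccvg u l.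
Proof.
move=> h; apply: cvg_near_cst.
by exists N => // n /= Nn; rewrite h // subrr cabs0.
Qed.

Lemma poisson_dil_poly (p : {poly R[i]}) rho z : cabs z < 1 ->
  poisson (dil (horner p) rho) z = p.[rho%:C * z].
Proof.
move=> z1.
have h := poisson_analytic (dil_polyL2 p rho) (@inner_dil_poly_neg p rho) z1.
apply: (ccvg_uniq h); apply: (@ccvg_evc _ _ (size p)) => n pn.
rewrite (@horner_coef_wide _ n) //; apply: eq_bigr => k _.
by rewrite inner_dil_poly_pos exprMn mulrA.
Qed.

Lemma dil_lim (P : nat -> {poly R[i]}) F rho g :
  (forall rho, 0 < rho < 1 -> exists M, forall n z, cabs z <= rho -> cabs (P n).[z] <= M) ->
  (forall z, cabs z < 1 -> ccvg (fun n => (P n).[z]) (F z)) -> 0 < rho < 1 -> L2 g ->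
  L2 (dil F rho) /\ ccvg (fun n => inner (dil (horner (P n)) rho) g) (inner (dil F rho) g).
Proof.
move=> bP cP r01 hg; have [M hM] := bP _ r01; move/andP: r01 => [r0 r1].
apply: (@inner_bounded_lim _ _ _ M).
- by move=> n; exact: (L2_meas (dil_polyL2 (P n) rho)).
- by move=> t _; apply: cP; rewrite cabs_dil.
- by move=> n t _; apply: hM; rewrite cabs_dil.
- exact: hg.
Qed.

Lemma ccvg_cancel (u : nat -> R[i]) l c : c != 0 -> ccvg (fun n => u n * c) l -> ccvg u (l / c).
Proof.
move=> c0 h; apply: eq_ccvg (ccvgM h (ccvg_cst c^-1)) => n.
by rewrite mulfK.
Qed.

(* The coefficients of F are read off from F on circles of radius rho < 1, where the approximating
   polynomials converge boundedly. *)
Lemma hardy2_of_means F (M : R) : poly_lim F -> (forall rho, 0 < rho < 1 -> norm2 (dil F rho) ^+ 2 <= M) ->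
  hardy2 F.
Proof.
move=> [P [bP cP]] leM.
have cf rho k (r01 : 0 < rho < 1) := dil_lim bP cP r01 (char_posL2 R k).
have cn rho k (r01 : 0 < rho < 1) := dil_lim bP cP r01 (char_negL2 R k).
have rnz rho k : 0 < rho < 1 -> rho%:C ^+ k != 0 :> R[i].
  move=> /andP[r0 _]; rewrite expf_neq0 //; apply/eqP => /(congr1 (@complex.Re R)) /= e.
  by move: r0; rewrite e ltxx.
have cc rho k (r01 : 0 < rho < 1) : ccvg (fun n => (P n)`_k) (inner (dil F rho) (char_pos k) / rho%:C ^+ k).
  apply: ccvg_cancel; first exact: rnz.
  by apply: eq_ccvg (cf rho k r01).2 => n; exact: inner_dil_poly_pos.
have h01 : 0 < (2^-1 : R) < 1 by rewrite invr_gt0 ltr0n invf_lt1 ?ltr0n // ltr1n.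
(* Any radius would do: the quotient is the limit of the k-th coefficients of the polynomials,
   whatever the circle. *)
pose a k := inner (dil F 2^-1) (char_pos k) / (2^-1)%:C ^+ k.
have aE rho k : 0 < rho < 1 -> inner (dil F rho) (char_pos k) = a k * rho%:C ^+ k.
  move=> r01; rewrite /a (ccvg_uniq (cc _ k h01) (cc _ k r01)) divfK //; exact: rnz.
have neg rho k : 0 < rho < 1 -> (0 < k)%N -> inner (dil F rho) (char_neg k) = 0.
  move=> r01 k0; apply: (ccvg_uniq (cn rho k r01).2).
  by apply: eq_ccvg (ccvg_cst 0) => n; rewrite inner_dil_poly_neg.
have hb rho N : 0 < rho < 1 -> \sum_(0 <= k < N) cabs (a k) ^+ 2 * rho ^+ (2 * k) <= M.
  move=> r01; apply: le_trans (leM _ r01).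
  apply: le_trans (bessel_char N (cf rho 0%N r01).1).
  rewrite le_eqVlt; apply/orP; left; apply/eqP; apply: eq_bigr => k _.
  rewrite aE // cabsM exprMn cabsX cabs_real ger0_norm; last by case/andP: r01 => /ltW.
  by rewrite -exprM mulnC.
have ha N : \sum_(0 <= k < N) cabs (a k) ^+ 2 <= M.
  have c1 : (fun rho => \sum_(0 <= k < N) cabs (a k) ^+ 2 * rho ^+ (2 * k)) @ (1 : R)^'- -->
      (\sum_(0 <= k < N) cabs (a k) ^+ 2 * 1 ^+ (2 * k) : R).
    elim: N => [|N IH]; first by under eq_fun do rewrite big_nil; rewrite big_nil; exact: cvg_cst.
    under eq_fun do rewrite big_nat_recr //=; rewrite big_nat_recr //=.
    apply: cvgD; first exact: IH.
    apply: cvgM; first exact: cvg_cst.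
    by apply: cvg_at_left_filter; exact: exprn_continuous.
  rewrite (eq_bigr (fun k => cabs (a k) ^+ 2 * 1 ^+ (2 * k))) => [|k _]; last by rewrite expr1n mulr1.
  apply: (cvgr_to_le c1); near=> rho; apply: hb; apply/andP; split.
    by near: rho; apply: nbhs_left_gt; exact: ltr01.
  by near: rho; exact: nbhs_left_lt.
exists a; split.
  apply: nondecreasing_is_cvgn.
    by apply/nondecreasing_seqP => k; rewrite seriesSr /= lerDl sqr_ge0.
  by exists M => _ [n _ <-]; exact: ha.
move=> z z1; apply/cvg_complexP.
(* On a circle of radius strictly between |z| and 1 the approximation is bounded. There F z is the
   Poisson integral, at z / rho, of the restriction of [F]. *)
pose rho := (cabs z + 1) / 2.
have r01 : 0 < rho < 1 by rewrite /rho; have := cabs_ge0 z; lra.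
have zr : cabs z < rho by rewrite /rho; lra.
have r0 : 0 < rho by case/andP: r01.
have rC0 : rho%:C != 0 :> R[i] := rnz rho 1%N r01.
pose w := z / rho%:C.
have ew : rho%:C * w = z by rewrite /w mulrC divfK.
have w1 : cabs w < 1 by rewrite /w cabsM cabsV cabs_real ger0_norm ?(ltW r0) // ltr_pdivrMr // mul1r.
have Lf := (cf rho 0%N r01).1.
have h1 := poisson_analytic Lf (fun k => @neg rho k r01) w1.
have h2 : poisson (dil F rho) w = F z.
  have h := (dil_lim bP cP r01 (pkL2 w1)).2.
  apply: (ccvg_uniq h); apply: eq_ccvg (cP z z1) => n.
  by rewrite -[inner _ _]/(poisson _ w) poisson_dil_poly // ew.
rewrite h2 in h1; apply: eq_ccvg h1 => n; apply: eq_bigr => k _.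
by rewrite aE // -mulrA -exprMn ew.
Unshelve. all: by end_near. Qed.

End poly_limits.

(** * The complex exponential as a limit of powers *)

Section complex_exponential.
Variable R : realType.
Implicit Types (x y z a b : R[i]) (F G : R[i] -> R[i]).

Lemma cexp0 : cexp (0 : R[i]) = 1.
Proof. by rewrite /cexp /= expR0 cis0 mulr1. Qed.

Lemma cexpD x y : cexp (x + y) = cexp x * cexp y.
Proof. by rewrite /cexp ReD ImD expRD cisD rmorphM /=; ring. Qed.

Lemma cabs_cexp x : cabs (cexp x) = expR (complex.Re x).
Proof. by rewrite /cexp cabsM cabs_real cabs_cis mulr1 ger0_norm // expR_ge0. Qed.

Lemma cexpMn x n : cexp (n%:R * x) = cexp x ^+ n.
Proof.
elim: n => [|n IH]; first by rewrite mul0r cexp0 expr0.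
by rewrite -natr1 mulrDl mul1r cexpD IH exprSr.
Qed.

Lemma deriv_seq (f : R -> R) (a : R) : is_derive (0 : R) (1 : R) f a ->
  (fun n => n.+1%:R * (f n.+1%:R^-1 - f 0)) @ \oo --> a.
Proof.
move=> [df <-].
have h : (fun h : R => h^-1 *: (f (h *: (1 : R) + 0) - f 0)) @ (0 : R)^' --> 'D_1 f (0 : R) by exact: df.
have h1 := cvg_dnbhs_at_right h.
have /cvg_at_rightP h2 := h1.
rewrite (_ : (fun n => _) = (fun n => (n.+1%:R^-1)^-1 *: (f (n.+1%:R^-1 *: (1 : R) + 0) - f 0))).
  apply: (h2 (fun n => n.+1%:R^-1)); split; last exact: cvg_harmonic.
  by move=> n; rewrite invr_gt0 ltr0n.
by apply/funext => n; rewrite invrK addr0 [_ *: 1]mulr1.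
Qed.

Lemma cexp_deriv x : ccvg (fun n => n.+1%:R * (cexp (n.+1%:R^-1 * x) - 1)) x.
Proof.
set a := complex.Re x; set b := complex.Im x.
have h1 : is_derive (0 : R) (1 : R) (fun h : R => expR (h * a) * cos (h * b)) a.
  apply: is_derive_eq.
  by rewrite !mul0r expR0 cos0 sin0 /GRing.scale /=; ring.
have h2 : is_derive (0 : R) (1 : R) (fun h : R => expR (h * a) * sin (h * b)) b.
  apply: is_derive_eq.
  by rewrite !mul0r expR0 cos0 sin0 /GRing.scale /=; ring.
have {}h1 := deriv_seq h1; have {}h2 := deriv_seq h2.
have d (u : nat -> R) (l : R) : u @ \oo --> l -> (fun n => `|u n - l|) @ \oo --> (0 : R).
  move=> h; have : (fun n => u n - l) @ \oo --> (l - l : R) by apply: cvgB => //; exact: cvg_cst.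
  by rewrite subrr => /cvg_norm; rewrite normr0.
set fa := fun n : nat => _ in h1; set fb := fun n : nat => _ in h2.
have h3 : (fun n => `|fa n - a| + `|fb n - b|) @ \oo --> (0 + 0 : R).
  by apply: cvgD; exact: d.
rewrite addr0 in h3; rewrite /ccvg.
apply: (squeeze_cvgr _ (cvg_cst 0) h3); apply: nearW => n; rewrite cabs_ge0 /=.
apply: (le_trans (cabs_le_ReIm _)).
have en : (n.+1%:R : R[i]) = (n.+1%:R)%:C by rewrite rmorph_nat.
have ei : (n.+1%:R^-1 : R[i]) = (n.+1%:R^-1)%:C by rewrite fmorphV rmorph_nat.
rewrite ei en /fa /fb !mul0r expR0 cos0 sin0.
rewrite !(ReD, ImD, ReN, ImN, ReM, ImM) /= !(mul0r, subr0, addr0, add0r, mulr0, mulr1, oppr0, ReM, ImM, mul1r) /=.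
by [].
Qed.

Lemma cabs_subX a b n (m : R) : 1 <= m -> cabs a <= m -> cabs b <= m ->
  cabs (a ^+ n - b ^+ n) <= n%:R * m ^+ n * cabs (a - b).
Proof.
move=> m1 am bm; have m0 : 0 <= m := le_trans ler01 m1.
elim: n => [|n IH]; first by rewrite !expr0 subrr cabs0 mul0r mul0r.
rewrite !exprS (_ : _ - _ = a * (a ^+ n - b ^+ n) + (a - b) * b ^+ n); last by ring.
apply: (le_trans (cabsD _ _)); rewrite !cabsM.
have h1 : cabs a * cabs (a ^+ n - b ^+ n) <= m * (n%:R * m ^+ n * cabs (a - b)).
  by rewrite ler_pM ?cabs_ge0.
have h2 : cabs (a - b) * cabs (b ^+ n) <= cabs (a - b) * (m * m ^+ n).
  rewrite ler_wpM2l ?cabs_ge0 // cabsX -exprS.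
  apply: (@le_trans _ _ (m ^+ n)); last by rewrite exprS ler_peMl ?exprn_ge0.
  by apply: lerXn2r => //; rewrite nnegrE ?cabs_ge0.
apply: (le_trans (lerD h1 h2)); rewrite -natr1 le_eqVlt; apply/orP; left; apply/eqP; ring.
Qed.

Lemma expR_natV (C : R) n : expR (n.+1%:R^-1 * C) ^+ n.+1 = expR C.
Proof. by rewrite -expRM_natl mulrA mulfV ?mul1r // pnatr_eq0. Qed.

Lemma cabs_step (x : R[i]) (C : R) n : cabs x <= C -> cabs (1 + n.+1%:R^-1 * x) <= expR (n.+1%:R^-1 * C).
Proof.
move=> xC; apply: le_trans (expR_ge1Dx _); apply: (le_trans (cabsD _ _)).
rewrite cabs1 lerD2l cabsM (_ : n.+1%:R^-1 = (n.+1%:R^-1)%:C :> R[i]); last by rewrite fmorphV rmorph_nat.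
by rewrite cabs_real ger0_norm ?invr_ge0 ?ler0n // ler_wpM2l ?invr_ge0 ?ler0n.
Qed.

(** With n for n + 1: the powers of 1 + u/n and of exp (x/n) are compared by factoring a^n - b^n,
    both bases being bounded by exp (C/n). There remains a constant times |u - n (exp (x/n) - 1)|,
    which tends to 0 by the derivative at 0. *)
Lemma cexp_lim (u : nat -> R[i]) x (C : R) : ccvg u x -> (forall n, cabs (u n) <= C) ->
  ccvg (fun n => (1 + n.+1%:R^-1 * u n) ^+ n.+1) (cexp x).
Proof.
move=> ux uC; have xC := ccvg_le ux uC; have C0 : 0 <= C := le_trans (cabs_ge0 _) xC.
have h1 := ccvgD ux (ccvgM (ccvg_cst (-1)) (cexp_deriv x)).
rewrite mulN1r subrr in h1.
have h : (fun n => expR C * cabs (u n + -1 * (n.+1%:R * (cexp (n.+1%:R^-1 * x) - 1)) - 0)) @ \oo --> (expR C * 0 : R).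
  exact: (cvgM (cvg_cst _) h1).
rewrite mulr0 in h; rewrite /ccvg; apply: (squeeze_cvgr _ (cvg_cst 0) h); apply: nearW => n; rewrite cabs_ge0 /=.
have n0 : (n.+1%:R : R[i]) != 0 by rewrite pnatr_eq0.
have -> : cexp x = cexp (n.+1%:R^-1 * x) ^+ n.+1 by rewrite -cexpMn mulrA mulfV // mul1r.
have m1 : 1 <= expR (n.+1%:R^-1 * C).
  by rewrite -expR0 ler_expR mulr_ge0 // invr_ge0 ler0n.
have bm : cabs (cexp (n.+1%:R^-1 * x)) <= expR (n.+1%:R^-1 * C).
  rewrite cabs_cexp ler_expR; apply: (le_trans (ler_norm _)); apply: (le_trans (Re_le_cabs _)).
  rewrite cabsM (_ : n.+1%:R^-1 = (n.+1%:R^-1)%:C :> R[i]); last by rewrite fmorphV rmorph_nat.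
  by rewrite cabs_real ger0_norm ?invr_ge0 ?ler0n // ler_wpM2l ?invr_ge0 ?ler0n.
apply: (le_trans (cabs_subX n.+1 m1 (cabs_step n (uC n)) bm)).
rewrite expR_natV (mulrC _ (expR C)) -mulrA ler_wpM2l ?expR_ge0 //.
rewrite (_ : n.+1%:R = cabs (n.+1%:R : R[i])); last first.
  by rewrite -(rmorph_nat (@real_complex R)) cabs_real ger0_norm.
rewrite -cabsM subr0 le_eqVlt; apply/orP; left; apply/eqP; congr cabs.
by rewrite mulrBr mulrDr mulrA mulfV // mul1r mulr1; ring.
Qed.

(** The approximants of [cexp_lim] are polynomials in the [P n], and exp M bounds them wherever M
    bounds the [P n]. *)
Lemma poly_lim_cexp F : poly_lim F -> poly_lim (fun z => cexp (F z)).
Proof.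
move=> [P [bP cP]]; exists (fun n => (1 + (n.+1%:R^-1)%:P * P n) ^+ n.+1); split=> [rho r01|z z1].
  have [M hM] := bP _ r01; exists (expR M) => n z zr.
  rewrite horner_exp hornerD hornerM !hornerC cabsX -(expR_natV M n).
  by apply: lerXn2r; rewrite ?nnegrE ?cabs_ge0 ?expR_ge0 //; apply: cabs_step; exact: hM.
have r01 : 0 < (cabs z + 1) / 2 < 1 by have := cabs_ge0 z; lra.
have [M hM] := bP _ r01.
apply: eq_ccvg (cexp_lim (C := M) (cP z z1) _) => n.
  by rewrite horner_exp hornerD hornerM !hornerC.
by apply: hM; lra.
Qed.

End complex_exponential.

(** * Herglotz transforms and the functions v_s *)

Section singular_functions.
Variable R : realType.
Local Notation mR := (measurableTypeR R).
Local Notation circle := (@circle R : set mR).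
Local Notation leb := (@lebesgue_measure R).
Local Notation V := (R -> R[i]^o).
Local Notation ip2 := (@inner R : V -> V -> R[i]).
Implicit Types (f g : V) (t s rho : R) (F G B : R[i] -> R[i]) (z : R[i]).

Let hL := L2_pre_hilbert R.

(** The Herglotz kernel, with real part [pk z t] in the disk. *)
Definition hkernel z t : R[i] := (cis t + z) / (cis t - z).

Lemma hkernelE z t : cabs z < 1 -> hkernel z t = 2 * (1 - z * conjc (cis t))^-1 - 1.
Proof.
move=> z1; rewrite /hkernel; have c := cis_conjM t.
have n1 : cis t - z != 0.
  by apply/eqP => e; have := cabs_cis_sub_gt0 t z1; rewrite e cabs0 ltxx.
have n2 : 1 - z * conjc (cis t) != 0.
  by apply/eqP => e; move: n1; rewrite cis_subM e mulr0 eqxx.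
have n3 : cis t != 0 by apply/eqP => e; move: n1; rewrite cis_subM e mul0r eqxx.
have ez : z = cis t * (z * conjc (cis t)) by rewrite mulrCA c mulr1.
move: n1 n2 n3; rewrite {1 3 4}ez; move: (z * conjc (cis t)) (cis t) => w a n1 n2 n3.
by field; rewrite n2 n1.
Qed.

Lemma Re_hkernel z t : cabs z < 1 -> complex.Re (hkernel z t) = pk z t.
Proof.
move=> z1; rewrite hkernelE //; have := pk_split t z1; set w := z * conjc (cis t) => /= h.
have h1 : complex.Re ((1 - conjc w)^-1) = complex.Re ((1 - w)^-1).
  have -> : (1 - conjc w)^-1 = conjc ((1 - w)^-1) by rewrite fmorphV rmorphB rmorph1.
  exact: Re_conj.
have := congr1 (@complex.Re R) h; rewrite !ReD h1 ReN /= => ->.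
by rewrite ReM /=; ring.
Qed.

Variable mu : {measure set mR -> \bar R}.
Hypothesis bmu : bounded_mass mu.

Definition herglotz z : R[i] := cintegral mu (hkernel z).

Lemma cabs_zcis z t : cabs (z * conjc (cis t)) = cabs z.
Proof. by rewrite cabsM cabs_conj cabs_cis mulr1. Qed.

Lemma cabs_geom_part (w : R[i]) n : cabs w < 1 -> cabs (\sum_(k < n) w ^+ k) <= (1 - cabs w)^-1.
Proof.
move=> w1; apply: (le_trans (cabs_sum _ _ _)).
rewrite (eq_bigr (fun k : 'I_n => cabs w ^+ k)) => [|k _]; last by rewrite cabsX.
by apply: geom_le; rewrite cabs_ge0.
Qed.

Lemma cmeas_cisX n : cmeas (fun t : mR => conjc (cis t) ^+ n).
Proof. exact: (cmeasX _ (cmeas_conj (cmeas_cis R))). Qed.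

Lemma cmeas_geom z n : cmeas (fun t : mR => \sum_(k < n) (z * conjc (cis t)) ^+ k).
Proof.
apply: cmeas_sum => k; apply: cmeasX; apply: cmeasM; first exact: cmeas_cst.
exact: (cmeas_conj (cmeas_cis R)).
Qed.

Lemma cmeas_cauchy z : cabs z < 1 -> cmeas (fun t : mR => (1 - z * conjc (cis t))^-1).
Proof.
move=> z1; apply: (cmeas_lim (cmeas_geom z)) => t _; apply: ccvg_geom_part.
by rewrite cabs_zcis.
Qed.

Lemma cabs_cauchy z t : cabs z < 1 -> cabs ((1 - z * conjc (cis t))^-1) <= (1 - cabs z)^-1.
Proof.
move=> z1; apply: (ccvg_le (ccvg_geom_part _)); first by rewrite cabs_zcis.
by move=> n; rewrite -(cabs_zcis z t); apply: cabs_geom_part; rewrite cabs_zcis.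
Qed.

Lemma cint_cauchy z : cabs z < 1 -> cint mu (fun t : mR => (1 - z * conjc (cis t))^-1).
Proof.
by move=> z1; apply: (cint_bounded bmu (cmeas_cauchy z1)) => t _; exact: cabs_cauchy.
Qed.

Lemma cint_cst (a : R[i]) : cint mu (fun=> a).
Proof. exact: (cint_bounded bmu (cmeas_cst _) (M := cabs a)). Qed.

Lemma cint_hkernel z : cabs z < 1 -> cint mu (hkernel z).
Proof.
move=> z1; have -> : hkernel z = fun t => 2 * (1 - z * conjc (cis t))^-1 + (-1).
  by apply/funext => t; exact: hkernelE.
by apply: cintD; [apply: cintZ; exact: cint_cauchy|exact: cint_cst].
Qed.

Lemma herglotzE z : cabs z < 1 ->
  herglotz z = 2 * cintegral mu (fun t : mR => (1 - z * conjc (cis t))^-1) + cintegral mu (fun=> -1).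
Proof.
move=> z1; rewrite /herglotz (_ : hkernel z = fun t => 2 * (1 - z * conjc (cis t))^-1 + (-1)); last first.
  by apply/funext => t; exact: hkernelE.
rewrite cintegralD; [|by apply: cintZ; exact: cint_cauchy|exact: cint_cst].
by rewrite cintegralZ //; exact: cint_cauchy.
Qed.

Lemma poly_lim_eq F G : (forall z, cabs z < 1 -> F z = G z) -> poly_lim F -> poly_lim G.
Proof.
move=> FG [P [bP cP]]; exists P; split; first exact: bP.
by move=> z z1; rewrite -FG //; exact: cP.
Qed.

(** The geometric series of the Cauchy kernel is integrated term by term; the coefficients are
    moments of [mu], bounded because its mass is finite. *)
Lemma poly_lim_herglotz : poly_lim herglotz.
Proof.
apply: (@poly_lim_eq (fun z => 2 * cintegral mu (fun t : mR => (1 - z * conjc (cis t))^-1) + cintegral mu (fun=> -1))).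
  by move=> z z1; rewrite herglotzE.
apply: poly_limD; last exact: poly_lim_cst.
apply: poly_limM; first exact: poly_lim_cst.
apply: (@series_poly_lim _ (fun n => cintegral mu (fun t => conjc (cis t) ^+ n))
  (2 * Rintegral mu circle (fun=> 1))) => [n|z z1].
  have h1 t : cabs (conjc (cis t) ^+ n) = 1 by rewrite cabsX cabs_conj cabs_cis expr1n.
  have h : cint mu (fun t => conjc (cis t) ^+ n).
    by apply: (cint_bounded bmu (cmeas_cisX n)) => t _; rewrite h1.
  apply: (le_trans (cabs_cintegral h)); rewrite ler_pM2l ?ltr0n //.
  by under eq_Rintegral do rewrite h1.
have e n : \sum_(k < n) cintegral mu (fun t => conjc (cis t) ^+ k) * z ^+ k =
    cintegral mu (fun t => \sum_(k < n) (z * conjc (cis t)) ^+ k).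
  have hk k : cint mu (fun t => conjc (cis t) ^+ k).
    apply: (cint_bounded bmu (cmeas_cisX k)) => t _.
    by rewrite cabsX cabs_conj cabs_cis expr1n.
  have [_ ->] := @cint_sum R mu _ (index_enum 'I_n) (fun k t => (z * conjc (cis t)) ^+ k)
     (fun k => cint_bounded bmu (cmeasX k (cmeasM (cmeas_cst z) (cmeas_conj (cmeas_cis R))))
        (fun t _ => (ltac:(by rewrite cabsX cabs_zcis) : cabs ((z * conjc (cis t)) ^+ k) <= cabs z ^+ k))).
  apply: eq_bigr => k _; rewrite mulrC -cintegralZ //; apply: eq_cintegral => t _.
  by rewrite exprMn.
apply: (@eq_ccvg _ (fun n => cintegral mu (fun t => \sum_(k < n) (z * conjc (cis t)) ^+ k))); first by move=> n; rewrite e.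
apply: (@cintegral_dct R mu _ _ (fun=> (1 - cabs z)^-1)).
- exact: cmeas_geom.
- exact: cmeas_cauchy.
- exact: rint_cst.
- by apply: aeW => t ct; apply: ccvg_geom_part; rewrite cabs_zcis.
- by move=> n t _; rewrite -(cabs_zcis z t); apply: cabs_geom_part; rewrite cabs_zcis.
- exact: cint_cauchy.
Qed.

Lemma Re_herglotz z : cabs z < 1 -> complex.Re (herglotz z) = Rintegral mu circle (pk z).
Proof.
by move=> z1; apply: eq_Rintegral => t _; exact: Re_hkernel.
Qed.

Lemma Re_herglotz_ge0 z : cabs z < 1 -> 0 <= complex.Re (herglotz z).
Proof.
move=> z1; rewrite Re_herglotz //; apply: Rintegral_ge0 => t _; exact: pk_ge0.
Qed.

(** The function v_s, without unimodular factor so that v_s v_t = v_{s+t} holds exactly. *)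
Definition sing s z : R[i] := cexp (- (s%:C * herglotz z)).

Lemma sing0 z : sing 0 z = 1.
Proof. by rewrite /sing mul0r oppr0 cexp0. Qed.

Lemma singD s t z : sing (s + t) z = sing s z * sing t z.
Proof. by rewrite /sing rmorphD mulrDl opprD cexpD. Qed.

Lemma cabs_sing s z : cabs (sing s z) = expR (- (s * complex.Re (herglotz z))).
Proof. by rewrite /sing cabs_cexp ReN ReM /= mul0r subr0. Qed.

Lemma cabs_sing_le1 s z : 0 <= s -> cabs z < 1 -> cabs (sing s z) <= 1.
Proof.
move=> s0 z1; rewrite cabs_sing -expR0 ler_expR oppr_le0 mulr_ge0 //; exact: Re_herglotz_ge0.
Qed.

Lemma poly_lim_sing s : poly_lim (sing s).
Proof.
apply: poly_lim_cexp.
apply: (@poly_lim_eq (fun z => (- s%:C) * herglotz z)); first by move=> z _; rewrite mulNr.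
by apply: poly_limM; [exact: poly_lim_cst|exact: poly_lim_herglotz].
Qed.

End singular_functions.

(** * Bounded multipliers of the Hardy space *)

Section bounded_multipliers.
Variable R : realType.
Local Notation mR := (measurableTypeR R).
Local Notation circle := (@circle R : set mR).
Local Notation leb := (@lebesgue_measure R).
Local Notation V := (R -> R[i]^o).
Local Notation ip2 := (@inner R : V -> V -> R[i]).
Implicit Types (f g : V) (t s rho : R) (F G B : R[i] -> R[i]) (z : R[i]).

Let hL := L2_pre_hilbert R.

Lemma norm2_le f g (M : R) : L2 f -> L2 g -> 0 <= M ->
  (forall t, circle t -> cabs (f t) <= M * cabs (g t)) -> norm2 f <= M * norm2 g.
Proof.
move=> hf hg M0 le.
rewrite -(ler_pXn2r (n:=2)) ?nnegrE ?mulr_ge0 ?sqrtr_ge0 // exprMn (norm2_sqr hf) (norm2_sqr hg).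
rewrite mulrCA ler_pM2l ?invr_gt0 ?pi2_gt0 // -(RintegralZl (M ^+ 2) (@measurable_circle R) (L2_rint hg)).
apply: le_Rintegral; [exact: measurable_circle|exact: (L2_rint hf)|exact: rintZ (L2_rint hg)|].
by move=> t ct; rewrite -exprMn; apply: lerXn2r; rewrite ?nnegrE ?mulr_ge0 ?cabs_ge0 //; exact: le.
Qed.

Lemma poly_lim_dilL2 F rho : poly_lim F -> 0 < rho < 1 -> L2 (dil F rho).
Proof. by move=> [P [bP cP]] r01; case: (dil_lim bP cP r01 (cst_L2 1)). Qed.

Lemma norm2_dil_poly (p : {poly R[i]}) rho n : (size p <= n)%N -> 0 <= rho <= 1 ->
  norm2 (dil (horner p) rho) ^+ 2 <= \sum_(0 <= k < n) cabs p`_k ^+ 2.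
Proof.
move=> pn /andP[r0 r1].
have hp := dil_polyL2 p rho.
have := nrm_sqr hL hp; rewrite -[nrm _ _]/(norm2 _) => ->.
rewrite (inner_dil_poly p rho hp).
have -> : \sum_(k < size p) p`_k * rho%:C ^+ k * inner (char_pos k) (dil (horner p) rho) =
   \sum_(k < size p) (cabs (p`_k * rho%:C ^+ k) ^+ 2)%:C.
  apply: eq_bigr => k _; rewrite (ipC hL hp (char_posL2 R k)) inner_dil_poly_pos cabs_sqrC; by [].
rewrite -rmorph_sum /= big_mkord.
apply: (@le_trans _ _ (\sum_(k < size p) cabs p`_k ^+ 2)).
  apply: ler_sum => k _; rewrite cabsM exprMn ler_piMr ?sqr_ge0 //.
  rewrite cabsX cabs_real ger0_norm // -exprM; exact: exprn_ile1.
rewrite (big_ord_widen_cond n xpredT (fun k => cabs p`_k ^+ 2) pn).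
rewrite [X in _ <= X](bigID (fun i : 'I_n => (i < size p)%N)) /= lerDl.
by apply: sumr_ge0 => k _; exact: sqr_ge0.
Qed.

(** The converse of [hardy2_of_means]. On a fixed circle the Taylor polynomials have norm at most
    sqrt C and their inner products with [F] tend to |F|^2, so Cauchy-Schwarz gives |F|^2 <= sqrt C
    * |F|. *)
Lemma hardy2_means F : hardy2 F -> exists M, forall rho, 0 < rho < 1 -> norm2 (dil F rho) <= M.
Proof.
move=> hF; have pF := hardy2_poly_lim hF; case: hF => a [ca hF].
have aC N : \sum_(0 <= k < N) cabs (a k) ^+ 2 <= limn (series (fun n => cabs (a n) ^+ 2)).
  apply: nondecreasing_cvgn_le => //.
  by apply/nondecreasing_seqP => k; rewrite seriesSr /= lerDl sqr_ge0.
set C := limn _ in aC; have C0 : 0 <= C by apply: le_trans (aC 0%N); rewrite big_nil.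
exists (Num.sqrt C) => rho r01; have hd := poly_lim_dilL2 pF r01.
pose P n := \poly_(k < n) a k.
have PC n : norm2 (dil (horner (P n)) rho) <= Num.sqrt C.
  rewrite -(ler_pXn2r (n:=2)) ?nnegrE ?sqrtr_ge0 // (sqr_sqrtr C0).
  apply: (@le_trans _ _ (\sum_(0 <= k < n) cabs (P n)`_k ^+ 2)).
    apply: norm2_dil_poly; first exact: size_poly.
    by case/andP: r01 => r0 r1; rewrite !ltW.
  apply: le_trans (aC n); rewrite big_nat [X in _ <= X]big_nat; apply: ler_sum => k /andP[_ kn].
  by rewrite coef_poly kn.
have cP z : cabs z < 1 -> ccvg (fun n => (P n).[z]) (F z).
  by move=> z1; apply: (@eq_ccvg _ (fun n => \sum_(k < n) a k * z ^+ k));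
    [move=> n; rewrite horner_poly|apply/cvg_complexP; exact: hF].
have bP : forall rho, 0 < rho < 1 -> exists M, forall n z, cabs z <= rho -> cabs (P n).[z] <= M.
  have a2 n : cabs (a n) <= Num.sqrt C.
    rewrite -(ler_pXn2r (n:=2)) ?nnegrE ?sqrtr_ge0 ?cabs_ge0 // sqr_sqrtr //.
    apply: le_trans (aC n.+1); rewrite big_nat_recr //= lerDr; apply: sumr_ge0 => k _; exact: sqr_ge0.
  move=> r /andP[r0 r1]; exists (Num.sqrt C * (1 - r)^-1) => n z zr; rewrite horner_poly.
  apply: (le_trans (cabs_sum _ _ _)).
  apply: (@le_trans _ _ (Num.sqrt C * \sum_(k < n) r ^+ k)); last first.
    by rewrite ler_wpM2l ?sqrtr_ge0 // geom_le // (ltW r0).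
  rewrite mulr_sumr; apply: ler_sum => k _; rewrite cabsM cabsX ler_pM ?exprn_ge0 ?cabs_ge0 //.
  by apply: lerXn2r => //; rewrite nnegrE ?cabs_ge0 // ltW.
have [_ lim] := dil_lim bP cP r01 hd.
have le n : cabs (inner (dil (horner (P n)) rho) (dil F rho)) <= Num.sqrt C * norm2 (dil F rho).
  apply: (le_trans (cauchy_schwarz hL (dil_polyL2 _ _) hd)).
  by apply: ler_wpM2r; [exact: sqrtr_ge0|exact: PC].
have := ccvg_le lim le.
have := nrm_sqr hL hd; rewrite -[nrm _ _]/(norm2 _) => h2.
have := Re_le_cabs (inner (dil F rho) (dil F rho)); rewrite -h2 => h3 h4.
have {h3}h4 := le_trans (le_trans (ler_norm _) h3) h4.
have := sqrtr_ge0 (complex.Re (inner (dil F rho) (dil F rho))); rewrite -/(norm2 (dil F rho)).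
rewrite le_eqVlt => /orP[/eqP <-|n0]; first exact: sqrtr_ge0.
by move: h4; rewrite expr2 ler_pM2r.
Qed.

(** The coefficients of a product are hard to bound, but its means on circles are at most C times
    those of [F]. *)
Lemma hardy2_mul B F (C : R) : poly_lim B -> 0 <= C -> (forall z, cabs z < 1 -> cabs (B z) <= C) -> hardy2 F ->
  hardy2 (fun z => B z * F z).
Proof.
move=> pB C0 BC hF; have pF := hardy2_poly_lim hF; have [M hM] := hardy2_means hF.
have pBF := poly_limM pB pF.
apply: (@hardy2_of_means _ _ ((C * M) ^+ 2) pBF) => rho r01.
have hd := poly_lim_dilL2 pF r01; have hd' := poly_lim_dilL2 pBF r01.
have nM : norm2 (dil F rho) <= M := hM _ r01.
apply: lerXn2r; rewrite ?nnegrE ?sqrtr_ge0 //.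
  by rewrite mulr_ge0 // (le_trans _ nM) // sqrtr_ge0.
apply: (@le_trans _ _ (C * norm2 (dil F rho))); last by rewrite ler_wpM2l.
apply: norm2_le => // t _; rewrite cabsM ler_wpM2r ?cabs_ge0 //; apply: BC.
by case/andP: r01 => r0 r1; rewrite cabs_dil.
Qed.

Lemma hardy2_cst (a : R[i]) : hardy2 (fun=> a).
Proof.
apply: (@hardy2_of_means _ _ (cabs a ^+ 2) (poly_lim_cst a)) => rho _.
have := norm2_le (cst_L2 a) (cst_L2 1) (cabs_ge0 a); rewrite norm2_cst1 mulr1 => h.
have {}h : norm2 (fun _ : R => a) <= cabs a by apply: h => t _; rewrite cabs1 mulr1.
by apply: lerXn2r; rewrite ?nnegrE ?sqrtr_ge0 ?cabs_ge0.
Qed.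

Lemma hardy2_bounded B (C : R) : poly_lim B -> (forall z, cabs z < 1 -> cabs (B z) <= C) -> hardy2 B.
Proof.
move=> pB BC; have C0 : 0 <= C by apply: le_trans (BC 0 _); rewrite ?cabs_ge0 ?cabs0.
apply: (@eq_hardy2 _ (fun z => B z * 1)); first by move=> z _; rewrite mulr1.
exact: (hardy2_mul pB C0 BC (hardy2_cst 1)).
Qed.

End bounded_multipliers.

(** * Singular inner functions *)

Section circle_tonelli.
Variable R : realType.
Local Notation mR := (measurableTypeR R).
Local Notation circle := (@circle R : set mR).
Local Notation leb := (@lebesgue_measure R).
Variable mu : {finite_measure set mR -> \bar R}.
Variables (k : mR * mR -> R) (M : R).
Hypotheses (mk : measurable_fun setT k) (k01 : forall p, 0 <= k p <= M).

Let mass_mu : bounded_mass mu.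
Proof. by rewrite /bounded_mass -ge0_fin_numE //; exact: fin_num_measure (@measurable_circle R). Qed.

Let f (p : mR * mR) : \bar R := ((\1_circle p.1 * \1_circle p.2) * k p)%:E.

Let mf : measurable_fun setT f.
Proof.
apply/measurable_EFinP; apply: measurable_funM => //; apply: measurable_funM.
  apply: (measurableT_comp (f := \1_circle : mR -> R)); last exact: measurable_fst.
  exact: measurable_indic (@measurable_circle R).
apply: (measurableT_comp (f := \1_circle : mR -> R)); last exact: measurable_snd.
exact: measurable_indic (@measurable_circle R).
Qed.

Let f0 p : (0 <= f p)%E.
Proof. by rewrite lee_fin mulr_ge0 ?mulr_ge0 //; case/andP: (k01 p). Qed.

Let fE1 t : (\int[mu]_x f (t, x))%E = ((fun t => \int[mu]_(x in circle) (k (t, x))%:E) \_ circle)%E t.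
Proof.
rewrite patchE; case: ifPn => ct.
  rewrite [RHS]integral_mkcond; apply: eq_integral => x _; rewrite patchE /f /= !indicE ct mul1r.
  by case: ifPn => _; rewrite ?mul1r ?mul0r.
by rewrite (eq_integral (fun=> 0%E)) ?integral0 // => x _; rewrite /f /= !indicE (negbTE ct) !mul0r.
Qed.

Let fE2 x : (\int[leb]_t f (t, x))%E = ((fun x => \int[leb]_(t in circle) (k (t, x))%:E) \_ circle)%E x.
Proof.
rewrite patchE; case: ifPn => ct.
  rewrite [RHS]integral_mkcond; apply: eq_integral => t _; rewrite patchE /f /= !indicE ct mulr1.
  by case: ifPn => _; rewrite ?mul1r ?mul0r.
by rewrite (eq_integral (fun=> 0%E)) ?integral0 // => t _; rewrite /f /= !indicE (negbTE ct) mulr0 !mul0r.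
Qed.

Let mk1 t : measurable_fun circle (fun x : mR => k (t, x)).
Proof. by apply: measurable_funTS; apply: measurableT_comp => //; exact: pair1_measurable. Qed.

Let mk2 x : measurable_fun circle (fun t : mR => k (t, x)).
Proof. by apply: measurable_funTS; apply: measurableT_comp => //; exact: pair2_measurable. Qed.

Let rint_k (nu : {measure set mR -> \bar R}) (g : mR -> R) : bounded_mass nu -> measurable_fun circle g ->
  (forall t, 0 <= g t <= M) -> rint nu g.
Proof.
move=> bnu mg h; apply: (rint_le mg (rint_cst M bnu)) => t _.
by case/andP: (h t) => h0 h1; rewrite ger0_norm.
Qed.

Let EFin_Rint (nu : {measure set mR -> \bar R}) (g : mR -> R) : rint nu g ->
  (Rintegral nu circle g)%:E = (\int[nu]_(x in circle) (g x)%:E)%E.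
Proof. by move=> hg; rewrite /Rintegral fineK //; exact: integrable_fin_num hg. Qed.

Lemma measurable_circle_section : measurable_fun circle (fun x => Rintegral leb circle (fun t => k (t, x))).
Proof.
have h := @measurable_fun_fubini_tonelli_G _ _ _ _ _ leb f mf f0.
have h1 : measurable_fun circle (fun x => (Rintegral leb circle (fun t => k (t, x)))%:E).
  apply: (eq_measurable_fun (fun x => \int[leb]_t f (t, x))%E); last exact: measurable_funTS.
  move=> x cx; rewrite fE2 patchE cx EFin_Rint //.
  by apply: rint_k => //; exact: leb_mass.
exact/measurable_EFinP.
Qed.

Lemma circle_tonelli : Rintegral leb circle (fun t => Rintegral mu circle (fun x => k (t, x))) =
  Rintegral mu circle (fun x => Rintegral leb circle (fun t => k (t, x))).
Proof.
have h := @fubini_tonelli _ _ _ _ _ leb mu f mf f0.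
rewrite {1 3}/Rintegral; congr fine.
rewrite integral_mkcond [RHS]integral_mkcond.
rewrite (eq_integral (fun t => \int[mu]_x f (t, x)))%E; last first.
  move=> t _; rewrite fE1 !patchE; case: ifPn => // _; rewrite EFin_Rint //.
  by apply: rint_k.
rewrite h; apply: eq_integral => x _; rewrite fE2 !patchE; case: ifPn => // _; rewrite EFin_Rint //.
by apply: rint_k => //; exact: leb_mass.
Qed.

End circle_tonelli.

(** * Unimodularity of v_s on the circle *)

Section unimodular_boundary.
Variable R : realType.
Local Notation mR := (measurableTypeR R).
Local Notation circle := (@circle R : set mR).
Local Notation leb := (@lebesgue_measure R).
Local Notation V := (R -> R[i]^o).
Implicit Types (f g : V) (t x s rho : R) (z : R[i]) (C : set R).

Lemma ae_mono (nu : {measure set mR -> \bar R}) (P Q : mR -> Prop) : (forall t, P t -> Q t) ->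
  {ae nu, forall t, P t} -> {ae nu, forall t, Q t}.
Proof. by move=> PQ; apply: filterS. Qed.

Lemma pk_rot rho t x : pk (rho%:C * cis t) x = pk rho%:C (x - t).
Proof.
rewrite /pk cabsM cabs_cis mulr1; congr (_ / _ ^+ 2).
have {1}-> : x = t + (x - t) by rewrite addrC subrK.
by rewrite cisD mulrC -mulrBl cabsM cabs_cis mulr1.
Qed.

Lemma pk_sym rho t x : pk (rho%:C * cis x) t = pk (rho%:C * cis t) x.
Proof.
rewrite /pk !cabsM !cabs_cis; congr (_ / _ ^+ 2).
rewrite -cabs_conj -[LHS]mulr1 -(cabs_cis (t + x)) -cabsM cisD; congr cabs.
have ct := cis_conjM t; have cx := cis_conjM x.
rewrite conjcD conjcN conjcM conjc_real mulrBl.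
rewrite (_ : conjc (cis t) * (cis t * cis x) = cis x * (cis t * conjc (cis t))); last by ring.
rewrite (_ : rho%:C * conjc (cis x) * (cis t * cis x) = rho%:C * cis t * (cis x * conjc (cis x))); last by ring.
by rewrite ct cx !mulr1.
Qed.

Lemma cabs_rcis rho t : 0 < rho < 1 -> cabs (rho%:C * cis t) < 1.
Proof. by move=> /andP[r0 r1]; rewrite cabsM cabs_real cabs_cis mulr1 ger0_norm // ltW. Qed.

Lemma measurable_pk2 rho : 0 < rho < 1 -> measurable_fun setT (fun p : mR * mR => pk rho%:C (p.2 - p.1)).
Proof.
move=> /andP[r0 r1]; apply: (measurableT_comp (f := pk rho%:C : mR -> R)).
  apply: measurable_realfun.continuous_measurable_fun; apply: pk_continuous.
  by rewrite cabs_real ger0_norm // ltW.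
by apply: measurable_funB; [exact: measurable_snd|exact: measurable_fst].
Qed.

Lemma Rint_pk z : cabs z < 1 -> rint leb (pk z) /\ Rintegral leb circle (pk z) = 2 * pi.
Proof.
move=> z1; split.
  apply: (rint_le (pk_measurable z1) (rint_cst (2 / (1 - cabs z)) (leb_mass R))) => t _.
  by rewrite ger0_norm ?pk_ge0 // pk_bound.
have := congr1 (@complex.Re R) (poisson_cst z1); rewrite /poisson /inner.
have ReZ (a : R) (y : R[i]) : complex.Re (a%:C * y) = a * complex.Re y by rewrite ReM /= mul0r subr0.
rewrite ReZ => h.
have p0 := pi2_gt0 R.
rewrite -[RHS]mulr1 -[X in _ = _ * X]h mulrA mulfV ?lt0r_neq0 // mul1r.
by apply: eq_Rintegral => t _; rewrite mul1r conjc_real.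
Qed.

Lemma closed_sep C x : closed C -> ~ C x -> exists2 d : R, 0 < d & forall t, C t -> d <= `|x - t|.
Proof.
move=> cC nC; have : nbhs x (~` C) by apply: open_nbhs_nbhs; split => //; exact: closed_openC.
move=> /nbhs_ballP[d /= d0 h]; exists d => // t Ct; rewrite leNgt; apply/negP => lt.
by apply: (h t).
Qed.

(** Angles 0 and 2 pi are one point of the circle: only a set away from both turns a gap between
    angles into a gap between points. *)
Lemma circle_sep C x : closed C -> C `<=` circle -> ~ C 0 -> ~ C (2 * pi) -> circle x -> ~ C x ->
  exists2 c : R, 0 < c & forall t, C t -> c <= cabs (cis x - cis t).
Proof.
move=> cC sC n0 n2 /circleP/andP[x0 x2] nx.
have [d0 p0 h0] := closed_sep cC n0; have [d2 p2 h2] := closed_sep cC n2; have [dx px hx] := closed_sep cC nx.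
pose d := Num.min pi (Num.min d0 (Num.min d2 dx)).
have dd : [/\ 0 < d, d <= pi, d <= d0, d <= d2 & d <= dx].
  by rewrite /d !lt_min pi_gt0 p0 p2 px !ge_min !lexx !orbT.
case: dd => dp dpi dd0 dd2 ddx; have [|c c0 hc] := @cis_sep R d; first by rewrite dp.
exists c => // t Ct; apply: hc.
have := hx t Ct; have := h0 t Ct; have := h2 t Ct; have /circleP/andP[t0 t2] := sC t Ct.
rewrite sub0r normrN (ger0_norm t0) [X in _ <= X -> _]ger0_norm ?subr_ge0; last exact: ltW.
move=> a1 a2 a3; apply/andP; split; first exact: le_trans a3.
by rewrite ler_norml; apply/andP; split; lra.
Qed.

(** A fixed sequence of radii, needed for dominated convergence; [n.+2] keeps the first one
    positive. *)
Lemma cvg_rho : (fun n => 1 - n.+2%:R^-1 : R) @ \oo --> (1 : R).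
Proof.
have h : (fun n => 1 - n.+2%:R^-1 : R) @ \oo --> (1 - 0 : R).
  apply: cvgB; first exact: cvg_cst.
  by rewrite (cvg_shiftS (fun n => n.+1%:R^-1 : R)); exact: cvg_harmonic.
by rewrite subr0 in h.
Qed.

Lemma rho01 n : 0 < (1 - n.+2%:R^-1 : R) < 1.
Proof. by rewrite subr_gt0 gtrBl invr_gt0 ltr0n andbT invf_lt1 ?ltr0n // ltr1n. Qed.

Lemma left_seq (F : R -> R) (l : R) : F @ (1 : R)^'- --> l -> (fun n => F (1 - n.+2%:R^-1)) @ \oo --> l.
Proof.
move=> /cvg_at_leftP h; apply: (h (fun n => 1 - n.+2%:R^-1)); split; last exact: cvg_rho.
by move=> n; case/andP: (rho01 n).
Qed.

Variable mu : {finite_measure set mR -> \bar R}.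

Lemma finite_mass : bounded_mass mu.
Proof. by rewrite /bounded_mass -ge0_fin_numE //; exact: fin_num_measure (@measurable_circle R). Qed.
Local Notation bmu := finite_mass.

(* Tonelli, with the symmetry of the Poisson kernel in its two angles. *)
Lemma herglotz_mean (w : mR -> R) rho : measurable_fun setT w -> (forall t, 0 <= w t <= 1) -> 0 < rho < 1 ->
  Rintegral leb circle (fun t => w t * complex.Re (herglotz mu (rho%:C * cis t))) =
  Rintegral mu circle (fun x => Rintegral leb circle (fun t => w t * pk (rho%:C * cis x) t)) /\
  measurable_fun circle (fun x => Rintegral leb circle (fun t => w t * pk (rho%:C * cis x) t)).
Proof.
move=> mw w01 r01.
have r1 : cabs (rho%:C : R[i]) < 1 by have := cabs_rcis 0 r01; rewrite cis0 mulr1.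
have mk : measurable_fun setT (fun p : mR * mR => w p.1 * pk rho%:C (p.2 - p.1)).
  apply: measurable_funM; last exact: measurable_pk2.
  by apply: measurableT_comp => //; exact: measurable_fst.
have k01 (p : mR * mR) : 0 <= w p.1 * pk rho%:C (p.2 - p.1) <= 2 / (1 - cabs (rho%:C : R[i])).
  have /andP[w0 w1] := w01 p.1; have k0 := pk_ge0 (p.2 - p.1) r1; have kb := pk_bound (p.2 - p.1) r1.
  rewrite mulr_ge0 //=; apply: le_trans kb; exact: ler_piMl.
have e x t : pk (rho%:C * cis x) t = pk rho%:C (x - t) by rewrite pk_sym pk_rot.
split; last first.
  have h := @measurable_circle_section R _ _ mk k01.
  by under eq_fun do under eq_Rintegral do rewrite e.
have h := circle_tonelli mu mk k01.
under [RHS]eq_Rintegral do under eq_Rintegral do rewrite e.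
rewrite -h; apply: eq_Rintegral => t _.
have z1 := cabs_rcis t r01.
have ip : rint mu (pk (rho%:C * cis t)).
  apply: (rint_le (pk_measurable z1) (rint_cst (2 / (1 - cabs (rho%:C * cis t))) bmu)) => x _.
  by rewrite ger0_norm ?pk_ge0 // pk_bound.
rewrite (Re_herglotz mu z1) -(RintegralZl (w t) (@measurable_circle R) ip).
by apply: eq_Rintegral => x _; rewrite pk_rot.
Qed.

(** After exchanging the integrals, the integrand at x is the Poisson integral over [C] at a point
    tending radially to x. For x in [N], hence off [C], it tends to 0, and 2 pi dominates it. *)
Lemma herglotz_mean_cvg C (N : set R) : compact C -> C `<=` circle -> ~ C 0 -> mu (circle `\` N) = 0%E ->
   measurable (N : set mR) -> C `&` N = set0 ->
  (fun n => Rintegral leb circle (fun t => \1_C t * complex.Re (herglotz mu ((1 - n.+2%:R^-1)%:C * cis t)))) @ \oo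
  --> (0 : R).
Proof.
move=> kC sC n0 muN mN CN.
have cC := compact_closed (@Rhausdorff R) kC.
have mC : measurable (C : set mR) by exact: closed_measurable.
have n2 : ~ C (2 * pi) by move=> /sC/circleP; rewrite ltxx andbF.
have mw : measurable_fun setT (\1_C : mR -> R) by exact: measurable_indic.
have w01 t : 0 <= (\1_C t : R) <= 1 by rewrite indicE; case: (_ \in _); rewrite ?lexx ?ler01.
under eq_fun do rewrite (herglotz_mean mw w01 (rho01 _)).1.
have jle n x : 0 <= Rintegral leb circle (fun t => \1_C t * pk ((1 - n.+2%:R^-1)%:C * cis x) t) <= 2 * pi.
  have z1 := cabs_rcis x (rho01 n).
  apply/andP; split.
    by apply: Rintegral_ge0 => t _; rewrite mulr_ge0 ?pk_ge0 //; case/andP: (w01 t).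
  have [i1 i2] := Rint_pk z1; rewrite -i2; apply: le_Rintegral.
  - exact: (@measurable_circle R).
  - apply: (rint_le _ i1); first by apply: measurable_funM; [exact: measurable_funTS|exact: pk_measurable].
    move=> t _; have /andP[w0 w1] := w01 t; rewrite (ger0_norm (mulr_ge0 w0 (pk_ge0 t z1))).
    exact: (ler_piMl (pk_ge0 t z1) w1).
  - exact: i1.
  - by move=> t _; have /andP[w0 w1] := w01 t; exact: (ler_piMl (pk_ge0 t z1) w1).
apply: (@Rintegral_dct R mu _ (fun=> 2 * pi)).
- by move=> n; exact: (herglotz_mean mw w01 (rho01 n)).2.
- exact: rint_cst bmu.
- have aeN : {ae mu, forall x, circle x -> N x}.
    exists (circle `\` N); split => //; first by apply: measurableD => //; exact: (@measurable_circle R).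
    by move=> x /= h; apply/not_implyP => ?; apply: h.
  apply: (ae_mono _ aeN) => x xN cx; have {xN} Nx := xN cx.
  have nC : ~ C x by move=> Cx; have : (C `&` N) x by []; rewrite CN.
  have [c c0 hc] := circle_sep cC sC n0 n2 cx nC.
  have lim : (fun n => 2 * pi * (8 / c ^+ 2) * (1 - (1 - n.+2%:R^-1)) : R) @ \oo --> (2 * pi * (8 / c ^+ 2) * (1 - 1) : R).
    by apply: cvgM; [exact: cvg_cst|apply: cvgB; [exact: cvg_cst|exact: cvg_rho]].
  rewrite subrr mulr0 in lim.
  apply: (squeeze_cvgr _ (cvg_cst 0) lim).
  have near_c : \forall n \near \oo, 1 - c / 2 <= (1 - n.+2%:R^-1 : R).
    have := cvg_rho; move/cvgrPdist_le => /(_ (c / 2)); rewrite divr_gt0 // => /(_ isT).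
    by apply: filterS => n; move: (n.+2%:R^-1 : R) => y; rewrite ler_norml => /andP[_ ?]; lra.
  apply: filterS near_c => n cn; have /andP[-> _] := jle n x; rewrite /=.
  set rho := 1 - n.+2%:R^-1 in cn *; have r01 : 0 < rho < 1 := rho01 n; have z1 := cabs_rcis x r01.
  have r0 : 0 <= rho by case/andP: r01 => /ltW.
  have cz : cabs (rho%:C * cis x) = rho by rewrite cabsM cabs_real cabs_cis mulr1 ger0_norm.
  have ple t : C t -> pk (rho%:C * cis x) t <= 8 / c ^+ 2 * (1 - rho).
    move=> Ct; have c2 : 0 < c / 2 by rewrite divr_gt0.
    have far : c / 2 <= cabs (cis t - rho%:C * cis x).
      have h := hc t Ct; rewrite cabs_distC in h.
      have h2 : cabs (cis t - cis x) <= cabs (cis t - rho%:C * cis x) + (1 - rho).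
        have er : 1 - rho = cabs ((1 - rho)%:C * cis x).
          by rewrite cabsM cabs_real cabs_cis mulr1 ger0_norm // subr_ge0; case/andP: r01 => _ /ltW.
        rewrite [X in _ <= _ + X]er.
        rewrite (_ : cis t - cis x = (cis t - rho%:C * cis x) + - ((1 - rho)%:C * cis x)).
          by apply: (le_trans (cabsD _ _)); rewrite cabsN.
        have -> : (1 - rho)%:C = 1 - rho%:C :> R[i] by exact: (rmorphB (@real_complex R)).
        by move: (rho%:C) (cis t) (cis x) => a1 a2 a3; ring.
      lra.
    have := pk_le z1 c2 far; rewrite cz; move=> h; apply: (le_trans h).
    rewrite le_eqVlt; apply/orP; left; apply/eqP.
    by field; exact: lt0r_neq0.
  have cst0 : 0 <= 8 / c ^+ 2 * (1 - rho).
    by rewrite mulr_ge0 ?divr_ge0 ?sqr_ge0 // subr_ge0; case/andP: r01 => _ /ltW.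
  apply: (@le_trans _ _ (Rintegral leb circle (fun=> 8 / c ^+ 2 * (1 - rho)))).
    have [i1 i2] := Rint_pk z1.
    apply: le_Rintegral.
    - exact: (@measurable_circle R).
    - apply: (rint_le _ i1); first by apply: measurable_funM; [exact: measurable_funTS|exact: pk_measurable].
      move=> t _; have /andP[w0 w1] := w01 t; rewrite (ger0_norm (mulr_ge0 w0 (pk_ge0 t z1))).
      exact: (ler_piMl (pk_ge0 t z1) w1).
    - exact: rint_cst (leb_mass R).
    - move=> t _; rewrite indicE; case: (boolP (t \in C)) => /=; last by rewrite mul0r.
      by move=> /set_mem/ple; rewrite mul1r.
  rewrite Rintegral_cst; last exact: (@measurable_circle R).
  have -> : fine (leb circle) = 2 * pi by rewrite [leb circle]circle_mu.
  by rewrite mulrC !mulrA lexx.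
- by move=> n t _; have /andP[j0 j1] := jle n t; rewrite ger0_norm.
Qed.

(* [1 - |v_s|] is at most [s] times the real part of the Herglotz transform, whose integral over a
   compact set off the support of the singular measure tends to 0. *)
Lemma unimodular_compact C (N : set R) s (b : V) : compact C -> C `<=` circle -> ~ C 0 ->
  mu (circle `\` N) = 0%E -> measurable (N : set mR) -> C `&` N = set0 ->
  0 <= s -> L2 b -> boundary_value (sing mu s) b ->
  {ae leb, forall t, circle t -> C t -> cabs (b t) = 1}.
Proof.
move=> kC sC n0 muN mN CN s0 hb bv.
have cC := compact_closed (@Rhausdorff R) kC.
have mC : measurable (C : set mR) by exact: closed_measurable.
have mw : measurable_fun circle (\1_C : mR -> R) by apply: measurable_funTS; exact: measurable_indic.
have w01 t : 0 <= (\1_C t : R) <= 1 by rewrite indicE; case: (_ \in _); rewrite ?lexx ?ler01.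
have lim1 := herglotz_mean_cvg kC sC n0 muN mN CN.
pose r n : R := 1 - n.+2%:R^-1.
have hsg n : L2 (dil (sing mu s) (r n)) := poly_lim_dilL2 (poly_lim_sing bmu s) (rho01 n).
have hhg n : L2 (dil (herglotz mu) (r n)) := poly_lim_dilL2 (poly_lim_herglotz bmu) (rho01 n).
have ib : rint leb (fun t => cabs (b t)).
  by have [_] := L2_mul hb (cst_L2 1); under eq_fun do rewrite mulr1.
have mab : measurable_fun circle (fun t : mR => cabs (b t)) := cmeas_cabs (L2_meas hb).
have mE n : measurable_fun circle (fun t : mR => `|cabs (dil (sing mu s) (r n) t) - cabs (b t)|).
  apply: measurableT_comp; first exact: normr_measurable.
  by apply: measurable_funB => //; exact: cmeas_cabs (L2_meas (hsg n)).
have iG : rint leb (fun t => 1 + cabs (b t)) by apply: rintD => //; exact: rint_cst (leb_mass R).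
have leG n t : circle t -> `|(`|cabs (dil (sing mu s) (r n) t) - cabs (b t)|)| <= 1 + cabs (b t).
  move=> _; rewrite normr_id; apply: (le_trans (ler_normB _ _)).
  rewrite !(ger0_norm (cabs_ge0 _)) lerD2r; apply: (cabs_sing_le1 _ s0); exact: cabs_rcis (rho01 n).
have lim2 : (fun n => Rintegral leb circle (fun t => `|cabs (dil (sing mu s) (r n) t) - cabs (b t)|)) @ \oo --> (0 : R).
  apply: (Rintegral_dct mE iG) => //.
  move/boundary_valueP: bv; apply: ae_leb1 => t h ct; have := left_seq (h ct) => h'.
  apply: (squeeze_cvgr _ (cvg_cst 0) h'); apply: nearW => n; rewrite normr_ge0 /=; exact: cabs_dist.
have iW : rint leb (fun t => \1_C t * `|1 - cabs (b t)|).
  apply: (rint_le _ iG).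
    apply: measurable_funM => //; apply: measurableT_comp; first exact: normr_measurable.
    by apply: measurable_funB => //; exact: measurable_cst.
  move=> t _; have /andP[w0 w1] := w01 t; rewrite ger0_norm ?mulr_ge0 //.
  apply: (@le_trans _ _ `|1 - cabs (b t)|); first exact: ler_piMl.
  by apply: (le_trans (ler_normB _ _)); rewrite normr1 ger0_norm ?cabs_ge0.
have iE n : rint leb (fun t => `|cabs (dil (sing mu s) (r n) t) - cabs (b t)|) := rint_le (mE n) iG (leG n).
have iH n : rint leb (fun t => \1_C t * complex.Re (dil (herglotz mu) (r n) t)).
  have [mh ih] : cint leb (fun t => dil (herglotz mu) (r n) t * 1) := L2_mul (hhg n) (cst_L2 1).
  have {}ih : rint leb (fun t => cabs (dil (herglotz mu) (r n) t)).
    by move: ih; under eq_fun do rewrite mulr1.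
  apply: (rint_le _ ih); first by apply: measurable_funM => //; have [] := L2_meas (hhg n).
  move=> t _; have /andP[w0 w1] := w01 t; rewrite normrM (ger0_norm w0).
  apply: le_trans (Re_le_cabs _); exact: ler_piMl.
(* |b| is replaced by |v_s| on the circle of radius [r n], at a cost which tends to 0 by [lim2]; the
   defect 1 - |v_s| goes into the second term. *)
have key n : Rintegral leb circle (fun t => \1_C t * `|1 - cabs (b t)|) <=
   Rintegral leb circle (fun t => `|cabs (dil (sing mu s) (r n) t) - cabs (b t)|) +
   s * Rintegral leb circle (fun t => \1_C t * complex.Re (dil (herglotz mu) (r n) t)).
  rewrite -(RintegralZl _ (@measurable_circle R) (iH n)).
  rewrite -(RintegralD (@measurable_circle R) (iE n) (rintZ s (iH n))).
  apply: le_Rintegral; [exact: (@measurable_circle R)|exact: iW|exact: (rintD (iE n) (rintZ s (iH n)))|].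
  move=> t _; have /andP[w0 w1] := w01 t.
  have z1 := cabs_rcis t (rho01 n); have y0 := Re_herglotz_ge0 mu z1.
  rewrite -[(r n)%:C * cis t]/((1 - n.+2%:R^-1)%:C * cis t) in y0.
  have e1 : cabs (dil (sing mu s) (r n) t) = expR (- (s * complex.Re (dil (herglotz mu) (r n) t))) := cabs_sing mu s _.
  have e2 := expR_ge1Dx (- (s * complex.Re (dil (herglotz mu) (r n) t))); rewrite -e1 in e2.
  have e3 : cabs (dil (sing mu s) (r n) t) <= 1 := cabs_sing_le1 mu s0 z1.
  have e4 : 0 <= complex.Re (dil (herglotz mu) (r n) t) := y0.
  move: e2 e3 e4; set A := cabs (dil _ _ _); set H := complex.Re _ => e2 e3 e4.
  have h1 : `|1 - cabs (b t)| <= `|A - cabs (b t)| + (1 - A).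
    have -> : 1 - A = `|1 - A| by rewrite ger0_norm // subr_ge0.
    have {1}-> : 1 - cabs (b t) = (A - cabs (b t)) + (1 - A) by move: A (cabs (b t)) {e2 e3} => x y; ring.
    exact: ler_normD.
  move: w0 w1; rewrite indicE; case: (t \in C) => _ _; first by rewrite /= !mul1r; lra.
  by rewrite !mul0r mulr0 addr0.
have lim3 : (fun n => Rintegral leb circle (fun t => `|cabs (dil (sing mu s) (r n) t) - cabs (b t)|) +
   s * Rintegral leb circle (fun t => \1_C t * complex.Re (dil (herglotz mu) (r n) t))) @ \oo --> (0 + s * 0 : R).
  by apply: cvgD; [exact: lim2|apply: cvgM; [exact: cvg_cst|exact: lim1]].
rewrite mulr0 addr0 in lim3.
have W0 : Rintegral leb circle (fun t => \1_C t * `|1 - cabs (b t)|) <= 0.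
  by apply: (cvgr_to_ge lim3); exact: nearW.
have {}W0 : Rintegral leb circle (fun t => \1_C t * `|1 - cabs (b t)|) = 0.
  apply/eqP; rewrite eq_le W0 /=; apply: Rintegral_ge0 => t _.
  by have /andP[w0 w1] := w01 t; rewrite mulr_ge0.
have e : (\int[leb]_(t in circle) `|(\1_C t * `|1 - cabs (b t)|)%:E| = 0)%E.
  have fi : (\int[leb]_(t in circle) (\1_C t * `|1 - cabs (b t)|)%:E)%E \is a fin_num.
    exact: integrable_fin_num iW.
  rewrite -[RHS](_ : (Rintegral leb circle (fun t => \1_C t * `|1 - cabs (b t)|))%:E = _); last by rewrite W0.
  rewrite /Rintegral fineK //; apply: eq_integral => t _.
  by have /andP[w0 w1] := w01 t; rewrite /= ger0_norm ?mulr_ge0.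
have := (ae_eq_integral_abs leb (@measurable_circle R) (measurable_int _ iW)).1 e.
apply: ae_leb1 => t h ct Ct; have [] := h ct; rewrite indicE mem_set // mul1r.
by move=> /eqP; rewrite normr_eq0 subr_eq0 => /eqP <-.
Qed.

(** By inner regularity, compact sets avoiding the support [N] of the measure and the cut at angle 0
    exhaust the circle up to a Lebesgue null set. *)
Lemma sing_unimodular s (b : V) : singular_to_lebesgue mu -> 0 <= s -> L2 b -> boundary_value (sing mu s) b ->
  {ae leb, forall t, circle t -> cabs (b t) = 1}.
Proof.
move=> [N [mN N0 muN]] s0 hb bv.
pose D : set R := circle `\` (N `|` [set 0]).
have m0 : measurable ([set 0] : set mR) by exact: measurable_set1.
have mD : measurable (D : set mR).
  by apply: measurableD; [exact: (@measurable_circle R)|apply: measurableU].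
have Dfin : (leb D < +oo)%E.
  apply: le_lt_trans (leb_mass R); apply: le_measure; [by rewrite inE|by rewrite inE; exact: (@measurable_circle R)|by move=> x []].
have ex k : exists C : set R, [/\ compact C, C `<=` D & (leb (D `\` C) < (k.+1%:R^-1)%:E)%E].
  by apply: lebesgue_regularity_inner => //; rewrite invr_gt0 ltr0n.
have [Cf hC] := choice ex.
have mCf k : measurable (Cf k : set mR).
  by have [kC _ _] := hC k; exact: closed_measurable (compact_closed (@Rhausdorff R) kC).
have all : {ae leb, forall t, forall k, circle t -> Cf k t -> cabs (b t) = 1}.
  apply/ae_foralln => k; have [kC sC _] := hC k.
  apply: (@unimodular_compact _ N s) => //.
  - by move=> x /sC [].
  - by move=> /sC [_]; apply; right.
  - by rewrite -subset0 => x [/sC[_ h] Nx]; apply: h; left.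
have null : {ae leb, forall t, circle t -> exists k, Cf k t}.
  have mN0 : measurable (N `|` [set 0] : set mR) by exact: measurableU.
  have mB : measurable (\bigcap_k (D `\` Cf k) : set mR).
    by apply: bigcapT_measurable => k; exact: measurableD.
  exists ((N `|` [set 0]) `|` \bigcap_k (D `\` Cf k)); split; first exact: measurableU.
  - apply/eqP; rewrite eq_le measure_ge0 andbT.
    apply: (le_trans (measureU2 leb mN0 mB)).
    have B0 : (leb (\bigcap_k (D `\` Cf k)) <= 0)%E.
      apply/lee_addgt0Pr => e e0; rewrite add0e.
      have [k hk] : exists k, (k.+1%:R^-1 : R) <= e.
        have := @cvg_harmonic R; move/cvgrPdist_le => /(_ e e0) [k _ /(_ k (leqnn _))].
        by rewrite sub0r normrN ger0_norm ?invr_ge0 // => h; exists k.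
      apply: (@le_trans _ _ (leb (D `\` Cf k))).
        apply: le_measure; [by rewrite inE|rewrite inE; exact: measurableD|by move=> x h; exact: h].
      by have [_ _ /ltW h] := hC k; apply: (le_trans h); rewrite lee_fin.
    have N00 : (leb (N `|` [set 0%R]) <= 0)%E.
      have e0 : (leb N <= 0)%E by rewrite N0.
      have e1 : (leb [set 0%R] <= 0)%E by rewrite lebesgue_measure_set1.
      by apply: (le_trans (measureU2 leb mN m0)); apply: (le_trans (leeD e0 e1)); rewrite adde0.
    by apply: (le_trans (leeD N00 B0)); rewrite adde0.
  - move=> x /= /not_implyP[cx nk].
    have [hN|hN] := pselect ((N `|` [set 0]) x); [by left|right] => k _.
    by split; [split|move=> ck; apply: nk; exists k].
apply: ae_leb2 all null => t h1 h2 ct; have [k hk] := h2 ct; exact: h1 hk.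
Qed.

End unimodular_boundary.

(** * Model spaces *)

Section inner_functions.
Variable R : realType.
Local Notation mR := (measurableTypeR R).
Local Notation circle := (@circle R : set mR).
Local Notation leb := (@lebesgue_measure R).
Local Notation V := (R -> R[i]^o).
Local Notation ip2 := (@inner R : V -> V -> R[i]).
Implicit Types (f g h b d k : V) (t s rho : R) (F G v : R[i] -> R[i]) (z l : R[i]).

Let hL := L2_pre_hilbert R.

Definition mulf f g : V := fun t => f t * g t.
Definition conjf f : V := fun t => conjc (f t).

Definition ae_bounded f (M : R) := {ae leb, forall t, circle t -> cabs (f t) <= M}.

Lemma mulfA f g h : mulf f (mulf g h) = mulf (mulf f g) h.
Proof. by apply/funext => t; exact: mulrA. Qed.

Lemma mulfC f g : mulf f g = mulf g f.
Proof. by apply/funext => t; exact: mulrC. Qed.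

Lemma mulf_lin f (a : R[i]) g h : mulf f (a *: g + h) = a *: mulf f g + mulf f h.
Proof.
by apply/funext => t; rewrite /mulf !fctE /GRing.scale /= mulrDr; congr (_ + _); exact: mulrCA.
Qed.

Lemma mulfB f g h : mulf f (g - h) = mulf f g - mulf f h.
Proof. by apply/funext => t; rewrite /mulf !fctE mulrBr. Qed.

Lemma mulf_L2 f (M : R) g : L2 f -> ae_bounded f M -> L2 g -> L2 (mulf f g).
Proof.
move=> hf bf hg; apply: (@L2_le_ae _ _ g M); first exact: cmeasM (L2_meas hf) (L2_meas hg).
  exact: hg.
by apply: ae_leb1 bf => t h ct; rewrite cabsM; apply: ler_wpM2r; [exact: cabs_ge0|exact: h].
Qed.

Lemma inner_mulf f g h : inner (mulf f g) h = inner g (mulf (conjf f) h).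
Proof.
rewrite /inner; congr (_ * _); apply: eq_cintegral => t _.
by rewrite /mulf /conjf conjcM conjcK mulrCA mulrA.
Qed.

Lemma conjfK f : conjf (conjf f) = f.
Proof. by apply/funext => t; exact: conjcK. Qed.

Lemma inner_circle_eqr f g g' : L2 f -> L2 g -> L2 g' -> circle_eq g g' -> inner f g = inner f g'.
Proof.
by move=> hf hg hg' e; rewrite (ipC hL hg hf) (ipC hL hg' hf) (inner_circle_eql hg hg' hf e).
Qed.

Lemma boundary_valueM F G f g : boundary_value F f -> boundary_value G g ->
  boundary_value (fun z => F z * G z) (mulf f g).
Proof.
move=> h1 h2; apply: ae_leb2 h1 h2 => t h1 h2 ct.
by apply: (@cvgM _ _ _ _ (fun rho => F (rho%:C * cis t)) (fun rho => G (rho%:C * cis t))); [exact: h1|exact: h2].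
Qed.

Lemma boundary_bounded F f (M : R) : boundary_value F f -> (forall z, cabs z < 1 -> cabs (F z) <= M) -> ae_bounded f M.
Proof.
move=> /boundary_valueP bf FM; apply: ae_leb1 bf => t h ct; have {}h := h ct.
have h1 := left_seq h.
apply: (@ccvg_le _ (fun n => F ((1 - n.+2%:R^-1)%:C * cis t))); first exact: h1.
by move=> n; apply: FM; apply: cabs_rcis; exact: rho01.
Qed.

Lemma HinftyI F f (M : R) : L2 f -> hardy2 F -> boundary_value F f -> (forall z, cabs z < 1 -> cabs (F z) <= M) -> Hinfty f.
Proof.
by move=> hf hF bf FM; split; [split; [|exists F]|exists F; split => //; exists M].
Qed.

Lemma Hinfty_H2 f : Hinfty f -> H2 f.
Proof. by case. Qed.

Lemma Hinfty_L2 f : Hinfty f -> L2 f.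
Proof. by move=> /Hinfty_H2/H2_L2. Qed.

Lemma Hinfty_bounded f : Hinfty f -> exists M, ae_bounded f M.
Proof. by move=> [_ [F [hF bF [M FM]]]]; exists M; exact: boundary_bounded bF FM. Qed.

Lemma mulHinfty_L2 f g : Hinfty f -> L2 g -> L2 (mulf f g).
Proof. by move=> hf hg; have [M bf] := Hinfty_bounded hf; exact: mulf_L2 (Hinfty_L2 hf) bf hg. Qed.

Lemma mulHinfty_H2 f g : Hinfty f -> H2 g -> H2 (mulf f g).
Proof.
move=> hf hg; split; first exact: mulHinfty_L2 hf (H2_L2 hg).
have [hG bG] := H2_poisson hg.
have [_ [F [hF bF [M FM]]]] := hf.
have M0 : 0 <= M by apply: le_trans (FM 0 _); rewrite ?cabs_ge0 ?cabs0.
exists (fun z => F z * poisson g z); split; last exact: boundary_valueM.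
exact: (hardy2_mul (hardy2_poly_lim hF) M0 FM hG).
Qed.

Lemma mulHinfty f g : Hinfty f -> Hinfty g -> Hinfty (mulf f g).
Proof.
move=> hf hg; have h := mulHinfty_H2 hf (Hinfty_H2 hg).
have [_ [F [hF bF [M FM]]]] := hf; have [_ [G [hG bG [N GN]]]] := hg.
have M0 : 0 <= M by apply: le_trans (FM 0 _); rewrite ?cabs_ge0 ?cabs0.
apply: (@HinftyI (fun z => F z * G z) _ (M * N)).
- exact: H2_L2.
- exact: (hardy2_mul (hardy2_poly_lim hF) M0 FM hG).
- exact: boundary_valueM.
- by move=> z z1; rewrite cabsM; apply: ler_pM; rewrite ?cabs_ge0 //; [exact: FM|exact: GN].
Qed.

Lemma hardy2_lin (a : R[i]) F G : hardy2 F -> hardy2 G -> hardy2 (fun z => a * F z + G z).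
Proof.
move=> hF hG; have [f hf [bf fn [Ff _]]] := hardy2_boundary hF; have [g hg [bg gn [Gg _]]] := hardy2_boundary hG.
have h : H2 (a *: f + g) by apply: H2_lin; apply/H2P.
have [hp _] := H2_poisson h.
apply: (eq_hardy2 _ hp) => z z1; rewrite Ff // Gg // /poisson; exact: (ipL hL a hf hg (pkL2 z1)).
Qed.

Lemma Hinfty_lin (a : R[i]) f g : Hinfty f -> Hinfty g -> Hinfty (a *: f + g).
Proof.
move=> hf hg; have [_ [F [hF bF [M FM]]]] := hf; have [_ [G [hG bG [N GN]]]] := hg.
apply: (@HinftyI (fun z => a * F z + G z) _ (cabs a * M + N)).
- exact: (phL hL _ (Hinfty_L2 hf) (Hinfty_L2 hg)).
- exact: hardy2_lin.
- apply: ae_leb2 bF bG => t h1 h2 ct.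
  apply: (@cvgD _ (R[i]^o) _ _ _ (fun rho => a * F (rho%:C * cis t)) (fun rho => G (rho%:C * cis t))); last exact: h2.
  by apply: (@cvgM _ _ _ _ (fun=> a) (fun rho => F (rho%:C * cis t))); [exact: cvg_cst|exact: h1].
- move=> z z1; apply: (le_trans (cabsD _ _)); rewrite cabsM; apply: lerD; last exact: GN.
  by apply: ler_wpM2l; [exact: cabs_ge0|exact: FM].
Qed.

Lemma Hinfty_char n : Hinfty (@char_pos R n).
Proof.
have h := char_posH2 R n.
have hp : hardy2 (fun z : R[i] => z ^+ n).
  apply: (@hardy2_bounded _ _ 1).
    elim: n {h} => [|n IH].
      by apply: (poly_lim_eq _ (poly_lim_cst 1)) => z _; rewrite expr0.
    apply: (@poly_lim_eq _ (fun z => z * z ^+ n)); first by move=> z _; rewrite exprS.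
    apply: poly_limM => //; exists (fun=> 'X); split=> [rho _|z _].
      by exists rho => _ z; rewrite hornerX.
    by apply: (eq_ccvg _ (ccvg_cst z)) => _; rewrite hornerX.
  by move=> z z1; rewrite cabsX; apply: exprn_ile1; rewrite ?cabs_ge0 // ltW.
apply: (@HinftyI (fun z => z ^+ n) _ 1).
- exact: char_posL2.
- exact: hp.
- apply/boundary_valueP; apply: ae_lebW => t ct.
  have c : (fun rho : R => `|rho ^+ n - 1|) @ (1 : R)^'- --> (`|1 ^+ n - 1| : R).
    apply: cvg_norm; apply: cvgB; last exact: cvg_cst.
    by apply: cvg_at_left_filter; exact: exprn_continuous.
  rewrite expr1n subrr normr0 in c.
  rewrite (_ : (fun rho => _) = (fun rho : R => `|rho ^+ n - 1|)) //.
  apply/funext => rho; rewrite exprMn /char_pos -{2}[cis t ^+ n]mul1r -mulrBl cabsM [cabs (cis t ^+ n)]cabsX.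
  by rewrite cabs_cis expr1n mulr1 -rmorphXn -(rmorphB (@real_complex R) _ 1) cabs_real.
- by move=> z z1; rewrite cabsX; apply: exprn_ile1; rewrite ?cabs_ge0 // ltW.
Qed.

(** A chosen boundary function [b] accompanies [v], so that multiplication and division by [v]
    become operations on functions of the angle. *)
Record inner_fn v b : Prop := InnerFn {
  if_hardy : hardy2 v;
  if_le1 : forall z, cabs z < 1 -> cabs (v z) <= 1;
  if_L2 : L2 b;
  if_bv : boundary_value v b;
  if_uni : {ae leb, forall t, circle t -> cabs (b t) = 1} }.

Section one_inner.
Variables (v : R[i] -> R[i]) (b : V) (hv : inner_fn v b).

Lemma if_Hinfty : Hinfty b.
Proof. exact: (HinftyI (if_L2 hv) (if_hardy hv) (if_bv hv) (if_le1 hv)). Qed.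

Lemma mul_inner_L2 f : L2 f -> L2 (mulf b f).
Proof. exact: mulHinfty_L2 if_Hinfty. Qed.

Lemma mul_conj_L2 f : L2 f -> L2 (mulf (conjf b) f).
Proof.
have [M bM] := Hinfty_bounded if_Hinfty.
apply: (@mulf_L2 _ M); first exact: L2_conj (if_L2 hv).
by apply: ae_leb1 bM => t h ct; rewrite cabs_conj; exact: h.
Qed.

Lemma conj_mulK f : circle_eq (mulf (conjf b) (mulf b f)) f.
Proof.
apply: ae_leb1 (if_uni hv) => t h ct; rewrite /mulf /conjf mulrA (mulrC (conjc _)) -cabs_sqrC (h ct).
by rewrite expr1n mul1r.
Qed.

Lemma mul_conjK f : circle_eq (mulf b (mulf (conjf b) f)) f.
Proof. by rewrite mulfA (mulfC b) -mulfA; exact: conj_mulK. Qed.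

Lemma inner_mul_inner f g : L2 f -> L2 g -> inner (mulf b f) (mulf b g) = inner f g.
Proof.
move=> hf hg; rewrite inner_mulf.
exact: (inner_circle_eqr hf (mul_conj_L2 (mul_inner_L2 hg)) hg (conj_mulK g)).
Qed.

Lemma inner_mul_conj f g : L2 f -> L2 g -> inner (mulf (conjf b) f) (mulf (conjf b) g) = inner f g.
Proof.
move=> hf hg; rewrite inner_mulf conjfK.
exact: (inner_circle_eqr hf (mul_inner_L2 (mul_conj_L2 hg)) hg (mul_conjK g)).
Qed.

(* As |b| = 1 almost everywhere, division by b is multiplication by its conjugate: the condition is closed in L^2. *)
Lemma mulH2P g : mulH2 v g <-> L2 g /\ H2 (mulf (conjf b) g).
Proof.
split=> [[hg [F [hF bF]]]|[hg hf]].
  split; first exact: hg.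
  have [f hf [bf fn _]] := hardy2_boundary hF.
  have e : circle_eq g (mulf b f) := boundary_value_uniq bF (boundary_valueM (if_bv hv) bf).
  have H2f : H2 f by apply/H2P.
  apply: (H2_circle_eq (L2_meas (mul_conj_L2 hg)) H2f).
  apply: circle_eq_trans (circle_eq_sym (conj_mulK f)) _.
  by apply: ae_leb1 e => t h ct; rewrite /mulf /= -/(mulf b f t) (h ct).
split; first exact: hg.
have [hF bF] := H2_poisson hf; exists (poisson (mulf (conjf b) g)); split; first exact: hF.
apply: boundary_value_circle_eq (boundary_valueM (if_bv hv) bF) _; exact: mul_conjK.
Qed.

Lemma mulH2_L2 g : mulH2 v g -> L2 g.
Proof. by case. Qed.

Lemma mulH2_H2 g : mulH2 v g -> H2 g.
Proof.
move=> [hg [F [hF bF]]]; split; first exact: hg.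
exists (fun z => v z * F z); split; last exact: bF.
exact: (hardy2_mul (hardy2_poly_lim (if_hardy hv)) ler01 (if_le1 hv) hF).
Qed.

Lemma mulH2_mul f : H2 f -> mulH2 v (mulf b f).
Proof.
move=> hf; have hf2 := H2_L2 hf; have hbf := mul_inner_L2 hf2; apply/mulH2P; split; first exact: hbf.
apply: (H2_circle_eq (L2_meas (mul_conj_L2 hbf)) hf); exact: circle_eq_sym (conj_mulK f).
Qed.

Lemma mulH2_0 : mulH2 v (0 : V).
Proof.
apply/mulH2P; split; first exact: (ph0 hL).
rewrite (_ : mulf _ _ = 0) //; first exact: H2_0.
by apply/funext => t; rewrite /mulf mulr0.
Qed.

Lemma mulH2_lin (a : R[i]) f g : mulH2 v f -> mulH2 v g -> mulH2 v (a *: f + g).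
Proof.
move=> /mulH2P[hf hf'] /mulH2P[hg hg']; apply/mulH2P; split; first exact: (phL hL).
by rewrite mulf_lin; exact: H2_lin.
Qed.

Lemma mulH2_complete : ip_complete ip2 (mulH2 v : set V).
Proof.
apply: L2_limit_sub; first by move=> x; exact: mulH2_L2.
move=> x y hx hy xy; apply/mulH2P; split; first exact: hy.
have hx' n : L2 (x n) := mulH2_L2 (hx n).
apply: (@H2_closed _ (fun n => mulf (conjf b) (x n))).
- by move=> n; have /mulH2P[] := hx n.
- exact: mul_conj_L2.
- have [M bM] := Hinfty_bounded if_Hinfty.
  move=> e e0; have [N hN] := xy e e0; exists N => n Nn; rewrite -mulfB.
  have hB := phB hL (hx' n) hy.
  apply: le_trans (hN n Nn); rewrite le_eqVlt; apply/orP; left; apply/eqP.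
  by rewrite /nrm; congr (Num.sqrt (complex.Re _)); exact: inner_mul_conj.
Qed.

Lemma model_H2 f : model_space v f -> H2 f.
Proof. by case. Qed.

Lemma model_L2 f : model_space v f -> L2 f.
Proof. by move=> /model_H2/H2_L2. Qed.

Lemma model_0 : model_space v (0 : V).
Proof. by split; [exact: H2_0|move=> g /mulH2_L2; exact: (ip0l hL)]. Qed.

Lemma model_lin (a : R[i]) f g : model_space v f -> model_space v g -> model_space v (a *: f + g).
Proof.
move=> [hf of_] [hg og]; split; first exact: H2_lin.
move=> h hh; rewrite (ipL hL a (H2_L2 hf) (H2_L2 hg) (mulH2_L2 hh)).
by rewrite (of_ h hh) (og h hh) mulr0 addr0.
Qed.

Lemma model_pre_hilbert : pre_hilbert ip2 (model_space v : set V).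
Proof. exact: (pre_hilbert_sub hL model_L2 model_0 model_lin). Qed.

Lemma model_complete : ip_complete ip2 (model_space v : set V).
Proof.
apply: L2_limit_sub; first exact: model_L2.
move=> x y hx hy xy; split.
  by apply: (H2_closed _ hy xy) => n; exact: model_H2.
move=> g hg; apply: (cvg_to_ip hL _ hy (mulH2_L2 hg) xy).
  by move=> n; exact: model_L2.
by move=> n; have [_] := hx n; apply.
Qed.

(** The decomposition of H^2 into K_v and v H^2: v H^2 is complete, and the residual of the
    projection of [f] onto it lies in K_v, so it is orthogonal to itself. *)
Lemma orth_model_mulH2 f : H2 f -> (forall k, model_space v k -> inner f k = 0) -> mulH2 v f.
Proof.
move=> hf fk; have hf2 := H2_L2 hf.
have [m hm om] := @projection _ _ ip2 (@H2 R : set V) (@H2_pre_hilbert R) (mulH2 v : set V) f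
  mulH2_H2 mulH2_0 mulH2_lin (@H2_complete R) mulH2_complete hf.
have hm2 := mulH2_L2 hm; have hmH := mulH2_H2 hm.
have hk : model_space v (f - m).
  by split; [exact: (phB (@H2_pre_hilbert R) hf hmH)|exact: om].
have e0 : inner (f - m) (f - m) = 0.
  rewrite (ipBl hL hf2 hm2 (model_L2 hk)) (fk _ hk) sub0r.
  by rewrite (ipC hL (model_L2 hk) hm2) (om _ hm) conjc0 oppr0.
have e : circle_eq m f by apply: circle_eq_sym; exact: (norm2B_eq0 hf2 hm2 (nrm_eq0 e0)).
case: hm => _ [F [hF bF]]; split; first exact: hf2.
by exists F; split; [exact: hF|exact: boundary_value_circle_eq bF e].
Qed.

End one_inner.

Lemma conjcX z n : conjc (z ^+ n) = conjc z ^+ n.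
Proof. by elim: n => [|n IH]; [rewrite !expr0 conjc1|rewrite !exprS conjcM IH]. Qed.

(** The reproducing kernel of H^2 at [l]. *)
Definition cauchy_k l : V := fun t => (1 - conjc l * cis t)^-1.

Lemma cauchy_kL2 l : cabs l < 1 -> L2 (cauchy_k l) /\ forall h, L2 h ->
   ccvg (fun n => inner (fun t => \sum_(k < n) (conjc l * cis t) ^+ k) h) (inner (cauchy_k l) h).
Proof.
move=> l1.
have c1 t : cabs (conjc l * cis t) = cabs l by rewrite cabsM cabs_conj cabs_cis mulr1.
have key h : L2 h -> L2 (cauchy_k l) /\ ccvg (fun n => inner (fun t => \sum_(k < n) (conjc l * cis t) ^+ k) h) (inner (cauchy_k l) h).
  move=> hh; apply: (@inner_bounded_lim _ _ _ _ (1 - cabs l)^-1) => //.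
  - move=> n; apply: (@cmeas_sum R) => k; apply: cmeasX; apply: cmeasM; first exact: cmeas_cst.
    exact: cmeas_cis.
  - by move=> t _; apply: ccvg_geom_part; rewrite c1.
  - by move=> n t _; rewrite -(c1 t); apply: cabs_geom_part; rewrite c1.
by split; [case: (key _ (cst_L2 1))|move=> h /key[]].
Qed.

Lemma inner_cauchy_k l h : cabs l < 1 -> H2 h -> inner h (cauchy_k l) = poisson h l.
Proof.
move=> l1 hh; have hh2 := H2_L2 hh; have [cL2 /(_ h hh2) lim] := cauchy_kL2 l1.
have /H2P[_ hn] := hh; have lim2 := poisson_analytic hh2 hn l1.
rewrite (ipC hL cL2 hh2).
have lim3 : ccvg (fun n => conjc (inner (fun t => \sum_(k < n) (conjc l * cis t) ^+ k) h)) (conjc (inner (cauchy_k l) h)).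
  rewrite /ccvg (_ : (fun n => _) = (fun n => cabs (inner (fun t => \sum_(k < n) (conjc l * cis t) ^+ k) h - inner (cauchy_k l) h))).
    exact: lim.
  by apply/funext => n; rewrite -cabs_conj conjcD conjcN !conjcK.
apply: (ccvg_uniq lim3); apply: (eq_ccvg _ lim2) => n.
have cp (i : nat) := char_posL2 R i.
have -> : (fun t => \sum_(k < n) (conjc l * cis t) ^+ k) = \sum_(k < n) (conjc l ^+ k) *: (@char_pos R k : V).
  by apply/funext => t; rewrite fct_sumE; apply: eq_bigr => k _; rewrite exprMn.
rewrite -(ipC hL (ph_lincomb hL (fun k : 'I_n => conjc l ^+ k) (fun k : 'I_n => cp k)) hh2).
rewrite (ip_lincombr hL (fun k : 'I_n => conjc l ^+ k) (fun k : 'I_n => cp k) hh2).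
apply: eq_bigr => k _; rewrite mulrC; congr (_ * _).
by rewrite conjcX conjcK.
Qed.

Lemma cauchy_k_Hinfty l : cabs l < 1 -> Hinfty (cauchy_k l).
Proof.
move=> l1; have cl : cabs (conjc l) < 1 by rewrite cabs_conj.
have d0 : 0 < 1 - cabs l by rewrite subr_gt0.
have bd z : cabs z < 1 -> cabs ((1 - conjc l * z)^-1) <= (1 - cabs l)^-1.
  move=> z1; have w1 : cabs (conjc l * z) < 1.
    by rewrite cabsM; apply: le_lt_trans cl; apply: ler_piMr; [exact: cabs_ge0|exact: ltW].
  have wl : cabs (conjc l * z) <= cabs l.
    by rewrite cabsM cabs_conj; apply: ler_piMr; [exact: cabs_ge0|exact: ltW].
  apply: (ccvg_le (ccvg_geom_part w1)) => n; apply: (le_trans (cabs_geom_part n w1)).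
  by rewrite lef_pV2 ?posrE ?subr_gt0 // lerB.
apply: (HinftyI _ _ _ bd).
- by have [] := cauchy_kL2 l1.
- exact: hardy2_bounded (poly_lim_geom cl) bd.
- apply: ae_lebW => t ct.
  apply: (@cvgV _ _ _ _ (fun rho : R => 1 - conjc l * (rho%:C * cis t))).
    apply/eqP => e; have : cabs (conjc l * cis t) < 1 by rewrite cabsM cabs_cis mulr1.
    by move/eqP: e; rewrite subr_eq0 => /eqP <-; rewrite cabs1 ltxx.
  apply/cvg_complexP.
  have c : (fun rho : R => cabs l * (1 - rho)) @ (1 : R)^'- --> (cabs l * (1 - 1) : R).
    apply: cvgM; first exact: cvg_cst.
    by apply: cvgB; [exact: cvg_cst|apply: cvg_at_left_filter; exact: cvg_id].
  rewrite subrr mulr0 in c; apply: (squeeze_cvgr _ (cvg_cst 0) c); near=> rho; rewrite cabs_ge0 /=.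
  have r1 : rho < 1 by near: rho; exact: nbhs_left_lt.
  have -> : 1 - conjc l * (rho%:C * cis t) - (1 - conjc l * cis t) = conjc l * cis t * (1 - rho%:C) by ring.
  rewrite -(rmorphB (@real_complex R) 1 rho) !cabsM cabs_cis cabs_conj mulr1 cabs_real ger0_norm //.
  by rewrite subr_ge0 ltW.
Unshelve. all: by end_near. Qed.

Lemma Hinfty_cst (a : R[i]) : Hinfty (fun=> a).
Proof.
apply: (@HinftyI (fun=> a) _ (cabs a)).
- exact: cst_L2.
- exact: hardy2_cst.
- by apply: ae_lebW => t ct; exact: cvg_cst.
- by [].
Qed.

(** * Reproducing kernels of model spaces and density of bounded functions *)

Section reproducing_kernel.
Variables (v : R[i] -> R[i]) (b : V) (hv : inner_fn v b).

(** The reproducing kernel of K_v at [l], that is the projection of [cauchy_k l]. It is bounded,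
    which provides explicit bounded elements of K_v. *)
Definition kernel_k l : V := mulf (fun t => 1 - conjc (v l) * b t) (cauchy_k l).

Lemma kernel_kE l : kernel_k l = (- conjc (v l)) *: mulf b (cauchy_k l) + cauchy_k l.
Proof.
apply/funext => t; rewrite /kernel_k /mulf !fctE /GRing.scale /=; ring.
Qed.

Lemma kernel_k_Hinfty l : cabs l < 1 -> Hinfty (kernel_k l).
Proof.
move=> l1; rewrite kernel_kE; apply: Hinfty_lin; last exact: cauchy_k_Hinfty.
by apply: mulHinfty; [exact: if_Hinfty hv|exact: cauchy_k_Hinfty].
Qed.

Lemma inner_kernel_k l f : cabs l < 1 -> L2 f ->
  inner f (kernel_k l) = inner f (cauchy_k l) - v l * inner f (mulf b (cauchy_k l)).
Proof.
move=> l1 hf; have hc := Hinfty_L2 (cauchy_k_Hinfty l1); have hbc := mul_inner_L2 hv hc.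
rewrite kernel_kE (ipDr hL (phZ hL _ hbc) hc hf) (ipZr hL _ hbc hf).
by rewrite conjcN conjcK mulNr addrC.
Qed.

Lemma kernel_k_model l : cabs l < 1 -> model_space v (kernel_k l).
Proof.
move=> l1; have hk := kernel_k_Hinfty l1; split; first exact: Hinfty_H2.
move=> g hg; have hg2 := mulH2_L2 hg.
have hc := Hinfty_L2 (cauchy_k_Hinfty l1).
rewrite (ipC hL hg2 (Hinfty_L2 hk)) (inner_kernel_k l1 hg2).
have /(mulH2P hv)[_ hf] := hg; set f := mulf (conjf b) g in hf.
have hbf := mul_inner_L2 hv (H2_L2 hf); have eg : circle_eq (mulf b f) g := mul_conjK hv g.
have hbc := mul_inner_L2 hv hc.
rewrite -(inner_circle_eql hbf hg2 hc eg) -(inner_circle_eql hbf hg2 hbc eg).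
rewrite (inner_mul_inner hv (H2_L2 hf) hc).
rewrite (inner_cauchy_k l1 hf) (inner_cauchy_k l1 (mulH2_H2 hv (mulH2_mul hv hf))).
have [hF bF] := H2_poisson hf.
have hbF := hardy2_mul (hardy2_poly_lim (if_hardy hv)) ler01 (if_le1 hv) hF.
have [_ e _] := H2_facts hbf hbF (boundary_valueM (if_bv hv) bF).
by rewrite -(e l l1) subrr conjc0.
Qed.

Lemma inner_kernel_k_model l f : cabs l < 1 -> model_space v f -> inner f (kernel_k l) = poisson f l.
Proof.
move=> l1 [hf of_]; have hc := Hinfty_H2 (cauchy_k_Hinfty l1).
rewrite (inner_kernel_k l1 (H2_L2 hf)) (inner_cauchy_k l1 hf).
by rewrite (of_ _ (mulH2_mul hv hc)) mulr0 subr0.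
Qed.

(** An element of K_v orthogonal to the bounded ones is orthogonal to all kernels, so its Poisson
    integral vanishes in the disk and its boundary function is null. *)
Lemma model_Hinfty_dense f (e : R) : model_space v f -> 0 < e ->
  exists2 d, model_space v d /\ Hinfty d & nrm ip2 (f - d) <= e.
Proof.
move=> hf e0.
have hK := model_pre_hilbert v.
have orth (y : V) : model_space v y -> (forall z : V, model_space v z /\ Hinfty z -> inner y z = 0) -> nrm ip2 y = 0.
  move=> hy oy; have [_ bF] := H2_poisson (model_H2 hy).
  have b0 : boundary_value (fun=> 0) y.
    apply: (eq_boundary_value _ bF) => l l1; rewrite -(inner_kernel_k_model l1 hy).
    by apply: oy; split; [exact: kernel_k_model|exact: kernel_k_Hinfty].
  have b00 : boundary_value (fun=> 0) (0 : V) by apply: ae_lebW => t ct; exact: cvg_cst.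
  have := circle_eq_norm2B (model_L2 hy) (ph0 hL) (boundary_value_uniq b0 b00).
  by rewrite subr0.
have [d dD hd] := @dense_of_orth _ _ ip2 (model_space v : set V) hK
  [set d | model_space v d /\ Hinfty d] f (@model_complete v) (fun d hd => hd.1)
  (conj (model_0 v) (Hinfty_cst 0)) (fun a x y hx hy => conj (model_lin a hx.1 hy.1) (Hinfty_lin a hx.2 hy.2))
  orth hf e e0.
by exists d.
Qed.

End reproducing_kernel.
End inner_functions.

(** * The chain of model spaces of the functions v_s *)

Section singular_family.
Variable R : realType.
Local Notation mR := (measurableTypeR R).
Local Notation circle := (@circle R : set mR).
Local Notation leb := (@lebesgue_measure R).
Local Notation V := (R -> R[i]^o).
Local Notation ip2 := (@inner R : V -> V -> R[i]).
Local Notation nrm2 := (nrm ip2).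
Implicit Types (f g h x y : V) (s t r : R).

Let hL := L2_pre_hilbert R.

Lemma cabs_eps0 (a : R[i]) (C : R) : (forall e : R, 0 < e -> cabs a <= C * e) -> a = 0.
Proof.
move=> h; apply: cabs_eq0; apply/eqP; rewrite eq_le cabs_ge0 andbT; apply/ler_addgt0Pr => e e0; rewrite add0r.
have C1 : 0 < `|C| + 1 by rewrite ltr_wpDl.
apply: (le_trans (h (e / (`|C| + 1)) _)); first by rewrite divr_gt0.
rewrite mulrCA ler_piMr ?(ltW e0) // ler_pdivrMr // mul1r.
by apply: (le_trans (ler_norm _)); rewrite lerDl.
Qed.

Variable mu : {finite_measure set mR -> \bar R}.
Hypothesis smu : singular_to_lebesgue mu.
Local Notation v := (sing mu).

Lemma sing_hardy2 s : 0 <= s -> hardy2 (v s).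
Proof.
move=> s0; apply: (@hardy2_bounded _ _ 1); first exact: (poly_lim_sing (finite_mass mu) s).
by move=> z; exact: cabs_sing_le1.
Qed.

Lemma sing_inner_fn s : 0 <= s -> exists b, inner_fn (v s) b.
Proof.
move=> s0; have hv := sing_hardy2 s0; have [b hb [bv _ _]] := hardy2_boundary hv.
exists b; split; [exact: hv| |exact: hb|exact: bv|exact: (sing_unimodular smu s0 hb bv)].
by move=> z; exact: cabs_sing_le1.
Qed.

Local Notation K s := (model_space (v s) : set V).

Lemma mulH2_sing_mono s t g : 0 <= s <= t -> mulH2 (v t) g -> mulH2 (v s) g.
Proof.
move=> /andP[s0 st] [hg [F [hF bF]]]; split; first exact: hg.
have d0 : 0 <= t - s by rewrite subr_ge0.
exists (fun z => v (t - s) z * F z); split.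
  by apply: (hardy2_mul (poly_lim_sing (finite_mass mu) _) ler01 _ hF) => z; exact: cabs_sing_le1.
apply: (eq_boundary_value _ bF) => z _.
by rewrite mulrA -singD addrC subrK.
Qed.

Lemma model_sing_mono s t f : 0 <= s <= t -> K s f -> K t f.
Proof. by move=> st [hf of_]; split; [exact: hf|move=> g hg; apply: of_; exact: (mulH2_sing_mono st hg)]. Qed.

Lemma model_sing0 f : K 0 f -> nrm2 f = 0.
Proof.
move=> [hf of_]; apply: nrm_eq0; apply: of_; split; first exact: H2_L2.
have [hF bF] := H2_poisson hf; exists (poisson f); split; first exact: hF.
by apply: (eq_boundary_value _ bF) => z _; rewrite sing0 mul1r.
Qed.

(** With [model_block_out], this is the orthogonal decomposition of K_{v_{s+d}} into K_{v_s} and v_s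
    K_{v_d}: division by v_s takes v_{s+d} H^2 to v_d H^2. *)
Lemma model_block_in s d (b e : V) : 0 <= s -> 0 <= d -> inner_fn (v s) b -> K d e ->
  K (s + d) (mulf b e) /\ forall k, K s k -> inner (mulf b e) k = 0.
Proof.
move=> s0 d0 hb he; have eH := model_H2 he; have eL := H2_L2 eH.
have hm := mulH2_mul hb eH; have hmL := mulH2_L2 hm.
split; last first.
  by move=> k [hk ok]; rewrite (ipC hL (H2_L2 hk) hmL) (ok _ hm) conjc0.
split; first exact: (mulH2_H2 hb hm).
move=> g hg; have sd : 0 <= s <= s + d by rewrite s0 lerDl.
have /(mulH2P hb)[gL hg'] := mulH2_sing_mono sd hg.
rewrite inner_mulf; have [_ oe] := he; apply: oe.
split; first exact: H2_L2.
have [hp bp] := H2_poisson hg'.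
case: hg => _ [F [hF bF]]; exists F; split; first exact: hF.
have hG : hardy2 (fun z => v d z * F z).
  by apply: (hardy2_mul (poly_lim_sing (finite_mass mu) _) ler01 _ hF) => z; exact: cabs_sing_le1.
have [G GL [bG Gn _]] := hardy2_boundary hG.
have e1 : circle_eq g (mulf b G).
  apply: (boundary_value_uniq bF); apply: (eq_boundary_value _ (boundary_valueM (if_bv hb) bG)) => z _.
  by rewrite mulrA -singD.
apply: boundary_value_circle_eq bG _; apply: circle_eq_trans (circle_eq_sym (conj_mulK hb G)) _.
by apply: ae_leb1 e1 => t h ct; rewrite [mulf _ g t]/mulf (h ct).
Qed.

Lemma model_block_out s d (b y : V) : 0 <= s -> 0 <= d -> inner_fn (v s) b -> K (s + d) y ->
  (forall k, K s k -> inner y k = 0) -> exists2 e, K d e & circle_eq y (mulf b e).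
Proof.
move=> s0 d0 hb [yH oy] yk; have yL := H2_L2 yH.
have /(mulH2P hb)[_ eH] := orth_model_mulH2 hb yH yk.
exists (mulf (conjf b) y); last exact: (circle_eq_sym (mul_conjK hb y)).
split; first exact: eH.
move=> g [gL [F [hF bF]]]; rewrite inner_mulf conjfK; apply: oy.
split; first exact: (mul_inner_L2 hb gL).
exists F; split; first exact: hF.
apply: (eq_boundary_value _ (boundary_valueM (if_bv hb) bF)) => z _.
by rewrite mulrA -singD.
Qed.

Lemma mulH2_Hinfty s (b f g : V) : inner_fn (v s) b -> Hinfty f -> mulH2 (v s) g -> mulH2 (v s) (mulf f g).
Proof.
move=> hb hf /(mulH2P hb)[gL hg]; apply/(mulH2P hb); split; first exact: mulHinfty_L2.
by rewrite mulfA (mulfC _ f) -mulfA; exact: mulHinfty_H2.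
Qed.

(* Expanding psi in powers reduces the claim to the invariance of v_s H^2 under multiplication by z^n. *)
Lemma conj_symbol_orth s (b psi d k : V) : inner_fn (v s) b -> H2 psi -> K s d -> Hinfty d -> H2 k ->
  (forall y, K s y -> inner k y = 0) -> inner (mulf (conjf psi) d) k = 0.
Proof.
move=> hb hpsi [_ od] dI kH ok.
have hk := orth_model_mulH2 hb kH ok.
have -> : inner (mulf (conjf psi) d) k = inner (mulf d (conjf k)) psi.
  by rewrite /inner; congr (_ * _); apply: eq_cintegral => t _; rewrite /mulf /conjf; ring.
apply: orth_char_pos_H2 hpsi; first exact: (mulHinfty_L2 dI (L2_conj (H2_L2 kH))).
move=> n; rewrite mulfC inner_mulf conjfK mulfC; apply: od.
by apply: mulH2_Hinfty hb _ hk; exact: Hinfty_char.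
Qed.

(** Being orthogonal to K_{v_r}, [q] is v_r G with G in H^2. As d <= r, the product q v_s e equals
    v_{s+d} times v_{r-d} e G, and boundedness of [e] keeps this cofactor in H^2. *)
Lemma analytic_symbol_orth s d r (b br q e k : V) : 0 <= s -> 0 <= d <= r -> inner_fn (v s) b ->
  inner_fn (v r) br -> H2 q -> (forall y, K r y -> inner q y = 0) -> Hinfty e -> K (s + d) k ->
  inner (mulf q (mulf b e)) k = 0.
Proof.
move=> s0 /andP[d0 dr] hb hbr qH oq eI [kH ok].
have dI : Hinfty (mulf b e) := mulHinfty (if_Hinfty hb) eI.
have qdL : L2 (mulf q (mulf b e)) by rewrite mulfC; exact: (mulHinfty_L2 dI (H2_L2 qH)).
suff hm : mulH2 (v (s + d)) (mulf q (mulf b e)) by rewrite (ipC hL (H2_L2 kH) qdL) (ok _ hm) conjc0.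
split; first exact: qdL.
have [_ [G [hG bG]]] := orth_model_mulH2 hbr qH oq.
have [_ [E [hE bE [M EM]]]] := eI.
have M0 : 0 <= M by apply: le_trans (EM 0 _); rewrite ?cabs_ge0 ?cabs0.
have rd0 : 0 <= r - d by rewrite subr_ge0.
exists (fun z => v (r - d) z * (E z * G z)); split.
  apply: (hardy2_mul (poly_lim_sing (finite_mass mu) _) ler01).
    by move=> z; exact: cabs_sing_le1.
  exact: (hardy2_mul (hardy2_poly_lim hE) M0 EM hG).
apply: (eq_boundary_value _ (boundary_valueM bG (boundary_valueM (if_bv hb) bE))) => z _.
have er : v r z = v d z * v (r - d) z by rewrite -singD addrC subrK.
rewrite /= singD er; move: (v s z) (v d z) (v (r - d) z) (E z) (G z) => a1 a2 a3 a4 a5; ring.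
Qed.

Lemma model_proj s t : 0 <= s <= t -> exists P : V -> V, forall x, K t x ->
  K s (P x) /\ forall z, K s z -> inner (x - P x) z = 0.
Proof.
move=> st; have st0 : 0 <= t by case/andP: st; exact: le_trans.
have ex (x : V) : exists y : V, K t x -> K s y /\ forall z, K s z -> inner (x - y) z = 0.
  have [hx|nx] := pselect (K t x); last by exists 0 => /nx.
  have [b hb] := sing_inner_fn st0; have s0 : 0 <= s by case/andP: st.
  have [y hy oy] := @projection _ _ ip2 (K t) (model_pre_hilbert (v t)) (K s) x
    (fun f => @model_sing_mono s t f st) (model_0 (v s)) (@model_lin _ (v s)) (@model_complete _ (v t))
    (@model_complete _ (v s)) hx.
  by exists y.
by have [P hP] := choice ex; exists P.
Qed.

End singular_family.

(** * The analytic part of a truncated Toeplitz operator *)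

Section analytic_part.
Variable R : realType.
Local Notation mR := (measurableTypeR R).
Local Notation circle := (@circle R : set mR).
Local Notation leb := (@lebesgue_measure R).
Local Notation V := (R -> R[i]^o).
Local Notation ip2 := (@inner R : V -> V -> R[i]).
Local Notation nrm2 := (nrm ip2).

Let hL := L2_pre_hilbert R.

Variable mu : {finite_measure set mR -> \bar R}.
Hypothesis smu : singular_to_lebesgue mu.
Local Notation v := (sing mu).
Local Notation K s := (model_space (v s) : set V).

Let hK s := model_pre_hilbert (v s).
Let KL s (x : V) (hx : K s x) : L2 x := model_L2 hx.

Variables (N : nat) (dl : R).
Hypotheses (dl0 : 0 <= dl) (Ndl : N%:R * dl = 1).
Local Notation sj j := (j%:R * dl : R).

Let sj0 j : 0 <= sj j. Proof. by rewrite mulr_ge0. Qed.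
Let sjS j : sj j.+1 = sj j + dl. Proof. by rewrite -natr1 mulrDl mul1r. Qed.
Let sj_mono i j : (i <= j)%N -> 0 <= sj i <= sj j.
Proof. by move=> ij; rewrite sj0 ler_wpM2r ?ler_nat. Qed.
Let sj_le1 j : (j <= N)%N -> 0 <= sj j <= 1.
Proof. by move=> /sj_mono; rewrite Ndl. Qed.

Variable P : nat -> V -> V.
Hypothesis hP : forall j, (j <= N)%N -> forall x, K 1 x -> K (sj j) (P j x) /\ forall z, K (sj j) z -> inner (x - P j x) z = 0.

Let Kmono j x : (j <= N)%N -> K (sj j) x -> K 1 x.
Proof. by move=> jN; apply: model_sing_mono; exact: sj_le1. Qed.

Let PK j x : (j <= N)%N -> K 1 x -> K 1 (P j x).
Proof. by move=> jN hx; apply: (Kmono jN); have [] := hP jN hx. Qed.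

Let hPj j : (j <= N)%N -> orth_proj ip2 (K 1) (P j).
Proof.
move=> jN; split=> [x hx|x y hx hy]; first exact: PK.
have h1 := PK jN hx; have h2 := PK jN hy; have [hPx _] := hP jN hx; have [_ oy] := hP jN hy.
have e : inner (P j x) (y - P j y) = 0.
  by rewrite (ipC (hK 1) (phB (hK 1) hy h2) h1) (oy _ hPx) conjc0.
have := e; rewrite (ipBr (hK 1) hy h2 h1) => /eqP; rewrite subr_eq0 => /eqP -> //.
Qed.

Let P_fix j x : (j <= N)%N -> K (sj j) x -> nrm2 (P j x - x) = 0.
Proof.
move=> jN hx; have hx1 := Kmono jN hx; have [h1 h2] := hP jN hx1.
rewrite (nrmBC (hK 1) (PK jN hx1) hx1); apply: nrm_eq0; apply: h2.
exact: (phB (hK _) hx h1).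
Qed.

Let P_null j x : (j <= N)%N -> K 1 x -> (forall z, K (sj j) z -> inner x z = 0) -> nrm2 (P j x) = 0.
Proof.
move=> jN hx ox; have [h1 h2] := hP jN hx; apply: nrm_eq0.
have := h2 _ h1; rewrite (ipBl (hK 1) hx (PK jN hx) (PK jN hx)) (ox _ h1) sub0r => /eqP.
by rewrite oppr_eq0 => /eqP.
Qed.

Variables (p r : R) (phi psi h0 : V) (A D : V -> V).
Hypotheses (p1 : 1 < p) (dr : dl <= r) (r1 : r <= 1) (hphi : H2 phi) (hpsi : H2 psi) (hh0 : K r h0).
Hypothesis ophi : forall k, K r k -> inner (phi - h0) k = 0.
Hypotheses (lA : lin_op ip2 (K 1) A) (lD : lin_op ip2 (K 1) D).
Hypotheses (sA : spb ip2 (K 1) p A) (sD : spb ip2 (K 1) p D).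
Hypothesis eA : forall g, K 1 g -> Hinfty g -> forall k, K 1 k -> inner (A g) k = inner (mulf (phi + conjf psi) g) k.
Hypothesis eD : forall g, K 1 g -> Hinfty g -> forall k, K 1 k -> inner (D g) k = inner (mulf h0 g) k.

Let B (x : V) : V := A x + - D x.
Let Q j (x : V) : V := x - P j x.
Let W j (x : V) : V := Q j (B x).

(** Operators are additive only up to null vectors. The difference of projections is distributed, so
    that each term is literally [B] composed with orthogonal projections. *)
Definition analytic_op (x : V) : V := D x + \sum_(j < N) (W j.+1 (P j.+1 x) + - W j.+1 (P j x)).
Local Notation T := analytic_op.

Let lB : lin_op ip2 (K 1) B.
Proof. exact: (lin_opD (hK 1) lA (lin_opN (hK 1) lD)). Qed.

Let lW j : (j <= N)%N -> lin_op ip2 (K 1) (W j).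
Proof. by move=> jN; exact: (lin_op_comp (hK 1) (orth_proj_lin (hK 1) (orth_projC (hK 1) (hPj jN))) lB). Qed.

Let lWP j i : (j <= N)%N -> (i <= N)%N -> lin_op ip2 (K 1) (fun x => W j (P i x)).
Proof. by move=> jN iN; exact: (lin_op_comp (hK 1) (lW jN) (orth_proj_lin (hK 1) (hPj iN))). Qed.

Lemma analytic_op_lin : lin_op ip2 (K 1) T.
Proof.
apply: (lin_opD (hK 1) lD); apply: (lin_op_sum (hK 1)) => j.
by apply: (lin_opD (hK 1)); [exact: lWP|apply: (lin_opN (hK 1)); apply: lWP => //; exact: ltnW].
Qed.

Lemma analytic_op_spb : spb ip2 (K 1) p T.
Proof.
have p0 : 0 < p := lt_trans ltr01 p1.
have sB : spb ip2 (K 1) p B.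
  by exact: (spbD (hK 1) p0 lA (lin_opN (hK 1) lD) sA (spbN (hK 1) lD sD)).
have sWP j i : (j <= N)%N -> (i <= N)%N -> spb ip2 (K 1) p (fun x => W j (P i x)).
  move=> jN iN; apply: (spb_projr (hK 1) p0 (lW jN) (hPj iN)).
  exact: (spb_projl (hK 1) p0 lB (orth_projC (hK 1) (hPj jN)) sB).
have l1 (j : 'I_N) : lin_op ip2 (K 1) (fun x => - W j.+1 (P j x)).
  by apply: (lin_opN (hK 1)); apply: lWP => //; exact: ltnW.
have l2 (j : 'I_N) : lin_op ip2 (K 1) (fun x => W j.+1 (P j.+1 x) + - W j.+1 (P j x)).
  by apply: (lin_opD (hK 1)); [exact: lWP|exact: l1].
apply: (spbD (hK 1) p0 lD _ sD); first by apply: (lin_op_sum (hK 1)) => j; exact: l2.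
apply: (spb_sum (hK 1) p0) => [j|j]; first exact: l2.
apply: (spbD (hK 1) p0 _ (l1 j)); [exact: lWP|exact: sWP|].
by apply: (spbN (hK 1)); [apply: lWP => //; exact: ltnW|apply: sWP => //; exact: ltnW].
Qed.

Let qH : H2 (phi - h0) := phB (@H2_pre_hilbert R) hphi (model_H2 hh0).

(** The projections [P i] fix [d] for i > j and annihilate it for i <= j, so the sum collapses to
    its term [j]. The test vector is then split by [P j.+1] into [k1], seen through [D], and [k2],
    seen through [A]. *)
Lemma analytic_op_block j (b e k : V) : (j < N)%N -> inner_fn (v (sj j)) b -> K dl e -> Hinfty e -> K 1 k ->
  inner (T (mulf b e)) k = inner (mulf phi (mulf b e)) k.
Proof.
move=> jN hb he eI hk; set d := mulf b e; have jN' : (j <= N)%N := ltnW jN.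
have dI : Hinfty d := mulHinfty (if_Hinfty hb) eI.
have [dK od] := model_block_in (sj0 j) dl0 hb he; rewrite -/d -sjS in dK od.
have dK1 := Kmono jN dK.
pose k1 := P j.+1 k; pose k2 := Q j.+1 k.
have hk1 : K 1 k1 := PK jN hk.
have hk2 : K 1 k2 := phB (hK 1) hk hk1.
have [k1K ok2] := hP jN hk.
have kE : k = k1 + k2 by rewrite /k1 /k2 /Q addrC subrK.
have tmI (i : 'I_N) : K 1 (W i.+1 (P i.+1 d) + - W i.+1 (P i d)).
  apply: (phD (hK 1)); first exact: (op_in (lWP (ltn_ord i) (ltn_ord i)) dK1).
  by apply: (phN (hK 1)); apply: (op_in (lWP (ltn_ord i) _) dK1); exact: ltnW.
have WPhi i m : (i <= N)%N -> (m <= N)%N -> (j < m)%N -> inner (W i (P m d)) k = inner (W i d) k.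
  move=> iN mN jm; apply: (op_ip_eqv (hK 1) (lW iN) (PK mN dK1) dK1 hk); apply: (P_fix mN).
  by apply: (model_sing_mono _ dK); exact: sj_mono.
have WPlo i m : (i <= N)%N -> (m <= N)%N -> (m <= j)%N -> inner (W i (P m d)) k = 0.
  move=> iN mN mj; have n0 : nrm2 (P m d) = 0.
    apply: (P_null mN dK1) => z hz; apply: od; apply: (model_sing_mono _ hz); exact: sj_mono.
  rewrite (op_ip_eqv (hK 1) (lW iN) (PK mN dK1) (ph0 (hK 1)) hk) ?subr0 //.
  exact: (op0_ip (hK 1) (lW iN) hk).
have sumE : inner (\sum_(i < N) (W i.+1 (P i.+1 d) + - W i.+1 (P i d))) k = inner (W j.+1 d) k.
  rewrite (ip_suml (hK 1) _ (fun i _ => tmI i) hk).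
  have tE (i : 'I_N) : inner (W i.+1 (P i.+1 d) + - W i.+1 (P i d)) k =
      inner (W i.+1 (P i.+1 d)) k - inner (W i.+1 (P i d)) k.
    exact: (ipBl (hK 1) (op_in (lWP (ltn_ord i) (ltn_ord i)) dK1) (op_in (lWP (ltn_ord i) (ltnW (ltn_ord i))) dK1) hk).
  rewrite (bigD1 (Ordinal jN)) //= big1 => [|i /eqP ij].
    by rewrite addr0 (tE (Ordinal jN)) /= (WPhi j.+1 j.+1 jN jN (ltnSn j)) (WPlo j.+1 j jN jN' (leqnn j)) subr0.
  rewrite tE; have [lt|gt|eq] := ltngtP i j.
  - by rewrite (WPlo _ _ (ltn_ord i) (ltn_ord i) lt) (WPlo _ _ (ltn_ord i) (ltnW (ltn_ord i)) (ltnW lt)) subr0.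
  - rewrite (WPhi _ _ (ltn_ord i) (ltn_ord i) (ltnW gt : (j < i.+1)%N)).
    by rewrite (WPhi _ _ (ltn_ord i) (ltnW (ltn_ord i)) gt) subrr.
  - by case: ij; exact: val_inj.
have DK := op_in lD dK1; have AK := op_in lA dK1.
have SK : K 1 (\sum_(i < N) (W i.+1 (P i.+1 d) + - W i.+1 (P i d))) by apply: (ph_sum (hK 1)) => i _; exact: tmI.
have s1 : inner (T d) k = inner (D d) k + inner (W j.+1 d) k.
  by rewrite -sumE; exact: (ipDl (hK 1) DK SK hk).
(* The subtracted term cancels the part of [D d] along [k2], so that [D] survives only against
   [k1]. *)
have s2 : inner (W j.+1 d) k = inner (A d) k2 - inner (D d) k2.
  rewrite (orth_proj_sym (hK 1) (orth_projC (hK 1) (hPj jN)) (op_in lB dK1) hk).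
  exact: (ipBl (hK 1) AK DK hk2).
have s3 : inner (D d) k = inner (D d) k1 + inner (D d) k2.
  by rewrite {1}kE; exact: (ipDr (hK 1) hk1 hk2 DK).
have pL := H2_L2 hphi; have psL : L2 (conjf psi) := L2_conj (H2_L2 hpsi).
have mL (f : V) : L2 f -> L2 (mulf f d) by move=> hf; rewrite mulfC; exact: (mulHinfty_L2 dI hf).
have s4 : inner (A d) k2 = inner (mulf phi d) k2.
  rewrite (eA dK1 dI hk2) (_ : mulf (phi + conjf psi) d = mulf phi d + mulf (conjf psi) d); last first.
    by apply/funext => t; rewrite /mulf !fctE mulrDl.
  rewrite (ipDl hL (mL _ pL) (mL _ psL) (KL hk2)).
  have [b' hb'] := sing_inner_fn smu (sj0 j.+1).
  by rewrite (conj_symbol_orth hb' hpsi dK dI (model_H2 hk2) ok2) addr0.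
have s5 : inner (D d) k1 = inner (mulf phi d) k1.
  rewrite (eD dK1 dI hk1).
  have [br hbr] := sing_inner_fn smu (le_trans dl0 dr).
  have k1K' : K (sj j + dl) k1 by rewrite -sjS.
  have dr' : 0 <= dl <= r by rewrite dl0.
  have h := analytic_symbol_orth (sj0 j) dr' hb hbr qH ophi eI k1K'; rewrite -/d in h.
  have e1 : mulf (phi - h0) d = mulf phi d - mulf h0 d by rewrite mulfC mulfB !(mulfC d).
  rewrite e1 (ipBl hL (mL _ pL) (mL _ (KL hh0)) (KL hk1)) in h.
  by move/eqP: h; rewrite subr_eq0 => /eqP ->.
have s6 : inner (mulf phi d) k = inner (mulf phi d) k1 + inner (mulf phi d) k2.
  by rewrite {1}kE; exact: (ipDr hL (KL hk1) (KL hk2) (mL _ pL)).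
rewrite s1 s2 s3 s4 s5 s6; move: (inner (mulf phi d) k1) (inner (mulf phi d) k2) (inner (D d) k2) => a1 a2 a3.
by ring.
Qed.

Let dset : set V := [set d | [/\ K 1 d, Hinfty d & forall k, K 1 k -> inner (T d) k = inner (mulf phi d) k]].

Let dset0 : dset 0.
Proof.
split; [exact: model_0|exact: Hinfty_cst|move=> k hk].
rewrite (op0_ip (hK 1) analytic_op_lin hk) (_ : mulf phi 0 = 0) ?(ip0l hL (KL hk)) //.
by apply/funext => t; rewrite /mulf mulr0.
Qed.

Let mulphi_L2 g : Hinfty g -> L2 (mulf phi g).
Proof. by move=> gI; rewrite mulfC; exact: (mulHinfty_L2 gI (H2_L2 hphi)). Qed.

Let dset_lin a x y : dset x -> dset y -> dset (a *: x + y).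
Proof.
move=> [hx xI ex] [hy yI ey]; split.
- exact: model_lin.
- exact: Hinfty_lin.
- move=> k hk; rewrite (op_ip (hK 1) analytic_op_lin a hx hy hk) (ex k hk) (ey k hk) mulf_lin.
  by rewrite (ipL hL a (mulphi_L2 xI) (mulphi_L2 yI) (KL hk)).
Qed.

(** By induction on [j], [x] is orthogonal to K_{v_{j/N}}: the new part of the next space is v_{j/N}
    K_{v_{1/N}}, where bounded elements are dense and belong to [dset] after multiplication by
    v_{j/N}. At j = N the vector is orthogonal to itself. *)
Let dset_orth x : K 1 x -> (forall z, dset z -> inner x z = 0) -> nrm2 x = 0.
Proof.
move=> hx ox; have xL := KL hx.
have key j : (j <= N)%N -> forall y, K (sj j) y -> inner x y = 0.
  elim: j => [_ y|j IH jN y hy].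
    rewrite mul0r => hy; rewrite (ipC hL (KL hy) xL) (nrm0_ip hL (KL hy) xL) ?conjc0 //.
    exact: (model_sing0 hy).
  have jN' := ltnW jN; have [yj oy] := hP jN' (Kmono jN hy).
  have hy' := Kmono jN hy; have yj1 : K (sj j.+1) (P j y) by apply: (model_sing_mono _ yj); exact: sj_mono.
  have hz : K (sj j + dl) (y - P j y) by rewrite -sjS; exact: (phB (hK _) hy yj1).
  have [b hb] := sing_inner_fn smu (sj0 j).
  have [e he eq] := model_block_out (sj0 j) dl0 hb hz oy.
  have eL := KL he; have beL := mul_inner_L2 hb eL.
  rewrite -(subrK (P j y) y) (ipDr hL (KL hz) (KL yj) xL) (IH jN' _ yj) addr0.
  rewrite (inner_circle_eqr xL (KL hz) beL eq).
  apply: (@cabs_eps0 _ _ (nrm2 x)) => eps eps0.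
  have [bd hbd] := sing_inner_fn smu dl0.
  have [d [hd dI] le] := model_Hinfty_dense hbd he eps0.
  have dL := KL hd; have bdL := mul_inner_L2 hb dL.
  have bdK := (model_block_in (sj0 j) dl0 hb hd).1; rewrite -sjS in bdK.
  have e0 : inner x (mulf b d) = 0.
    apply: ox; split; first exact: (Kmono jN bdK).
      exact: (mulHinfty (if_Hinfty hb) dI).
    by move=> k hk; exact: (analytic_op_block jN hb hd dI hk).
  have -> : inner x (mulf b e) = inner x (mulf b (e - d)).
    by rewrite mulfB (ipBr hL beL bdL xL) e0 subr0.
  have edL := phB hL eL dL.
  apply: (le_trans (cauchy_schwarz hL xL (mul_inner_L2 hb edL))).
  apply: ler_wpM2l; first exact: sqrtr_ge0.
  by rewrite /nrm (inner_mul_inner hb edL edL).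
apply: nrm_eq0; apply: (key N (leqnn N)); rewrite Ndl; exact: hx.
Qed.

(** Multiplication by [phi] is unbounded, so the form is not jointly continuous. For bounded [k],
    the symbol moves to the side of [k] and [g] is approximated from [dset]. Then, [g] being
    bounded, [phi g] is a fixed element of L^2 and [k] is approximated by bounded elements. *)
Lemma analytic_op_extends g k : K 1 g -> Hinfty g -> K 1 k -> inner (T g) k = inner (mulf phi g) k.
Proof.
move=> hg gI hk; have [b hb] := sing_inner_fn smu ler01.
have Tg := KL (op_in analytic_op_lin hg); have pgL := mulphi_L2 gI.
have step1 k' : K 1 k' -> Hinfty k' -> inner (T g) k' = inner (mulf phi g) k'.
  move=> hk' kI; apply/eqP; rewrite -subr_eq0; apply/eqP.
  have [M M0 hM] := op_bd_pos analytic_op_lin.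
  have ckL : L2 (mulf (conjf phi) k') by rewrite mulfC; exact: (mulHinfty_L2 kI (L2_conj (H2_L2 hphi))).
  apply: (@cabs_eps0 _ _ (M * nrm2 k' + nrm2 (mulf (conjf phi) k'))) => eps eps0.
  have [d [hd dI ed] le] := @dense_of_orth _ _ ip2 (K 1) (hK 1) dset g (@model_complete _ (v 1))
    (fun x hx => let: And3 h _ _ := hx in h) dset0 dset_lin dset_orth hg eps eps0.
  have gd := phB (hK 1) hg hd.
  have -> : inner (T g) k' - inner (mulf phi g) k' = inner (T (g - d)) k' - inner (mulf phi (g - d)) k'.
    rewrite (opB_ip (hK 1) analytic_op_lin hg hd hk') mulfB (ipBl hL pgL (mulphi_L2 dI) (KL hk')) (ed k' hk').
    by rewrite opprB addrA subrK.
  rewrite inner_mulf mulrDl; apply: (le_trans (cabsB _ _)); apply: lerD.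
    apply: (le_trans (cauchy_schwarz hL (KL (op_in analytic_op_lin gd)) (KL hk'))).
    rewrite mulrAC; apply: ler_wpM2r; first exact: sqrtr_ge0.
    by apply: (le_trans (hM _ gd)); apply: ler_wpM2l => //; exact: ltW.
  apply: (le_trans (cauchy_schwarz hL (KL gd) ckL)).
  by rewrite mulrC; apply: ler_wpM2l; first exact: sqrtr_ge0.
apply/eqP; rewrite -subr_eq0 -(ipBl hL Tg pgL (KL hk)); apply/eqP.
apply: (@cabs_eps0 _ _ (nrm2 (T g - mulf phi g))) => eps eps0.
have [k' [hk' kI] le] := model_Hinfty_dense hb hk eps0.
have wL := phB hL Tg pgL.
have e0 : inner (T g - mulf phi g) k' = 0 by rewrite (ipBl hL Tg pgL (KL hk')) step1 // subrr.
have -> : inner (T g - mulf phi g) k = inner (T g - mulf phi g) (k - k').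
  by rewrite (ipBr hL (KL hk) (KL hk') wL) e0 subr0.
apply: (le_trans (cauchy_schwarz hL wL (phB hL (KL hk) (KL hk')))).
by apply: ler_wpM2l; first exact: sqrtr_ge0.
Qed.

End analytic_part.

(** * Translation into the definitions of the statement *)

Section reformulation.
Variable R : realType.
Local Notation mR := (measurableTypeR R).
Local Notation circle := (@circle R : set mR).
Local Notation leb := (@lebesgue_measure R).
Local Notation V := (R -> R[i]^o).
Local Notation ip2 := (@inner R : V -> V -> R[i]).
Local Notation nrm2 := (nrm ip2).

Let hL := L2_pre_hilbert R.

Lemma nneseries_bounded (a : nat -> R) : (forall n, 0 <= a n) ->
  (\sum_(0 <= n <oo) (a n)%:E < +oo)%E <-> exists C : R, forall N, \sum_(0 <= n < N) a n <= C.
Proof.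
move=> a0; have a0' n : (0 <= n)%N -> true -> (0 <= (a n)%:E)%E by move=> _ _; rewrite lee_fin.
have cv : cvgn (fun n => \sum_(0 <= i < n) (a i)%:E)%E by apply: is_cvg_nneseries.
split=> [lt|[C hC]].
  exists (fine (\sum_(0 <= n <oo) (a n)%:E)%E) => N.
  have ge : (0 <= \sum_(0 <= n <oo) (a n)%:E)%E by apply: nneseries_ge0.
  rewrite -lee_fin fineK ?ge0_fin_numE // -sumEFin.
  by apply: nneseries_lim_ge.
apply: (@le_lt_trans _ _ C%:E); last exact: ltry.
by apply: lime_le => //; apply: nearW => N; rewrite sumEFin lee_fin.
Qed.

Section schatten.
Variable K : set V.
Hypotheses (KL2 : K `<=` (@L2 R : set V)) (hK : pre_hilbert ip2 K) (cK : ip_complete ip2 K).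

Lemma circle_eq_nrm0 (f g : V) : K f -> K g -> circle_eq f g <-> nrm2 (f - g) = 0.
Proof.
move=> hf hg; split; first exact: (circle_eq_norm2B (KL2 hf) (KL2 hg)).
exact: (norm2B_eq0 (KL2 hf) (KL2 hg)).
Qed.

Lemma bounded_operatorP (T : V -> V) : bounded_operator K T <-> lin_op ip2 K T.
Proof.
split=> [[h1 h2 h3]|[h1 h2 h3]]; split.
- exact: h1.
- move=> a x y hx hy; apply/circle_eq_nrm0; last exact: (h2 a x y hx hy).
    by apply: h1; exact: (phL hK).
  by apply: (phL hK); exact: h1.
- exact: h3.
- exact: h1.
- move=> a x y hx hy; have h := h2 a x y hx hy; apply/circle_eq_nrm0; last exact: h.
    by apply: h1; exact: (phL hK a hx hy).
  by apply: (phL hK a); exact: h1.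
- exact: h3.
Qed.

Lemma schattenP (p : R) (T : V -> V) : 1 < p -> schatten K p T <-> lin_op ip2 K T /\ spb ip2 K p T.
Proof.
move=> p1; have p0 : 0 < p := lt_trans ltr01 p1.
split=> [[/bounded_operatorP lT [s [[e [h1 h2 h3 h4 h5]] hs]]]|[lT sT]].
  split; first exact: lT.
  have [C hC] := (nneseries_bounded (fun n => powR_ge0 (s n) p)).1 hs.
  apply: (sing_data_spb hK cK p1 lT (s := s) (e := e) _ hC); split.
  - exact: h1.
  - exact: h2.
  - exact: h3.
  - exact: h4.
  - move=> g hg og; have := (circle_eq_nrm0 (op_in lT hg) (ph0 hK)).1 (h5 g hg og).
    by rewrite subr0.
split; first exact/bounded_operatorP.
have [s [e [[h1 h2 h3 h4 h5] hC]]] := spb_sing_data hK cK p0 lT sT.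
exists s; split; last by apply/(nneseries_bounded (fun n => powR_ge0 (s n) p)).
exists e; split.
- exact: h1.
- exact: h2.
- exact: h3.
- exact: h4.
- move=> g hg og; apply: (circle_eq_nrm0 (op_in lT hg) (ph0 hK)).2.
  by rewrite subr0; exact: h5.
Qed.

End schatten.

Lemma extendsP (w : R[i] -> R[i]) (f : V) (T : V -> V) : L2 f ->
  (forall x, model_space w x -> model_space w (T x)) ->
  extends_tto w f T <-> (forall g, model_space w g -> Hinfty g -> forall k, model_space w k ->
    inner (T g) k = inner (mulf f g) k).
Proof.
move=> hf hT.
have key g k : model_space w g -> Hinfty g -> model_space w k ->
    inner (mulf f g - T g) k = inner (mulf f g) k - inner (T g) k.
  move=> hg gI hk; apply: (ipBl hL _ (model_L2 (hT _ hg)) (model_L2 hk)).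
  by rewrite mulfC; exact: (mulHinfty_L2 gI hf).
split=> [h g hg gI k hk|h g hg gI].
  have [_ /(_ k hk) e] := h g hg gI; rewrite -[inner _ k]/(inner (mulf f g - T g) k) (key g k hg gI hk) in e.
  by move/eqP: e; rewrite subr_eq0 => /eqP ->.
split; first exact: hT.
by move=> k hk; rewrite -[inner _ k]/(inner (mulf f g - T g) k) (key g k hg gI hk) (h g hg gI k hk) subrr.
Qed.

(** The unimodular constant of [singular_inner] is absorbed by the H^2 factor, so the model spaces
    are those of the [sing mu s]. *)
Lemma eq_mulH2 (a : R[i]) (w w' : R[i] -> R[i]) : cabs a = 1 -> (forall z, cabs z < 1 -> w z = a * w' z) ->
  mulH2 w = mulH2 w'.
Proof.
move=> a1 ww; have a0 : a != 0 by apply/eqP => e; move: a1; rewrite e cabs0 => /eqP; rewrite eq_sym oner_eq0.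
have cst (b : R[i]) F : hardy2 F -> hardy2 (fun z => b * F z).
  by move=> hF; apply: (hardy2_mul (poly_lim_cst b) (cabs_ge0 b) _ hF) => z _; exact: lexx.
apply/seteqP; split=> g [hg [F [hF bF]]]; split=> //.
  exists (fun z => a * F z); split; first exact: cst.
  by apply: (eq_boundary_value _ bF) => z z1; rewrite ww // mulrCA mulrA.
exists (fun z => a^-1 * F z); split; first exact: cst.
by apply: (eq_boundary_value _ bF) => z z1; rewrite ww // mulrACA mulfV // mul1r.
Qed.

Lemma eq_model_space (a : R[i]) (w w' : R[i] -> R[i]) : cabs a = 1 -> (forall z, cabs z < 1 -> w z = a * w' z) ->
  model_space w = model_space w'.
Proof. by move=> a1 ww; rewrite /model_space (eq_mulH2 a1 ww). Qed.

Variable mu : {finite_measure set mR -> \bar R}.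

Lemma Rintegral_mscale (r : {nonneg R}) (g : mR -> R) : rint mu g ->
  Rintegral (mscale r mu) circle g = r%:num * Rintegral mu circle g.
Proof.
move=> ig; have mg := measurable_int _ ig.
have ifin : (\int[mu]_(x in circle) (g x)%:E)%E \is a fin_num := integrable_fin_num (@measurable_circle R) ig.
rewrite /Rintegral -[r%:num]/(fine (r%:num%:E)) -fineM //; congr fine.
rewrite integralE [in RHS]integralE.
rewrite (ge0_integral_mscale _ (@measurable_circle R) r (measurable_funepos mg)); last by move=> x _; exact: funepos_ge0.
rewrite (ge0_integral_mscale _ (@measurable_circle R) r (measurable_funeneg mg)); last by move=> x _; exact: funeneg_ge0.
symmetry; apply: muleBr; [by []|exact: (integrable_add_def (@measurable_circle R) ig)].
Qed.

Lemma singular_inner_sing (c : R[i]) z : singular_inner c mu z = c * sing mu 1 z.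
Proof. by rewrite /sing mul1r. Qed.

Lemma singular_inner_mscale (c : R[i]) (r : {nonneg R}) z : cabs z < 1 ->
  singular_inner c (mscale r mu) z = c * sing mu r%:num z.
Proof.
move=> z1; have hk := cint_hkernel (finite_mass mu) z1.
rewrite /singular_inner /sing; congr (_ * cexp (- _)).
rewrite /herglotz /cintegral; apply: complexP; rewrite ?ReM ?ImM /= mul0r ?subr0 ?addr0.
  exact: (Rintegral_mscale r (cint_Re hk)).
exact: (Rintegral_mscale r (cint_Im hk)).
Qed.

End reformulation.

(** * The normalization of the canonical symbol *)

Section canonical.
Variable R : realType.
Local Notation mR := (measurableTypeR R).
Local Notation V := (R -> R[i]^o).
Local Notation ip2 := (@inner R : V -> V -> R[i]).

Let hL := L2_pre_hilbert R.

Lemma conj_orth_H2 (psi h : V) : H2 psi -> inner psi (fun=> 1) = 0 -> H2 h -> inner (conjf psi) h = 0.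
Proof.
move=> hpsi psi0; apply: orth_char_pos_H2; first exact: L2_conj (H2_L2 hpsi).
have h1 := cst_L2 (1 : R[i]).
move=> n; have e : inner (conjf psi) (@char_pos R n) = conjc (inner psi (@char_neg R n)).
  rewrite -(inner_conj2 (H2_L2 hpsi) (char_negL2 R n)); congr (inner _ _).
  by apply/funext => t; rewrite /conj_fun /char_neg /char_pos conjcX conjcK.
rewrite e; have /H2P[_ neg] := hpsi; case: n {e} => [|n]; last by rewrite neg // conjc0.
by rewrite char_neg0 psi0 conjc0.
Qed.

(** As [psi] lies in the model space, its inner product with 1 equals the one with the projection of
    1, which vanishes by normalization. *)
Lemma canonical_orth_one (w : R[i] -> R[i]) (b phi psi : V) : inner_fn w b -> canonical_symbol w phi psi ->
  inner psi (fun=> 1) = 0.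
Proof.
move=> hw [_ hpsi h]; have h1 := Hinfty_H2 (Hinfty_cst (1 : R[i])).
have K2 := @model_H2 R w; have one := cst_L2 (1 : R[i]).
have [k hk ok] := @projection _ _ ip2 (@H2 R : set V) (@H2_pre_hilbert R) (model_space w : set V) (fun=> 1)
  K2 (model_0 w) (@model_lin _ w) (@H2_complete R) (@model_complete _ w) h1.
have kL := model_L2 hk; have pL := model_L2 hpsi.
have e : inner psi k = 0 by apply: h; split; [exact: hk|exact: ok].
have := ok _ hpsi; rewrite (ipBl hL one kL pL) (ipC hL pL kL) e conjc0 subr0 => e1.
by rewrite (ipC hL one pL) e1 conjc0.
Qed.

End canonical.

Theorem theorem5 (R : realType) (c : R[i])
    (mu : {finite_measure set (measurableTypeR R) -> \bar R})
    (hc : cabs c = 1) (hmu : singular_to_lebesgue mu)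
    (u : R[i] -> R[i]) (hu : u = singular_inner c mu)
    (p : R) (hp : 1 < p)
    (phi psi f : R -> R[i]) (hcan : canonical_symbol u phi psi)
    (hf : f = (fun t => phi t + conj_fun psi t))
    (A : (R -> R[i]) -> (R -> R[i]))
    (hA : schatten (model_space u) p A) (hAf : extends_tto u f A) :
  (forall r : {nonneg R}, 0 < r%:num < 1 ->
     (proj_tto_in_schatten u (singular_inner c (mscale r mu)) p f <->
      proj_tto_in_schatten u (singular_inner c (mscale r mu)) p phi)) /\
  ((exists r : {nonneg R}, 0 < r%:num < 1 /\
     proj_tto_in_schatten u (singular_inner c (mscale r mu)) p f) ->
   tto_in_schatten u p phi /\ tto_in_schatten u p (conj_fun psi)).
Proof.
pose V := R -> R[i]^o; pose ip2 : V -> V -> R[i] := @inner R.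
pose K s : set V := model_space (sing mu s).
have hL := L2_pre_hilbert R.
have uK : model_space u = K 1.
  by apply: (eq_model_space hc) => z _; rewrite hu singular_inner_sing.
have rK (r : {nonneg R}) : model_space (singular_inner c (mscale r mu)) = K r%:num.
  by apply: (eq_model_space hc) => z; exact: singular_inner_mscale.
have psi0 : inner psi (fun=> 1) = 0.
  have [b hb] := sing_inner_fn hmu ler01; apply: (canonical_orth_one hb (phi := phi)).
  by move: hcan; rewrite /canonical_symbol uK.
have [hphi hpsi] : K 1 phi /\ K 1 psi by case: hcan; rewrite uK.
have phiH := model_H2 hphi; have psiH := model_H2 hpsi.
have phiL := H2_L2 phiH; have psiL := L2_conj (H2_L2 psiH).
have fE : f = ((phi : V) + conjf psi) by rewrite hf.
have fL : L2 f by rewrite fE; exact: (phD hL phiL psiL).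
have projE r h : is_proj (K r) f h <-> is_proj (K r) phi h.
  have e k : K r h -> K r k -> inner ((f : V) - h) k = inner ((phi : V) - h) k.
    move=> hh hk; have hL' := model_L2 hh; have kL := model_L2 hk.
    rewrite (ipBl hL fL hL' kL) (ipBl hL phiL hL' kL) fE (ipDl hL phiL psiL kL).
    by rewrite (conj_orth_H2 psiH psi0 (model_H2 hk)) addr0.
  split=> -[hh oh]; split; try exact: hh.
    by move=> k hk; rewrite -[LHS](e k hh hk); exact: oh.
  by move=> k hk; rewrite [LHS](e k hh hk); exact: oh.
have hK := model_pre_hilbert (sing mu 1); have cK := @model_complete _ (sing mu 1).
have KL : K 1 `<=` (@L2 R : set V) by move=> x; exact: model_L2.
have SP T := schattenP KL hK cK T hp.
have EP := @extendsP R (sing mu 1).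
have euE g T : extends_tto u g T <-> extends_tto (sing mu 1) g T by rewrite /extends_tto uK.
have tuE g : tto_in_schatten u p g <-> exists T, schatten (K 1) p T /\ extends_tto (sing mu 1) g T.
  by rewrite /tto_in_schatten /extends_tto uK.
split=> [r _|[r [/andP[r0 r1] [h0 [hh0 /tuE[D [sD xD]]]]]]].
  rewrite /proj_tto_in_schatten rK; split=> -[h [hh hT]]; exists h; split.
  - exact: (projE _ _).1 hh.
  - exact: hT.
  - exact: (projE _ _).2 hh.
  - exact: hT.
move: hh0; rewrite rK => /projE[hh0 oh0].
have [lD spD] := (SP D).1 sD.
have [lA spA] : lin_op ip2 (K 1) A /\ spb ip2 (K 1) p A by apply/SP; rewrite -uK.
have h0L := model_L2 hh0.
have xA := (EP f A fL (op_in lA)).1 ((euE f A).1 hAf).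
have {}xD := (EP h0 D h0L (op_in lD)).1 xD.
have [k hk] : exists k : nat, k.+1%:R^-1 <= r%:num.
  have := @cvg_harmonic R; move/cvgrPdist_le => /(_ r%:num r0) [k _ /(_ k (leqnn _))].
  by rewrite sub0r normrN ger0_norm ?invr_ge0 // => hk; exists k.
set N := k.+1; pose dl : R := N%:R^-1.
have dl0 : 0 <= dl by rewrite invr_ge0.
have Ndl : N%:R * dl = 1 by rewrite mulfV ?pnatr_eq0.
(* Choice needs a map for every natural number; beyond [N] the identity is a mere default. *)
have exP j : exists P : V -> V, (j <= N)%N -> forall x, K 1 x ->
    K (j%:R * dl) (P x) /\ forall z, K (j%:R * dl) z -> inner (x - P x) z = 0.
  have [jN|jN] := leqP j N; last by exists id.
  have j01 : 0 <= j%:R * dl <= 1 by rewrite mulr_ge0 //= -{2}Ndl ler_wpM2r ?ler_nat.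
  by have [P hP] := model_proj hmu j01; exists P.
have [P hP] := choice exP.
rewrite fE in xA.
pose T := analytic_op N P A D.
have lT : lin_op ip2 (K 1) T by exact: (analytic_op_lin dl0 Ndl hP lA lD).
have spT : spb ip2 (K 1) p T by exact: (analytic_op_spb dl0 Ndl hP hp lA lD spA spD).
have xT := analytic_op_extends hmu dl0 Ndl hP hk phiH psiH hh0 oh0 lA lD xA xD.
have p0 : 0 < p := lt_trans ltr01 hp.
have lN := lin_opN hK lT; have spN := spbN hK lT spT.
split; apply/tuE.
  exists T; split; first by apply/SP; split; [exact: lT|exact: spT].
  apply/(EP phi T phiL (op_in lT)) => g hg gI k' hk'; exact: (xT g k' hg gI hk').
pose S (x : V) : V := A x + - T x.
have lS : lin_op ip2 (K 1) S by exact: (lin_opD hK lA lN).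
exists S; split; first by apply/SP; split; [exact: lS|exact: (spbD hK p0 lA lN spA spN)].
apply/(EP (conj_fun psi) S psiL (op_in lS)) => g hg gI k' hk'.
have mL (h : V) : L2 h -> L2 (mulf h g) by move=> hh; rewrite mulfC; exact: (mulHinfty_L2 gI hh).
have -> : inner (S g) k' = inner (A g) k' - inner (T g) k' := ipBl hL (model_L2 (op_in lA hg)) (model_L2 (op_in lT hg)) (model_L2 hk').
rewrite (xA g hg gI k' hk') (xT g k' hg gI hk').
rewrite (_ : mulf (phi + conjf psi) g = mulf phi g + mulf (conjf psi) g); last first.
  by apply/funext => t; rewrite /mulf !fctE mulrDl.
by rewrite (ipDl hL (mL _ phiL) (mL _ psiL) (model_L2 hk')) addrAC subrr add0r.
Qed.
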